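(* Let $\alpha\in(0,1)$ and let $(\beta^y,\,y\ge0)$ be a type-1 evolution, respectively a type-0 evolution, with initial state $\beta^0\in\mathcal I$. Then the total mass process $(\|\beta^y\|,\,y\ge0)$ is a $\mathrm{BESQ}(0)$ diffusion, respectively a $\mathrm{BESQ}(2\alpha)$ diffusion, starting from $\|\beta^0\|$.
   Context: **Interval partitions.** An interval partition is a set $\beta$ of disjoint open subintervals (blocks) of some finite interval $[0,M]$ covering $[0,M]$ up to a Lebesgue-null set; $\|\beta\|:=M$; $\emptyset$ is the empty interval partition. For $c>0$, $c\beta:=\{(ca,cb):(a,b)\in\beta\}$. If $(\gamma_U)_{U\in\beta}$ are interval partitions with $\sum_{U\in\beta}\|\gamma_U\|<\infty$, their concatenation is $\star_{U\in\beta}\gamma_U:=\{(S(U)+x,S(U)+y):U\in\beta,(x,y)\in\gamma_U\}$, where $S(U)=\sum_{(u',v')\in\beta:\,u'<u}\|\gamma_{(u',v')}\|$ for $U=(u,v)$. Concatenation of two partitions is written $\gamma\star\gamma'$, and $(0,L)\star\gamma$ means $\{(0,L)\}\star\gamma$. **State space.** Fix $\alpha\in(0,1)$. $\mathcal I$ is the set of interval partitions $\beta$ such that $\mathscr D_\beta(t):=\Gamma(1-\alpha)\lim_{h\downarrow0}h^\alpha\#\{(a,b)\in\beta:b-a>h,\,b\le t\}$ exists for all $t\in[0,\|\beta\|]$. Write $\mathscr D_\beta(U)$ for the constant value on a block $U$, and $\mathscr D_\beta(\infty):=\mathscr D_\beta(\|\beta\|)$. A correspondence from $\beta$ to $\gamma$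 is a finite sequence $(U_j,V_j)_{1\le j\le n}$ in $\beta\times\gamma$, $n\ge0$, with $(U_j)$ and $(V_j)$ each strictly increasing in left-to-right order. Its distortion is the maximum of $\sup_j|\mathscr D_\beta(U_j)-\mathscr D_\gamma(V_j)|$, $|\mathscr D_\beta(\infty)-\mathscr D_\gamma(\infty)|$, $\sum_j|\mathrm{Leb}(U_j)-\mathrm{Leb}(V_j)|+\|\beta\|-\sum_j\mathrm{Leb}(U_j)$, and $\sum_j|\mathrm{Leb}(U_j)-\mathrm{Leb}(V_j)|+\|\gamma\|-\sum_j\mathrm{Leb}(V_j)$. $d_{\mathcal I}(\beta,\gamma)$ is the infimum of distortions over all correspondences. **Poisson–Dirichlet interval partition.** Let $Y$ be a stable subordinator with $\mathbf E[e^{-\lambda Y(s)}]=e^{-s\lambda^\alpha}$, $Z$ an independent exponential variable (any rate) and $S=\inf\{s>0:Y(s)>Z\}$. With $\beta=\{(Y(s-),Y(s)):s\in(0,S),\,Y(s-)<Y(s)\}$, the law of $\|\beta\|^{-1}\beta$ is called $\mathrm{PDIP}(\alpha,\alpha)$. **Type-1 and type-0 evolutions.** $\mathrm{Gamma}(a,r)$ has density $r^ax^{a-1}e^{-rx}/\Gamma(a)$ on $(0,\infty)$. For $b,r>0$ let $B_r\sim\mathrm{Gamma}(\alpha,r)$, $\bar\gamma\sim\mathrm{PDIP}(\alpha,\alpha)$ and a $(0,\infty)$-valued $L_{b,r}$ with $$\mathbf E[e^{-\lambda L_{b,r}}]=\Big(\frac{r+\lambda}{r}\Big)^\alpha\frac{e^{br^2/(r+\lambda)}-1}{e^{br}-1},\quad\lambda\ge0,$$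 be independent, and set $\mu^{(\alpha)}_{b,r}=e^{-br}\delta_\emptyset+(1-e^{-br})\mathbf P\{(0,L_{b,r})\star B_r\bar\gamma\in\cdot\,\}$. For $y>0$, $\kappa^{(\alpha)}_y(\beta,\cdot)$ is the law of $\star_{U\in\beta}\gamma_U$ with $\gamma_U\sim\mu^{(\alpha)}_{\mathrm{Leb}(U),1/(2y)}$ independent, and $\widetilde\kappa^{(\alpha)}_y(\beta,\cdot)$ is the law of $B\bar\gamma\star(\star_{U\in\beta}\gamma_U)$ with additionally independent $B\sim\mathrm{Gamma}(\alpha,1/(2y))$, $\bar\gamma\sim\mathrm{PDIP}(\alpha,\alpha)$; at $y=0$ both are $\delta_\beta$. A type-1 (resp. type-0) evolution is a path-continuous Hunt process on $(\mathcal I,d_{\mathcal I})$ with transition semigroup $(\kappa^{(\alpha)}_y)$ (resp. $(\widetilde\kappa^{(\alpha)}_y)$). **BESQ.** For $\delta\in\mathbb R$, $b\ge0$, $\mathrm{BESQ}(\delta)$ starting from $b$ is the $[0,\infty)$-valued diffusion $dZ(y)=\delta\,dy+2\sqrt{Z(y)}\,dB(y)$, $Z(0)=b$, $0<y<\zeta$, with $B$ Brownian motion, $\zeta=\infty$ if $\delta>0$ and $\zeta=\inf\{y\ge0:Z(y)=0\}$ if $\delta\le0$, and $Z(y)=0$ for $y\ge\zeta$. *)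

(* Defs.v *)
From HB Require Import structures.
From mathcomp Require Import all_boot all_order all_algebra.
From mathcomp Require Import finmap.
From mathcomp Require Import all_classical all_reals all_analysis.

Set Implicit Arguments.
Unset Strict Implicit.
Unset Printing Implicit Defensive.

Import Order.TTheory GRing.Theory Num.Theory.
Import numFieldNormedType.Exports.

Local Open Scope classical_set_scope.
Local Open Scope ring_scope.

(** * Interval partitions *)

(* A block ]a, b[ is encoded by the pair (a, b). *)
Definition block_set (R : realType) (U : R * R) : set R := `]U.1, U.2[%classic.
Definition leb (R : realType) (U : R * R) : R := U.2 - U.1.

Definition is_intpart (R : realType) (M : R) (b : set (R * R)) : Prop :=
  [/\ 0 <= M,
      forall U, b U -> [/\ 0 <= U.1, U.1 < U.2 & U.2 <= M],
      forall U V, b U -> b V -> U != V -> block_set U `&` block_set V = set0 &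
      lebesgue_measure (`[0, M]%classic `\` \bigcup_(U in b) block_set U) = 0%E].

(* [mass] is determined by [blocks]. *)
Record intpart (R : realType) := IntPart {
  blocks : set (R * R);
  mass : R;
  intpartP : is_intpart mass blocks }.

Definition shift_blocks (R : realType) (x : R) (b : set (R * R)) : set (R * R) :=
  [set (x + U.1, x + U.2) | U in b].

Definition scale_blocks (R : realType) (c : R) (b : set (R * R)) : set (R * R) :=
  [set (c * U.1, c * U.2) | U in b].

(* Meaningful only when the masses [m U], U in [b], are summable. *)
Definition concat_offset (R : realType) (b : set (R * R)) (m : R * R -> R)
    (U : R * R) : R :=
  fine (\esum_(V in [set V | b V /\ V.1 < U.1]) (m V)%:E).

Definition concat_blocks (R : realType) (b : set (R * R))
    (g : R * R -> intpart R) : set (R * R) :=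
  \bigcup_(U in b)
    shift_blocks (concat_offset b (fun V => mass (g V)) U) (blocks (g U)).

(** * The state space and its metric *)

Definition Gamma (R : realType) (a : R) : R :=
  \int[lebesgue_measure]_(x in `]0, +oo[%classic) (x `^ (a - 1) * expR (- x)).

Definition diversity_approx (R : realType) (alpha : R) (b : set (R * R))
    (t h : R) : R :=
  h `^ alpha * (#|` fset_set [set U | [/\ b U, h < leb U & U.2 <= t]]|)%:R.

Definition diversity (R : realType) (alpha : R) (b : set (R * R)) (t : R) : R :=
  Gamma (1 - alpha) * lim (diversity_approx alpha b t h @[h --> 0^'+]).

Definition has_diversity (R : realType) (alpha : R) (b : intpart R) : Prop :=
  forall t, 0 <= t <= mass b ->
    cvg (diversity_approx alpha (blocks b) t h @[h --> 0^'+]).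

Record ipspace (R : realType) (alpha : R) := IPSpace {
  ip_val :> intpart R;
  ip_valP : has_diversity alpha ip_val }.

Lemma is_intpart0 (R : realType) : is_intpart (0 : R) set0.
Proof.
split => //; rewrite bigcup_set0 setD0.
by rewrite lebesgue_measure_itv /= ltxx.
Qed.

Definition ip_empty (R : realType) : intpart R := IntPart (is_intpart0 R).

Lemma has_diversity_empty (R : realType) (alpha : R) :
  has_diversity alpha (ip_empty R).
Proof.
move=> t _; apply/cvg_ex; exists 0.
have -> : diversity_approx alpha (blocks (ip_empty R)) t = cst 0.
  apply/funext => h; rewrite /diversity_approx /=.
  have -> : [set U : R * R | [/\ set0 U, h < leb U & U.2 <= t]] = set0.
    by apply/seteqP; split => U //= [].
  by rewrite fset_set0 mulr0.
exact: cvg_cst.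
Qed.

Definition ipspace_empty (R : realType) (alpha : R) : ipspace alpha :=
  IPSpace (@has_diversity_empty R alpha).

(* The diversity function is constant on a block; it is read off at the
   midpoint. *)
Definition block_diversity (R : realType) (alpha : R) (b : set (R * R))
    (U : R * R) : R := diversity alpha b ((U.1 + U.2) / 2).

Definition correspondence (R : realType) (b c : intpart R)
    (s : seq ((R * R) * (R * R))) : Prop :=
  [/\ forall p, p \in s -> blocks b p.1 /\ blocks c p.2,
      sorted (fun p q : (R * R) * (R * R) => p.1.1 < q.1.1) s &
      sorted (fun p q : (R * R) * (R * R) => p.2.1 < q.2.1) s].

Definition distortion (R : realType) (alpha : R) (b c : intpart R)
    (s : seq ((R * R) * (R * R))) : R :=
  let gap := \sum_(p <- s) `|leb p.1 - leb p.2| in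
  Num.max
    (Num.max
      (\big[Num.max/0]_(p <- s) `|block_diversity alpha (blocks b) p.1
                                  - block_diversity alpha (blocks c) p.2|)
      `|diversity alpha (blocks b) (mass b)
        - diversity alpha (blocks c) (mass c)|)
    (Num.max
      (gap + mass b - \sum_(p <- s) leb p.1)
      (gap + mass c - \sum_(p <- s) leb p.2)).

Definition ipdist (R : realType) (alpha : R) (b c : ipspace alpha) : R :=
  inf [set distortion alpha b c s | s in correspondence b c].

Definition ipspace_open (R : realType) (alpha : R) (A : set (ipspace alpha)) :
    Prop :=
  forall b, A b -> exists2 e : R, 0 < e & forall c, ipdist b c < e -> A c.

(* [ipspace alpha] carries the Borel sigma-algebra of [ipdist]. *)
HB.instance Definition _ (R : realType) (alpha : R) :=
  gen_eqMixin (ipspace alpha).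
HB.instance Definition _ (R : realType) (alpha : R) :=
  gen_choiceMixin (ipspace alpha).
HB.instance Definition _ (R : realType) (alpha : R) :=
  isPointed.Build (ipspace alpha) (ipspace_empty alpha).
HB.instance Definition _ (R : realType) (alpha : R) :=
  @isMeasurable.Build (sigma_display (@ipspace_open R alpha)) (ipspace alpha)
    <<s @ipspace_open R alpha >>
    (@sigma_algebra0 _ setT (@ipspace_open R alpha))
    (@sigma_algebraC (ipspace alpha) (@ipspace_open R alpha))
    (@sigma_algebra_bigcup _ setT (@ipspace_open R alpha)).

(** * Laws, independence, filtrations *)

Definition has_law (R : realType) (d d' : measure_display)
    (Omega : measurableType d) (T : measurableType d')
    (P : probability Omega R) (X : Omega -> T) (nu : set T -> \bar R) : Prop :=
  forall A, measurable A -> P (X @^-1` A) = nu A.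

Definition sigma_of (d d' : measure_display)
    (Omega : measurableType d) (T : measurableType d') (X : Omega -> T) :
    set (set Omega) :=
  preimage_set_system setT X measurable.

Definition sigma_process (R : realType) (d d' : measure_display)
    (Omega : measurableType d) (T : measurableType d')
    (D : set R) (X : R -> Omega -> T) : set (set Omega) :=
  <<s \bigcup_(t in D) sigma_of (X t) >>.

Definition independent (R : realType) (d : measure_display)
    (Omega : measurableType d) (P : probability Omega R)
    (E1 E2 : set (set Omega)) : Prop :=
  forall A1 A2, E1 A1 -> E2 A2 -> P (A1 `&` A2) = (P A1 * P A2)%E.

Definition mutually_independent (R : realType) (d : measure_display)
    (Omega : measurableType d) (P : probability Omega R)
    (I : eqType) (D : set I) (E : I -> set (set Omega)) : Prop :=
  forall (s : seq I) (A : I -> set Omega), uniq s ->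
    (forall i, i \in s -> D i /\ E i (A i)) ->
    P (\bigcap_(i in [set i | i \in s]) A i) = (\prod_(i <- s) P (A i))%E.

Definition filtration (R : realType) (d : measure_display)
    (Omega : measurableType d) (F : R -> set (set Omega)) : Prop :=
  [/\ forall t, 0 <= t -> sigma_algebra setT (F t),
      forall t, 0 <= t -> F t `<=` measurable &
      forall s t, 0 <= s -> s <= t -> F s `<=` F t].

Definition right_continuous_filtration (R : realType) (d : measure_display)
    (Omega : measurableType d) (F : R -> set (set Omega)) : Prop :=
  forall t, 0 <= t -> \bigcap_(s in [set s | t < s]) F s `<=` F t.

Definition adapted (R : realType) (d d' : measure_display)
    (Omega : measurableType d) (T : measurableType d')
    (F : R -> set (set Omega)) (X : R -> Omega -> T) : Prop :=
  forall t, 0 <= t -> sigma_of (X t) `<=` F t.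

Definition stopping_time (R : realType) (d : measure_display)
    (Omega : measurableType d) (F : R -> set (set Omega))
    (tau : Omega -> \bar R) : Prop :=
  (forall w, (0 <= tau w)%E) /\
  (forall t, 0 <= t -> F t [set w | (tau w <= t%:E)%E]).

Definition stopped_events (R : realType) (d : measure_display)
    (Omega : measurableType d) (F : R -> set (set Omega))
    (tau : Omega -> \bar R) : set (set Omega) :=
  [set A | measurable A /\
     forall t, 0 <= t -> F t (A `&` [set w | (tau w <= t%:E)%E])].

(** * The Poisson-Dirichlet interval partition *)

Definition stable_subordinator (R : realType) (alpha : R) (d : measure_display)
    (Omega : measurableType d) (P : probability Omega R)
    (Y : R -> {RV P >-> R}) : Prop :=
  [/\ {ae P, forall w, [/\ Y 0 w = 0,
         forall s t, 0 <= s -> s <= t -> Y s w <= Y t w &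
         forall t, 0 <= t -> Y u w @[u --> t^'+] --> Y t w]},
      forall s t, 0 <= s -> s <= t ->
         independent P (sigma_process `[0, s]%classic Y)
           (sigma_of (fun w => Y t w - Y s w)),
      forall s t, 0 <= s -> s <= t ->
         has_law P (fun w => Y t w - Y s w) (distribution P (Y (t - s))) &
      forall s lam, 0 <= s -> 0 <= lam ->
         ('E_P[fun w => expR (- lam * Y s w)]
          = (expR (- (s * lam `^ alpha)))%:E)%E].

(* The jump intervals of the path [y] before its first passage above [z]. *)
Definition jump_blocks (R : realType) (y : R -> R) (z : R) : set (R * R) :=
  let S := inf [set s | 0 < s /\ z < y s] in
  [set U | exists s, [/\ 0 < s < S, U.1 = lim (y u @[u --> s^'-]), U.2 = y s &
                        U.1 < U.2]].

Definition is_PDIP (R : realType) (alpha : R)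
    (nu : set (ipspace alpha) -> \bar R) : Prop :=
  exists (d : measure_display) (Omega : measurableType d)
    (P : probability Omega R) (Y : R -> {RV P >-> R}) (Z : {RV P >-> R})
    (q : R) (G : {RV P >-> ipspace alpha}),
  [/\ stable_subordinator alpha Y,
      0 < q /\ has_law P Z (exponential_prob q),
      independent P (sigma_process `[0, +oo[%classic Y) (sigma_of Z),
      {ae P, forall w, exists2 b : intpart R,
         blocks b = jump_blocks (Y ^~ w) (Z w) &
         blocks (G w) = scale_blocks (mass b)^-1 (blocks b)} &
      has_law P G nu].

(** * Transition kernels of the type-1 and type-0 evolutions *)

Definition gamma_law (R : realType) (a r : R) (A : set R) : \bar R :=
  (\int[lebesgue_measure]_(x in A `&` (`]0, +oo[%classic)%R)
     (r `^ a * x `^ (a - 1) * expR (- (r * x)) / Gamma a)%:E)%E.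

Definition is_mu (R : realType) (alpha b r : R)
    (nu : set (ipspace alpha) -> \bar R) : Prop :=
  exists (d : measure_display) (Omega : measurableType d)
    (P : probability Omega R) (L B : {RV P >-> R})
    (g G : {RV P >-> ipspace alpha}),
  [/\ {ae P, forall w, 0 < L w} /\
      (forall lam, 0 <= lam -> ('E_P[fun w => expR (- lam * L w)] =
         (((r + lam) / r) `^ alpha *
          ((expR (b * r ^+ 2 / (r + lam)) - 1) / (expR (b * r) - 1)))%:E)%E),
      has_law P B (gamma_law alpha r) /\ is_PDIP (distribution P g),
      mutually_independent P [set: 'I_3]
        (fun i => nth set0 [:: sigma_of L; sigma_of B; sigma_of g] i),
      {ae P, forall w, blocks (G w) =
         (0, L w) |` shift_blocks (L w) (scale_blocks (B w) (blocks (g w)))} &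
      forall A, measurable A ->
        nu A = ((expR (- (b * r)))%:E * \d_(ipspace_empty alpha) A
                + (1 - expR (- (b * r)))%:E * P (G @^-1` A))%E].

Definition is_kappa1 (R : realType) (alpha y : R) (b : ipspace alpha)
    (nu : set (ipspace alpha) -> \bar R) : Prop :=
  (y = 0 -> forall A, measurable A -> nu A = \d_b A) /\
  (0 < y ->
   exists (d : measure_display) (Omega : measurableType d)
     (P : probability Omega R) (g : R * R -> {RV P >-> ipspace alpha})
     (G : {RV P >-> ipspace alpha}),
   [/\ forall U, blocks b U -> is_mu (leb U) (2 * y)^-1 (distribution P (g U)),
       mutually_independent P (blocks b) (fun U => sigma_of (g U)),
       {ae P, forall w, (\esum_(U in blocks b) (mass (g U w))%:E < +oo)%E},
       {ae P, forall w, blocks (G w) =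
          concat_blocks (blocks b) (fun U => g U w)} &
       has_law P G nu]).

(* The independent family of the immigration mass, the immigrating
   PDIP(alpha, alpha) and the offspring of the blocks is indexed by
   [bool + R * R]. *)
Definition is_kappa0 (R : realType) (alpha y : R) (b : ipspace alpha)
    (nu : set (ipspace alpha) -> \bar R) : Prop :=
  (y = 0 -> forall A, measurable A -> nu A = \d_b A) /\
  (0 < y ->
   exists (d : measure_display) (Omega : measurableType d)
     (P : probability Omega R) (B : {RV P >-> R})
     (g0 : {RV P >-> ipspace alpha}) (g : R * R -> {RV P >-> ipspace alpha})
     (G : {RV P >-> ipspace alpha}),
   [/\ has_law P B (gamma_law alpha (2 * y)^-1) /\
       is_PDIP (distribution P g0),
       forall U, blocks b U -> is_mu (leb U) (2 * y)^-1 (distribution P (g U)),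
       mutually_independent P
         [set i : (bool + R * R)%type | if i is inr U then blocks b U else True]
         (fun i => match i with
                   | inl true => sigma_of B
                   | inl false => sigma_of g0
                   | inr U => sigma_of (g U)
                   end),
       {ae P, forall w, (\esum_(U in blocks b) (mass (g U w))%:E < +oo)%E /\
          blocks (G w) =
            scale_blocks (B w) (blocks (g0 w)) `|`
            shift_blocks (B w * mass (g0 w))
              (concat_blocks (blocks b) (fun U => g U w))} &
       has_law P G nu]).

(** * Hunt processes and the two evolutions *)

Definition ip_path_continuous (R : realType) (alpha : R)
    (x : R -> ipspace alpha) : Prop :=
  forall t, 0 <= t -> forall e : R, 0 < e ->
    exists2 eta : R, 0 < eta &
      forall s, 0 <= s -> `|s - t| < eta -> ipdist (x t) (x s) < e.

(* A path-continuous Hunt process with transition kernels [kappa], under the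
   law started from the state [b0].  Continuity of the paths entails
   quasi-left-continuity, and the lifetime is infinite because the kernels
   have total mass 1. *)
Definition continuous_hunt_process (R : realType) (alpha : R)
    (kappa : R -> R.-pker (ipspace alpha) ~> (ipspace alpha))
    (d : measure_display) (Omega : measurableType d) (P : probability Omega R)
    (X : R -> {RV P >-> ipspace alpha}) (b0 : ipspace alpha) : Prop :=
  [/\ {ae P, forall w, X 0 w = b0},
      forall w, ip_path_continuous (X ^~ w) &
      exists F : R -> set (set Omega),
      [/\ filtration F, right_continuous_filtration F, adapted F X &
          forall (tau : Omega -> \bar R) (y : R) (A : set Omega)
            (C : set (ipspace alpha)),
            stopping_time F tau -> 0 <= y -> measurable C ->
            stopped_events F tau A -> (forall w, A w -> (tau w < +oo)%E) ->
            P (A `&` [set w | C (X (fine (tau w) + y) w)]) =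
            (\int[P]_(w in A) kappa y (X (fine (tau w)) w) C)%E]].

Definition type1_evolution (R : realType) (alpha : R)
    (d : measure_display) (Omega : measurableType d) (P : probability Omega R)
    (X : R -> {RV P >-> ipspace alpha}) (b0 : ipspace alpha) : Prop :=
  exists kappa : R -> R.-pker (ipspace alpha) ~> (ipspace alpha),
    (forall y b, 0 <= y -> is_kappa1 y b (kappa y b)) /\
    continuous_hunt_process kappa X b0.

Definition type0_evolution (R : realType) (alpha : R)
    (d : measure_display) (Omega : measurableType d) (P : probability Omega R)
    (X : R -> {RV P >-> ipspace alpha}) (b0 : ipspace alpha) : Prop :=
  exists kappa : R -> R.-pker (ipspace alpha) ~> (ipspace alpha),
    (forall y b, 0 <= y -> is_kappa0 y b (kappa y b)) /\
    continuous_hunt_process kappa X b0.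

(** * Squared Bessel processes *)

Definition brownian_motion (R : realType)
    (d : measure_display) (Omega : measurableType d) (P : probability Omega R)
    (F : R -> set (set Omega)) (B : R -> {RV P >-> R}) : Prop :=
  [/\ adapted F B,
      {ae P, forall w, B 0 w = 0 /\ {within `[0, +oo[, continuous (B ^~ w)}},
      forall s t, 0 <= s -> s < t ->
        independent P (F s) (sigma_of (fun w => B t w - B s w)) &
      forall s t, 0 <= s -> s < t ->
        has_law P (fun w => B t w - B s w)
          (normal_prob 0 (Num.sqrt (t - s)))].

Definition ito_sum (R : realType) (Omega : Type) (H B : R -> Omega -> R)
    (y : R) (n : nat) (w : Omega) : R :=
  \sum_(i < n) H (y * i%:R / n%:R) w *
    (B (y * i.+1%:R / n%:R) w - B (y * i%:R / n%:R) w).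

(* For an adapted integrand [H] with continuous paths, the Ito integral of [H]
   against [B] over [0, y] is the limit in probability of the left-point sums;
   it is only used for such integrands. *)
Definition is_ito_integral (R : realType)
    (d : measure_display) (Omega : measurableType d) (P : probability Omega R)
    (H B : R -> Omega -> R) (y : R) (J : Omega -> R) : Prop :=
  measurable_fun setT J /\
  forall e : R, 0 < e ->
    P [set w | e <= `|ito_sum H B y n w - J w|] @[n --> \oo] --> 0%E.

Definition besq_lifetime (R : realType) (delta : R) (z : R -> R) : \bar R :=
  if 0 < delta then +oo%E
  else ereal_inf [set y%:E | y in [set y | 0 <= y /\ z y = 0]].

(* A weak solution of dZ = delta dy + 2 sqrt(Z) dB up to the lifetime, started
   from [b] and set to 0 after the lifetime.  The stochastic integral need not
   be stopped, as its integrand vanishes after the lifetime. *)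
Definition besq_sde (R : realType) (delta b : R)
    (d : measure_display) (Omega : measurableType d) (P : probability Omega R)
    (F : R -> set (set Omega)) (B Z : R -> {RV P >-> R}) : Prop :=
  [/\ filtration F /\ brownian_motion F B,
      adapted F Z,
      forall w, {within `[0, +oo[, continuous (Z ^~ w)} /\
        forall y, 0 <= y -> 0 <= Z y w,
      {ae P, forall w, Z 0 w = b /\
        forall y, 0 <= y -> (besq_lifetime delta (Z ^~ w) <= y%:E)%E ->
          Z y w = 0} &
      forall y, 0 <= y -> exists J : Omega -> R,
        is_ito_integral P (fun u w => Num.sqrt (Z u w)) B y J /\
        {ae P, forall w, Z y w =
           b + delta * fine (mine y%:E (besq_lifetime delta (Z ^~ w)))
           + 2 * J w}].

(* A continuous [0, +oo[-valued process is BESQ(delta) from [b] when it has the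
   law (equivalently, the finite-dimensional distributions) of such a
   solution. *)
Definition is_BESQ (R : realType) (delta b : R)
    (d : measure_display) (Omega : measurableType d) (P : probability Omega R)
    (W : R -> Omega -> R) : Prop :=
  [/\ forall y, 0 <= y -> measurable_fun setT (W y),
      forall w, {within `[0, +oo[, continuous (W ^~ w)} /\
        forall y, 0 <= y -> 0 <= W y w &
      exists (d' : measure_display) (Omega' : measurableType d')
        (P' : probability Omega' R) (F : R -> set (set Omega'))
        (B Z : R -> {RV P' >-> R}),
        besq_sde delta b F B Z /\
        forall (s : seq R) (A : R -> set R),
          (forall t, t \in s -> 0 <= t /\ measurable (A t)) ->
          P (\bigcap_(t in [set t | t \in s]) (W t @^-1` A t)) =
          P' (\bigcap_(t in [set t | t \in s]) (Z t @^-1` A t))].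

(* Main.v *)
From HB Require Import structures.
Require Import Defs.
From mathcomp Require Import all_boot all_order all_algebra.
From mathcomp Require Import finmap.
From mathcomp Require Import all_classical all_reals all_analysis.
From mathcomp Require Import measurable_realfun.
From mathcomp Require Import ring lra zify.

Set Implicit Arguments.
Unset Strict Implicit.
Unset Printing Implicit Defensive.

Import Order.TTheory GRing.Theory Num.Theory.
Import numFieldNormedType.Exports.

Local Open Scope classical_set_scope.
Local Open Scope ring_scope.

Import HBNNSimple.

(* The mass of a state has an explicit Laplace transform under both kernels:
   started from mass m, after time h it is
     (1 + 2 h l)^-a exp (- l m / (1 + 2 h l))    with a = 0 or a = alpha,
   because block masses add up, PDIP(alpha, alpha) has mass 1 almost surely (a
   stable path has a jump in every interval) and the factors are independent.
   Differentiating gives the first four conditional moments of the increments of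
   the mass process M: with delta = 2 a, M_t - M_0 - delta t is a martingale with
   bracket 4 int M, and fourth moments are quadratic in time.

   The driving Brownian motion is dB = dM~ / (2 sqrt M) where M > 0 and an
   independent noise where M = 0.  It is built as the limit of the sums of
     c_e(M) (M_(t+h) - M_t - delta h) + k_e(M) (W_(t+h) - W_t)
   along dyadic times h = 2^-n, where c_e(m) = 1 / (2 sqrt (m + e)),
   k_e(m) = sqrt (e / (m + e)), W is an auxiliary dyadic Brownian motion and
   e = (9/10)^n.  The isometry shows that the sums are Cauchy, Lindeberg
   replacement against the heat semigroup that the limit has independent normal
   increments, and a Kolmogorov chaining argument that it has a continuous
   version.  The Ito sums of sqrt M against B converge to
   (M_t - M_0 - delta t) / 2 by orthogonality of the errors.

   The auxiliary W lives on pairs (g, u) with g normal and u uniform: the digits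
   of u give two independent uniform variables, and
   (g, u) |-> (((g + x) / sqrt 2, u1), ((g - x) / sqrt 2, u2)), with x normal
   extracted from u, refines one normal increment into two independent ones.

   When delta = 0, absorption at 0 follows from the martingale property alone, by
   stopping at the first dyadic time at which M is below a level. *)

(** * Monotone classes and expectations *)

(** [is_BESQ] asks for a weak solution with the same finite-dimensional laws, so the mass process
    itself, carried to a product space, serves as the solution and no uniqueness theorem for the
    equation is involved. The product is forced: a mass process started at 0 with [delta = 0] is
    almost surely zero, and its space may carry no Brownian motion at all. The obstacle is the
    singularity of 1 / (2 sqrt M) at 0. Since 4 m c_e^2 + k_e^2 = 1, each step has conditional
    variance close to h whatever the mass, while c_e stays bounded. The price is the expectation of
    e / (M + e) on M > 0, which tends to 0 with e by the Laplace transform of M. The level e may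
    shrink only slowly, because freezing the mass over a cell costs sqrt h / e. Most of the
    dependence on alpha disappears before any of this: in the offspring of one block the
    alpha-powers of the leftmost block and of the gamma mass cancel, and the exponent left is linear
    in the block length. The law of the mass thus depends on the state through its mass alone, and
    alpha survives only in the immigration of type 0. *)

Section functional_monotone_class.
Context d (T : measurableType d) (R : realType).
Local Open Scope ereal_scope.

Definition nnfunctional (I : (T -> \bar R) -> \bar R) : Prop :=
  [/\ I (cst 0) = 0,
      forall f g : T -> \bar R, (forall x, 0 <= f x) -> measurable_fun setT f ->
        (forall x, 0 <= g x) -> measurable_fun setT g ->
        I (fun x => f x + g x) = I f + I g,
      forall (c : R) (f : T -> \bar R), (0 <= c)%R -> (forall x, 0 <= f x) ->
        measurable_fun setT f -> I (fun x => c%:E * f x) = c%:E * I f &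
      forall (f : (T -> \bar R)^nat) (g : T -> \bar R),
        (forall n x, 0 <= f n x) -> (forall n, measurable_fun setT (f n)) ->
        (forall x, nondecreasing_seq (f ^~ x)) ->
        (forall x, f n x @[n --> \oo] --> g x) ->
        I (f n) @[n --> \oo] --> I g].

(** Linearity gives agreement on nonnegative simple functions, and the increasing approximation
    [nnsfun_approx] passes it to the limit. Stated for abstract functionals, so that weighted
    integrals, image laws and kernels are covered by one argument. *)
Lemma nnfunctional_eq I1 I2 : nnfunctional I1 -> nnfunctional I2 ->
  (forall C, measurable C ->
    I1 (fun x => (\1_C x)%:E) = I2 (fun x => (\1_C x)%:E)) ->
  forall f, (forall x, 0 <= f x) -> measurable_fun setT f -> I1 f = I2 f.
Proof.
move=> [z1 a1 m1 l1] [z2 a2 m2 l2] H f f0 mf.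
have sumE (I : (T -> \bar R) -> \bar R) (Iz : I (cst 0) = 0)
   (Ia : forall f g : T -> \bar R, (forall x, 0 <= f x) -> measurable_fun setT f ->
        (forall x, 0 <= g x) -> measurable_fun setT g ->
        I (fun x => f x + g x) = I f + I g)
   (Im : forall (c : R) (f : T -> \bar R), (0 <= c)%R -> (forall x, 0 <= f x) ->
        measurable_fun setT f -> I (fun x => c%:E * f x) = c%:E * I f)
   (g : {nnsfun T >-> R}) (s : seq R) : (forall r, r \in s -> (0 <= r)%R) ->
   I (fun x => \sum_(r <- s) r%:E * (\1_(g @^-1` [set r]) x)%:E) =
   \sum_(r <- s) r%:E * I (fun x => (\1_(g @^-1` [set r]) x)%:E).
  have mi r : measurable_fun setT (fun x => (\1_(g @^-1` [set r]) x)%:E : \bar R).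
    apply/measurable_EFinP/measurable_indic.
    by rewrite -(setTI (_ @^-1` _)); exact: measurable_funP.
  elim: s => [|r s ih] rs.
    by rewrite big_nil -[RHS]Iz; congr I; apply/funext => x; rewrite big_nil.
  have r0 : (0 <= r)%R by apply: rs; rewrite mem_head.
  have s0 r' : r' \in s -> (0 <= r')%R by move=> r's; apply: rs; rewrite inE r's orbT.
  rewrite big_cons -ih// -Im//.
  rewrite -Ia//.
  - by congr I; apply/funext => x; rewrite big_cons.
  - by move=> x; rewrite mule_ge0// lee_fin.
  - exact: measurable_funeM.
  - move=> x; rewrite big_seq; apply: sume_ge0 => r' r's.
    by rewrite mule_ge0// lee_fin s0.
  - apply: emeasurable_sum => r'; exact: measurable_funeM.
pose g := nnsfun_approx measurableT mf.
have gE (n : nat) : (fun x => (g n x)%:E) = (fun x => \sum_(r <- fset_set (range (g n)))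
    r%:E * (\1_(g n @^-1` [set r]) x)%:E) :> (T -> \bar R).
  apply/funext => x; rewrite (fimfunE (g n) x) -fsumEFin// fsbig_finite//=.
have gf x : (g n x)%:E @[n --> \oo] --> f x by exact: cvg_nnsfun_approx.
have nd x : nondecreasing_seq (fun n => (g n x)%:E).
  by move=> m n mn; rewrite lee_fin; have /lefP := nd_nnsfun_approx measurableT mf mn; exact.
have mg n : measurable_fun setT (fun x => (g n x)%:E) by exact/measurable_EFinP.
have g0 n x : 0 <= (g n x)%:E by rewrite lee_fin.
have c1 := l1 (fun n x => (g n x)%:E) f g0 mg nd gf.
have c2 := l2 (fun n x => (g n x)%:E) f g0 mg nd gf.
have E12 n : I1 (fun x => (g n x)%:E) = I2 (fun x => (g n x)%:E).
  have pos r : r \in fset_set (range (g n)) -> (0 <= r)%R.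
    by rewrite in_fset_set// => /set_mem [x _ <-].
  rewrite gE (sumE I1)// (sumE I2)//; apply: eq_bigr => r _; congr (_ * _).
  by apply: H; rewrite -(setTI (_ @^-1` _)); exact: measurable_funP.
have c3 : I1 (fun x => (g n x)%:E) @[n --> \oo] --> I2 f.
  by apply: cvg_trans c2; apply: near_eq_cvg; near=> n; rewrite E12.
exact: (cvg_unique _ c1 c3).
Unshelve. all: by end_near. Qed.

End functional_monotone_class.

Section nnfunctional_instances.
Context d (Omega : measurableType d) d' (T : measurableType d') (R : realType).
Local Open Scope ereal_scope.

Lemma nnfunctional_weight (mu : {measure set Omega -> \bar R})
    (h : Omega -> \bar R) : (forall w, 0 <= h w) -> measurable_fun setT h ->
  nnfunctional (fun f : Omega -> \bar R => \int[mu]_w (h w * f w)).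
Proof.
move=> h0 mh; split.
- by rewrite integral0_eq// => w _; rewrite mule0.
- move=> f g f0 mf g0 mg; rewrite -ge0_integralD//; first last.
  + exact: emeasurable_funM.
  + by move=> w _; rewrite mule_ge0.
  + exact: emeasurable_funM.
  + by move=> w _; rewrite mule_ge0.
  by apply: eq_integral => w _; rewrite ge0_muleDr.
- move=> c f c0 f0 mf; rewrite -ge0_integralZl//; first last.
  + by move=> w _; rewrite mule_ge0.
  + exact: emeasurable_funM.
  by apply: eq_integral => w _; rewrite muleCA.
- move=> f g f0 mf nd fg.
  have -> : (fun w => h w * g w) = (fun w => limn (fun n => h w * f n w)).
    apply/funext => w; apply/esym/cvg_lim => //.
    (* Multiplication by an infinite weight is not continuous at 0. Either the limit is 0 and, by
       monotonicity, every [f n w] is 0, or [f n w] is eventually positive and the product is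
       eventually [+oo]. *)
    have [h_oo|hfin] := eqVneq (h w) +oo.
      rewrite h_oo.
      have [g00|g0] := eqVneq (g w) 0.
        have f00 n : f n w = 0.
          apply/eqP; rewrite eq_le f0 andbT -g00.
          rewrite (cvg_unique _ (fg w) (ereal_nondecreasing_cvgn (nd w)))//.
          by apply: ereal_sup_ubound; exists n.
        under eq_fun do rewrite f00 mule0.
        by rewrite g00 mule0; exact: cvg_cst.
      have gp : 0 < g w.
        rewrite lt0e g0 /= -(cvg_lim _ (fg w))//.
        by apply: lime_ge; [apply/cvg_ex; eexists; exact: fg|exact: nearW].
      rewrite gt0_mulye//; apply: cvg_near_cst.
      have : \forall n \near \oo, 0 < f n w.
        apply: (fg w [set y | 0 < y]); apply: open_nbhs_nbhs; split => //.
        exact: open_ereal_gt_ereal.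
      by apply: filterS => n; exact: gt0_mulye.
    apply: cvgeZl => //.
    by rewrite ge0_fin_numE// lt_neqAle hfin leey.
  apply: cvg_monotone_convergence => //.
  + by move=> n; apply: emeasurable_funM.
  + by move=> n w _; rewrite mule_ge0.
  + by move=> w _ m n mn; apply: lee_wpmul2l => //; exact: nd.
Qed.

Lemma nnfunctional_comp (mu : {measure set Omega -> \bar R}) (X : Omega -> T)
    (h : Omega -> \bar R) : measurable_fun setT X ->
  (forall w, 0 <= h w) -> measurable_fun setT h ->
  nnfunctional (fun f : T -> \bar R => \int[mu]_w (h w * f (X w))).
Proof.
move=> mX h0 mh.
have mc (f : T -> \bar R) : measurable_fun setT f -> measurable_fun setT (f \o X).
  by move=> mf; exact: (measurableT_comp mf mX).
have [J0 Ja Jm Jl] := nnfunctional_weight mu h0 mh.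
split => //.
- move=> f g f0 mf g0 mg; apply: (Ja (f \o X) (g \o X)).
  + by move=> w; exact: f0.
  + exact: mc.
  + by move=> w; exact: g0.
  + exact: mc.
- move=> c f c0 f0 mf; apply: (Jm c (f \o X)) => //.
  + by move=> w; exact: f0.
  + exact: mc.
- move=> f g f0 mf nd fg; apply: (Jl (fun n => f n \o X) (g \o X)).
  + by move=> n w /=.
  + by move=> n; exact: (mc (f n)).
  + by move=> w; exact: nd.
  + by move=> w; exact: fg.
Qed.

Lemma nnfunctional_kernel (mu : {measure set Omega -> \bar R})
    (k : Omega -> {measure set T -> \bar R})
    (mk : forall U, measurable U -> measurable_fun setT (k ^~ U))
    (h : Omega -> \bar R) :
  (forall w, 0 <= h w) -> measurable_fun setT h ->
  nnfunctional (fun f : T -> \bar R => \int[mu]_w (h w * \int[k w]_x f x)).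
Proof.
move=> h0 mh.
have mi (f : T -> \bar R) : (forall x, 0 <= f x) -> measurable_fun setT f ->
    measurable_fun setT (fun w => \int[k w]_x f x).
  by move=> f0 mf; exact: measurable_fun_integral_kernel.
have k0 (f : T -> \bar R) : (forall x, 0 <= f x) -> forall w, 0 <= \int[k w]_x f x.
  by move=> f0 w; exact: integral_ge0.
have [J0 Ja Jm Jl] := nnfunctional_weight mu h0 mh.
split.
- rewrite -[RHS]J0; apply: eq_integral => w _; congr (_ * _).
  exact: integral0.
- move=> f g f0 mf g0 mg; rewrite -Ja//; try exact: mi; try exact: k0.
  by apply: eq_integral => w _; congr (_ * _); rewrite ge0_integralD.
- move=> c f c0 f0 mf; rewrite -Jm//; try exact: mi; try exact: k0.
  by apply: eq_integral => w _; congr (_ * _); rewrite ge0_integralZl.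
- move=> f g f0 mf nd fg; apply: Jl.
  + by move=> n w; exact: k0.
  + by move=> n; exact: mi.
  + by move=> w m n mn; apply: ge0_le_integral => // x _; exact: nd.
  + move=> w.
    have -> : \int[k w]_x g x = \int[k w]_x limn (f ^~ x).
      by apply: eq_integral => x _; apply/esym/cvg_lim => //; exact: fg.
    exact: cvg_monotone_convergence.
Qed.

End nnfunctional_instances.

Section transfer.
Context (R : realType) d1 d2 d' (O1 : measurableType d1) (O2 : measurableType d2)
  (T : measurableType d').
Local Open Scope ereal_scope.

(** The weights let one statement serve as change of variables, as density formula and, with [X1]
    the identity into a coarser sigma-algebra, as a property of conditional expectations. *)
Lemma ge0_integral_transfer (m1 : {measure set O1 -> \bar R})
    (m2 : {measure set O2 -> \bar R}) (X1 : O1 -> T) (X2 : O2 -> T)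
    (h1 : O1 -> \bar R) (h2 : O2 -> \bar R) :
  measurable_fun setT X1 -> measurable_fun setT X2 ->
  (forall w, 0 <= h1 w) -> measurable_fun setT h1 ->
  (forall w, 0 <= h2 w) -> measurable_fun setT h2 ->
  (forall C, measurable C -> \int[m1]_w (h1 w * (\1_C (X1 w))%:E) =
     \int[m2]_w (h2 w * (\1_C (X2 w))%:E)) ->
  forall f : T -> \bar R, (forall x, 0 <= f x) -> measurable_fun setT f ->
  \int[m1]_w (h1 w * f (X1 w)) = \int[m2]_w (h2 w * f (X2 w)).
Proof.
move=> mX1 mX2 h10 mh1 h20 mh2 H f f0 mf.
apply: (nnfunctional_eq (nnfunctional_comp m1 mX1 h10 mh1)
  (nnfunctional_comp m2 mX2 h20 mh2) H) => //.
Qed.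

End transfer.

(** * Integrable and square-integrable random variables *)

Section expectation.
Context d (Omega : measurableType d) (R : realType) (P : probability Omega R).
Implicit Types f g : Omega -> R.

Definition integ f := P.-integrable setT (EFin \o f).
Local Notation E f := (Rintegral P setT f).

Lemma integ_meas f : integ f -> measurable_fun setT f.
Proof. by move=> /measurable_int /measurable_EFinP. Qed.

Lemma EFinE f : integ f -> (\int[P]_w (f w)%:E = (E f)%:E)%E.
Proof. by move=> If; rewrite fineK//; exact: integrable_fin_num. Qed.

Lemma integ_cst c : integ (cst c).
Proof. exact: finite_measure_integrable_cst. Qed.

Lemma E_cst c : E (cst c) = c.
Proof. apply: EFin_inj; rewrite -EFinE; last exact: integ_cst.
have := expectation_cst P c; by rewrite unlock.
Qed.

Lemma integD f g : integ f -> integ g -> integ (fun w => f w + g w).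
Proof. by move=> If Ig; exact: (integrableD measurableT If Ig). Qed.

Lemma ED f g : integ f -> integ g -> E (fun w => f w + g w) = E f + E g.
Proof. by move=> If Ig; exact: RintegralD. Qed.

Lemma integB f g : integ f -> integ g -> integ (fun w => f w - g w).
Proof. by move=> If Ig; exact: (integrableB measurableT If Ig). Qed.

Lemma EB f g : integ f -> integ g -> E (fun w => f w - g w) = E f - E g.
Proof. by move=> If Ig; exact: RintegralB. Qed.

Lemma integZ c f : integ f -> integ (fun w => c * f w).
Proof. by move=> If; exact: (integrableZl measurableT c If). Qed.

Lemma EZ c f : integ f -> E (fun w => c * f w) = c * E f.
Proof. by move=> If; exact: RintegralZl. Qed.

Lemma EN f : integ f -> E (fun w => - f w) = - E f.
Proof.
move=> If; rewrite -[RHS]mulN1r -EZ//.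
by apply: eq_Rintegral => w _; rewrite mulN1r.
Qed.

Lemma integ_sum (I : Type) (s : seq I) (h : I -> Omega -> R) :
  (forall i, integ (h i)) -> integ (fun w => \sum_(i <- s) h i w).
Proof.
move=> Ih; elim: s => [|i s ih].
  by under eq_fun do rewrite big_nil; exact: integ_cst.
by under eq_fun do rewrite big_cons; exact: integD.
Qed.

Lemma E_sum (I : Type) (s : seq I) (h : I -> Omega -> R) :
  (forall i, integ (h i)) ->
  E (fun w => \sum_(i <- s) h i w) = \sum_(i <- s) E (h i).
Proof.
move=> Ih; elim: s => [|i s ih].
  by under eq_fun do rewrite big_nil; rewrite big_nil E_cst.
under eq_fun do rewrite big_cons; rewrite big_cons -ih ED//.
exact: integ_sum.
Qed.

Lemma E_ge0 f : (forall w, 0 <= f w) -> 0 <= E f.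
Proof. by move=> f0; apply: Rintegral_ge0. Qed.

Lemma E_le f g : integ f -> integ g -> (forall w, f w <= g w) -> E f <= E g.
Proof. by move=> If Ig fg; exact: le_Rintegral. Qed.

Lemma integ_le f g : measurable_fun setT f -> integ g ->
  (forall w, `|f w| <= g w) -> integ f.
Proof.
move=> mf Ig fg; apply: (le_integrable _ _ _ Ig) => //.
  exact/measurable_EFinP.
by move=> w _ /=; rewrite lee_fin (le_trans (fg w))// ler_norm.
Qed.

Lemma integ_norm f : integ f -> integ (fun w => `|f w|).
Proof. by move=> If; exact: integrable_norm. Qed.

Lemma E_norm_le f : integ f -> `|E f| <= E (fun w => `|f w|).
Proof. by move=> If; exact: le_normr_Rintegral. Qed.

Lemma integ_bounded f M : measurable_fun setT f -> (forall w, `|f w| <= M) ->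
  integ f.
Proof. by move=> mf fM; apply: (integ_le mf (integ_cst M)). Qed.

Lemma integ_boundedM f g M : measurable_fun setT f -> (forall w, `|f w| <= M) ->
  integ g -> integ (fun w => f w * g w).
Proof.
move=> mf fM Ig; apply: (integ_le _ (integZ M (integ_norm Ig))).
  by apply: measurable_funM => //; exact: integ_meas.
by move=> w; rewrite normrM ler_wpM2r.
Qed.

Definition sqint f := measurable_fun setT f /\ integ (fun w => f w ^+ 2).

Lemma sqint_integM f g : sqint f -> sqint g -> integ (fun w => f w * g w).
Proof.
move=> [mf If] [mg Ig]; apply: (integ_le _ (integD If Ig)).
  exact: measurable_funM.
move=> w; rewrite normrM -(real_normK (num_real (f w))) -(real_normK (num_real (g w))).
have := sqr_ge0 (`|f w| - `|g w|); have := normr_ge0 (f w); have := normr_ge0 (g w).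
by set a := `|f w|; set b := `|g w|; nra.
Qed.

Lemma sqint_cst c : sqint (cst c).
Proof. by split => //; exact: (integ_cst (c ^+ 2)). Qed.

Lemma sqint_integ f : sqint f -> integ f.
Proof.
move=> sf; have := sqint_integM sf (sqint_cst 1).
by under eq_fun do rewrite /= mulr1.
Qed.

Lemma sqintD f g : sqint f -> sqint g -> sqint (fun w => f w + g w).
Proof.
move=> sf sg; split; first by apply: measurable_funD; [case: sf|case: sg].
have -> : (fun w => (f w + g w) ^+ 2) =
    (fun w => f w ^+ 2 + (2 * (f w * g w) + g w ^+ 2)).
  by apply/funext => w; ring.
apply: integD; first by case: sf.
by apply: integD; [exact/integZ/sqint_integM|case: sg].
Qed.

Lemma sqint_boundedM f g M : measurable_fun setT f -> (forall w, `|f w| <= M) ->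
  sqint g -> sqint (fun w => f w * g w).
Proof.
move=> mf fM [mg Ig]; split; first exact: measurable_funM.
under eq_fun do rewrite exprMn.
apply: (@integ_boundedM _ _ (M ^+ 2)) => //; first exact: measurable_funX.
by move=> w; rewrite normrX lerXn2r// nnegrE// (le_trans _ (fM w)).
Qed.

Lemma sqintZ c f : sqint f -> sqint (fun w => c * f w).
Proof. by move=> sf; apply: (@sqint_boundedM (cst c) _ `|c|). Qed.

Lemma sqintN f : sqint f -> sqint (fun w => - f w).
Proof. by move=> /(sqintZ (-1)); under eq_fun do rewrite mulN1r. Qed.

Lemma sqintB f g : sqint f -> sqint g -> sqint (fun w => f w - g w).
Proof. by move=> sf /sqintN sg; exact: sqintD. Qed.

Lemma sqint_sum (I : Type) (s : seq I) (h : I -> Omega -> R) :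
  (forall i, sqint (h i)) -> sqint (fun w => \sum_(i <- s) h i w).
Proof.
move=> Ih; elim: s => [|i s ih].
  by under eq_fun do rewrite big_nil; exact: sqint_cst.
by under eq_fun do rewrite big_cons; exact: sqintD.
Qed.

Lemma integ_indicM C f : measurable C -> integ f -> integ (fun w => \1_C w * f w).
Proof.
move=> mC; apply: (@integ_boundedM _ _ 1) => //.
by move=> w; rewrite indicE; case: (_ \in _); rewrite ?normr1 ?normr0.
Qed.

Lemma indic_le1 (C : set Omega) w : `|\1_C w : R| <= 1.
Proof. by rewrite indicE; case: (_ \in _); rewrite ?normr1 ?normr0. Qed.

Lemma E_indic C : measurable C -> (E (\1_C))%:E = P C.
Proof.
move=> mC; rewrite -EFinE ?integral_indic ?setIT//.
exact: integrable_indic.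
Qed.

End expectation.

(** A sub-sigma-algebra is carried by a copy of the type [Omega], so that measurability for [F] is
    ordinary measurability after a cast of the domain. *)
Notation subsig F := (g_sigma_algebraType F).

(** * Conditional moments against adapted factors *)

Section pull_out.
Context d (Omega : measurableType d) (R : realType) (P : probability Omega R).
Implicit Types f g : Omega -> R.
Local Notation E f := (Rintegral P setT f).
Variable F : set (set Omega).
Hypotheses (sF : sigma_algebra setT F) (FM : F `<=` measurable).

Lemma measurable_subsig : (@measurable _ (subsig F)) = F.
Proof. exact: measurable_g_measurableTypeE. Qed.

Lemma measurable_id_subsig : measurable_fun setT (id : Omega -> subsig F).
Proof. by move=> _ B; rewrite setTI measurable_subsig => /FM. Qed.

Lemma subsig_meas d' (T : measurableType d') (g : Omega -> T) :
  measurable_fun setT (g : subsig F -> T) -> measurable_fun setT g.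
Proof.
move=> mg; have := measurableT_comp mg measurable_id_subsig.
exact.
Qed.

(** The hypothesis says that [xi] and [eta] have the same conditional expectation given [F]; a
    factor measurable for [F] may then be inserted. This is how conditional moments of increments
    are used against unbounded adapted coefficients. *)
Lemma pull_out xi eta (G : Omega -> R) : integ P xi -> integ P eta ->
  (forall C, F C -> E (fun w => \1_C w * xi w) = E (fun w => \1_C w * eta w)) ->
  measurable_fun setT (G : subsig F -> R) ->
  integ P (fun w => G w * xi w) -> integ P (fun w => G w * eta w) ->
  E (fun w => G w * xi w) = E (fun w => G w * eta w).
Proof.
move=> Ixi Ieta H mG IGx IGe.
(* Signs are removed by exchanging parts: h1 = xi^+ + eta^- and h2 = xi^- + eta^+ are nonnegative
   with [h1 - h2 = xi - eta], so the hypothesis becomes the equality on [F] of two measures with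
   densities [h1] and [h2]. *)
pose h1 w := Num.max (xi w) 0 + Num.max (- eta w) 0.
pose h2 w := Num.max (- xi w) 0 + Num.max (eta w) 0.
have mx := integ_meas Ixi; have me := integ_meas Ieta.
have mG' := subsig_meas mG.
have mp (f : Omega -> R) : measurable_fun setT f -> measurable_fun setT (fun w => Num.max (f w) 0).
  by move=> mf; exact: measurable_maxr.
have mN (f : Omega -> R) : measurable_fun setT f -> measurable_fun setT (fun w => - f w).
  by move=> mf; exact: measurableT_comp.
have mh1 : measurable_fun setT h1 by apply: measurable_funD; apply: mp => //; exact: mN.
have mh2 : measurable_fun setT h2 by apply: measurable_funD; apply: mp => //; exact: mN.
have h10 w : 0 <= h1 w by rewrite addr_ge0// le_max lexx orbT.
have h20 w : 0 <= h2 w by rewrite addr_ge0// le_max lexx orbT.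
have hh w : h1 w - h2 w = xi w - eta w.
  by rewrite /h1 /h2; case: (leP (xi w) 0); case: (leP (eta w) 0);
     case: (leP (- xi w) 0); case: (leP (- eta w) 0); lra.
have hle1 w : h1 w <= `|xi w| + `|eta w|.
  by apply: lerD; rewrite ge_max normr_ge0 andbT ?ler_norm// -normrN ler_norm.
have hle2 w : h2 w <= `|xi w| + `|eta w|.
  by apply: lerD; rewrite ge_max normr_ge0 andbT ?ler_norm// -normrN ler_norm.
have Ih1 : integ P h1.
  apply: (integ_le mh1 (integD (integ_norm Ixi) (integ_norm Ieta))) => w.
  by rewrite ger0_norm.
have Ih2 : integ P h2.
  apply: (integ_le mh2 (integD (integ_norm Ixi) (integ_norm Ieta))) => w.
  by rewrite ger0_norm.
have HT : forall f : subsig F -> R, (forall x, 0 <= f x) -> measurable_fun setT f ->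
   (\int[P]_w ((h1 w)%:E * (f w)%:E) = \int[P]_w ((h2 w)%:E * (f w)%:E))%E.
  move=> f f0 mf.
  apply: (@ge0_integral_transfer _ _ _ _ _ _ (subsig F) P P id id (EFin \o h1) (EFin \o h2)
    measurable_id_subsig measurable_id_subsig _ _ _ _ _ (EFin \o f)) => //.
  - exact/measurable_EFinP.
  - exact/measurable_EFinP.
  - move=> C; rewrite measurable_subsig => FC; have mC := FM FC.
    under eq_integral do rewrite /= -EFinM mulrC.
    under [RHS]eq_integral do rewrite /= -EFinM mulrC.
    rewrite !EFinE; [|exact: integ_indicM..].
    congr (_%:E); apply/eqP; rewrite -subr_eq0 -EB; [|exact: integ_indicM..].
    under eq_Rintegral do rewrite -mulrBr hh mulrBr.
    by rewrite EB ?H ?subrr//; exact: integ_indicM.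
  - exact/measurable_EFinP.
have HR : forall f : subsig F -> R, (forall x, 0 <= f x) -> measurable_fun setT f ->
   (forall w, `|f w| <= `|G w|) ->
   E (fun w => f w * xi w) = E (fun w => f w * eta w).
  move=> f f0 mf fG; have mf' := subsig_meas mf.
  have Ifx : integ P (fun w => f w * xi w).
    apply: (integ_le _ (integ_norm IGx)); first exact: measurable_funM.
    by move=> w; rewrite !normrM ler_wpM2r.
  have Ife : integ P (fun w => f w * eta w).
    apply: (integ_le _ (integ_norm IGe)); first exact: measurable_funM.
    by move=> w; rewrite !normrM ler_wpM2r.
  have Ib : integ P (fun w => `|f w * xi w| + `|f w * eta w|).
    by apply: integD; exact: integ_norm.
  have I1 : integ P (fun w => h1 w * f w).
    apply: (integ_le _ Ib); first exact: measurable_funM.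
    by move=> w; rewrite !normrM mulrC -mulrDr ler_wpM2l// ger0_norm.
  have I2 : integ P (fun w => h2 w * f w).
    apply: (integ_le _ Ib); first exact: measurable_funM.
    by move=> w; rewrite !normrM mulrC -mulrDr ler_wpM2l// ger0_norm.
  apply/eqP; rewrite -subr_eq0 -EB//.
  have -> : (fun w => f w * xi w - f w * eta w) = (fun w => h1 w * f w - h2 w * f w).
    by apply/funext => w; rewrite -mulrBr -hh; ring.
  rewrite EB// subr_eq0; apply/eqP/EFin_inj.
  by rewrite -!EFinE//; exact: HT.
have mGp : measurable_fun setT (fun w : subsig F => Num.max (G w) 0).
  exact: measurable_maxr.
have mGm : measurable_fun setT (fun w : subsig F => Num.max (- G w) 0).
  by apply: measurable_maxr => //; exact: measurableT_comp.
have GE w : G w = Num.max (G w) 0 - Num.max (- G w) 0.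
  by case: (leP (G w) 0); case: (leP (- G w) 0); lra.
have le1 w : `|Num.max (G w) 0| <= `|G w|.
  by rewrite ger0_norm ?le_max ?lexx ?orbT// ge_max ler_norm normr_ge0.
have le2 w : `|Num.max (- G w) 0| <= `|G w|.
  by rewrite ger0_norm ?le_max ?lexx ?orbT// ge_max -normrN ler_norm normr_ge0.
have Isub f z : measurable_fun setT f -> integ P (fun w => G w * z w) ->
    measurable_fun setT z ->
    (forall w, `|f w| <= `|G w|) -> integ P (fun w => f w * z w).
  move=> mf Iz mz fG; apply: (integ_le _ (integ_norm Iz)).
    exact: measurable_funM.
  by move=> w; rewrite !normrM ler_wpM2r.
have spl z : integ P (fun w => G w * z w) -> measurable_fun setT z ->
   E (fun w => G w * z w) =
   E (fun w => Num.max (G w) 0 * z w) - E (fun w => Num.max (- G w) 0 * z w).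
  move=> Iz mz; rewrite -EB.
  - by apply: eq_Rintegral => w _; rewrite {1}GE mulrBl.
  - by apply: Isub => //; exact: (subsig_meas mGp).
  - by apply: Isub => //; exact: (subsig_meas mGm).
rewrite !spl// !HR// => w; by rewrite le_max lexx orbT.
Qed.

End pull_out.

(** * Almost sure convergence from summable expectations *)

Section as_convergence.
Context d (Omega : measurableType d) (R : realType) (P : probability Omega R).
Local Notation E f := (Rintegral P setT f).
Implicit Types (X : nat -> Omega -> R) (Y : Omega -> R).

Lemma E_bounded_cvg X Y K : (forall n, measurable_fun setT (X n)) ->
  measurable_fun setT Y -> (forall n w, `|X n w| <= K) ->
  {ae P, forall w, X n w @[n --> \oo] --> Y w} ->
  E (X n) @[n --> \oo] --> E Y.
Proof.
move=> mX mY XK XY.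
have [IY _ H] : [/\ P.-integrable setT (EFin \o Y),
   [sequence \int[P]_(x in setT) `|(X n x)%:E - (Y x)%:E|]_n @ \oo --> 0 &
   [sequence \int[P]_(x in setT) (X n x)%:E]_n @ \oo --> (\int[P]_(x in setT) (EFin \o Y) x)]%E.
  apply: (@dominated_convergence _ _ _ P setT measurableT
     (fun n w => (X n w)%:E) (EFin \o Y) (fun=> K%:E)) => //.
  - by move=> n; exact/measurable_EFinP.
  - exact/measurable_EFinP.
  - move: XY; apply: filterS => w XYw _.
    by apply: cvg_EFin => //; exact: nearW.
  - exact: (integ_cst P K).
  - by apply: aeW => w n _; rewrite /= lee_fin.
apply: fine_cvg; rewrite (fineK (integrable_fin_num measurableT IY)).
exact: H.
Qed.

Lemma sum_geometric_le (n : nat) : \sum_(k < n) (4^-1 : R) ^+ k <= 2.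
Proof.
suff : \sum_(k < n) (4^-1 : R) ^+ k <= 2 - 2 * 4^-1 ^+ n.
  by move=> /le_trans; apply; rewrite lerBlDr lerDl mulr_ge0// exprn_ge0.
elim: n => [|n ih]; first by rewrite big_ord0 expr0; lra.
rewrite big_ord_recr /= exprS; have : 0 <= (4^-1 : R) ^+ n by rewrite exprn_ge0.
lra.
Qed.

(** The rate 16^-k for squares gives the rate 4^-k in L^1, so the sum of the absolute increments is
    almost surely finite. The bound is asked only from a rank [k0] on, because a given dyadic time
    enters the horizon only at some rank. *)
Lemma as_cvg_of_sqdist X k0 : (forall n, sqint P (X n)) ->
  (forall k, (k0 <= k)%N -> E (fun w => (X k.+1 w - X k w) ^+ 2) <= (16^-1) ^+ k) ->
  {ae P, forall w, cvgn (X ^~ w)}.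
Proof.
move=> sX HX.
pose Y k w := `|X (k + k0).+1 w - X (k + k0)%N w|.
have Y0 k w : (0 <= (Y k w)%:E)%E by rewrite lee_fin /Y.
have sY k : sqint P (fun w => X (k + k0).+1 w - X (k + k0)%N w) by exact: sqintB.
have IY k : integ P (Y k) by apply: integ_norm; exact: sqint_integ.
have EY k : E (Y k) <= (4^-1) ^+ k.
  have r0 : 0 < (4^-1 : R) ^+ k by rewrite exprn_gt0// invr_gt0.
  have I2 := (sY k).2; have Ic := integ_cst P ((4^-1) ^+ k / 2).
  (* AM-GM with weight r = 4^-k, that is |z| <= z^2 / (2 r) + r / 2, in place of the Cauchy-Schwarz
     inequality. *)
  apply: (@le_trans _ _ (E (fun w => (2 * 4^-1 ^+ k)^-1 *
      (X (k + k0).+1 w - X (k + k0)%N w) ^+ 2 + 4^-1 ^+ k / 2))).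
    apply: E_le => //; first by apply: integD => //; exact: integZ.
    move=> w; rewrite /Y; set z := X _ w - X _ w.
    rewrite -(real_normK (num_real z)).
    have -> : (2 * 4^-1 ^+ k)^-1 * `|z| ^+ 2 + 4^-1 ^+ k / 2 =
      `|z| + (2 * 4^-1 ^+ k)^-1 * (`|z| - 4^-1 ^+ k) ^+ 2.
      by field; rewrite gt_eqF.
    by rewrite lerDl mulr_ge0 ?sqr_ge0// invr_ge0 mulr_ge0// ltW.
  rewrite (ED (integZ _ I2) Ic) (EZ _ I2) (E_cst P).
  have := HX (k + k0)%N (leq_addl _ _); set e := E _ => He.
  have He' : e <= (4^-1 ^+ k) ^+ 2.
    have -> : (4^-1 ^+ k) ^+ 2 = 16^-1 ^+ k :> R.
      by rewrite -exprM mulnC exprM; congr (_ ^+ _); field.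
    apply: le_trans He _; rewrite exprD ler_piMr ?exprn_ge0//.
    by apply: exprn_ile1 => //; lra.
  have := ler_wpM2l (_ : 0 <= (2 * 4^-1 ^+ k)^-1) He'.
  rewrite invr_ge0 mulr_ge0 ?(ltW r0)// => /(_ isT) H.
  apply: le_trans (lerD H (lexx _)) _.
  by rewrite le_eqVlt; apply/orP; left; apply/eqP; field; rewrite gt_eqF.
have IS : (\int[P]_w (\sum_(0 <= k <oo) (Y k w)%:E) < +oo)%E.
  rewrite integral_nneseries//; last first.
    by move=> k; apply/measurable_EFinP; exact: integ_meas.
  apply: (@le_lt_trans _ _ 2%:E); last exact: ltry.
  apply: lime_le.
    by apply: is_cvg_ereal_nneg_natsum => k _; exact: integral_ge0.
  apply: nearW => n; rewrite big_mkord.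
  under eq_bigr do rewrite EFinE//.
  rewrite sumEFin lee_fin; apply: le_trans (sum_geometric_le n).
  by apply: ler_sum => k _; exact: EY.
have mS : measurable_fun setT (fun w => \sum_(0 <= k <oo) (Y k w)%:E)%E.
  apply: ge0_emeasurable_sum.
  - by [].
  - by move=> k _; apply/measurable_EFinP; exact: integ_meas.
have IS' : P.-integrable setT (fun w => \sum_(0 <= k <oo) (Y k w)%:E)%E.
  apply/integrableP; split => //.
  rewrite (eq_integral (fun w => \sum_(0 <= k <oo) (Y k w)%:E)%E)// => w _.
  by rewrite gee0_abs//; exact: nneseries_ge0.
have := integrable_ae measurableT IS'; apply: filterS => w /(_ Logic.I) Sfin.
have cS : cvgn (series (fun k => X (k + k0).+1 w - X (k + k0)%N w)).
  apply: normed_cvg; apply: nondecreasing_is_cvgn.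
    by apply: nondecreasing_series => k _ _ /=.
  exists (fine (\sum_(0 <= k <oo) (Y k w)%:E)%E) => _ [n _ <-].
  rewrite -lee_fin fineK// /series /= -sumEFin.
  by apply: (@nneseries_lim_ge R (fun k => (Y k w)%:E) xpredT 0 n).
have E1 n : series (fun k => X (k + k0).+1 w - X (k + k0)%N w) n = X (n + k0)%N w - X k0 w.
  rewrite /series /=; elim: n => [|n ih]; first by rewrite big_geq// subrr.
  by rewrite big_nat_recr//= ih addSn; ring.
have c2 : cvgn (fun n => X (n + k0)%N w).
  have -> : (fun n => X (n + k0)%N w) =
     (fun n => series (fun k => X (k + k0).+1 w - X (k + k0)%N w) n + X k0 w).
    by apply/funext => n; rewrite E1 subrK.
  by apply: is_cvgD => //; exact: is_cvg_cst.
apply/cvg_ex; have /cvg_ex[l Hl] := c2; exists l.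
by rewrite -(cvg_shiftn k0).
Qed.

(** Borel-Cantelli in expectation form: the series of the [Y n] has finite expectation, hence
    converges almost surely. *)
Lemma as_cvg0_of_sum (Y : nat -> Omega -> R) (B : R) : (forall n w, 0 <= Y n w) ->
  (forall n, integ P (Y n)) -> (forall n, \sum_(k < n) E (Y k) <= B) ->
  {ae P, forall w, Y n w @[n --> \oo] --> 0}.
Proof.
move=> Y0' IY EY; have Y0 n w : (0 <= (Y n w)%:E)%E by rewrite lee_fin.
have IS : (\int[P]_w (\sum_(0 <= k <oo) (Y k w)%:E) < +oo)%E.
  rewrite integral_nneseries//; last first.
    by move=> k; apply/measurable_EFinP; exact: integ_meas.
  apply: (@le_lt_trans _ _ B%:E); last exact: ltry.
  apply: lime_le.
    by apply: is_cvg_ereal_nneg_natsum => k _; exact: integral_ge0.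
  apply: nearW => n; rewrite big_mkord.
  under eq_bigr do rewrite EFinE//.
  by rewrite sumEFin lee_fin.
have mS : measurable_fun setT (fun w => \sum_(0 <= k <oo) (Y k w)%:E)%E.
  apply: ge0_emeasurable_sum.
  - by [].
  - by move=> k _; apply/measurable_EFinP; exact: integ_meas.
have IS' : P.-integrable setT (fun w => \sum_(0 <= k <oo) (Y k w)%:E)%E.
  apply/integrableP; split => //.
  rewrite (eq_integral (fun w => \sum_(0 <= k <oo) (Y k w)%:E)%E)// => w _.
  by rewrite gee0_abs//; exact: nneseries_ge0.
have := integrable_ae measurableT IS'; apply: filterS => w /(_ Logic.I) Sfin.
apply: (@cvg_series_cvg_0 _ R (Y ^~ w)).
apply: nondecreasing_is_cvgn; first by apply: nondecreasing_series => k _ _ /=.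
exists (fine (\sum_(0 <= k <oo) (Y k w)%:E)%E) => _ [n _ <-].
rewrite -lee_fin fineK// /series /= -sumEFin.
by apply: (@nneseries_lim_ge R (fun k => (Y k w)%:E) xpredT 0 n).
Qed.

End as_convergence.

(** * Regularised coefficients and dyadic times *)

Section regularised_inverse_root.
Variable R : realType.
Implicit Types e m x y : R.

(** Written as a real power, so that measurability comes from that of powers; [invsqrtE] gives back
    the square root on the range of use. *)
Definition invsqrt e m : R := (m + e) `^ (- 2^-1).

Lemma invsqrtE e m : 0 < e -> 0 <= m -> invsqrt e m = (Num.sqrt (m + e))^-1.
Proof.
move=> e0 m0; rewrite /invsqrt powRN powR12_sqrt// addr_ge0//; exact: ltW.
Qed.

Lemma invsqrt_ge0 e m : 0 <= invsqrt e m.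
Proof. exact: powR_ge0. Qed.

Lemma measurable_invsqrt e : measurable_fun setT (invsqrt e).
Proof.
apply: (measurableT_comp (measurable_powR _)).
exact: measurable_funD.
Qed.

Lemma sqrtD_gt0 e m : 0 < e -> 0 <= m -> 0 < Num.sqrt (m + e).
Proof. by move=> e0 m0; rewrite sqrtr_gt0 ltr_wpDl. Qed.

Lemma invsqrt_sqr e m : 0 < e -> 0 <= m -> invsqrt e m ^+ 2 = (m + e)^-1.
Proof.
move=> e0 m0; rewrite invsqrtE// exprVn sqr_sqrtr//.
by rewrite addr_ge0//; exact: ltW.
Qed.

Lemma invsqrt_le e m : 0 < e -> 0 <= m -> invsqrt e m <= (Num.sqrt e)^-1.
Proof.
move=> e0 m0; rewrite invsqrtE// lef_pV2 ?posrE ?sqrtr_gt0 ?ltr_wpDl//.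
by rewrite ler_wsqrtr// lerDr.
Qed.

Lemma invsqrt_sqr_le e m : 0 < e -> 0 <= m -> invsqrt e m ^+ 2 <= e^-1.
Proof.
move=> e0 m0; rewrite invsqrt_sqr// lef_pV2 ?posrE ?ltr_wpDl//.
by rewrite lerDr.
Qed.

Lemma invsqrt_diff_sqr_le e e' m m' : 0 < e -> 0 < e' -> 0 <= m -> 0 <= m' ->
  e' <= e -> (invsqrt e m - invsqrt e' m') ^+ 2 <= e'^-1.
Proof.
move=> e0 e'0 m0 m'0 ee'.
have h1 : invsqrt e m ^+ 2 <= e'^-1.
  by apply: (le_trans (invsqrt_sqr_le e0 m0)); rewrite lef_pV2.
have h2 := invsqrt_sqr_le e'0 m'0.
have := invsqrt_ge0 e m; have := invsqrt_ge0 e' m'.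
move: h1 h2; set a := invsqrt e m; set b := invsqrt e' m'; set c := e'^-1.
move=> h1 h2 b0 a0; case: (leP a b) => ab; nra.
Qed.

(** With x = sqrt (m + e) and y = sqrt (m' + e) the left side is (x - y)^2 / y^2; here (x - y)^2 <=
    |x^2 - y^2| and y^2 >= e. This is the cost of freezing the mass over a cell. *)
Lemma coef_same_eps e m m' : 0 < e -> 0 <= m -> 0 <= m' ->
  (m + e) * (invsqrt e m - invsqrt e m') ^+ 2 <= `|m - m'| / e.
Proof.
move=> e0 m0 m'0; rewrite !invsqrtE//.
have x0 := sqrtD_gt0 e0 m0; have y0 := sqrtD_gt0 e0 m'0.
have xE : Num.sqrt (m + e) ^+ 2 = m + e by rewrite sqr_sqrtr// addr_ge0// ltW.
have yE : Num.sqrt (m' + e) ^+ 2 = m' + e by rewrite sqr_sqrtr// addr_ge0// ltW.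
have -> : `|m - m'| = `|Num.sqrt (m + e) ^+ 2 - Num.sqrt (m' + e) ^+ 2|.
  by rewrite xE yE; congr `|_|; ring.
rewrite -{1}xE; move: x0 y0 yE xE.
set x := Num.sqrt (m + e); set y := Num.sqrt (m' + e) => x0 y0 yE xE.
have -> : x ^+ 2 * (x^-1 - y^-1) ^+ 2 = (x - y) ^+ 2 * y ^- 2.
  by field; rewrite !gt_eqF.
apply: ler_pM; rewrite ?sqr_ge0 ?invr_ge0 ?sqr_ge0//.
  rewrite subr_sqr normrM -real_normK ?num_real// expr2 ler_wpM2l//.
  have xy0 : 0 <= x + y by lra.
  by rewrite (ger0_norm xy0) ler_norml; apply/andP; split; lra.
by rewrite lef_pV2 ?posrE ?exprn_gt0// yE lerDr.
Qed.

(** The left side is the squared distance of the unit vectors (sqrt m, sqrt e) / sqrt (m + e) and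
    (sqrt m, sqrt e') / sqrt (m + e'), that is, 2 minus twice their scalar product. At m = 0 both
    are (0, 1), so the bound vanishes there, whereas e / (m + e) would equal 1 and would not tend to
    0 with e. *)
Lemma coef_same_mass e e' m : 0 < e' -> e' <= e -> 0 <= m ->
  m * (invsqrt e m - invsqrt e' m) ^+ 2 +
  (Num.sqrt e * invsqrt e m - Num.sqrt e' * invsqrt e' m) ^+ 2 <=
  if 0 < m then 2 * (e / (m + e)) else 0.
Proof.
move=> e'0 ee' m0; have e0 := lt_le_trans e'0 ee'.
case: ltP => [mp|mn]; last first.
  have -> : m = 0 by apply/eqP; rewrite eq_le mn.
  rewrite !invsqrtE// !add0r !mulfV ?gt_eqF ?sqrtr_gt0// subrr expr0n /=.
  by rewrite mul0r addr0.
rewrite !invsqrtE//.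
have x0 := sqrtD_gt0 e0 m0; have y0 := sqrtD_gt0 e'0 m0.
have xE : Num.sqrt (m + e) ^+ 2 = m + e by rewrite sqr_sqrtr// addr_ge0// ltW.
have yE : Num.sqrt (m + e') ^+ 2 = m + e' by rewrite sqr_sqrtr// addr_ge0// ltW.
have xy : Num.sqrt (m + e') <= Num.sqrt (m + e) by rewrite ler_wsqrtr// lerD2l.
have sE : Num.sqrt e ^+ 2 = e by rewrite sqr_sqrtr ?ltW.
have s'E : Num.sqrt e' ^+ 2 = e' by rewrite sqr_sqrtr ?ltW.
have s0 : 0 < Num.sqrt e by rewrite sqrtr_gt0.
have s'0 : 0 < Num.sqrt e' by rewrite sqrtr_gt0.
rewrite -[in leRHS]xE; move: x0 y0 xE yE xy sE s'E s0 s'0.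
set x := Num.sqrt (m + e); set y := Num.sqrt (m + e').
set s := Num.sqrt e; set s' := Num.sqrt e' => x0 y0 xE yE xy sE s'E s0 s'0.
have -> : m * (x^-1 - y^-1) ^+ 2 + (s / x - s' / y) ^+ 2 =
   (m + s ^+ 2) * x ^- 2 + (m + s' ^+ 2) * y ^- 2 - 2 * (m + s * s') * (x^-1 * y^-1).
  by field; rewrite !gt_eqF.
rewrite sE s'E -xE -yE !mulfV ?gt_eqF ?exprn_gt0//.
have -> : 2 * (e / x ^+ 2) = 2 - 2 * (m * x ^- 2).
  have -> : e = x ^+ 2 - m by rewrite xE; ring.
  by field; rewrite gt_eqF.
suff : m * x ^- 2 <= (m + s * s') * (x^-1 * y^-1) by lra.
apply: ler_pM; rewrite ?invr_ge0 ?sqr_ge0//.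
  by rewrite lerDl mulr_ge0 ?ltW.
by rewrite expr2 invfM ler_wpM2l ?invr_ge0 ?(ltW x0)// lef_pV2.
Qed.

(** Passes through the coefficients at level [e] and mass [m]: the first term on the right pays for
    the change of mass, the second for the change of level. *)
Lemma coef_dist e e' m m' : 0 < e' -> e' <= e -> 0 <= m -> 0 <= m' ->
  m * (invsqrt e m' - invsqrt e' m) ^+ 2 +
  (Num.sqrt e * invsqrt e m' - Num.sqrt e' * invsqrt e' m) ^+ 2 <=
  2 * (`|m - m'| / e) + 2 * (if 0 < m then 2 * (e / (m + e)) else 0).
Proof.
move=> e'0 ee' m0 m'0; have e0 := lt_le_trans e'0 ee'.
have h1 := coef_same_eps e0 m0 m'0; have h2 := coef_same_mass e'0 ee' m0.
have sE : Num.sqrt e ^+ 2 = e by rewrite sqr_sqrtr ?ltW.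
apply: le_trans (lerD (ler_wpM2l (ltW (ltr0n R 2)) h1) (ler_wpM2l (ltW (ltr0n R 2)) h2)).
move: sE; set s := Num.sqrt e; set s' := Num.sqrt e'.
set a := invsqrt e m'; set b := invsqrt e' m; set c := invsqrt e m => sE.
have -> : (m + e) * (c - a) ^+ 2 = m * (c - a) ^+ 2 + (s * c - s * a) ^+ 2.
  by rewrite -sE; ring.
have hA : (a - b) ^+ 2 <= 2 * (c - a) ^+ 2 + 2 * (c - b) ^+ 2.
  have := sqr_ge0 (a + b - 2 * c); lra.
have hB : (s * a - s' * b) ^+ 2 <= 2 * (s * c - s * a) ^+ 2 + 2 * (s * c - s' * b) ^+ 2.
  have := sqr_ge0 (s * a + s' * b - 2 * (s * c)); lra.
have := ler_wpM2l m0 hA; lra.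
Qed.

End regularised_inverse_root.

(** * Dyadic grids and the rates of the approximation *)

Section dyadic.
Variable R : realType.

Definition mesh n : R := (2 ^+ n)^-1.
Definition dyad n i : R := i%:R * mesh n.

Lemma mesh_gt0 n : 0 < mesh n.
Proof. by rewrite invr_gt0 exprn_gt0. Qed.

Lemma mesh_ge0 n : 0 <= mesh n.
Proof. exact/ltW/mesh_gt0. Qed.

Lemma dyad_ge0 n i : 0 <= dyad n i.
Proof. by rewrite mulr_ge0// mesh_ge0. Qed.

Lemma dyadS n i : dyad n i.+1 = dyad n i + mesh n.
Proof. by rewrite /dyad -addn1 natrD mulrDl mul1r. Qed.

Lemma meshS n : mesh n = 2 * mesh n.+1.
Proof. by rewrite /mesh exprS invfM mulrA divff ?mul1r. Qed.

Lemma dyad_double n i : dyad n.+1 i.*2 = dyad n i.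
Proof. by rewrite /dyad (meshS n) -muln2 natrM mulrA. Qed.

Lemma ler_dyad n i j : (dyad n i <= dyad n j) = (i <= j)%N.
Proof. by rewrite ler_pM2r ?mesh_gt0// ler_nat. Qed.

Lemma dyad0 n : dyad n 0 = 0.
Proof. by rewrite /dyad mul0r. Qed.

End dyadic.

Section dyadic_refine.
Variable R : realType.

Lemma mesh_exp n p : mesh R n = (2 ^ p)%:R * mesh R (n + p).
Proof.
by rewrite /mesh exprD invfM natrX mulrCA divff ?mulr1// gt_eqF ?exprn_gt0.
Qed.

Lemma dyad_exp n p i : dyad R (n + p) (i * 2 ^ p) = dyad R n i.
Proof. by rewrite /dyad (mesh_exp n p) natrM mulrA. Qed.

Lemma dyad_floor n p j :
  dyad R n (j %/ 2 ^ p) <= dyad R (n + p) j <= dyad R n (j %/ 2 ^ p) + mesh R n.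
Proof.
have E := divn_eq j (2 ^ p).
rewrite -dyadS -!(dyad_exp n p) !ler_dyad {2}E leq_addr /=.
by rewrite [leqLHS]E mulSn addnC leq_add2r ltnW// ltn_mod expn_gt0.
Qed.

Lemma sum_mesh_lt (m N : nat) (x : R) : 0 <= x ->
  \sum_(j < N) mesh R m * (dyad R m j < x)%R%:R <= x + mesh R m.
Proof.
move=> x0; have h0 := mesh_gt0 R m.
(* The second bound feeds the first: a new term counts only if [dyad R m N < x], and the sum so far
   is then at most [dyad R m N]. *)
suff [//] : \sum_(j < N) mesh R m * (dyad R m j < x)%R%:R <= x + mesh R m /\
   \sum_(j < N) mesh R m * (dyad R m j < x)%R%:R <= dyad R m N.
elim: N => [|N [ih1 ih2]]; first by rewrite big_ord0 dyad0; split; lra.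
rewrite big_ord_recr /= dyadS; case: ltP => [lt|ge]; rewrite ?mulr1 ?mulr0; lra.
Qed.

(** One sequence with two uses, as level of regularisation and as modulus of continuity in the
    chaining. The first needs sqrt mesh / eps to decay, that is, a ratio above sqrt (1/2); the
    second works with fourth moments and needs a ratio whose fourth power exceeds 1/2. The ratio
    9/10 satisfies both. *)
Definition eps n : R := (9 / 10) ^+ n.

Lemma eps_gt0 n : 0 < eps n.
Proof. by rewrite exprn_gt0//; lra. Qed.

Lemma eps_le n p : eps (n + p) <= eps n.
Proof.
rewrite /eps exprD ler_piMr ?exprn_ge0//; try lra.
by apply: exprn_ile1; lra.
Qed.

Definition rate : R := Num.sqrt (2^-1) / (9 / 10).

Lemma rate_ge0 : 0 <= rate.
Proof. by rewrite divr_ge0// ?sqrtr_ge0//; lra. Qed.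

Lemma rate_lt1 : rate < 1.
Proof.
rewrite ltr_pdivrMr ?mul1r; last lra.
have s0 := sqrtr_ge0 (2^-1 : R).
have : Num.sqrt (2^-1 : R) ^+ 2 = 2^-1 by rewrite sqr_sqrtr// invr_ge0.
move: s0; set s := (Num.sqrt _ : R) => s0 sE; nra.
Qed.

Lemma sqrt_mesh n : Num.sqrt (mesh R n) = Num.sqrt 2^-1 ^+ n.
Proof.
elim: n => [|n ih]; first by rewrite /mesh expr0 invr1 sqrtr1.
rewrite exprS -ih -sqrtrM ?invr_ge0//; congr Num.sqrt.
by rewrite /mesh exprS invfM.
Qed.

Lemma sqrt_mesh_eps n : Num.sqrt (mesh R n) / eps n = rate ^+ n.
Proof. by rewrite sqrt_mesh /rate (expr_div_n (Num.sqrt 2^-1) (9 / 10) n). Qed.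

Lemma mesh_le1 n : mesh R n <= 1.
Proof. by rewrite invf_le1 ?exprn_gt0// exprn_ege1// ler1n. Qed.

Lemma mesh_le_sqrt n : mesh R n <= Num.sqrt (mesh R n).
Proof.
have h0 := mesh_ge0 R n; rewrite -{1}(sqr_sqrtr h0) expr2 ler_piMr ?sqrtr_ge0//.
by rewrite -[leRHS]sqrtr1 ler_wsqrtr// mesh_le1.
Qed.

Lemma eps_le1 n : eps n <= 1.
Proof. by rewrite -[leRHS](expr0 (9/10)) -/(eps 0) -[n]add0n eps_le. Qed.

Lemma mesh_eps_le n : mesh R n / eps n <= rate ^+ n.
Proof.
by rewrite -sqrt_mesh_eps ler_pM2r ?mesh_le_sqrt// invr_gt0 eps_gt0.
Qed.

Lemma mesh_eps_mono n p : mesh R (n + p) / eps (n + p) <= mesh R n / eps n.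
Proof.
rewrite /mesh /eps !exprD !invfM mulrACA ler_piMr ?mulr_ge0 ?invr_ge0 ?exprn_ge0//;
  try lra.
rewrite -!exprVn -exprMn exprn_ile1//; lra.
Qed.

Lemma mesh_le_rate n : mesh R n <= rate ^+ n.
Proof.
apply: le_trans (mesh_eps_le n); rewrite ler_peMr ?mesh_ge0//.
by rewrite invf_ge1 ?eps_gt0// eps_le1.
Qed.

Lemma cvg_rate : rate ^+ n @[n --> \oo] --> (0 : R).
Proof. by apply: cvg_expr; rewrite ger0_norm ?rate_ge0 ?rate_lt1. Qed.

Lemma cvg_eps : eps n @[n --> \oo] --> (0 : R).
Proof. by apply: cvg_expr; rewrite ger0_norm; lra. Qed.

(* Cost of replacing [m] by the regularisation [m + e]. *)
Definition qf e m : R := if 0 < m then e / (m + e) else 0.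

Lemma qf_ge0 e m : 0 <= e -> 0 <= qf e m.
Proof.
by rewrite /qf => e0; case: ltP => // m0; rewrite divr_ge0// addr_ge0// ltW.
Qed.

Lemma qf_le1 e m : 0 <= e -> qf e m <= 1.
Proof.
rewrite /qf => e0; case: ltP => // m0; rewrite ler_pdivrMr ?mul1r ?ltr_wpDr//.
by rewrite lerDr ltW.
Qed.

Lemma measurable_qf e : 0 <= e -> measurable_fun setT (qf e).
Proof.
move=> e0; rewrite (_ : qf e = fun m => if 0 < m then e * (m + e) `^ (-1) else 0); last first.
  apply/funext => m; rewrite /qf; case: ltP => // m0.
  by rewrite powR_inv1// addr_ge0// ltW.
apply: measurable_fun_ifT => //; first exact: measurable_fun_ltr.
apply: measurable_funM => //; apply: (measurableT_comp (measurable_powR _)).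
exact: measurable_funD.
Qed.

Lemma sqr_amgm (x r : R) : 0 < r -> x <= (2 * r)^-1 * x ^+ 2 + r / 2.
Proof.
move=> r0; have -> : (2 * r)^-1 * x ^+ 2 + r / 2 = x + (2 * r)^-1 * (x - r) ^+ 2.
  by field; rewrite gt_eqF.
by rewrite lerDl mulr_ge0 ?sqr_ge0// invr_ge0 mulr_ge0// ltW.
Qed.

Lemma step_bound_arith (delta m h a b s s' q1 q2 e' : R) : 0 <= delta -> 0 <= h ->
  m * (a - b) ^+ 2 + (s * a - s' * b) ^+ 2 <= q1 + 2 * (2 * q2) ->
  (a - b) ^+ 2 <= e' ->
  (a / 2 - b / 2) ^+ 2 * (4 * m * h + 2 * delta * h ^+ 2) + (s * a - s' * b) ^+ 2 * h
  <= h * (q1 + (4 * q2 + delta / 2 * (h * e'))).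
Proof.
move=> d0 h0 H1 H2.
have := ler_wpM2l h0 H1; have := ler_wpM2l (mulr_ge0 d0 (sqr_ge0 h)) H2.
set X := (a - b) ^+ 2; set Y := (s * a - s' * b) ^+ 2.
have -> : (a / 2 - b / 2) ^+ 2 = X / 4 by rewrite /X; field.
lra.
Qed.

(** Interpolates a third absolute moment between the second and the fourth; [r] is to be chosen as
    the typical size of [z]. *)
Lemma cube_amgm (z r : R) : 0 < r -> `|z| ^+ 3 <= 2^-1 * (r * z ^+ 2 + r^-1 * z ^+ 4).
Proof.
move=> r0; rewrite -(real_normK (num_real z)) (_ : z ^+ 4 = (`|z| ^+ 2) ^+ 2); last first.
  by rewrite real_normK ?num_real// -exprM.
set a := `|z|; have a0 : 0 <= a := normr_ge0 _.
have -> : 2^-1 * (r * a ^+ 2 + r^-1 * (a ^+ 2) ^+ 2) =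
   a ^+ 3 + 2^-1 * (r^-1 * (a * (a - r)) ^+ 2).
  by field; rewrite gt_eqF.
by rewrite lerDl mulr_ge0 ?invr_ge0// mulr_ge0 ?sqr_ge0// invr_ge0 ltW.
Qed.

Lemma pow4D_le (x y : R) : (x + y) ^+ 4 <= 8 * (x ^+ 4 + y ^+ 4).
Proof.
have sq (a b : R) : (a + b) ^+ 2 <= 2 * (a ^+ 2 + b ^+ 2).
  by have := sqr_ge0 (a - b); lra.
have e4 (a : R) : a ^+ 4 = (a ^+ 2) ^+ 2 by rewrite -exprM.
rewrite e4; apply: (@le_trans _ _ ((2 * (x ^+ 2 + y ^+ 2)) ^+ 2)).
  by rewrite lerXn2r ?nnegrE ?sqr_ge0 ?mulr_ge0 ?addr_ge0 ?sqr_ge0.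
have := sq (x ^+ 2) (y ^+ 2); rewrite !e4; lra.
Qed.

(** The weight sqrt h / e balances a second moment of order h against a fourth moment of order h^2 /
    e^2: both terms become h (sqrt h / e) up to constants. *)
Lemma third_moment_arith (h e m2 m4 delta K KW : R) : 0 < h -> 0 < e -> e <= 1 -> h / e <= 1 ->
  0 <= K -> 0 <= KW -> 0 <= delta ->
  m2 <= h * (1 + delta / 2 * (h / e)) -> m4 <= 8 * ((16 * e ^+ 2)^-1 * (K * h ^+ 2) + KW * h ^+ 2) ->
  2^-1 * (Num.sqrt h / e * m2 + (Num.sqrt h / e)^-1 * m4) <=
  h * (Num.sqrt h / e * (1 + delta + K + 8 * KW)).
Proof.
move=> h0 e0 e1 he K0 KW0 d0 H2 H4.
have s0 : 0 < Num.sqrt h by rewrite sqrtr_gt0.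
have sE : Num.sqrt h ^+ 2 = h by rewrite sqr_sqrtr// ltW.
move: s0 sE; set s := Num.sqrt h => s0 sE.
have r0 : 0 < s / e by rewrite divr_gt0.
have ri0 : 0 < (s / e)^-1 by rewrite invr_gt0.
have A := ler_wpM2l (ltW r0) H2; have B := ler_wpM2l (ltW ri0) H4.
have EB : (s / e)^-1 * (8 * ((16 * e ^+ 2)^-1 * (K * h ^+ 2) + KW * h ^+ 2)) =
   h * (s / e * (K / 2 + 8 * KW * e ^+ 2)).
  by rewrite -sE; field; rewrite !gt_eqF.
rewrite EB in B.
have EA : s / e * (h * (1 + delta / 2 * (h / e))) = h * (s / e * (1 + delta / 2 * (h / e))).
  by ring.
rewrite EA in A.
have C1 : delta / 2 * (h / e) <= delta / 2 * 1 by rewrite ler_wpM2l// divr_ge0.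
have C2 : KW * e ^+ 2 <= KW * 1 by rewrite ler_wpM2l// expr_le1// ltW.
have : h * (s / e * (1 + delta / 2 * (h / e) + (K / 2 + 8 * KW * e ^+ 2))) <=
   h * (s / e * (2 * (1 + delta + K + 8 * KW))).
  by rewrite ler_wpM2l ?(ltW h0)// ler_wpM2l ?(ltW r0)//; lra.
have -> : h * (s / e * (1 + delta / 2 * (h / e) + (K / 2 + 8 * KW * e ^+ 2))) =
  h * (s / e * (1 + delta / 2 * (h / e))) + h * (s / e * (K / 2 + 8 * KW * e ^+ 2)) by ring.
have -> : h * (s / e * (2 * (1 + delta + K + 8 * KW))) =
  2 * (h * (s / e * (1 + delta + K + 8 * KW))) by ring.
lra.
Qed.

Lemma dist_bound_arith (delta A s T h r q : R) : 0 <= delta -> 0 <= A -> 0 <= s -> s <= T ->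
  0 <= h -> h <= T -> 0 < r -> r <= q -> r ^+ 2 = h ->
  (2 * r)^-1 * (4 * h * (A + delta * s) + 2 * delta * h ^+ 2) + (r / 2 + delta * h)
  <= (2 * (A + delta * T) + delta * T + 2^-1 + delta * q) * r.
Proof.
move=> d0 A0 s0 sT h0 hT r0 rq rE.
have -> : (2 * r)^-1 * (4 * h * (A + delta * s) + 2 * delta * h ^+ 2) =
   r * (2 * (A + delta * s) + delta * h).
  by rewrite -rE; field; rewrite gt_eqF.
have e1 : delta * s <= delta * T by rewrite ler_wpM2l.
have e2 : delta * h <= delta * T by rewrite ler_wpM2l.
have e3 : delta * h <= delta * q * r.
  by rewrite -rE expr2 mulrA ler_wpM2r ?(ltW r0)// ler_wpM2l.
have : r * (2 * (A + delta * s) + delta * h) <= r * (2 * (A + delta * T) + delta * T).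
  by rewrite ler_wpM2l ?(ltW r0)//; lra.
lra.
Qed.

(** For negative [t] the truncation returns 0, so that the dyadic approximations sit at time 0
    there. *)
Definition tr n (t : R) : nat := Num.truncn (t * 2 ^+ n).

Lemma tr_itv n t : 0 <= t -> dyad R n (tr n t) <= t < dyad R n (tr n t) + mesh R n.
Proof.
move=> t0; have h0 := mesh_gt0 R n.
have x0 : 0 <= t * 2 ^+ n by rewrite mulr_ge0// exprn_ge0.
have tE : t = t * 2 ^+ n * mesh R n.
  by rewrite /mesh -mulrA divff ?mulr1// gt_eqF// exprn_gt0.
rewrite -dyadS {2 3}tE /dyad ler_pM2r// ltr_pM2r//.
exact: truncn_itv.
Qed.

Lemma tr_dyad m n i : (m <= n)%N -> tr n (dyad R m i) = (i * 2 ^ (n - m))%N.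
Proof.
move=> mn; rewrite /tr -(subnKC mn) -(dyad_exp m (n - m) i) addKn.
rewrite /dyad /mesh -mulrA mulVf ?gt_eqF ?exprn_gt0// mulr1.
exact: natrK.
Qed.

End dyadic_refine.

Lemma eps_lt (R : realType) (e : R) : 0 < e ->
  exists n1, forall n, (n1 <= n)%N -> eps R n < e.
Proof.
move=> e0; have /cvgrPdist_lt /(_ e e0) [n1 _ H] := @cvg_eps R.
exists n1 => n /H /=; rewrite sub0r normrN; apply: le_lt_trans; exact: ler_norm.
Qed.

Lemma sum_geom_le (R : realType) (r : R) n : 0 <= r -> r < 1 ->
  \sum_(k < n) r ^+ k <= (1 - r)^-1.
Proof.
move=> r0 r1; rewrite -[leRHS]mul1r ler_pdivlMr ?subr_gt0//.
have := subrX1 r n; have rn : 0 <= r ^+ n by rewrite exprn_ge0.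
move=> H; have -> : (\sum_(k < n) r ^+ k) * (1 - r) = 1 - r ^+ n by rewrite -[RHS]opprB H; ring.
by rewrite lerBlDr lerDl.
Qed.

Lemma mesh_eps (R : realType) n : mesh R n <= eps R n.
Proof. by rewrite /mesh /eps -exprVn lerXn2r ?nnegrE//; lra. Qed.

Lemma cvg_mesh (R : realType) : mesh R n @[n --> \oo] --> (0 : R).
Proof.
apply/cvgrPdist_lt => e e0; have [n1 Hn1] := eps_lt e0; exists n1 => // n /= /Hn1 H.
by rewrite sub0r normrN gtr0_norm ?mesh_gt0// (le_lt_trans (mesh_eps _ _)).
Qed.

Lemma dyad_tr_cvg (R : realType) (t : R) : 0 <= t -> dyad R n (tr n t) @[n --> \oo] --> t.
Proof.
move=> t0; apply/cvgrPdist_lt => e e0; have [n1 Hn1] := eps_lt e0; exists n1 => // n /= /Hn1 H.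
have /andP[a1 a2] := tr_itv n t0; rewrite ger0_norm ?subr_ge0//.
have := mesh_eps R n; lra.
Qed.

Lemma dyad_trS_cvg (R : realType) (t : R) : 0 <= t -> dyad R n (tr n t).+1 @[n --> \oo] --> t.
Proof.
move=> t0; have -> : (fun n => dyad R n (tr n t).+1) = (fun n => dyad R n (tr n t) + mesh R n).
  by apply/funext => n; rewrite dyadS.
rewrite -{2}[t]addr0; apply: cvgD; [exact: dyad_tr_cvg|exact: cvg_mesh].
Qed.

Lemma tr_lt_tr (R : realType) (s t : R) : 0 <= s -> s < t ->
  exists n1, forall n, (n1 <= n)%N -> (tr n s < tr n t)%N.
Proof.
move=> s0 st; have t0 : 0 <= t by lra.
have d0 : 0 < (t - s) / 2 by lra.
have [n1 Hn1] := eps_lt d0; exists n1 => n /Hn1 H.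
have /andP[a1 a2] := tr_itv n t0; have /andP[b1 b2] := tr_itv n s0.
rewrite ltnNge -(ler_dyad R n) -ltNge; have := mesh_eps R n; lra.
Qed.

Lemma within_cvg_seq (R : realType) (x : R -> R) (u : nat -> R) (t : R) :
  {within `[0, +oo[, continuous x} -> 0 <= t -> (forall n, 0 <= u n) ->
  u n @[n --> \oo] --> t -> x (u n) @[n --> \oo] --> x t.
Proof.
move=> /subspace_continuousP cx t0 u0 ut V Vx.
have At : `[0, +oo[%classic t by rewrite /= in_itv /= t0.
have H : nbhs t [set y | `[0, +oo[%classic y -> V (x y)] := cx t At V Vx.
have [n0 _ Hn0] := ut _ H; exists n0 => // n /= /Hn0 /=; apply.
by rewrite in_itv /= u0.
Qed.

Lemma cvg_sum_ord (R : realType) (N : nat) (f : nat -> nat -> R) (l : nat -> R) :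
  (forall i, f i n @[n --> \oo] --> l i) ->
  \sum_(i < N) f i n @[n --> \oo] --> \sum_(i < N) l i.
Proof.
move=> H; elim: N => [|N ih].
  by rewrite big_ord0; under eq_fun do rewrite big_ord0; exact: cvg_cst.
rewrite big_ord_recr; under eq_fun do rewrite big_ord_recr.
by apply: cvgD; [exact: ih|exact: H].
Qed.

Lemma cvg_ge_id (f : nat -> nat) : (forall k, (k <= f k)%N) -> f @ \oo --> \oo.
Proof.
move=> Hf V [N _ HN]; exists N => // k /= Nk; apply: HN => /=.
exact: leq_trans (Hf k).
Qed.

(** * Continuous extension of a function known at dyadic times *)

Section dyadic_extension.
Variables (R : realType) (x : R -> R).

(** What the chaining argument provides: locally, and from some level on, the values at neighbouring
    dyadic points differ by at most a term of a summable sequence. *)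
Definition dyadic_modulus : Prop := forall K : nat, exists n0 : nat,
  forall n j, (n0 <= n)%N -> (j < K * 2 ^ n)%N ->
    `|x (dyad R n j.+1) - x (dyad R n j)| <= eps R n.

Hypothesis hx : dyadic_modulus.

Let xn n (t : R) := x (dyad R n (tr n t)).

Lemma tr_lt (K n : nat) (t : R) : 0 <= t -> t < K%:R -> (tr n t < K * 2 ^ n)%N.
Proof.
move=> t0 tK; have /andP[le _] := tr_itv n t0.
rewrite ltnNge -(ler_dyad R n) -ltNge; apply: le_lt_trans le _.
rewrite /dyad natrM -mulrA (_ : (2 ^ n)%:R * mesh R n = 1) ?mulr1//.
by rewrite natrX divff// gt_eqF// exprn_gt0.
Qed.

Lemma tr_half n (t : R) : 0 <= t -> (tr n.+1 t)./2 = tr n t.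
Proof.
move=> t0; have /andP[a1 a2] := tr_itv n t0; have /andP[b1 b2] := tr_itv n.+1 t0.
rewrite -dyadS in a2; rewrite -dyadS in b2.
have c1 : ((tr n t).*2 < (tr n.+1 t).+1)%N.
  rewrite ltnNge -(ler_dyad R n.+1) dyad_double -ltNge.
  exact: le_lt_trans a1 b2.
have c2 : (tr n.+1 t < (tr n t).+1.*2)%N.
  rewrite ltnNge -(ler_dyad R n.+1) dyad_double -ltNge.
  exact: le_lt_trans b1 a2.
move: c1 c2; move: (tr n t) (tr n.+1 t) => a b; lia.
Qed.

Lemma epsS n : eps R n.+1 = 9 / 10 * eps R n.
Proof. by rewrite /eps exprS. Qed.

(** Refining by one level either keeps the dyadic point below [t] or moves it to the midpoint of its
    cell, one neighbour away at the finer level. *)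
Lemma xnS (K n0 n : nat) (t : R) : 0 <= t -> t < K%:R ->
  (forall n j, (n0 <= n)%N -> (j < K * 2 ^ n)%N ->
    `|x (dyad R n j.+1) - x (dyad R n j)| <= eps R n) -> (n0 <= n)%N ->
  `|xn n.+1 t - xn n t| <= eps R n.+1.
Proof.
move=> t0 tK H nn0; rewrite /xn.
have := tr_half n t0; have b := odd_double_half (tr n.+1 t).
move=> hb; rewrite hb in b; rewrite -b.
case: (odd _); last by rewrite add0n dyad_double subrr normr0 ltW// eps_gt0.
rewrite add1n -(dyad_double R n); apply: H; first exact: leqW.
by rewrite expnS mulnCA mul2n ltn_double tr_lt.
Qed.

(** The factor 9 makes the bound telescope, since [eps R n.+1 = 9 * (eps R n - eps R n.+1)]. *)
Lemma xn_dist (K n0 : nat) (t : R) : 0 <= t -> t < K%:R ->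
  (forall n j, (n0 <= n)%N -> (j < K * 2 ^ n)%N ->
    `|x (dyad R n j.+1) - x (dyad R n j)| <= eps R n) -> forall n p, (n0 <= n)%N ->
  `|xn (n + p) t - xn n t| <= 9 * (eps R n - eps R (n + p)).
Proof.
move=> t0 tK H n p nn0; elim: p => [|p ih]; first by rewrite addn0 !subrr normr0 mulr0.
rewrite addnS; have -> : xn (n + p).+1 t - xn n t =
  (xn (n + p).+1 t - xn (n + p) t) + (xn (n + p) t - xn n t) by ring.
apply: le_trans (ler_normD _ _) _.
have n1 : (n0 <= n + p)%N by apply: leq_trans nn0 _; rewrite leq_addr.
have := xnS t0 tK H n1; rewrite epsS; move: ih.
set a := `|xn (n + p) t - _|; set b := `|xn _.+1 t - _|; lra.
Qed.

Lemma xn_cvg t : 0 <= t -> cvgn (fun n => xn n t).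
Proof.
move=> t0; have [_ tK] := andP (truncn_itv t0).
have [n0 H] := hx (Num.truncn t).+1.
apply/cauchy_cvgP/cauchy_exP => e e0.
have [n1 Hn1] := eps_lt (divr_gt0 e0 (ltr0n R 18)).
pose N := maxn n0 n1.
have N0 : (n0 <= N)%N by rewrite leq_maxl.
have N1 : eps R N < e / 18 by apply: Hn1; rewrite /= leq_maxr.
exists (xn N t), N => // k /= Nk; rewrite /ball /= distrC.
have := xn_dist t0 tK H (k - N) N0; rewrite subnKC// => h.
apply: le_lt_trans h _; have := eps_gt0 R k; lra.
Qed.

Definition dyadic_ext (t : R) : R := limn (fun n => x (dyad R n (tr n t))).

Lemma dyadic_extP t : 0 <= t -> x (dyad R n (tr n t)) @[n --> \oo] --> dyadic_ext t.
Proof. exact: xn_cvg. Qed.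

Lemma dyadic_ext_dist (K n0 : nat) (t : R) : 0 <= t -> t < K%:R ->
  (forall n j, (n0 <= n)%N -> (j < K * 2 ^ n)%N ->
    `|x (dyad R n j.+1) - x (dyad R n j)| <= eps R n) -> forall n, (n0 <= n)%N ->
  `|dyadic_ext t - x (dyad R n (tr n t))| <= 9 * eps R n.
Proof.
move=> t0 tK H n nn0.
have c : `|xn (p + n) t - xn n t| @[p --> \oo] --> `|dyadic_ext t - xn n t|.
  apply: cvg_norm; apply: cvgB; last exact: cvg_cst.
  rewrite (cvg_shiftn n (fun k => xn k t)); exact: dyadic_extP.
rewrite -(cvg_lim _ c)//; apply: limr_le; first by apply/cvg_ex; eexists; exact: c.
apply: nearW => p; rewrite addnC.
have := xn_dist t0 tK H p nn0; have := eps_gt0 R (n + p); lra.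
Qed.

Lemma dyadic_ext_right t : 0 <= t ->
  x (dyad R n (tr n t).+1) @[n --> \oo] --> dyadic_ext t.
Proof.
move=> t0; have [_ tK] := andP (truncn_itv t0).
have [n0 H] := hx (Num.truncn t).+1.
have -> : (fun n => x (dyad R n (tr n t).+1)) =
  (fun n => xn n t + (x (dyad R n (tr n t).+1) - xn n t)).
  by apply/funext => n; rewrite subrKC.
rewrite -[dyadic_ext t]addr0; apply: cvgD; first exact: dyadic_extP.
apply/cvgrPdist_lt => e e0; have [n1 Hn1] := eps_lt e0.
near=> n; rewrite sub0r normrN; apply: le_lt_trans (H n _ _ _) (Hn1 n _).
- by near: n; exists n0.
- exact: tr_lt.
- by near: n; exists n1.
Unshelve. all: by end_near. Qed.

Lemma dyadic_ext_continuous : {within `[0, +oo[, continuous dyadic_ext}.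
Proof.
apply/continuous_within_itvcyP.
have U t e : 0 <= t -> 0 < e -> exists2 eta : R, 0 < eta & forall s, 0 <= s ->
    `|t - s| < eta -> `|dyadic_ext t - dyadic_ext s| < e.
  move=> t0 e0; have t10 : 0 <= t + 1 by rewrite addr_ge0.
  have [_ tK] := andP (truncn_itv t10); set K := (Num.truncn _).+1 in tK.
  have [n0 H] := hx K.
  (* The budget is 9 + 1 + 9 = 19 times [eps R n]: two distances to the dyadic approximations and
     one step between neighbouring dyadic points. *)
  have [n1 Hn1] := eps_lt (divr_gt0 e0 (ltr0n R 20)).
  pose n := maxn n0 n1.
  have N0 : (n0 <= n)%N by rewrite leq_maxl.
  have N1 : eps R n < e / 20 by apply: Hn1; rewrite /= leq_maxr.
  exists (Num.min 1 (mesh R n)); first by rewrite lt_min ltr01 mesh_gt0.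
  move=> s s0; rewrite lt_min => /andP[st1 st2].
  have tK1 : t < K%:R by lra.
  have sK : s < K%:R by move: st1; rewrite ltr_norml => /andP[]; lra.
  have D1 := dyadic_ext_dist t0 tK1 H N0; have D2 := dyadic_ext_dist s0 sK H N0.
  (* Points closer than a mesh lie in the same cell or in adjacent ones. *)
  have D3 : `|x (dyad R n (tr n t)) - x (dyad R n (tr n s))| <= eps R n.
    have /andP[a1 a2] := tr_itv n t0; have /andP[b1 b2] := tr_itv n s0.
    move: st2; rewrite ltr_norml => /andP[c1 c2].
    have e1 : (tr n t < (tr n s).+2)%N.
      rewrite ltnNge -(ler_dyad R n) -ltNge dyadS dyadS; lra.
    have e2 : (tr n s < (tr n t).+2)%N.
      rewrite ltnNge -(ler_dyad R n) -ltNge dyadS dyadS; lra.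
    have jt := tr_lt n t0 tK1; have js := tr_lt n s0 sK.
    case: (ltngtP (tr n t) (tr n s)) => [lt|gt|->].
    - have -> : tr n s = (tr n t).+1 by apply/eqP; rewrite eqn_leq lt -ltnS e2.
      by rewrite distrC; exact: H.
    - have -> : tr n t = (tr n s).+1 by apply/eqP; rewrite eqn_leq gt -ltnS e1.
      exact: H.
    - by rewrite subrr normr0 ltW// eps_gt0.
  set a := dyadic_ext t in D1 *; set b := dyadic_ext s in D2 *.
  set p := x (dyad R n (tr n t)) in D1 D3; set q := x (dyad R n (tr n s)) in D2 D3.
  have -> : a - b = (a - p) + (p - q) - (b - q) by ring.
  apply: le_lt_trans (ler_normB _ _) _.
  apply: le_lt_trans (lerD (ler_normD _ _) (lexx _)) _; lra.
split.
- move=> t; rewrite in_itv /= andbT => t0; apply/cvgrPdist_lt => e e0.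
  have [eta eta0 H] := U t e (ltW t0) e0.
  near=> s; apply: H.
    by apply/ltW; near: s; exact: lt_nbhsr.
  by near: s; exists eta.
- apply/cvgrPdist_lt => e e0; have [eta eta0 H] := U 0 e (lexx 0) e0.
  near=> s; apply: H => //.
  rewrite sub0r normrN ger0_norm//; near: s; exact: nbhs_right_lt.
Unshelve. all: by end_near. Qed.

End dyadic_extension.

(** * Coarse grids read on a fine grid *)

Section blocks.
Variable b : nat -> nat.

(** For monotone [b], the left end of the coarse cell that contains the fine index [j]; the search
    goes down from the last coarse point and defaults to 0. It turns an Ito sum over a coarse grid
    into a sum over fine cells with frozen integrand. *)
Fixpoint block_start n j := if n is n'.+1 then
  if (b n' <= j)%N then b n' else block_start n' j else 0%N.

Lemma block_start_le n j : (block_start n j <= j)%N.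
Proof. by elim: n => //= n ih; case: ifP. Qed.

Hypotheses (b0 : b 0 = 0%N) (bS : forall i, (b i <= b i.+1)%N).

Lemma block_sum (R : realType) (f : nat -> nat -> R) n :
  \sum_(j < b n) f (block_start n j) j = \sum_(i < n) \sum_(b i <= j < b i.+1) f (b i) j.
Proof.
elim: n => [|n ih]; first by rewrite b0 !big_ord0.
rewrite [RHS]big_ord_recr -ih.
rewrite -(@big_mkord R 0 +%R (b n.+1) xpredT (fun j => f (block_start n.+1 j) j)).
rewrite -(@big_mkord R 0 +%R (b n) xpredT (fun j => f (block_start n j) j)).
rewrite (@big_cat_nat _ _ _ (b n))//=; congr (_ + _).
  by apply: eq_big_nat => j /andP[_ jn]; rewrite leqNgt jn.
by apply: eq_big_nat => j /andP[jn _]; rewrite jn.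
Qed.

Lemma block_startP n j : (j < b n)%N ->
  exists i, [/\ block_start n j = b i, (b i <= j)%N & (j < b i.+1)%N].
Proof.
elim: n => [|n ih] /=; first by rewrite b0.
move=> jn; case: ifPn => [nj|nj]; first by exists n.
by apply: ih; rewrite ltnNge.
Qed.

End blocks.

Section ito_coef.
Variable R : realType.

(** [m] is the mass at the fine time and [p] the mass where the integrand is frozen. With x = (sqrt
    (m + e) - sqrt p)^2, the martingale part contributes at most 4 x and the noise part at most 8 x
    + 8 e; then x <= |m - p| + e gives the constants 12 and 20. The [delta] term uses the cruder
    bound 2 + 2 p / e on the squared coefficient. *)
Lemma ito_coef_bound (m p e h delta : R) : 0 <= m -> 0 <= p -> 0 < e -> 0 <= h -> 0 <= delta ->
  (1 - 2 * Num.sqrt p * (invsqrt e m / 2)) ^+ 2 * (4 * m * h + 2 * delta * h ^+ 2) +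
  (- 2 * Num.sqrt p * (Num.sqrt e * invsqrt e m)) ^+ 2 * h <=
  h * (12 * `|m - p| + 20 * e) + 2 * delta * h ^+ 2 * (2 + 2 * (p / e)).
Proof.
move=> m0 p0 e0 h0 d0; rewrite invsqrtE//.
have me0 : 0 < m + e by rewrite ltr_wpDl.
have rE : Num.sqrt p ^+ 2 = p by rewrite sqr_sqrtr.
have sE : Num.sqrt (m + e) ^+ 2 = m + e by rewrite sqr_sqrtr// ltW.
have s0 : 0 < Num.sqrt (m + e) by rewrite sqrtr_gt0.
have r0 := sqrtr_ge0 p; have eE : Num.sqrt e ^+ 2 = e by rewrite sqr_sqrtr// ltW.
move: rE sE s0 r0 eE; set r := Num.sqrt p; set s := Num.sqrt (m + e); set t := Num.sqrt e.
move=> rE sE s0 r0 eE.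
have x0 : 0 <= (s - r) ^+ 2 := sqr_ge0 _.
have xle : (s - r) ^+ 2 <= `|m - p| + e.
  have H : (s - r) ^+ 2 <= `|s ^+ 2 - r ^+ 2|.
    rewrite -(real_normK (num_real (s - r))) subr_sqr normrM expr2 ler_wpM2l//.
    rewrite [leRHS]ger0_norm ?addr_ge0 ?(ltW s0)//.
    by rewrite ler_norml; apply/andP; split; lra.
  apply: le_trans H _; rewrite sE rE.
  have -> : m + e - p = (m - p) + e by ring.
  by apply: le_trans (ler_normD _ _) _; rewrite (gtr0_norm e0).
have u1 : m / (m + e) <= 1 by rewrite ler_pdivrMr// mul1r lerDl ltW.
have v1 : e / (m + e) <= 1 by rewrite ler_pdivrMr// mul1r lerDr.
have v0 : 0 <= e / (m + e) by rewrite divr_ge0// ltW.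
have A1 : (1 - 2 * r * (s^-1 / 2)) ^+ 2 = (s - r) ^+ 2 / (m + e).
  by rewrite -sE; field; rewrite gt_eqF.
have A2 : (- 2 * r * (t * s^-1)) ^+ 2 = 4 * p * (e / (m + e)).
  by rewrite -sE -rE -eE; field; rewrite gt_eqF.
have B1 : (1 - 2 * r * (s^-1 / 2)) ^+ 2 <= 2 + 2 * (p / e).
  have -> : 1 - 2 * r * (s^-1 / 2) = 1 - r / s by field; rewrite gt_eqF.
  have : (r / s) ^+ 2 <= p / e.
    rewrite exprMn exprVn rE sE ler_wpM2l// lef_pV2// ?posrE//.
    by rewrite lerDr.
  have := sqr_ge0 (1 + r / s).
  rewrite !sqrrD sqrrN; set q := r / s; set z := q ^+ 2; lra.
have C1 : 4 * m * ((s - r) ^+ 2 / (m + e)) <= 4 * (s - r) ^+ 2.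
  have := ler_wpM2l x0 u1; lra.
have C2 : 4 * p * (e / (m + e)) <= 8 * (s - r) ^+ 2 + 8 * e.
  have pb : p <= 2 * (s - r) ^+ 2 + 2 * (m + e).
    rewrite -rE -sE; have := sqr_ge0 (2 * s - r); rewrite !sqrrB; lra.
  have := ler_wpM2r v0 pb; have := ler_wpM2l x0 v1.
  have -> : (2 * (s - r) ^+ 2 + 2 * (m + e)) * (e / (m + e)) = 2 * ((s - r) ^+ 2 * (e / (m + e))) + 2 * e.
    by field; rewrite gt_eqF.
  lra.
rewrite mulrDr {1}A1 A2.
have D1 := ler_wpM2r h0 C1; have D2 := ler_wpM2r h0 C2; have D3 := ler_wpM2l h0 xle.
have dh : 0 <= 2 * delta * h ^+ 2 by rewrite !mulr_ge0// sqr_ge0.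
have D4 := ler_wpM2r dh B1.
lra.
Qed.

End ito_coef.

(** * Gaussian moments and the heat semigroup *)

Section transfer_laws.
Context (R : realType) d1 d2 d' (O1 : measurableType d1) (O2 : measurableType d2)
  (T : measurableType d').
Variables (m1 : {measure set O1 -> \bar R}) (m2 : {measure set O2 -> \bar R}).
Variables (X1 : O1 -> T) (X2 : O2 -> T).
Hypotheses (mX1 : measurable_fun setT X1) (mX2 : measurable_fun setT X2).
Local Open Scope ereal_scope.

Lemma integral_indic_preimage d (O : measurableType d) (m : {measure set O -> \bar R})
    (X : O -> T) C : measurable_fun setT X -> measurable C ->
  \int[m]_w (\1_C (X w))%:E = m (X @^-1` C).
Proof.
move=> mX mC; rewrite -[X in _ = m X]setIT -integral_indic//.
by rewrite -[X @^-1` C]setTI; exact: mX.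
Qed.

Lemma ge0_integral_density (h2 : O2 -> \bar R) :
  (forall w, 0 <= h2 w) -> measurable_fun setT h2 ->
  (forall C, measurable C -> m1 (X1 @^-1` C) =
     \int[m2]_w (h2 w * (\1_C (X2 w))%:E)) ->
  forall f : T -> \bar R, (forall x, 0 <= f x) -> measurable_fun setT f ->
  \int[m1]_w f (X1 w) = \int[m2]_w (h2 w * f (X2 w)).
Proof.
move=> h0 mh H f f0 mf; rewrite -(@ge0_integral_transfer R _ _ _ _ _ _ m1 m2 X1 X2 (cst 1) h2)//.
  by apply: eq_integral => w _; rewrite mul1e.
move=> C mC; rewrite -H//; under eq_integral do rewrite mul1e.
exact: integral_indic_preimage.
Qed.

Lemma ge0_integral_law :
  (forall C, measurable C -> m1 (X1 @^-1` C) = m2 (X2 @^-1` C)) ->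
  forall f : T -> \bar R, (forall x, 0 <= f x) -> measurable_fun setT f ->
  \int[m1]_w f (X1 w) = \int[m2]_w f (X2 w).
Proof.
move=> H f f0 mf; rewrite (@ge0_integral_density (cst 1))//.
  by apply: eq_integral => w _; rewrite mul1e.
move=> C mC; rewrite H//; under eq_integral do rewrite mul1e.
by rewrite integral_indic_preimage.
Qed.

End transfer_laws.

(** * Affine changes of variables for Lebesgue measure *)

Section affine.
Variable R : realType.
Local Notation leb := (@lebesgue_measure R).
Local Open Scope ereal_scope.

Lemma measurable_affine (a b : R) : measurable_fun setT (fun x : R => (a * x + b)%R).
Proof. by apply: measurable_funD => //; exact: measurable_funM. Qed.

Lemma lebesgue_affine (a b : R) (A : set R) : (0 < a)%R -> measurable A ->
  leb A = a%:E * leb ((fun x => a * x + b)%R @^-1` A).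
Proof.
move=> a0 mA; have an : (0 <= a)%R by exact: ltW.
have mf : measurable_fun [set: measurableTypeR R] (fun x : measurableTypeR R => a * x + b : measurableTypeR R)%R.
  exact: measurable_affine.
pose mu : {measure set (measurableTypeR R) -> \bar R} :=
  mscale (NngNum an) (pushforward leb (fun x : measurableTypeR R => a * x + b : measurableTypeR R)%R).
suff : leb A = mu mf A by [].
apply: (@lebesgue_measure_unique R (mu mf)) => // X [[c d] _ <-].
change (leb `]c, d]%classic = a%:E * leb ((fun x => a * x + b)%R @^-1` `]c, d]%classic)).
have -> : (fun x => a * x + b)%R @^-1` `]c, d]%classic = `]((c - b) / a)%R, ((d - b) / a)%R]%classic.
  apply/seteqP; split => x /=; rewrite !in_itv /= ltr_pdivrMr// ler_pdivlMr// [(a * x)%R]mulrC;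
   by rewrite ltrBlDr lerBrDr.
rewrite !lebesgue_measure_itv /= !lte_fin ltr_pM2r ?invr_gt0// ltrD2r.
case: ifPn => cd; last by rewrite mule0.
by rewrite -!EFinB -EFinM; congr EFin; field; rewrite gt_eqF.
Qed.

Lemma lebesgue_opp (A : set R) : measurable A -> leb A = leb (-%R @^-1` A).
Proof.
move=> mA.
have mf : measurable_fun [set: measurableTypeR R] (fun x : measurableTypeR R => - x : measurableTypeR R)%R.
  exact: oppr_measurable.
pose mu : {measure set (measurableTypeR R) -> \bar R} :=
  pushforward leb (fun x : measurableTypeR R => - x : measurableTypeR R)%R.
suff : leb A = mu mf A by [].
apply: (@lebesgue_measure_unique R (mu mf)) => // X [[c d] _ <-].
change (leb `]c, d]%classic = leb (-%R @^-1` `]c, d]%classic)).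
have -> : -%R @^-1` `]c, d]%classic = `[(- d)%R, (- c)%R[%classic.
  by apply/seteqP; split => x /=; rewrite !in_itv /= ltrNr lerNl => /andP[-> ->].
rewrite !lebesgue_measure_itv /= !lte_fin ltrN2; case: ifPn => // cd.
by rewrite -!EFinB; congr EFin; rewrite opprK addrC.
Qed.

Lemma ge0_integral_affine (a b : R) (f : R -> \bar R) : (a != 0)%R ->
  (forall x, 0 <= f x) -> measurable_fun setT f ->
  \int[leb]_x f x = `|a|%:E * \int[leb]_x f (a * x + b)%R.
Proof.
move=> a0 f0 mf.
have pos (c : R) (g : R -> \bar R) : (0 < c)%R ->
  (forall x, 0 <= g x) -> measurable_fun setT g ->
  \int[leb]_x g x = c%:E * \int[leb]_x g (c * x + b)%R.
  move=> c0 g0 mg.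
  have mcb := @measurable_affine c b.
  rewrite -ge0_integralZl//; last 2 first.
  - exact: (measurableT_comp mg mcb).
  - by rewrite lee_fin ltW.
  apply: (@ge0_integral_density R _ _ _ _ _ _ leb leb idfun (fun x : R => c * x + b)%R _ _ (cst c%:E)) => //.
  - exact: measurable_id.
  - by move=> w; rewrite lee_fin ltW.
  - move=> C mC; rewrite ge0_integralZl//; last 2 first.
    + apply/measurable_EFinP; apply: (measurableT_comp (measurable_indic mC)); exact: mcb.
    + by rewrite lee_fin ltW.
    rewrite [LHS](lebesgue_affine b c0 mC); congr (_ * _); apply/esym.
    exact: (integral_indic_preimage leb mcb mC).
have [apos|aneg] := ltP 0%R a; first by rewrite (pos a)// gtr0_norm.
have a0' : (0 < - a)%R by rewrite oppr_gt0 lt_neqAle a0.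
rewrite (pos (- a)%R)// ler0_norm//; congr (_ * _).
set g := fun x => f (- a * x + b)%R.
have mg : measurable_fun setT g by apply: (measurableT_comp mf); exact: measurable_affine.
have mo : measurable_fun setT (-%R : R -> R) by exact: oppr_measurable.
have H := @ge0_integral_law R _ _ _ _ _ _ leb leb idfun -%R (@measurable_id _ R setT) mo
  (fun C mC => lebesgue_opp mC) g (fun x => f0 _) mg.
by rewrite H; apply: eq_integral => x _; rewrite /g mulrNN.
Qed.

End affine.

Section tonelli.
Context d1 d2 (T1 : measurableType d1) (T2 : measurableType d2) (R : realType).
Variables (m1 : {sigma_finite_measure set T1 -> \bar R}).
Variables (m2 : {sigma_finite_measure set T2 -> \bar R}).
Variable f : T1 * T2 -> \bar R.
Hypotheses (f0 : forall z, (0 <= f z)%E) (mf : measurable_fun setT f).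
Local Open Scope ereal_scope.

Lemma tonelli : \int[m1]_x \int[m2]_y f (x, y) = \int[m2]_y \int[m1]_x f (x, y).
Proof. exact: fubini_tonelli. Qed.

Lemma measurable_integral2 : measurable_fun setT (fun x => \int[m2]_y f (x, y)).
Proof. exact: measurable_fun_fubini_tonelli_F. Qed.

Lemma measurable_integral1 : measurable_fun setT (fun y => \int[m1]_x f (x, y)).
Proof. exact: measurable_fun_fubini_tonelli_G. Qed.

End tonelli.

Section gauss.
Variable R : realType.
Local Notation leb := (@lebesgue_measure R).
Local Notation N := (@normal_prob R 0 1).
Local Notation pdf := (@normal_pdf R 0 1).
Local Open Scope ereal_scope.

Lemma ge0_integral_normal (s : R) (f : R -> \bar R) :
  (forall x, 0 <= f x) -> measurable_fun setT f ->
  \int[normal_prob 0 s]_x f x = \int[leb]_x ((normal_pdf 0 s x)%:E * f x).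
Proof.
move=> f0 mf; have mp := @measurable_normal_pdf R 0 s.
apply: (@ge0_integral_density R _ _ _ _ _ _ (normal_prob 0 s) leb idfun idfun _ _ (fun x => (normal_pdf 0 s x)%:E)) => //.
- exact: measurable_id.
- exact: measurable_id.
- by move=> x; rewrite lee_fin normal_pdf_ge0.
- exact/measurable_EFinP.
- move=> C mC; rewrite [LHS]integral_mkcond; apply: eq_integral => x _ /=.
  by rewrite patchE indicE; case: ifPn => _; rewrite ?mule1 ?mule0.
Qed.

Lemma normal_pdf01 x : pdf x = ((Num.sqrt (pi *+ 2))^-1 * expR (- x ^+ 2 / 2))%R.
Proof.
rewrite (normal_pdfE _ (oner_neq0 _)) /normal_peak /normal_fun subr0 expr1n mul1r.
by [].
Qed.

Lemma normal_pdf_scale (s x : R) : (0 < s)%R ->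
  (s * normal_pdf 0 s (s * x) = pdf x)%R.
Proof.
move=> s0; rewrite normal_pdf01 (normal_pdfE _ (lt0r_neq0 s0)) /normal_peak /normal_fun subr0.
rewrite -mulrnAr sqrtrM ?sqr_ge0// sqrtr_sqr gtr0_norm// invfM !mulrA divff ?gt_eqF// mul1r.
by congr (_ * expR _)%R; field; rewrite gt_eqF.
Qed.

Lemma normal_scale (s : R) (f : R -> \bar R) : (0 < s)%R ->
  (forall x, 0 <= f x) -> measurable_fun setT f ->
  \int[normal_prob 0 s]_x f x = \int[N]_x f (s * x)%R.
Proof.
move=> s0 f0 mf; have mp := @measurable_normal_pdf R 0 s.
have ms : measurable_fun setT (fun x => f (s * x)%R).
  by apply: (measurableT_comp mf); exact: measurable_funM.
have mq : measurable_fun setT (fun x => (normal_pdf 0 s x)%:E * f x).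
  by apply: emeasurable_funM => //; exact/measurable_EFinP.
have q0 x : 0 <= (normal_pdf 0 s x)%:E * f x by rewrite mule_ge0// lee_fin normal_pdf_ge0.
rewrite (ge0_integral_normal s f0 mf) (ge0_integral_normal 1 (fun x => f0 (s * x)%R) ms).
rewrite (ge0_integral_affine 0 (lt0r_neq0 s0) q0 mq).
have mq' : measurable_fun setT (fun x => (normal_pdf 0 s (s * x + 0))%:E * f (s * x + 0)%R).
  exact: (measurableT_comp mq (measurable_affine s 0)).
rewrite gtr0_norm// -(ge0_integralZl leb measurableT mq' (fun x _ => q0 _)) ?lee_fin ?(ltW s0)//.
by apply: eq_integral => x _; rewrite addr0 muleA -EFinM normal_pdf_scale.
Qed.

Lemma normal_opp (f : R -> \bar R) : (forall x, 0 <= f x) -> measurable_fun setT f ->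
  \int[N]_x f x = \int[N]_x f (- x)%R.
Proof.
move=> f0 mf; have mp := @measurable_normal_pdf R 0 1.
have mo : measurable_fun setT (fun x : R => f (- x)%R).
  by apply: (measurableT_comp mf); exact: oppr_measurable.
have mq : measurable_fun setT (fun x => (pdf x)%:E * f x).
  by apply: emeasurable_funM => //; exact/measurable_EFinP.
have q0 x : 0 <= (pdf x)%:E * f x by rewrite mule_ge0// lee_fin normal_pdf_ge0.
have n1 : (-1)%R != 0%R :> R by rewrite oppr_eq0 oner_eq0.
rewrite (ge0_integral_normal 1 f0 mf) (ge0_integral_normal 1 (fun x => f0 (- x)%R) mo).
rewrite (ge0_integral_affine 0 n1 q0 mq).
rewrite normrN1 mul1e; apply: eq_integral => x _.
by rewrite addr0 mulN1r; congr (_%:E * _); rewrite !normal_pdf01 sqrrN.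
Qed.

(** The total mass 1 of the density, rescaled by sqrt (1 + t). Both the integrability of fourth
    powers and the variance are deduced from this one integral. *)
Lemma normal_exp (t : R) : (-1 < t)%R ->
  \int[N]_x (expR (- t * x ^+ 2 / 2))%:E = ((Num.sqrt (1 + t))^-1)%:E.
Proof.
move=> t1; have t0 : (0 < 1 + t)%R by rewrite -ltrBlDl sub0r.
have s0 : (0 < Num.sqrt (1 + t))%R by rewrite sqrtr_gt0.
have mp := @measurable_normal_pdf R 0 1.
have me : measurable_fun setT (fun x : R => expR (- t * x ^+ 2 / 2)).
  apply: measurableT_comp => //; apply: measurable_funM => //.
  by apply: measurable_funM => //; exact: measurable_funX.
rewrite ge0_integral_normal//; last exact/measurable_EFinP.
have pe x : pdf (Num.sqrt (1 + t) * x) = (pdf x * expR (- t * x ^+ 2 / 2))%R.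
  rewrite !normal_pdf01 -[RHS]mulrA -expRD; congr (_ * expR _)%R.
  by rewrite exprMn sqr_sqrtr ?ltW//; field.
have := @integral_normal_pdf R 0 1; rewrite (@ge0_integral_affine R (Num.sqrt (1 + t)) 0); last 3 first.
- by rewrite gt_eqF.
- by move=> x; rewrite lee_fin normal_pdf_ge0.
- exact/measurable_EFinP.
under eq_integral do rewrite addr0 pe EFinM.
rewrite gtr0_norm//.
set I := \int[leb]_x _ => H.
have I0 : 0 <= I by apply: integral_ge0 => x _; rewrite mule_ge0// lee_fin ?normal_pdf_ge0.
case: I H I0 => [r|//|//]; last by rewrite gt0_muley.
move=> /eqP; rewrite -EFinM eqe => /eqP H _; congr EFin.
by apply: (mulfI (lt0r_neq0 s0)); rewrite H mulfV// lt0r_neq0.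
Qed.

(** The orthogonal map factors into two affine substitutions in one variable, y -> (s x - y) / c at
    fixed x and x -> c x + s y at fixed y, with an exchange of integrals between them. The Jacobians
    1 / c and c cancel. *)
Lemma lebesgue_rotation (c s : R) (G : R * R -> \bar R) : (0 < c)%R ->
  (c ^+ 2 + s ^+ 2 = 1)%R -> (forall z, 0 <= G z) -> measurable_fun setT G ->
  \int[leb]_x \int[leb]_y G (c * x + s * y, s * x - c * y)%R =
  \int[leb]_x \int[leb]_y G (x, y).
Proof.
move=> c0 cs G0 mG.
have cn : c != 0%R by rewrite gt_eqF.
pose T (z : R * R) := (c * z.1 + s * z.2, s * z.1 - c * z.2)%R.
have mT : measurable_fun setT T.
  apply/measurable_fun_pairP; split; rewrite /comp /=.
    by apply: measurable_funD; apply: measurable_funM.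
  by apply: measurable_funB; apply: measurable_funM.
have mGT : measurable_fun setT (G \o T) by exact: (measurableT_comp mG mT).
pose S (z : R * R) := (z.1, (s * z.1 - z.2) / c)%R.
have mS : measurable_fun setT S.
  apply/measurable_fun_pairP; split; rewrite /comp /=; first exact: measurable_fst.
  apply: measurable_funM => //; apply: measurable_funB => //.
  by apply: measurable_funM.
have mGS : measurable_fun setT (G \o S) by exact: (measurableT_comp mG mS).
have F1 := tonelli leb leb (fun z => G0 (T z)) mGT.
have F2 := tonelli leb leb (fun z => G0 (S z)) mGS.
have inner y : \int[leb]_x G (S (x, y)) = c%:E * \int[leb]_x G (T (x, y)).
  have mGy : measurable_fun setT (fun x => G (S (x, y))).
    exact: (measurableT_comp mGS (pair2_measurable y)).
  rewrite (ge0_integral_affine (s * y) cn (fun x => G0 _) mGy) gtr0_norm//.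
  congr (_ * _); apply: eq_integral => x _; congr (G (_, _)) => /=.
  have -> : (s * (c * x + s * y) - y = s * c * x + (s ^+ 2 - 1) * y)%R by ring.
  have -> : (s ^+ 2 - 1 = - c ^+ 2)%R by rewrite -cs; ring.
  by field.
have outer x : \int[leb]_y G (x, y) = (c^-1)%:E * \int[leb]_y G (S (x, y)).
  have mGx : measurable_fun setT (fun y => G (x, y)).
    exact: (measurableT_comp mG (pair1_measurable x)).
  have cn' : (- c^-1)%R != 0%R :> R by rewrite oppr_eq0 invr_eq0.
  rewrite (ge0_integral_affine (s * x / c) cn' (fun y => G0 _) mGx).
  rewrite normrN gtr0_norm ?invr_gt0//; congr (_ * _).
  by apply: eq_integral => y _; congr (G (_, _)) => /=; field.
have I0 x : 0 <= \int[leb]_y G (S (x, y)) by exact: integral_ge0.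
have J0 y : 0 <= \int[leb]_x G (T (x, y)) by exact: integral_ge0.
have ci : 0 <= (c^-1)%:E by rewrite lee_fin invr_ge0 ltW.
under [RHS]eq_integral do rewrite outer.
have c0' : 0 <= c%:E by rewrite lee_fin ltW.
rewrite (ge0_integralZl leb measurableT (measurable_integral2 leb (fun z => G0 (S z)) mGS) (fun x _ => I0 x) ci).
rewrite F2; under [in RHS]eq_integral do rewrite inner.
rewrite (ge0_integralZl leb measurableT (measurable_integral1 leb (fun z => G0 (T z)) mGT) (fun x _ => J0 x) c0').
by rewrite muleA -EFinM (mulVf cn) mul1e -F1.
Qed.

(** The density of a pair of independent normal variables depends only on x^2 + y^2, which the
    orthogonal map preserves. *)
Lemma normal_rotation (c s : R) (F : R * R -> \bar R) : (0 < c)%R ->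
  (c ^+ 2 + s ^+ 2 = 1)%R -> (forall z, 0 <= F z) -> measurable_fun setT F ->
  \int[N]_x \int[N]_y F (c * x + s * y, s * x - c * y)%R =
  \int[N]_x \int[N]_y F (x, y).
Proof.
move=> c0 cs F0 mF.
have mp := @measurable_normal_pdf R 0 1.
pose T (z : R * R) := (c * z.1 + s * z.2, s * z.1 - c * z.2)%R.
have mT : measurable_fun setT T.
  apply/measurable_fun_pairP; split; rewrite /comp /=.
    by apply: measurable_funD; apply: measurable_funM.
  by apply: measurable_funB; apply: measurable_funM.
pose D (z : R * R) := (pdf z.1 * pdf z.2)%R.
have D0 z : 0 <= (D z)%:E by rewrite lee_fin mulr_ge0// normal_pdf_ge0.
have mD : measurable_fun setT D.
  by apply: measurable_funM; apply: measurableT_comp.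
have DT z : D (T z) = D z.
  rewrite /D /T !normal_pdf01 /= mulrACA [RHS]mulrACA -!expRD; congr (_ * expR _)%R.
  by transitivity ((c ^+ 2 + s ^+ 2) * (- z.1 ^+ 2 / 2 + - z.2 ^+ 2 / 2))%R;
    [field|rewrite cs mul1r].
have key (H : R * R -> \bar R) : (forall z, 0 <= H z) -> measurable_fun setT H ->
    \int[N]_x \int[N]_y H (x, y) = \int[leb]_x \int[leb]_y ((D (x, y))%:E * H (x, y)).
  move=> H0 mH.
  have mHx x : measurable_fun setT (fun y => H (x, y)).
    exact: (measurableT_comp mH (pair1_measurable x)).
  have mpx : measurable_fun setT (fun y => (pdf y)%:E) by exact/measurable_EFinP.
  rewrite ge0_integral_normal; last 2 first.
  - by move=> x; exact: integral_ge0.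
  - exact: measurable_integral2.
  apply: eq_integral => x _; rewrite (ge0_integral_normal 1 (fun y => H0 (x, y)) (mHx x)).
  rewrite -(ge0_integralZl leb measurableT (emeasurable_funM mpx (mHx x))).
  - by apply: eq_integral => y _; rewrite muleA -EFinM.
  - by move=> y _; rewrite mule_ge0// lee_fin normal_pdf_ge0.
  - by rewrite lee_fin normal_pdf_ge0.
have mFT : measurable_fun setT (F \o T) by exact: (measurableT_comp mF mT).
rewrite (key F F0 mF) [LHS](key (F \o T) (fun z => F0 (T z)) mFT).
have mDF : measurable_fun setT (fun z => (D z)%:E * F z).
  by apply: emeasurable_funM => //; exact/measurable_EFinP.
rewrite -(lebesgue_rotation c0 cs (fun z => mule_ge0 (D0 z) (F0 z)) mDF).
by apply: eq_integral => x _; apply: eq_integral => y _; rewrite -(DT (x, y)).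
Qed.

End gauss.

Section heat_family.
Variable R : realType.

(* Abstract properties of u t x = E (f (x + sqrt t * N)), N standard normal,
   with u1 and u2 playing the roles of its first two space derivatives. *)
Definition heat_family (K : R) (u u1 u2 : R -> R -> R) : Prop :=
  [/\ forall t, 0 <= t -> [/\ measurable_fun setT (u t),
         measurable_fun setT (u1 t) & measurable_fun setT (u2 t)],
      forall t x, 0 <= t -> [/\ `|u t x| <= K, `|u1 t x| <= K & `|u2 t x| <= K],
      forall t x z, 0 <= t ->
        `|u t (x + z) - u t x - u1 t x * z - u2 t x * z ^+ 2 / 2| <= K * `|z| ^+ 3 &
      forall t h x, 0 <= t -> 0 <= h ->
        `|u (t + h) x - u t x - h / 2 * u2 t x| <= K * (h * Num.sqrt h)].

End heat_family.

(** * Moments of the standard normal law *)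

Section normal_moments.
Variable R : realType.
Local Notation N := (@normal_prob R 0 1).
Local Notation E f := (Rintegral N setT f).
Local Notation gint := (integ N).

Lemma integ_ge0 d (O : measurableType d) (P : probability O R) (f : O -> R) (r : R) :
  (forall w, 0 <= f w) -> measurable_fun setT f ->
  (\int[P]_w (f w)%:E = r%:E)%E -> integ P f /\ Rintegral P setT f = r.
Proof.
move=> f0 mf H; have I : integ P f.
  apply/integrableP; split; first exact/measurable_EFinP.
  by under eq_integral do rewrite /= ger0_norm//; rewrite H ltry.
by split => //; apply: EFin_inj; rewrite -EFinE.
Qed.

Lemma pow4_le_exp (x : R) : x ^+ 4 <= 64 * expR (- (- 2^-1) * x ^+ 2 / 2).
Proof.
have -> : - (- 2^-1) * x ^+ 2 / 2 = 2%:R * (x ^+ 2 / 8) by field.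
rewrite expRM_natl; have H := expR_ge1Dx (x ^+ 2 / 8); have x0 := sqr_ge0 x.
have H1 : x ^+ 2 / 8 <= expR (x ^+ 2 / 8) by lra.
have := lerXn2r 2 _ _ H1; rewrite !nnegrE expR_ge0 divr_ge0// => /(_ isT isT).
rewrite (_ : x ^+ 4 = 64 * (x ^+ 2 / 8) ^+ 2); last by field.
by rewrite ler_pM2l.
Qed.

Lemma normal_integ4 : gint (fun x => x ^+ 4).
Proof.
have me : measurable_fun setT (fun x : R => expR (- (- 2^-1) * x ^+ 2 / 2)).
  apply: measurableT_comp => //; apply: measurable_funM => //.
  by apply: measurable_funM => //; exact: measurable_funX.
have t1 : -1 < - 2^-1 :> R by lra.
have [I _] := @integ_ge0 _ _ N _ _ (fun=> expR_ge0 _) me (normal_exp t1).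
apply: (integ_le _ (integZ 64 I)); first exact: measurable_funX.
by move=> x; rewrite ger0_norm ?exprn_even_ge0// pow4_le_exp.
Qed.

Lemma abs_pow_le (k : nat) (x : R) : (k <= 4)%N -> `|x| ^+ k <= 1 + x ^+ 4.
Proof.
move=> k4; have -> : x ^+ 4 = `|x| ^+ 4 by rewrite -normrX ger0_norm ?exprn_even_ge0.
have x0 := normr_ge0 x; have [x1|x1] := leP `|x| 1.
  apply: (@le_trans _ _ 1); first exact: exprn_ile1.
  by rewrite lerDl exprn_ge0.
apply: (@le_trans _ _ (`|x| ^+ 4)); last by rewrite lerDr.
by rewrite ler_eXn2l.
Qed.

Lemma normal_integ_abs (k : nat) : (k <= 4)%N -> gint (fun x => `|x| ^+ k).
Proof.
move=> k4; apply: (integ_le _ (integD (integ_cst N 1) normal_integ4)).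
  by apply: measurable_funX; exact: normr_measurable.
by move=> x; rewrite ger0_norm ?exprn_ge0// abs_pow_le.
Qed.

Lemma normal_integ_pow (k : nat) : (k <= 4)%N -> gint (fun x => x ^+ k).
Proof.
move=> k4; apply: (integ_le _ (normal_integ_abs k4)); first exact: measurable_funX.
by move=> x; rewrite normrX.
Qed.

Lemma normal_mean : E id = 0.
Proof.
have mx : measurable_fun setT (fun x : R => Num.max x 0) by exact: measurable_maxr.
have mx' : measurable_fun setT (fun x : R => Num.max (- x) 0).
  by apply: measurable_maxr => //; exact: oppr_measurable.
have I1 := normal_integ_abs (isT : 1 <= 4)%N.
have bd (x : R) : `|Num.max x 0| <= `|x| ^+ 1.
  by rewrite expr1 /Num.max; case: ifP => _; rewrite ?normr0.
have Ip : gint (fun x => Num.max x 0) by apply: (integ_le _ I1); [exact: mx|exact: bd].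
have Im : gint (fun x => Num.max (- x) 0).
  by apply: (integ_le _ I1); [exact: mx'|move=> x; rewrite -(normrN x); exact: bd].
have -> : E id = E (fun x => Num.max x 0) - E (fun x => Num.max (- x) 0).
  rewrite -(EB Ip Im); apply: eq_Rintegral => x _.
  by rewrite /Num.max oppr_lt0; case: ltgtP => //= [_|_|->]; lra.
apply/eqP; rewrite subr_eq0; apply/eqP; apply: EFin_inj.
rewrite -(EFinE Ip) -(EFinE Im).
rewrite (@normal_opp R (fun x => (Num.max x 0)%:E))//.
- by move=> x; rewrite lee_fin le_max lexx orbT.
- exact/measurable_EFinP.
Qed.

Lemma exp_quad (y : R) : 0 <= y -> y - y ^+ 2 <= 1 - expR (- y) <= y.
Proof.
move=> y0; apply/andP; split; last by have := expR_ge1Dx (- y); lra.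
have H := expR_ge1Dx y; have y1 : 0 < 1 + y by lra.
rewrite expRN; suff : (expR y)^-1 <= 1 - y + y ^+ 2 by lra.
apply: (@le_trans _ _ (1 + y)^-1); first by rewrite lef_pV2// posrE expR_gt0.
rewrite -[leLHS]mul1r ler_pdivrMr//.
have -> : (1 - y + y ^+ 2) * (1 + y) = 1 + y ^+ 3 by ring.
by rewrite lerDl exprn_ge0.
Qed.

Lemma var_arith1 (tau m2 : R) : 0 < tau -> tau <= 2^-1 ->
  tau <= ((1 - tau) ^- 2 - 1) / 2 * m2 -> 1 - 2 * tau <= m2.
Proof.
move=> t0 t1; have p : 0 < 1 - tau by lra.
have -> : ((1 - tau) ^- 2 - 1) / 2 * m2 = tau * ((2 - tau) / 2 * m2 / (1 - tau) ^+ 2).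
  by field; rewrite gt_eqF.
rewrite ler_pMr// ler_pdivlMr ?exprn_gt0// mul1r => H.
apply: (@le_trans _ _ ((1 - tau) ^+ 2)); first by have := sqr_ge0 tau; lra.
have q : 0 < (2 - tau) / 2 by lra.
have m0 : 0 <= m2 by rewrite -(pmulr_rge0 _ q) (le_trans _ H)// sqr_ge0.
apply: le_trans H _; rewrite ler_piMl//; lra.
Qed.

Lemma var_arith2 (tau m2 m4 : R) : 0 < tau -> tau <= 2^-1 -> 0 <= m2 -> 0 <= m4 ->
  ((1 - tau) ^- 2 - 1) / 2 * m2 - (((1 - tau) ^- 2 - 1) / 2) ^+ 2 * m4 <= tau ->
  m2 <= 1 + 16 * m4 * tau.
Proof.
move=> t0 t1 m20 m40; have p : 0 < 1 - tau by lra.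
set r := (2 - tau) / 2 / (1 - tau) ^+ 2.
have -> : ((1 - tau) ^- 2 - 1) / 2 = tau * r by rewrite /r; field; rewrite gt_eqF.
have r1 : 1 <= r.
  by rewrite /r ler_pdivlMr ?exprn_gt0// mul1r; have := sqr_ge0 tau; nra.
have r4 : r <= 4.
  rewrite /r ler_pdivrMr ?exprn_gt0//.
  have : (2^-1) ^+ 2 <= (1 - tau) ^+ 2 by rewrite lerXn2r// ?nnegrE//; lra.
  by rewrite expr2; lra.
have -> : tau * r * m2 - (tau * r) ^+ 2 * m4 = tau * (r * m2 - tau * r ^+ 2 * m4) by ring.
rewrite ger_pMr// => H.
have h1 : m2 <= r * m2 by rewrite ler_peMl.
have h2 : tau * r ^+ 2 * m4 <= tau * 16 * m4.
  rewrite ler_wpM2r// ler_pM2l//; have : r ^+ 2 <= 4 ^+ 2 by rewrite lerXn2r// nnegrE; lra.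
  by rewrite (_ : 4 ^+ 2 = 16)//; ring.
lra.
Qed.

(** The parameter t is chosen with 1 / sqrt (1 + t) = 1 - tau, which makes E (1 - exp (- t x^2 / 2))
    equal to tau exactly. The bounds y - y^2 <= 1 - exp (- y) <= y then squeeze the variance between
    1 - 2 tau and 1 + 16 m4 tau, and tau tends to 0. *)
Lemma normal_var : E (fun x => x ^+ 2) = 1.
Proof.
have I2 := normal_integ_pow (isT : 2 <= 4)%N; have I4 := normal_integ4.
set m2 := E _; set m4 := E (fun x => x ^+ 4).
have m20 : 0 <= m2 by apply: E_ge0 => x; exact: sqr_ge0.
have m40 : 0 <= m4 by apply: E_ge0 => x; rewrite exprn_even_ge0.
have key tau : 0 < tau -> tau <= 2^-1 -> 1 - 2 * tau <= m2 /\ m2 <= 1 + 16 * m4 * tau.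
  move=> t0 t1; have p : 0 < 1 - tau by lra.
  pose t := (1 - tau) ^- 2 - 1.
  have tp : 0 < t.
    by rewrite subr_gt0 invf_gt1 ?exprn_gt0// expr_lt1 ?ltW// ?gtrBl.
  have tm1 : -1 < t by lra.
  have me : measurable_fun setT (fun x : R => expR (- t * x ^+ 2 / 2)).
    apply: measurableT_comp => //; apply: measurable_funM => //.
    by apply: measurable_funM => //; exact: measurable_funX.
  have [Ie Ee] := @integ_ge0 _ _ N _ _ (fun=> expR_ge0 _) me (normal_exp tm1).
  have sE : (Num.sqrt (1 + t))^-1 = 1 - tau.
    by rewrite /t subrKC sqrtrV ?exprn_ge0 ?(ltW p)// sqrtr_sqr gtr0_norm// invrK.
  have J := integB (integ_cst N 1) Ie.
  have EJ : E (fun x => 1 - expR (- t * x ^+ 2 / 2)) = tau.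
    by rewrite (EB (integ_cst N 1) Ie) E_cst Ee sE; ring.
  have bd x : t / 2 * x ^+ 2 - (t / 2) ^+ 2 * x ^+ 4 <= 1 - expR (- t * x ^+ 2 / 2) <= t / 2 * x ^+ 2.
    have -> : - t * x ^+ 2 / 2 = - (t / 2 * x ^+ 2) by ring.
    have -> : (t / 2) ^+ 2 * x ^+ 4 = (t / 2 * x ^+ 2) ^+ 2 by ring.
    by apply: exp_quad; rewrite mulr_ge0 ?sqr_ge0// divr_ge0// ltW.
  split.
    apply: var_arith1 => //; rewrite -/t -(EZ (t / 2) I2) -[leLHS]EJ.
    by apply: E_le => //; [exact: integZ|move=> x; have /andP[] := bd x].
  apply: (var_arith2 t0 t1 m20 m40); rewrite -/t -(EZ (t / 2) I2) -(EZ _ I4).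
  rewrite -(EB (integZ _ I2) (integZ _ I4)) -[leRHS]EJ; apply: E_le => //.
    by apply: integB; exact: integZ.
  by move=> x; have /andP[] := bd x.
apply/eqP; rewrite eq_le; apply/andP; split; apply/ler_addgt0Pr => e e0.
- pose tau := Num.min 2^-1 (e / (16 * m4 + 1)).
  have q : 0 < 16 * m4 + 1 by lra.
  have t0 : 0 < tau by rewrite lt_min invr_gt0 divr_gt0// ltr0n.
  have t1 : tau <= 2^-1 by rewrite ge_min lexx.
  have [_ /le_trans] := key tau t0 t1; apply; rewrite lerD2l.
  have : tau <= e / (16 * m4 + 1) by rewrite ge_min lexx orbT.
  by rewrite ler_pdivlMr//; nra.
- pose tau := Num.min 2^-1 (e / 2).
  have t0 : 0 < tau by rewrite lt_min invr_gt0 divr_gt0// ltr0n.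
  have t1 : tau <= 2^-1 by rewrite ge_min lexx.
  have [+ _] := key tau t0 t1.
  have : tau <= e / 2 by rewrite ge_min lexx orbT.
  lra.
Qed.

(** An orthogonal map with cosine sqrt (t / (t + h)) turns the argument into a multiple of one
    coordinate. At t = 0 the cosine is not positive and the identity is read off directly. *)
Lemma normal_rot_law (t h : R) (f : R -> \bar R) : 0 <= t -> 0 <= h ->
  (forall x, 0 <= f x)%E -> measurable_fun setT f ->
  (\int[N]_x \int[N]_y f (Num.sqrt t * x + Num.sqrt h * y)%R =
   \int[N]_x f (Num.sqrt (t + h)%R * x)%R)%E.
Proof.
move=> t0 h0 f0 mf; have [->|tn] := eqVneq t 0.
  rewrite sqrtr0 add0r; under eq_integral do under eq_integral do rewrite mul0r add0r.
  by rewrite integral_cst//= probability_setT mule1.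
have tp : 0 < t by rewrite lt_neqAle eq_sym tn.
have r0 : 0 < Num.sqrt (t + h) by rewrite sqrtr_gt0 ltr_wpDr.
pose c := Num.sqrt t / Num.sqrt (t + h); pose s := Num.sqrt h / Num.sqrt (t + h).
have c0 : 0 < c by rewrite divr_gt0// sqrtr_gt0.
have cs : c ^+ 2 + s ^+ 2 = 1.
  rewrite !exprMn !exprVn !sqr_sqrtr ?addr_ge0// -mulrDl divff//.
  by rewrite gt_eqF// ltr_wpDr.
pose F (z : R * R) := f (Num.sqrt (t + h) * z.1).
have mF : measurable_fun setT F.
  by apply: (measurableT_comp mf); apply: measurable_funM.
have := normal_rotation c0 cs (fun z => f0 _) mF.
rewrite /F /= => H; transitivity (\int[N]_x \int[N]_y f (Num.sqrt (t + h)%R * (c * x + s * y))%R)%E.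
  apply: eq_integral => x _; apply: eq_integral => y _; congr f.
  by rewrite /c /s; field; rewrite gt_eqF.
rewrite H; apply: eq_integral => x _; rewrite integral_cst//=.
by rewrite probability_setT mule1.
Qed.

End normal_moments.

(** * Gaussian averages of smooth test functions *)

Section smooth_test.
Variable R : realType.
Local Notation N := (@normal_prob R 0 1).
Local Notation E f := (Rintegral N setT f).

(** Smoothness through the inequalities that the replacement argument consumes; [f1] and [f2] stand
    for the first two derivatives. Nonnegativity of [f] serves the exchange of integrals in the
    semigroup property. *)
Definition smooth_test (K : R) (f f1 f2 : R -> R) : Prop :=
  [/\ (forall x, 0 <= f x) /\ forall x z, `|f (x + z) - f x| <= K * `|z|,
      forall x, [/\ `|f x| <= K, `|f1 x| <= K & `|f2 x| <= K],
      forall x z, `|f1 (x + z) - f1 x| <= K * `|z|,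
      forall x z, `|f2 (x + z) - f2 x| <= K * `|z| &
      forall x z, `|f (x + z) - f x - f1 x * z - f2 x * z ^+ 2 / 2| <= K * `|z| ^+ 3].

Definition gauss_avg (f : R -> R) (t x : R) : R := E (fun y => f (x + Num.sqrt t * y)).

Lemma lipschitz_continuous_fun (K : R) (g : R -> R) :
  (forall x z, `|g (x + z) - g x| <= K * `|z|) -> continuous g.
Proof.
move=> H x; apply/cvgrPdist_lt => e e0.
have K0 : 0 <= K by have := le_trans (normr_ge0 _) (H 0 1); rewrite normr1 mulr1.
near=> y; rewrite distrC -{1}(subrKC x y).
apply: le_lt_trans (H _ _) _.
apply: (@le_lt_trans _ _ ((K + 1) * `|y - x|)); first by rewrite ler_wpM2r// lerDl.
rewrite mulrC -ltr_pdivlMr ?ltr_wpDl//.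
near: y; apply: cvgr_distC_lt => //; by rewrite divr_gt0// ltr_wpDl.
Unshelve. all: by end_near. Qed.

Lemma measurable_gauss_arg (t x : R) (g : R -> R) : continuous g ->
  measurable_fun setT (fun y => g (x + Num.sqrt t * y)).
Proof.
move=> cg; apply: measurableT_comp; first exact: continuous_measurable_fun.
by apply: measurable_funD => //; exact: measurable_funM.
Qed.

Lemma integ_gauss_arg (K t x : R) (g : R -> R) : continuous g -> (forall x, `|g x| <= K) ->
  integ N (fun y => g (x + Num.sqrt t * y)).
Proof. by move=> cg gK; apply: (@integ_bounded _ _ R N _ K); [exact: measurable_gauss_arg|move=> y; exact: gK]. Qed.

Lemma gauss_avg_le (K t x : R) (g : R -> R) : continuous g -> (forall x, `|g x| <= K) ->
  `|gauss_avg g t x| <= K.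
Proof.
move=> cg gK; have I := integ_gauss_arg t x cg gK.
apply: le_trans (E_norm_le I) _; rewrite -[leRHS](E_cst N).
by apply: E_le (integ_norm I) (integ_cst _ _) _ => y; exact: gK.
Qed.

Lemma gauss_avg_lip (K t : R) (g : R -> R) : continuous g -> (forall x, `|g x| <= K) ->
  (forall x z, `|g (x + z) - g x| <= K * `|z|) ->
  forall x z, `|gauss_avg g t (x + z) - gauss_avg g t x| <= K * `|z|.
Proof.
move=> cg gK gL x z; have I1 := integ_gauss_arg t x cg gK; have I2 := integ_gauss_arg t (x + z) cg gK.
rewrite -(EB I2 I1); apply: le_trans (E_norm_le (integB I2 I1)) _.
rewrite -[leRHS](E_cst N); apply: E_le (integ_norm (integB I2 I1)) (integ_cst _ _) _ => y.
by rewrite addrAC; exact: gL.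
Qed.

Section heat.
Variables (K : R) (f f1 f2 : R -> R).
Hypothesis hf : smooth_test K f f1 f2.

Let K0 : 0 <= K.
Proof. by case: hf => _ /(_ 0) [/(le_trans (normr_ge0 _))]. Qed.
Let lf x z : `|f (x + z) - f x| <= K * `|z|. Proof. by case: hf => -[_ +] _ _ _ _; exact. Qed.
Let cf : continuous f. Proof. exact: lipschitz_continuous_fun lf. Qed.
Let cf1 : continuous f1. Proof. by case: hf => _ _ /lipschitz_continuous_fun. Qed.
Let cf2 : continuous f2. Proof. by case: hf => _ _ _ /lipschitz_continuous_fun. Qed.
Let bf x : `|f x| <= K. Proof. by case: hf => _ /(_ x) []. Qed.
Let bf1 x : `|f1 x| <= K. Proof. by case: hf => _ /(_ x) []. Qed.
Let bf2 x : `|f2 x| <= K. Proof. by case: hf => _ /(_ x) []. Qed.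
Let f0 x : 0 <= f x. Proof. by case: hf => -[]. Qed.
Let lf1 x z : `|f1 (x + z) - f1 x| <= K * `|z|. Proof. by case: hf => _ _ + _ _; exact. Qed.
Let lf2 x z : `|f2 (x + z) - f2 x| <= K * `|z|. Proof. by case: hf => _ _ _ + _; exact. Qed.
Let tf x z : `|f (x + z) - f x - f1 x * z - f2 x * z ^+ 2 / 2| <= K * `|z| ^+ 3.
Proof. by case: hf => _ _ _ _; exact. Qed.

Local Notation u := (gauss_avg f).
Local Notation u1 := (gauss_avg f1).
Local Notation u2 := (gauss_avg f2).

Lemma gauss_avg_taylor t x z :
  `|u t (x + z) - u t x - u1 t x * z - u2 t x * z ^+ 2 / 2| <= K * `|z| ^+ 3.
Proof.
have I := integ_gauss_arg t x cf bf; have I' := integ_gauss_arg t (x + z) cf bf.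
have I1 := integ_gauss_arg t x cf1 bf1; have I2 := integ_gauss_arg t x cf2 bf2.
have J := integB (integB (integB I' I) (integZ z I1)) (integZ (z ^+ 2 / 2) I2).
have -> : u t (x + z) - u t x - u1 t x * z - u2 t x * z ^+ 2 / 2 =
   E (fun y => f (x + z + Num.sqrt t * y) - f (x + Num.sqrt t * y)
     - z * f1 (x + Num.sqrt t * y) - z ^+ 2 / 2 * f2 (x + Num.sqrt t * y)).
  rewrite (EB (integB (integB I' I) (integZ z I1)) (integZ (z ^+ 2 / 2) I2)).
  rewrite (EB (integB I' I) (integZ z I1)) (EB I' I) (EZ _ I1) (EZ _ I2) /gauss_avg.
  by ring.
apply: le_trans (E_norm_le J) _; rewrite -[leRHS](E_cst N).
apply: E_le (integ_norm J) (integ_cst _ _) _ => y /=.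
have := tf (x + Num.sqrt t * y) z; rewrite (addrAC x z).
by apply: le_trans; rewrite le_eqVlt; apply/orP; left; apply/eqP; congr (`|_|); ring.
Qed.

Definition gauss_abs3 : R := E (fun y => `|y| ^+ 3).

(** Taylor expansion in sqrt h y with y normal: the first-order term has mean 0, the second-order
    term has mean h / 2 times [f2 p], and the remainder costs h sqrt h times the third absolute
    moment. *)
Lemma gauss_step h p : 0 <= h ->
  `|u h p - f p - h / 2 * f2 p| <= K * gauss_abs3 * (h * Num.sqrt h).
Proof.
move=> h0; have I := integ_gauss_arg h p cf bf.
have Ix : integ N id by exact: (normal_integ_pow R (isT : 1 <= 4)%N).
have Ix2 := normal_integ_pow R (isT : 2 <= 4)%N.
have Ia := normal_integ_abs R (isT : 3 <= 4)%N.
have Ic := integ_cst N (f p).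
have J1 := integZ (f1 p * Num.sqrt h) Ix; have J2 := integZ (f2 p * h / 2) Ix2.
have J := integB (integB (integB I Ic) J1) J2.
have -> : u h p - f p - h / 2 * f2 p = E (fun y => f (p + Num.sqrt h * y) - f p
   - f1 p * Num.sqrt h * y - f2 p * h / 2 * y ^+ 2).
  rewrite (EB (integB (integB I Ic) J1) J2) (EB (integB I Ic) J1) (EB I Ic) E_cst.
  by rewrite (EZ _ Ix) (EZ _ Ix2) normal_mean normal_var /gauss_avg; ring.
apply: le_trans (E_norm_le J) _.
rewrite [leRHS](_ : _ = E (fun y => K * (h * Num.sqrt h) * `|y| ^+ 3)); last first.
  by rewrite (EZ _ Ia) /gauss_abs3; ring.
apply: E_le (integ_norm J) (integZ _ Ia) _ => y /=.
have := tf p (Num.sqrt h * y); rewrite normrM (ger0_norm (sqrtr_ge0 h)) !exprMn sqr_sqrtr//.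
have -> : Num.sqrt h ^+ 3 = h * Num.sqrt h by rewrite exprSr sqr_sqrtr.
rewrite -!mulrA; apply: le_trans; rewrite le_eqVlt; apply/orP; left; apply/eqP.
by congr (`|_|); ring.
Qed.

Lemma gauss_avg_semigroup t h x : 0 <= t -> 0 <= h ->
  u (t + h) x = E (fun y => u h (x + Num.sqrt t * y)).
Proof.
move=> t0 h0.
have cu : continuous (u h) by exact: lipschitz_continuous_fun (gauss_avg_lip h cf bf lf).
have bu p : `|u h p| <= K by exact: gauss_avg_le.
have mf : measurable_fun setT (fun v => (f (x + v))%:E).
  apply/measurable_EFinP; apply: measurableT_comp; first exact: continuous_measurable_fun.
  exact: measurable_funD.
have f0' v : (0 <= (f (x + v))%:E)%E by rewrite lee_fin.
apply: EFin_inj; rewrite -(EFinE (integ_gauss_arg t x cu bu)).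
rewrite -(EFinE (integ_gauss_arg (t + h) x cf bf)) -(normal_rot_law t0 h0 f0' mf).
apply: eq_integral => y _.
rewrite -(EFinE (integ_gauss_arg h (x + Num.sqrt t * y) cf bf)).
by apply: eq_integral => z _; rewrite addrA.
Qed.

(** By the semigroup property the left side is the Gaussian average, at time [t], of the one-step
    error bounded in [gauss_step]. *)
Lemma gauss_avg_heat t h x : 0 <= t -> 0 <= h ->
  `|u (t + h) x - u t x - h / 2 * u2 t x| <= K * gauss_abs3 * (h * Num.sqrt h).
Proof.
move=> t0 h0.
have cu : continuous (u h) by exact: lipschitz_continuous_fun (gauss_avg_lip h cf bf lf).
have bu p : `|u h p| <= K by exact: gauss_avg_le.
have I := integ_gauss_arg t x cf bf; have I2 := integ_gauss_arg t x cf2 bf2.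
have Iu := integ_gauss_arg t x cu bu.
have J := integB (integB Iu I) (integZ (h / 2) I2).
rewrite gauss_avg_semigroup// -(EZ (h / 2) I2) -(EB Iu I) -(EB (integB Iu I) (integZ _ I2)).
apply: le_trans (E_norm_le J) _; rewrite -[leRHS](E_cst N).
by apply: E_le (integ_norm J) (integ_cst _ _) _ => y; exact: gauss_step.
Qed.

Lemma gauss_abs3_ge0 : 0 <= gauss_abs3.
Proof. by apply: E_ge0 => y; rewrite exprn_ge0. Qed.

Lemma smooth_heat_family : heat_family (K * (1 + gauss_abs3)) u u1 u2.
Proof.
have m0 := gauss_abs3_ge0.
have KK : K <= K * (1 + gauss_abs3) by rewrite ler_peMr// lerDl.
have meas g : continuous g -> (forall x, `|g x| <= K) ->
  (forall x z, `|g (x + z) - g x| <= K * `|z|) -> forall t, measurable_fun setT (gauss_avg g t).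
  move=> cg bg lg t; apply: continuous_measurable_fun.
  exact: lipschitz_continuous_fun (gauss_avg_lip t cg bg lg).
split.
- by move=> t _; split; apply: meas.
- by move=> t x _; split; apply: le_trans (gauss_avg_le _ _ _ _) KK.
- move=> t x z _; apply: le_trans (gauss_avg_taylor t x z) _.
  by rewrite ler_wpM2r// exprn_ge0.
- move=> t h x t0 h0; apply: le_trans (gauss_avg_heat x t0 h0) _.
  rewrite ler_wpM2r ?mulr_ge0 ?sqrtr_ge0// ler_wpM2l// lerDr; exact: ler01.
Qed.

Lemma gauss_avg0 : u 0 = f.
Proof.
apply/funext => x; rewrite /gauss_avg sqrtr0 -[RHS](E_cst N).
by apply: eq_Rintegral => y _; rewrite mul0r addr0.
Qed.

End heat.
End smooth_test.

(** * Taylor bounds of third order *)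

Section taylor3.
Variable R : realType.

Lemma mvt_bound (phi dphi : R -> R) (C : R) : phi 0 = 0 ->
  (forall s : R, is_derive s (1 : R) phi (dphi s)) ->
  (forall s, 0 <= s -> s <= 1 -> `|dphi s| <= C) -> `|phi 1| <= C.
Proof.
move=> phi0 D H.
have cphi : {within `[0, 1], continuous phi}.
  by apply: derivable_within_continuous => x _; have [] := D x.
have [c c01 E] := MVT ltr01 (fun x _ => D x) cphi.
have := E; rewrite phi0 !subr0 mulr1 => ->; apply: H.
  by move: c01; rewrite in_itv /= => /andP[/ltW].
by move: c01; rewrite in_itv /= => /andP[_ /ltW].
Qed.

Variables (g g1 g2 g3 : R -> R) (C : R).
Hypotheses (D0 : forall x : R, is_derive x (1 : R) g (g1 x))
  (D1 : forall x : R, is_derive x (1 : R) g1 (g2 x))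
  (D2 : forall x : R, is_derive x (1 : R) g2 (g3 x)) (b3 : forall x, `|g3 x| <= C).

Lemma is_derive_line (f df : R -> R) (x z s : R) :
  (forall x : R, is_derive x (1 : R) f (df x)) ->
  is_derive s (1 : R) (fun s => f (x + s * z)) (df (x + s * z) * z).
Proof.
move=> D; have Dl : is_derive s (1 : R) (fun s : R => x + s * z) z.
  by apply: is_derive_eq; rewrite /GRing.scale /=; ring.
have := @is_derive1_comp R f (fun s => x + s * z) s _ _ (D _) Dl.
by [].
Qed.

Lemma lipschitz_of_derive (f df : R -> R) (B : R) :
  (forall x : R, is_derive x (1 : R) f (df x)) ->
  (forall x, `|df x| <= B) -> forall x z, `|f (x + z) - f x| <= B * `|z|.
Proof.
move=> D b x z; pose phi s := f (x + s * z) - f x.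
have -> : f (x + z) - f x = phi 1 by rewrite /phi mul1r.
apply: (@mvt_bound phi (fun s => df (x + s * z) * z)).
- by rewrite /phi mul0r addr0 subrr.
- move=> s; have := is_derive_line x z s D => D'.
  by apply: is_derive_eq; rewrite subr0.
- by move=> s _ _; rewrite normrM ler_wpM2r.
Qed.

Lemma taylor2_bound x z : `|g1 (x + z) - g1 x - g2 x * z| <= C * `|z| ^+ 2.
Proof.
have C0 : 0 <= C by apply: le_trans (b3 0).
pose phi s := g1 (x + s * z) - g1 x - s * (g2 x * z).
have -> : g1 (x + z) - g1 x - g2 x * z = phi 1 by rewrite /phi !mul1r.
apply: (@mvt_bound phi (fun s => (g2 (x + s * z) - g2 x) * z)).
- by rewrite /phi !mul0r addr0 subrr subr0.
- move=> s; have D' := is_derive_line x z s D1.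
  apply: is_derive_eq; rewrite /GRing.scale /=; ring.
- move=> s s0 s1; rewrite normrM expr2 mulrA ler_wpM2r//.
  apply: le_trans (lipschitz_of_derive D2 b3 x (s * z)) _.
  by rewrite ler_wpM2l// normrM ger0_norm// ler_piMl.
Qed.

(** Along the segment from x to x + z the remainder vanishes at the start, and its derivative is z
    times the remainder one order below, so the mean value theorem passes the bound up one order. No
    factorial is gained. *)
Lemma taylor3_bound x z : `|g (x + z) - g x - g1 x * z - g2 x * z ^+ 2 / 2| <= C * `|z| ^+ 3.
Proof.
have C0 : 0 <= C by apply: le_trans (b3 0).
pose phi s := g (x + s * z) - g x - s * (g1 x * z) - s ^+ 2 * (g2 x * z ^+ 2 / 2).
have -> : g (x + z) - g x - g1 x * z - g2 x * z ^+ 2 / 2 = phi 1 by rewrite /phi expr1n !mul1r.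
apply: (@mvt_bound phi (fun s => (g1 (x + s * z) - g1 x - g2 x * (s * z)) * z)).
- by rewrite /phi expr0n !mul0r addr0 subrr !subr0.
- move=> s; have D' := is_derive_line x z s D0.
  apply: is_derive_eq; rewrite /GRing.scale /=; by field.
- move=> s s0 s1; rewrite normrM (exprSr `|z|) [leRHS]mulrA ler_wpM2r//.
  apply: le_trans (taylor2_bound x (s * z)) _.
  rewrite ler_wpM2l// normrM ger0_norm// exprMn ler_piMl ?exprn_ge0//.
  exact: exprn_ile1.
Qed.

End taylor3.

(** * Logistic functions as smooth test functions *)

Section logistic.
Variable R : realType.

(** A decreasing sigmoid; its derivative is the polynomial y^2 - y in itself, hence all its
    derivatives are bounded. *)
Definition logistic (x : R) : R := (1 + expR x)^-1.

Lemma logistic_gt0 x : 0 < logistic x.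
Proof. by rewrite invr_gt0 addr_gt0 ?expR_gt0. Qed.

Lemma logistic_le1 x : logistic x <= 1.
Proof. by rewrite invf_le1 ?addr_gt0 ?expR_gt0// lerDl expR_ge0. Qed.

Lemma is_derive_logistic (x : R) : is_derive x (1 : R) logistic (logistic x ^+ 2 - logistic x).
Proof.
have n0 : 1 + expR x != 0 by rewrite gt_eqF// addr_gt0 ?expR_gt0.
have De : is_derive x (1 : R) (fun x : R => 1 + expR x) (expR x).
  by apply: is_derive_eq; rewrite /GRing.scale /=; ring.
have := is_deriveV (f := fun x => 1 + expR x) (x := x) n0 De.
move=> H; apply: is_derive_eq; rewrite /logistic /GRing.scale /=; field.
by rewrite addrC.
Qed.

Lemma is_derive_poly_logistic (p q : R -> R) (x : R) :
  (forall y : R, is_derive y (1 : R) p (q y)) ->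
  is_derive x (1 : R) (fun x => p (logistic x)) (q (logistic x) * (logistic x ^+ 2 - logistic x)).
Proof. by move=> D; exact: (is_derive1_comp (D _) (is_derive_logistic x)). Qed.

Definition logit (a b x : R) := logistic (a * x + b).

Lemma is_derive_affine_arg (a b : R) (f df : R -> R) (x : R) :
  (forall x : R, is_derive x (1 : R) f (df x)) ->
  is_derive x (1 : R) (fun x => f (a * x + b)) (a * df (a * x + b)).
Proof.
move=> D; have Dl : is_derive x (1 : R) (fun x : R => a * x + b) a.
  by apply: is_derive_eq; rewrite /GRing.scale /=; ring.
by rewrite mulrC; exact: (is_derive1_comp (D _) Dl).
Qed.

(** The derivatives of [logistic] are the polynomials [p1], [p2], [p3] in it, at most 1 in absolute
    value on [0, 1]. The affine argument multiplies them by a, a^2, a^3, all at most (1 + a)^3. *)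
Lemma logit_smooth (a b : R) : 0 <= a ->
  exists f1 f2, smooth_test ((1 + a) ^+ 3) (logit a b) f1 f2.
Proof.
move=> a0.
pose p1 (y : R) := y ^+ 2 - y; pose p2 (y : R) := (2 * y - 1) * (y ^+ 2 - y).
pose p3 (y : R) := (6 * y ^+ 2 - 6 * y + 1) * (y ^+ 2 - y).
pose l1 x := p1 (logistic x); pose l2 x := p2 (logistic x); pose l3 x := p3 (logistic x).
have d1 (x : R) : is_derive x (1 : R) l1 (l2 x).
  apply: is_derive_eq (is_derive_poly_logistic (p := p1) (q := fun y => 2 * y - 1) _ _) _ => // y.
  by apply: is_derive_eq; rewrite /GRing.scale /=; ring.
have d2 (x : R) : is_derive x (1 : R) l2 (l3 x).
  apply: is_derive_eq (is_derive_poly_logistic (p := p2) (q := fun y => 6 * y ^+ 2 - 6 * y + 1) _ _) _ => // y.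
  by apply: is_derive_eq; rewrite /GRing.scale /=; ring.
have l01 x : 0 <= logistic x <= 1 by rewrite ltW ?logistic_gt0// logistic_le1.
have b0 x : `|logistic x| <= 1 by rewrite ger0_norm ?logistic_le1// ltW ?logistic_gt0.
have q1 (y : R) : 0 <= y <= 1 -> `|y ^+ 2 - y| <= 4^-1.
  by move=> /andP[y0 y1]; rewrite ler_norml; have := sqr_ge0 (y - 2^-1); nra.
have b1 x : `|l1 x| <= 1 by apply: le_trans (q1 _ (l01 x)) _; lra.
have b2 x : `|l2 x| <= 1.
  rewrite /l2 /p2 normrM; have /andP[y0 y1] := l01 x; have := q1 _ (l01 x).
  have : `|2 * logistic x - 1| <= 1 by rewrite ler_norml; lra.
  by move=> u v; apply: mulr_ile1 => //; lra.
have b3 x : `|l3 x| <= 1.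
  rewrite /l3 /p3 normrM; have /andP[y0 y1] := l01 x; have := q1 _ (l01 x).
  have : `|6 * logistic x ^+ 2 - 6 * logistic x + 1| <= 1.
    have := q1 _ (l01 x); rewrite !ler_norml; nra.
  by move=> u v; apply: mulr_ile1 => //; lra.
have D0 x := is_derive_affine_arg a b x is_derive_logistic.
have D1' x := is_derive_affine_arg a b x d1.
have D2' x := is_derive_affine_arg a b x d2.
have D1 (x : R) : is_derive x (1 : R) (fun x => a * l1 (a * x + b)) (a ^+ 2 * l2 (a * x + b)).
  by apply: is_derive_eq; rewrite /GRing.scale /=; ring.
have D2 (x : R) : is_derive x (1 : R) (fun x => a ^+ 2 * l2 (a * x + b)) (a ^+ 3 * l3 (a * x + b)).
  by apply: is_derive_eq; rewrite /GRing.scale /=; ring.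
pose K := (1 + a) ^+ 3.
have KE : K = 1 + 3 * a + 3 * a ^+ 2 + a ^+ 3 by rewrite /K; ring.
have [a2 a3] : 0 <= a ^+ 2 /\ 0 <= a ^+ 3 by rewrite !exprn_ge0.
have B (k : nat) (r y : R) : a ^+ k <= K -> `|y| <= 1 -> `|a ^+ k * y| <= K.
  move=> kK y1; rewrite normrM (ger0_norm (exprn_ge0 _ a0)); apply: le_trans kK.
  by rewrite ler_piMr// exprn_ge0.
have B1 x : `|a * l1 x| <= K by apply: (B 1%N a) => //; rewrite expr1 KE; lra.
have B2 x : `|a ^+ 2 * l2 x| <= K by apply: (B 2%N a) => //; rewrite KE; lra.
have B3 x : `|a ^+ 3 * l3 x| <= K by apply: (B 3%N a) => //; rewrite KE; lra.
exists (fun x => a * l1 (a * x + b)), (fun x => a ^+ 2 * l2 (a * x + b)); split.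
- split; first by move=> x; rewrite ltW ?logistic_gt0.
  exact: (lipschitz_of_derive D0 (fun x => B1 _)).
- move=> x; split => //; apply: le_trans (b0 _) _; rewrite -/K KE; lra.
- exact: (lipschitz_of_derive D1 (fun x => B2 _)).
- exact: (lipschitz_of_derive D2 (fun x => B3 _)).
- exact: (taylor3_bound D0 D1 D2 (fun x => B3 _)).
Qed.

End logistic.

(** * Identification of a normal law by logistic tests *)

Section normal_law.
Variable R : realType.
Local Notation N := (@normal_prob R 0 1).

(** A smooth version of the indicator of ]-oo, c], with argument k (x - c) - sqrt k. The shift sqrt
    k makes the value at c itself tend to 1 and is negligible against k (x - c) elsewhere. *)
Definition logit_step (c : R) (k : nat) : R -> R :=
  logit k%:R (- (k%:R * c + Num.sqrt k%:R)).

Lemma logistic_le (y r : R) : 0 <= r -> r <= y -> logistic y <= (1 + r)^-1.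
Proof.
move=> r0 ry; have r1 : 0 < 1 + r by lra.
have y1 : 0 < 1 + expR y by rewrite addr_gt0 ?expR_gt0.
rewrite /logistic lef_pV2//; have := expR_ge1Dx y; lra.
Qed.

Lemma logisticN (y : R) : 1 - logistic y = logistic (- y).
Proof.
have e0 := expR_gt0 y; rewrite /logistic expRN; field.
by rewrite !gt_eqF// addr_gt0.
Qed.

Lemma inv_sqrt_lt (e : R) : 0 < e -> \forall k \near \oo, (1 + Num.sqrt k%:R)^-1 < e.
Proof.
move=> e0; exists (Num.truncn (e ^- 2)).+1 => // k /= Hk.
have ep : 0 < e ^- 2 by rewrite invr_gt0 exprn_gt0.
have [_ H] := andP (truncn_itv (ltW ep)).
have ek : e ^- 2 < k%:R by apply: lt_le_trans H _; rewrite ler_nat.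
have r1 : 0 < 1 + Num.sqrt k%:R :> R by rewrite ltr_pwDl// sqrtr_ge0.
rewrite invf_plt ?posrE//.
have : Num.sqrt (e ^- 2) < Num.sqrt k%:R.
  by rewrite ltr_sqrt//; apply: lt_trans ek; rewrite invr_gt0 exprn_gt0.
rewrite sqrtrV ?sqr_ge0// sqrtr_sqr gtr0_norm//; lra.
Qed.

Lemma cvg_logit_step (c x : R) : logit_step c k x @[k --> \oo] --> (\1_(`]-oo, c]) x : R).
Proof.
apply/cvgrPdist_lt => e e0; rewrite indicE mem_setE in_itv /=.
have E k : k%:R * x - (k%:R * c + Num.sqrt k%:R) = k%:R * (x - c) - Num.sqrt k%:R :> R by ring.
have [xc|cx] := leP x c.
- near=> k; rewrite /logit_step /logit E logisticN ger0_norm ?ltW ?logistic_gt0//.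
  apply: le_lt_trans (logistic_le (sqrtr_ge0 k%:R) _) _; last by near: k; exact: inv_sqrt_lt.
  have : k%:R * (x - c) <= 0 by rewrite mulr_ge0_le0// subr_le0.
  lra.
(* The divisor 4 is chosen so that 1 + sqrt k > 1 / d and sqrt k >= 1 give sqrt k (x - c) >= 2,
   hence an argument of at least sqrt k. *)
- pose d := (x - c) / 4; have d0 : 0 < d by rewrite divr_gt0// subr_gt0.
  near=> k; rewrite sub0r normrN ger0_norm ?(ltW (logistic_gt0 _))//.
  rewrite /logit_step /logit E.
  apply: le_lt_trans (logistic_le (sqrtr_ge0 k%:R) _) _; last by near: k; exact: inv_sqrt_lt.
  have H : (1 + Num.sqrt k%:R)^-1 < d by near: k; exact: inv_sqrt_lt.
  have s0 := sqrtr_ge0 (k%:R : R); have s2 : Num.sqrt k%:R ^+ 2 = k%:R :> R by rewrite sqr_sqrtr.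
  have k1 : (1 <= k)%N by near: k; exists 1%N.
  have s1 : 1 <= Num.sqrt k%:R :> R by rewrite -[leLHS]sqrtr1 ler_wsqrtr// ler1n.
  have r1 : 0 < 1 + Num.sqrt k%:R :> R by rewrite ltr_pwDl// sqrtr_ge0.
  move: H; rewrite invf_plt ?posrE//.
  move: s0 s1; rewrite -[d^-1]mul1r ltr_pdivrMr// -[in k%:R * _]s2.
  have -> : x - c = d * 4 by rewrite /d; field.
  set s := Num.sqrt _ => s0 s1 H.
  have H1 : 2 <= s * (d * 4) by have := ler_wpM2r (ltW d0) s1; lra.
  have := ler_wpM2l s0 H1; lra.
Unshelve. all: by end_near. Qed.

Lemma measurable_logit_step (c : R) k : measurable_fun setT (logit_step c k).
Proof.
have [f1 [f2 [[_ L] _ _ _ _]]] := @logit_smooth R k%:R (- (k%:R * c + Num.sqrt k%:R)) (ler0n _ _).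
by apply: continuous_measurable_fun; exact: (lipschitz_continuous_fun L).
Qed.

Lemma logit_step_le1 (c : R) k x : `|logit_step c k x| <= 1.
Proof. by rewrite ger0_norm ?logistic_le1// ltW// logistic_gt0. Qed.

Lemma gauss_avg_step_cvg (c : R) j (dn : nat -> R) (h : R) : dn n @[n --> \oo] --> h ->
  gauss_avg (logit_step c j) (dn n) 0 @[n --> \oo] --> gauss_avg (logit_step c j) h 0.
Proof.
move=> cdn; have [f1 [f2 [[_ L] _ _ _ _]]] := @logit_smooth R j%:R (- (j%:R * c + Num.sqrt j%:R)) (ler0n _ _).
have cl : continuous (logit_step c j) by exact: (lipschitz_continuous_fun L).
apply: (@E_bounded_cvg _ _ R N (fun n y => logit_step c j (0 + Num.sqrt (dn n) * y)) _ 1).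
- by move=> n; exact: measurable_gauss_arg.
- exact: measurable_gauss_arg.
- by move=> n y; exact: logit_step_le1.
- apply: aeW => y.
  apply: (@continuous_cvg _ _ _ _ _ (fun n => 0 + Num.sqrt (dn n) * y) (logit_step c j)); first exact: cl.
  apply: cvgD; first exact: cvg_cst.
  apply: cvgMl; apply: (@continuous_cvg _ _ _ _ _ dn Num.sqrt) => //.
  exact: sqrt_continuous.
Qed.

Lemma measure_eq_rays (m1 m2 : {measure set (measurableTypeR R) -> \bar R}) :
  (forall c : R, m1 `]c, +oo[%classic = m2 `]c, +oo[%classic) ->
  (forall c : R, m1 `]c, +oo[%classic < +oo)%E ->
  forall C : set R, measurable C -> m1 C = m2 C.
Proof.
move=> H F C; rewrite [X in X C -> _](RGenOInfty.measurableE R) => mC.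
apply: (@g_sigma_algebra_measure_unique _ R (measurableTypeR R) (@RGenOInfty.G R) _
  (fun i => `](- i%:R)%R, +oo[%classic) _ _ m1 m2) => //.
- by move=> _ [c ->]; exact: measurable_itv.
- by move=> i; exists (- i%:R).
- rewrite -subTset => x _; exists (Num.truncn `|x|).+1 => //=.
  rewrite in_itv /= andbT ltrNl.
  have [_] := andP (truncn_itv (normr_ge0 x)); apply: le_lt_trans.
  by rewrite -normrN ler_norm.
- move=> _ _ [a ->] [b ->]; exists (Num.max a b); apply/seteqP; split => x /=.
    by rewrite !in_itv /= !andbT gt_max => -[-> ->].
  by rewrite !in_itv /= !andbT gt_max => /andP[].
- by move=> _ [c ->].
Qed.

Section limit_law.
Context d (Omega : measurableType d) (P : probability Omega R).
Variables (A : set Omega) (X : Omega -> R) (h : R).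
Hypotheses (mA : measurable A) (mX : measurable_fun setT X) (h0 : 0 < h).
Hypothesis H : forall c k, Rintegral P setT (fun w => \1_A w * logit_step c k (X w)) =
  Rintegral P setT (\1_A : Omega -> R) * gauss_avg (logit_step c k) h 0.

Let Y (y : R) : R := Num.sqrt h * y.
Let mY : measurable_fun setT Y. Proof. exact: measurable_funM. Qed.

Lemma normal_law_ray c : P (A `&` X @^-1` `]c, +oo[) = (P A * N (Y @^-1` `]c, +oo[))%E.
Proof.
pose U : set R := `]-oo, c]%classic; have mU : measurable U by exact: measurable_itv.
have mAf : measurable_fun setT (\1_A : Omega -> R) by exact: measurable_indic.
have mUX : measurable (X @^-1` U) by rewrite -[X @^-1` U]setTI; exact: mX.
have mUY : measurable (Y @^-1` U) by rewrite -[Y @^-1` U]setTI; exact: mY.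
have c1 : Rintegral P setT (fun w => \1_A w * logit_step c k (X w)) @[k --> \oo] -->
    Rintegral P setT (fun w => \1_A w * \1_U (X w)).
  apply: (@E_bounded_cvg _ _ R P _ _ 1).
  - move=> k; apply: measurable_funM => //.
    exact: (measurableT_comp (measurable_logit_step c k) mX).
  - apply: measurable_funM => //; exact: (measurableT_comp (measurable_indic mU) mX).
  - move=> k w; rewrite normrM; apply: mulr_ile1 => //; [exact: indic_le1|exact: logit_step_le1].
  - by apply: aeW => w; apply: cvgMr; exact: cvg_logit_step.
have c2 : gauss_avg (logit_step c k) h 0 @[k --> \oo] --> Rintegral N setT (fun y => \1_U (Y y)).
  apply: (@E_bounded_cvg _ _ R N (fun k y => logit_step c k (0 + Num.sqrt h * y)) _ 1).
  - move=> k; apply: (measurableT_comp (measurable_logit_step c k)).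
    exact: measurable_funD.
  - exact: (measurableT_comp (measurable_indic mU) mY).
  - by move=> k w; exact: logit_step_le1.
  - by apply: aeW => w; rewrite add0r; exact: cvg_logit_step.
have E1 : Rintegral P setT (fun w => \1_A w * \1_U (X w)) =
   Rintegral P setT (\1_A : Omega -> R) * Rintegral N setT (fun y => \1_U (Y y)).
  have c3 : Rintegral P setT (\1_A : Omega -> R) * gauss_avg (logit_step c k) h 0 @[k --> \oo] -->
      Rintegral P setT (\1_A : Omega -> R) * Rintegral N setT (fun y => \1_U (Y y)) by exact: cvgMr.
  have FE : (fun k => Rintegral P setT (fun w => \1_A w * logit_step c k (X w))) =
    (fun k => Rintegral P setT (\1_A : Omega -> R) * gauss_avg (logit_step c k) h 0) by exact/funext/H.
  by rewrite FE in c1; exact: (cvg_unique _ c1 c3).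
have AE : (fun w => \1_A w * \1_U (X w)) = \1_(A `&` X @^-1` U) :> (Omega -> R).
  by apply/funext => w; rewrite indicI.
have YE : (fun y => \1_U (Y y)) = \1_(Y @^-1` U) :> (R -> R) by [].
have E2 : P (A `&` X @^-1` U) = (P A * N (Y @^-1` U))%E.
  by rewrite -(E_indic P (measurableI _ _ mA mUX)) -(E_indic P mA) -(E_indic N mUY) -AE E1 -EFinM.
have -> : A `&` X @^-1` `]c, +oo[ = A `\` (A `&` X @^-1` U).
  apply/seteqP; split => w /=; rewrite !in_itv /= andbT.
    by move=> [Aw cX]; split => // -[_]; rewrite /U /= in_itv /= leNgt cX.
  by move=> [Aw nU]; split => //; rewrite ltNge; apply/negP => Xc; apply: nU; rewrite /U /= in_itv.
have -> : Y @^-1` `]c, +oo[ = ~` (Y @^-1` U).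
  apply/seteqP; split => y /=; rewrite !in_itv /= andbT; first by rewrite ltNge => /negP.
  by move=> /negP; rewrite ltNge.
rewrite measureD//; last 2 first.
- exact: measurableI.
- by apply: (@le_lt_trans _ _ 1%E); rewrite ?ltry// probability_le1.
rewrite setIA setIid [X in (P A - X)%E]E2.
have NE : N (~` (Y @^-1` U)) = (1 - N (Y @^-1` U))%E by exact: probability_setC.
rewrite NE -(fineK (fin_num_measure N _ mUY)) -(fineK (fin_num_measure P _ mA)).
rewrite -(EFinB 1) -!EFinM -EFinB; congr EFin; ring.
Qed.

(** Testing jointly with the indicator of [A] yields the normal law of [X] and its independence from
    [A] at once. The logistic tests determine the measure of rays, and rays determine both finite
    measures. *)
Lemma normal_law_of_logit C : measurable C ->
  P (A `&` X @^-1` C) = (P A * normal_prob 0 (Num.sqrt h) C)%E.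
Proof.
move=> mC.
have s0 : 0 < Num.sqrt h by rewrite sqrtr_gt0.
have -> : normal_prob 0 (Num.sqrt h) C = N (Y @^-1` C).
  have mC' : measurable_fun setT (fun y : R => (\1_C y : R)%:E).
    by apply/measurable_EFinP; exact: (measurable_indic mC).
  have := normal_scale s0 (fun y => _ : (0 <= (\1_C y : R)%:E)%E) mC'.
  rewrite (integral_indic_preimage N mY mC).
  rewrite (@integral_indic_preimage _ _ _ _ _ (normal_prob 0 (Num.sqrt h)) id C (@measurable_id _ _ setT) mC).
  by move=> -> // y; rewrite lee_fin.
have mX' : measurable_fun setT (X : Omega -> measurableTypeR R) by exact: mX.
have mY' : measurable_fun setT (Y : measurableTypeR R -> measurableTypeR R) by exact: mY.
pose m1 : {measure set (measurableTypeR R) -> \bar R} :=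
  pushforward (mrestr P mA) (X : Omega -> measurableTypeR R).
have p0 : (0 <= fine (P A))%R by rewrite fine_ge0.
pose m2 : {measure set (measurableTypeR R) -> \bar R} :=
  mscale (NngNum p0) (pushforward N (Y : measurableTypeR R -> measurableTypeR R)).
have PA : (fine (P A))%:E = P A by rewrite fineK// fin_num_measure.
have M1 (D : set R) : m1 mX' D = P (A `&` X @^-1` D) by rewrite setIC.
have M2 (D : set R) : m2 mY' D = (P A * N (Y @^-1` D))%E by rewrite -PA.
rewrite -M1 -M2; apply: measure_eq_rays => // [c|c]; rewrite M1.
  by rewrite M2 normal_law_ray.
apply: (@le_lt_trans _ _ 1%E); rewrite ?ltry// probability_le1//.
by apply: measurableI => //; rewrite -[_ @^-1` _]setTI; exact: mX.
Qed.

End limit_law.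
End normal_law.

(** * The driving Brownian motion *)

Section subsig_mono.
Context d (Omega : measurableType d) d' (T : measurableType d').
Variables F G : set (set Omega).
Hypotheses (sF : sigma_algebra setT F) (sG : sigma_algebra setT G).

Lemma subsig_mono (f : Omega -> T) : F `<=` G ->
  measurable_fun setT (f : subsig F -> T) ->
  measurable_fun setT (f : subsig G -> T).
Proof.
move=> FG mf _ B mB; rewrite (measurable_subsig sG); apply: FG.
by have := mf measurableT B mB; rewrite (measurable_subsig sF).
Qed.

End subsig_mono.

Section lindeberg_arith.
Variable R : realType.

Lemma lindeberg_arith (K h r eta e2 x3 q s delta K3 : R) :
  0 <= K -> 0 <= h -> 0 <= delta -> s <= r -> q <= r ->
  `|e2| <= K * (delta / 2 * (h * q)) -> x3 <= h * (r * K3) ->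
  eta <= K * x3 + K * (h * s) ->
  `|e2| / 2 + eta <= h * (r * (K * (delta + K3 + 1))).
Proof.
move=> K0 h0 d0 sr qr H2 H3 H.
have A1 := ler_wpM2l K0 H3.
have A2 := ler_wpM2l K0 (ler_wpM2l h0 sr).
have A3 := ler_wpM2l K0 (ler_wpM2l (divr_ge0 d0 (ler0n R 2)) (ler_wpM2l h0 qr)).
have : 0 <= K * (delta / 2 * (h * r)) by apply: le_trans A3; exact: le_trans H2.
lra.
Qed.

End lindeberg_arith.

Section sde.
Context d (Omega : measurableType d) (R : realType) (P : probability Omega R).
Local Notation E f := (Rintegral P setT f).
Variables (delta : R) (F : R -> set (set Omega)) (M W : R -> Omega -> R).
Hypothesis delta0 : 0 <= delta.
Implicit Types (G : Omega -> R) (K s t h : R) (C : set Omega).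
Hypothesis hF : filtration F.
Local Notation Fs t := (subsig (F t)).
Hypothesis M_ad : forall t, 0 <= t -> measurable_fun setT (M t : Fs t -> R).
Hypothesis M_ge0 : forall t w, 0 <= t -> 0 <= M t w.
Hypothesis M_sq : forall t, 0 <= t -> sqint P (M t).
(** By [m1] this is a martingale increment. The conditional variance in [m2] is that of a bracket 4
    int M: the conditional mean of M at s + u is M_s + delta u, whose integral over [0, h], times 4,
    is 4 M_s h + 2 delta h^2. *)
Definition incM s h w := M (s + h) w - M s w - delta * h.
Hypothesis m1 : forall s h C, 0 <= s -> 0 <= h -> F s C ->
  E (fun w => \1_C w * incM s h w) = 0.
Hypothesis m2 : forall s h C, 0 <= s -> 0 <= h -> F s C ->
  E (fun w => \1_C w * incM s h w ^+ 2) =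
  E (fun w => \1_C w * (4 * M s w * h + 2 * delta * h ^+ 2)).
Definition incW n i w := W (dyad R n i.+1) w - W (dyad R n i) w.
Hypothesis W_ad : forall n i, measurable_fun setT (W (dyad R n i) : Fs (dyad R n i) -> R).
Hypothesis W_sq : forall n i, sqint P (W (dyad R n i)).
Hypothesis w1 : forall n i C, F (dyad R n i) C ->
  E (fun w => \1_C w * incW n i w) = 0.
Hypothesis w2 : forall n i C, F (dyad R n i) C ->
  E (fun w => \1_C w * incW n i w ^+ 2) = E (fun w => \1_C w * mesh R n).
(** The auxiliary noise is conditionally uncorrelated with the martingale increments, so that steps
    combining both have no cross term in their variance. *)
Hypothesis w3 : forall n i C, F (dyad R n i) C ->
  E (fun w => \1_C w * (incM (dyad R n i) (mesh R n) w * incW n i w)) = 0.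

Definition xi m j := incM (dyad R m j) (mesh R m).

Let sF t : 0 <= t -> sigma_algebra setT (F t).
Proof. by case: hF => + _ _; exact. Qed.
Let FM t : 0 <= t -> F t `<=` measurable.
Proof. by case: hF => _ + _; exact. Qed.
Let Fmono s t : 0 <= s -> s <= t -> F s `<=` F t.
Proof. by case: hF => _ _; exact. Qed.
Let dg := dyad_ge0 R.
Let mg := mesh_ge0 R.

Lemma adm t (G : Omega -> R) : 0 <= t -> measurable_fun setT (G : Fs t -> R) ->
  measurable_fun setT G.
Proof. by move=> t0; apply: subsig_meas; [exact: sF|exact: FM]. Qed.

Lemma ad_mono s t (G : Omega -> R) : 0 <= s -> s <= t ->
  measurable_fun setT (G : Fs s -> R) -> measurable_fun setT (G : Fs t -> R).
Proof.
move=> s0 st; apply: subsig_mono; [exact: sF| |exact: Fmono].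
by apply: sF; exact: le_trans st.
Qed.

Lemma xi_ad m j : measurable_fun setT (xi m j : Fs (dyad R m j.+1) -> R).
Proof.
apply: measurable_funB => //; apply: measurable_funB.
  by rewrite dyadS; apply: M_ad; rewrite addr_ge0.
apply: ad_mono (M_ad (dg m j)) => //.
by rewrite dyadS lerDl.
Qed.

Lemma incW_ad m j : measurable_fun setT (incW m j : Fs (dyad R m j.+1) -> R).
Proof.
apply: measurable_funB; first exact: W_ad.
by apply: (@ad_mono (dyad R m j)) => //; rewrite dyadS lerDl.
Qed.

Lemma sqint_incM s h : 0 <= s -> 0 <= h -> sqint P (incM s h).
Proof.
move=> s0 h0; apply: sqintB; last exact: (sqint_cst P (delta * h)).
by apply: sqintB; apply: M_sq => //; exact: addr_ge0.
Qed.

Lemma sqint_xi m j : sqint P (xi m j).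
Proof. exact: sqint_incM. Qed.

Lemma sqint_incW m j : sqint P (incW m j).
Proof. by apply: sqintB. Qed.

Definition var m j w := 4 * M (dyad R m j) w * mesh R m + 2 * delta * mesh R m ^+ 2.

Lemma integ_varcst s h : 0 <= s ->
  integ P (fun w => 4 * M s w * h + 2 * delta * h ^+ 2).
Proof.
move=> s0; apply: integD; last exact: (integ_cst P (2 * delta * h ^+ 2)).
have -> : (fun w => 4 * M s w * h) = (fun w => (4 * h) * M s w).
  by apply/funext => w; ring.
exact/integZ/sqint_integ/M_sq.
Qed.

Lemma integ_var m j : integ P (var m j).
Proof. exact: integ_varcst. Qed.

Lemma var_ge0 m j w : 0 <= var m j w.
Proof. by rewrite addr_ge0// ?mulr_ge0 ?M_ge0 ?sqr_ge0. Qed.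

Lemma E_pull0 t (z G : Omega -> R) : 0 <= t -> integ P z ->
  (forall C, F t C -> E (fun w => \1_C w * z w) = 0) ->
  measurable_fun setT (G : Fs t -> R) -> integ P (fun w => G w * z w) ->
  E (fun w => G w * z w) = 0.
Proof.
move=> t0 Iz H mG IGz; rewrite -[RHS](E_cst P 0).
have -> : (cst 0 : Omega -> R) = (fun w => G w * 0) by apply/funext => w; rewrite mulr0.
apply: (@pull_out _ _ _ P (F t) _ _ z (fun=> 0)) => //.
- exact: sF.
- exact: FM.
- exact: (integ_cst P 0).
- move=> C FC; rewrite H//; under eq_Rintegral do rewrite mulr0.
  by rewrite (E_cst P 0).
- by under eq_fun do rewrite mulr0; exact: (integ_cst P 0).
Qed.

Lemma E_mul_incM_sqr s h (G : Omega -> R) : 0 <= s -> 0 <= h ->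
  measurable_fun setT (G : Fs s -> R) ->
  integ P (fun w => G w * incM s h w ^+ 2) ->
  integ P (fun w => G w * (4 * M s w * h + 2 * delta * h ^+ 2)) ->
  E (fun w => G w * incM s h w ^+ 2) =
  E (fun w => G w * (4 * M s w * h + 2 * delta * h ^+ 2)).
Proof.
move=> s0 h0 mG I1 I2; apply: (@pull_out _ _ _ P (F s)) => //.
- exact: sF.
- exact: FM.
- by case: (sqint_incM s0 h0).
- exact: integ_varcst.
- by move=> C FC; rewrite m2.
Qed.

Lemma E_mul_incW_sqr m j (G : Omega -> R) : measurable_fun setT (G : Fs (dyad R m j) -> R) ->
  integ P (fun w => G w * incW m j w ^+ 2) -> integ P (fun w => G w * mesh R m) ->
  E (fun w => G w * incW m j w ^+ 2) = E (fun w => G w * mesh R m).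
Proof.
move=> mG I1 I2; apply: (@pull_out _ _ _ P (F (dyad R m j))) => //.
- exact: sF.
- exact: FM.
- by case: (sqint_incW m j).
- exact: (integ_cst P (mesh R m)).
- by move=> C FC; rewrite w2.
Qed.

Definition adb m (c : nat -> Omega -> R) := forall j,
  measurable_fun setT (c j : Fs (dyad R m j) -> R) /\
  exists K, forall w, `|c j w| <= K.

(** Weaker than [adb]: the coefficients of the Ito error contain sqrt M and are unbounded, so only
    the integrability used by the isometry is recorded. *)
Definition adM m (c : nat -> Omega -> R) := forall j,
  [/\ measurable_fun setT (c j : Fs (dyad R m j) -> R),
      sqint P (fun w => c j w * xi m j w) &
      integ P (fun w => c j w ^+ 2 * var m j w)].

Definition adW m (e : nat -> Omega -> R) := forall j,
  [/\ measurable_fun setT (e j : Fs (dyad R m j) -> R),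
      sqint P (fun w => e j w * incW m j w) &
      integ P (fun w => e j w ^+ 2 * mesh R m)].

Lemma adb_adM m c : adb m c -> adM m c.
Proof.
move=> hc j; have [mc [K cK]] := hc j; have mc' := adm (dg _ _) mc; split => //.
- exact: sqint_boundedM cK (sqint_xi _ _).
- apply: (integ_boundedM _ _ (integ_var _ _) (M := K ^+ 2)).
    exact: measurable_funX.
  by move=> w; rewrite normrX lerXn2r// nnegrE// (le_trans _ (cK w)).
Qed.

Lemma adb_adW m c : adb m c -> adW m c.
Proof.
move=> hc j; have [mc [K cK]] := hc j; have mc' := adm (dg _ _) mc; split => //.
- exact: sqint_boundedM cK (sqint_incW _ _).
- apply: (integ_boundedM _ _ (integ_cst P (mesh R m)) (M := K ^+ 2)).
    exact: measurable_funX.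
  by move=> w; rewrite normrX lerXn2r// nnegrE// (le_trans _ (cK w)).
Qed.

Definition step m (c e : nat -> Omega -> R) j w := c j w * xi m j w + e j w * incW m j w.
Definition Ssum m c e N w := \sum_(j < N) step m c e j w.

(** * Isometry for sums of martingale and noise increments *)

Section isometry.
Variables (m : nat) (c e : nat -> Omega -> R).
Hypotheses (hc : adM m c) (he : adW m e).

Lemma step_ad j : measurable_fun setT (step m c e j : Fs (dyad R m j.+1) -> R).
Proof.
have jS : dyad R m j <= dyad R m j.+1 by rewrite dyadS lerDl.
apply: measurable_funD; apply: measurable_funM.
- by apply: ad_mono jS _ => //; case: (hc j).
- exact: xi_ad.
- by apply: ad_mono jS _ => //; case: (he j).
- exact: incW_ad.
Qed.

Lemma sqint_step j : sqint P (step m c e j).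
Proof. by apply: sqintD; [case: (hc j)|case: (he j)]. Qed.

Lemma Ssum_ad N : measurable_fun setT (Ssum m c e N : Fs (dyad R m N) -> R).
Proof.
rewrite /Ssum; elim: N => [|N ih].
  under eq_fun do rewrite big_ord0; exact: measurable_cst.
under eq_fun do rewrite big_ord_recr /=.
apply: measurable_funD; last exact: step_ad.
by apply: ad_mono ih => //; rewrite ler_dyad.
Qed.

Lemma sqint_Ssum N : sqint P (Ssum m c e N).
Proof. by apply: sqint_sum => i; exact: sqint_step. Qed.

Lemma E_mul_step j (G : Omega -> R) : measurable_fun setT (G : Fs (dyad R m j) -> R) ->
  sqint P G -> E (fun w => G w * step m c e j w) = 0.
Proof.
move=> mG sG; have [mc cs _] := hc j; have [me es _] := he j.
have -> : (fun w => G w * step m c e j w) =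
   (fun w => c j w * G w * xi m j w + e j w * G w * incW m j w).
  by apply/funext => w; rewrite /step; ring.
have I1 : integ P (fun w => c j w * G w * xi m j w).
  by under eq_fun do rewrite mulrAC mulrC; exact: sqint_integM.
have I2 : integ P (fun w => e j w * G w * incW m j w).
  by under eq_fun do rewrite mulrAC mulrC; exact: sqint_integM.
rewrite (ED I1 I2) !(@E_pull0 (dyad R m j))// ?addr0//.
- exact/sqint_integ/sqint_incW.
- exact: w1.
- exact: measurable_funM.
- exact/sqint_integ/sqint_xi.
- by move=> C; exact: m1.
- exact: measurable_funM.
Qed.

(** The square expands into three terms, given by [m2], [w2] and [w3]; the mixed one vanishes. *)
Lemma E_mul_step_sqr j (G : Omega -> R) (K0 : R) : measurable_fun setT (G : Fs (dyad R m j) -> R) ->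
  (forall w, `|G w| <= K0) -> E (fun w => G w * step m c e j w ^+ 2) =
  E (fun w => G w * (c j w ^+ 2 * var m j w + e j w ^+ 2 * mesh R m)).
Proof.
move=> mG GK0; have [mc cs ci] := hc j; have [me es ei] := he j.
have mG' := adm (dg _ _) mG.
pose G1 (w : Omega) := G w * c j w ^+ 2; pose G2 (w : Omega) := G w * e j w ^+ 2.
pose G3 (w : Omega) := 2 * G w * c j w * e j w.
have mG1 : measurable_fun setT (G1 : Fs (dyad R m j) -> R).
  by apply: measurable_funM => //; exact: measurable_funX.
have mG2 : measurable_fun setT (G2 : Fs (dyad R m j) -> R).
  by apply: measurable_funM => //; exact: measurable_funX.
have mG3 : measurable_fun setT (G3 : Fs (dyad R m j) -> R).
  apply: measurable_funM => //; apply: measurable_funM => //.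
  exact: measurable_funM.
have -> : (fun w => G w * step m c e j w ^+ 2) =
  (fun w => G1 w * xi m j w ^+ 2 + (G2 w * incW m j w ^+ 2 +
            G3 w * (xi m j w * incW m j w))).
  by apply/funext => w; rewrite /step /G1 /G2 /G3; ring.
have I1 : integ P (fun w => G1 w * xi m j w ^+ 2).
  rewrite (_ : (fun w => _) = (fun w => G w * (c j w * xi m j w) ^+ 2)).
    by apply: integ_boundedM GK0 _ => //; case: cs.
  by apply/funext => w; rewrite /G1; ring.
have I2 : integ P (fun w => G2 w * incW m j w ^+ 2).
  rewrite (_ : (fun w => _) = (fun w => G w * (e j w * incW m j w) ^+ 2)).
    by apply: integ_boundedM GK0 _ => //; case: es.
  by apply/funext => w; rewrite /G2; ring.
have I3 : integ P (fun w => G3 w * (xi m j w * incW m j w)).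
  rewrite (_ : (fun w => _) = (fun w => 2 * (G w * ((c j w * xi m j w) * (e j w * incW m j w))))).
    by apply/integZ; apply: integ_boundedM GK0 _ => //; exact: sqint_integM.
  by apply/funext => w; rewrite /G3; ring.
have I4 : integ P (fun w => G1 w * var m j w).
  rewrite (_ : (fun w => _) = (fun w => G w * (c j w ^+ 2 * var m j w))).
    by apply: integ_boundedM GK0 _.
  by apply/funext => w; rewrite /G1; ring.
have I5 : integ P (fun w => G2 w * mesh R m).
  rewrite (_ : (fun w => _) = (fun w => G w * (e j w ^+ 2 * mesh R m))).
    by apply: integ_boundedM GK0 _.
  by apply/funext => w; rewrite /G2; ring.
have II : integ P (fun w => xi m j w * incW m j w).
  by apply: sqint_integM; [exact: sqint_xi|exact: sqint_incW].
rewrite (ED I1 (integD I2 I3)) (ED I2 I3) (@E_pull0 (dyad R m j) _ G3)//; last exact: w3.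
rewrite addr0 (E_mul_incW_sqr mG2 I2 I5) (E_mul_incM_sqr _ _ mG1 I1 I4)//.
rewrite -(ED I4 I5); apply: eq_Rintegral => w _; rewrite /G1 /G2 /var; ring.
Qed.

Lemma integ_stepvar j :
  integ P (fun w => c j w ^+ 2 * var m j w + e j w ^+ 2 * mesh R m).
Proof. by apply: integD; [case: (hc j)|case: (he j)]. Qed.

Lemma Ssum_isometry N : E (fun w => Ssum m c e N w ^+ 2) =
  \sum_(j < N) E (fun w => c j w ^+ 2 * var m j w + e j w ^+ 2 * mesh R m).
Proof.
elim: N => [|N ih].
  rewrite big_ord0 -[RHS](E_cst P 0); apply: eq_Rintegral => w _.
  by rewrite /Ssum big_ord0 expr0n.
rewrite big_ord_recr /= -ih.
have -> : (fun w => Ssum m c e N.+1 w ^+ 2) =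
  (fun w => Ssum m c e N w ^+ 2 + (2 * (Ssum m c e N w * step m c e N w)
      + step m c e N w ^+ 2)).
  by apply/funext => w; rewrite /Ssum big_ord_recr /=; ring.
have I1 := sqint_integM (sqint_Ssum N) (sqint_step N).
have I2 := (sqint_step N).2; have I3 := (sqint_Ssum N).2.
rewrite (ED I3 (integD (integZ 2 I1) I2)) (ED (integZ 2 I1) I2) (EZ _ I1).
rewrite (E_mul_step (@Ssum_ad N) (sqint_Ssum N)) mulr0 add0r; congr (_ + _).
have := @E_mul_step_sqr N (fun=> 1) 1 (measurable_cst _).
rewrite (_ : (fun w => 1 * step m c e N w ^+ 2) = (fun w => step m c e N w ^+ 2)); last first.
  by apply/funext => w; rewrite mul1r.
move=> -> //; last by move=> w; rewrite normr1.
by apply: eq_Rintegral => w _; rewrite mul1r.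
Qed.

End isometry.

Lemma xiE m j w : xi m j w =
  M (dyad R m j.+1) w - M (dyad R m j) w - delta * mesh R m.
Proof. by rewrite /xi /incM -dyadS. Qed.

Lemma SsumS m c e N w : Ssum m c e N.+1 w = Ssum m c e N w + step m c e N w.
Proof. by rewrite /Ssum big_ord_recr. Qed.

Lemma Ssum_half n c e N w : Ssum n c e N w =
  Ssum n.+1 (fun j => c j./2) (fun j => e j./2) N.*2 w.
Proof.
elim: N => [|N ih]; first by rewrite /Ssum !big_ord0.
rewrite doubleS !SsumS -addrA -ih; congr (_ + _).
rewrite /step /= doubleK uphalf_double !xiE /incW -doubleS -(dyad_double _ n N).
rewrite -(dyad_double _ n N.+1) (meshS _ n); ring.
Qed.

(** Increments add up over a cell, so a coarse sum is a fine sum with coefficients frozen on coarse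
    cells. Sums of different levels can then be subtracted term by term. *)
Lemma Ssum_refine n p c e N w : Ssum n c e N w =
  Ssum (n + p) (fun j => c (j %/ 2 ^ p)%N)
    (fun j => e (j %/ 2 ^ p)%N) (N * 2 ^ p) w.
Proof.
elim: p => [|p ih].
  rewrite addn0 expn0 muln1; apply: eq_bigr => i _.
  by rewrite /step !divn1.
have E2 : (N * 2 ^ p.+1 = (N * 2 ^ p).*2)%N by rewrite expnS mulnCA mul2n.
rewrite ih Ssum_half addnS E2; apply: eq_bigr => i _.
by rewrite /step -!divn2 -!divnMA -expnS.
Qed.

Lemma EM t : 0 <= t -> E (M t) = E (M 0) + delta * t.
Proof.
move=> t0; have S1 := sqint_integ (M_sq t0); have S0 := sqint_integ (M_sq (lexx 0)).
have FT : F 0 setT.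
  by have [F0 FC _] := sF (lexx 0); have := FC _ F0; rewrite setD0.
have := @m1 0 t setT (lexx 0) t0 FT.
under eq_Rintegral do rewrite indicT mul1r /incM add0r.
have I := integ_cst P (delta * t).
rewrite (EB (integB S1 S0) I) (EB S1 S0) (E_cst P (delta * t)); lra.
Qed.

Lemma E_incM_sqr s h : 0 <= s -> 0 <= h ->
  E (fun w => incM s h w ^+ 2) = 4 * h * (E (M 0) + delta * s) + 2 * delta * h ^+ 2.
Proof.
move=> s0 h0.
have := @E_mul_incM_sqr s h (fun=> 1) s0 h0 (measurable_cst _).
rewrite (_ : (fun w => 1 * incM s h w ^+ 2) = (fun w => incM s h w ^+ 2)); last first.
  by apply/funext => w; rewrite mul1r.
rewrite (_ : (fun w => 1 * _) = (fun w => 4 * M s w * h + 2 * delta * h ^+ 2)); last first.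
  by apply/funext => w; rewrite mul1r.
move=> ->; [|by case: (sqint_incM s0 h0)|exact: integ_varcst].
have S0 := sqint_integ (M_sq s0); have I := integ_cst P (2 * delta * h ^+ 2).
rewrite -(EM s0) -(EZ (4 * h) S0) -[X in _ = _ + X](E_cst P).
rewrite -(ED (integZ _ S0) I); apply: eq_Rintegral => w _ /=; ring.
Qed.

(** AM-GM with weight sqrt h turns a second moment of order h into a first moment of order sqrt
    h. *)
Lemma E_dist_M T : exists2 K, 0 <= K & forall s h, 0 <= s -> 0 <= h ->
  s + h <= T -> E (fun w => `|M (s + h) w - M s w|) <= K * Num.sqrt h.
Proof.
have [T0|T0] := ltP T 0.
  by exists 0 => // s h s0 h0; have := addr_ge0 s0 h0; lra.
have A0 : 0 <= E (M 0) by apply: E_ge0 => w; exact: M_ge0.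
exists (2 * (E (M 0) + delta * T) + delta * T + 2^-1 + delta * Num.sqrt T).
  rewrite !addr_ge0// ?mulr_ge0 ?addr_ge0 ?mulr_ge0 ?sqrtr_ge0//; lra.
move=> s h s0 h0 shT.
have [->|hn0] := eqVneq h 0.
  rewrite sqrtr0 mulr0 addr0; under eq_Rintegral do rewrite subrr normr0.
  by rewrite (E_cst P 0).
have hp : 0 < h by rewrite lt_def hn0.
have rp : 0 < Num.sqrt h by rewrite sqrtr_gt0.
have rE : Num.sqrt h ^+ 2 = h by rewrite sqr_sqrtr.
have rT : Num.sqrt h <= Num.sqrt T by rewrite ler_wsqrtr//; lra.
have I2 := (sqint_incM s0 h0).2.
have sh0 : 0 <= s + h by exact: addr_ge0.
have ID := integB (sqint_integ (M_sq sh0)) (sqint_integ (M_sq s0)).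
move: rp rE rT; set r := Num.sqrt h; set q := Num.sqrt T => rp rE rT.
have Ic := integ_cst P (r / 2 + delta * h).
apply: (@le_trans _ _ (E (fun w => (2 * r)^-1 * incM s h w ^+ 2 + (r / 2 + delta * h)))).
  apply: E_le; [exact: integ_norm|exact: integD (integZ _ I2) Ic|].
  move=> w; have -> : M (s + h) w - M s w = incM s h w + delta * h by rewrite /incM; ring.
  apply: le_trans (ler_normD _ _) _.
  rewrite (ger0_norm (mulr_ge0 delta0 h0)) addrA lerD2r.
  by rewrite -(real_normK (num_real (incM s h w))) sqr_amgm.
rewrite (ED (integZ _ I2) Ic) (EZ _ I2) (E_cst P) E_incM_sqr//.
by apply: dist_bound_arith => //; lra.
Qed.

(* Their values [c], [k] at mass [m] satisfy [4 m c^2 + k^2 = 1], so that the steps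
   of [Bn] have conditional variance [mesh n], up to the [delta] term. *)
Definition cM n i w := invsqrt (eps R n) (M (dyad R n i) w) / 2.
Definition cW n i w := Num.sqrt (eps R n) * invsqrt (eps R n) (M (dyad R n i) w).
Definition Bn n := Ssum n (cM n) (cW n).

Lemma adb_invsqrt n k (i : nat -> nat) (r : R) : (forall j, dyad R k (i j) <= dyad R n j) ->
  adb n (fun j w => r * invsqrt (eps R k) (M (dyad R k (i j)) w)).
Proof.
move=> ij j; have e0 := eps_gt0 R k.
have mM : measurable_fun setT (M (dyad R k (i j)) : Fs (dyad R n j) -> R).
  by apply: ad_mono (ij j) _ => //; exact: M_ad.
split.
  apply: measurable_funM => //.
  exact: (measurableT_comp (measurable_invsqrt _) mM).
exists (`|r| * (Num.sqrt (eps R k))^-1) => w.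
rewrite normrM (ger0_norm (invsqrt_ge0 _ _)) ler_wpM2l//.
by apply: invsqrt_le => //; exact: M_ge0.
Qed.

Lemma adb_cM n : adb n (cM n).
Proof.
have -> : cM n = (fun i w => 2^-1 * invsqrt (eps R n) (M (dyad R n i) w)).
  by apply/funext => i; apply/funext => w; rewrite /cM mulrC.
exact: (adb_invsqrt (i := id)).
Qed.

Lemma adb_cW n : adb n (cW n).
Proof. exact: (adb_invsqrt (i := id)). Qed.

Lemma adM_cM n : adM n (cM n).
Proof. exact/adb_adM/adb_cM. Qed.

Lemma adW_cW n : adW n (cW n).
Proof. exact/adb_adW/adb_cW. Qed.

Hypothesis M_small : forall eta : R, 0 < eta -> exists2 e0 : R, 0 < e0 &
  forall e u, 0 < e <= e0 -> eta <= u -> E (fun w => qf e (M u w)) <= eta.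

Lemma integ_qf e u : 0 <= e -> 0 <= u -> integ P (fun w => qf e (M u w)).
Proof.
move=> e0 u0; apply: (@integ_bounded _ _ _ _ _ 1).
  exact: (measurableT_comp (measurable_qf e0) (adm u0 (M_ad u0))).
by move=> w; rewrite ger0_norm ?qf_ge0 ?qf_le1.
Qed.

Lemma Bn_diffE n p N w : Bn n N w - Bn (n + p) (N * 2 ^ p) w =
  Ssum (n + p) (fun j w => cM n (j %/ 2 ^ p)%N w - cM (n + p) j w)
    (fun j w => cW n (j %/ 2 ^ p)%N w - cW (n + p) j w) (N * 2 ^ p) w.
Proof.
rewrite /Bn (Ssum_refine n p) /Ssum -sumrB; apply: eq_bigr => i _.
by rewrite /step; ring.
Qed.

Lemma adbB n (c e : nat -> Omega -> R) : adb n c -> adb n e ->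
  adb n (fun j w => c j w - e j w).
Proof.
move=> hc he j; have [mc [K cK]] := hc j; have [me [K' eK']] := he j; split.
  exact: measurable_funB.
exists (K + K') => w; apply: le_trans (ler_normB _ _) _.
exact: lerD.
Qed.

(** The isometry applied to the difference of the coefficients. The three terms of a cell are the
    change of mass since the start of the coarse cell, of order sqrt mesh / eps; the change of
    level, measured by [qf]; and the part of the conditional variance due to [delta]. *)
Lemma Bn_sqdist n p N T K : 0 <= K -> dyad R n N <= T ->
  (forall s h, 0 <= s -> 0 <= h -> s + h <= T ->
     E (fun w => `|M (s + h) w - M s w|) <= K * Num.sqrt h) ->
  E (fun w => (Bn n N w - Bn (n + p) (N * 2 ^ p) w) ^+ 2) <=
  \sum_(j < N * 2 ^ p) mesh R (n + p) * (2 * (K * rate R ^+ n) +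
    (4 * E (fun w => qf (eps R n) (M (dyad R (n + p) j) w)) + delta / 2 * rate R ^+ n)).
Proof.
move=> K0 NT dM.
have hc : adb (n + p) (fun j w => cM n (j %/ 2 ^ p)%N w - cM (n + p) j w).
  apply: adbB; last exact: adb_cM.
  have -> : (fun j => cM n (j %/ 2 ^ p)%N) =
    (fun j w => 2^-1 * invsqrt (eps R n) (M (dyad R n (j %/ 2 ^ p)%N) w)).
    by apply/funext => i; apply/funext => w; rewrite /cM mulrC.
  apply: (adb_invsqrt (i := fun j => (j %/ 2 ^ p)%N)) => j.
  by have /andP[] := dyad_floor R n p j.
have he : adb (n + p) (fun j w => cW n (j %/ 2 ^ p)%N w - cW (n + p) j w).
  apply: adbB; last exact: adb_cW.
  apply: (adb_invsqrt (i := fun j => (j %/ 2 ^ p)%N)) => j.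
  by have /andP[] := dyad_floor R n p j.
under eq_Rintegral do rewrite Bn_diffE.
rewrite (Ssum_isometry (adb_adM hc) (adb_adW he)); apply: ler_sum => -[j /= jN] _.
set t := dyad R (n + p) j; set s := dyad R n (j %/ 2 ^ p).
have /andP[st ts] := dyad_floor R n p j; rewrite -/s -/t in st ts.
have s0 : 0 <= s := dg _ _; have t0 : 0 <= t := dg _ _.
have tT : t <= T.
  by apply: le_trans NT; rewrite -(dyad_exp R n p) ler_dyad ltnW.
have h0 := mesh_gt0 R (n + p); set h := mesh R (n + p) in h0 *.
have e'0 := eps_gt0 R (n + p); have ee' := eps_le R n p; have e0 := eps_gt0 R n.
have Iq := integ_qf (ltW e0) t0.
have Id := integ_norm (integB (sqint_integ (M_sq t0)) (sqint_integ (M_sq s0))).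
have Ic := integ_cst P (delta / 2 * (h / eps R (n + p))).
have I3 := integZ h (integD (integZ (2 / eps R n) Id) (integD (integZ 4 Iq) Ic)).
apply: (@le_trans _ _ (E (fun w => h * (2 / eps R n * `|M t w - M s w| +
   (4 * qf (eps R n) (M t w) + delta / 2 * (h / eps R (n + p))))))).
  apply: E_le => //; first exact: integ_stepvar (adb_adM hc) (adb_adW he) j.
  move=> w; rewrite /var -/t -/h /cM /cW -/s.
  have H1 := coef_dist e'0 ee' (M_ge0 w t0) (M_ge0 w s0).
  have H2 := invsqrt_diff_sqr_le e0 e'0 (M_ge0 w s0) (M_ge0 w t0) ee'.
  apply: step_bound_arith => //; first exact: ltW.
  apply: le_trans H1 _; rewrite /qf; case: ltP => _; lra.
rewrite (EZ h (integD (integZ (2 / eps R n) Id) (integD (integZ 4 Iq) Ic))).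
rewrite ler_wpM2l ?(ltW h0)// (ED (integZ (2 / eps R n) Id) (integD (integZ 4 Iq) Ic)).
rewrite (EZ _ Id) (ED (integZ 4 Iq) Ic) (EZ _ Iq) (E_cst P); apply: lerD.
  have := dM s (t - s) s0; rewrite subr_ge0 subrKC => /(_ st tT) H.
  have hs : Num.sqrt (t - s) <= Num.sqrt (mesh R n) by rewrite ler_wsqrtr// lerBlDl.
  rewrite -sqrt_mesh_eps; have -> : 2 * (K * (Num.sqrt (mesh R n) / eps R n)) =
    2 / eps R n * (K * Num.sqrt (mesh R n)) by ring.
  rewrite ler_wpM2l ?divr_ge0 ?(ltW e0)//; apply: le_trans H _.
  exact: ler_wpM2l.
rewrite lerD2l ler_wpM2l ?divr_ge0// (le_trans (mesh_eps_mono _ n p))//.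
exact: mesh_eps_le.
Qed.

Lemma Bn_cauchy T rho : 0 <= T -> 0 < rho -> \forall n \near \oo, forall p N,
  dyad R n N <= T ->
  E (fun w => (Bn n N w - Bn (n + p) (N * 2 ^ p) w) ^+ 2) <= rho.
Proof.
move=> T0 rho0; have [K K0 dM] := E_dist_M T.
(* The level error is at most 4 eta per unit of time, plus 4 eta for the times before eta: together
   at most rho / 2. The constant [A] below collects the coefficients of [rate R ^+ n]. *)
pose eta := rho / (8 * (T + 1)).
have T1 : 0 < T + 1 by rewrite ltr_wpDl.
have eta0 : 0 < eta by rewrite divr_gt0// mulr_gt0.
have [e0 e00 He0] := M_small eta0.
pose A := T * (2 * K + delta / 2) + 4.
have A0 : 0 < A by rewrite ltr_wpDl// mulr_ge0// addr_ge0 ?mulr_ge0// invr_ge0.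
have rA : 0 < rho / (2 * A) by rewrite divr_gt0// mulr_gt0.
have nE := @cvgr_le _ _ _ _ _ _ (@cvg_eps R) _ e00.
have nR := @cvgr_le _ _ _ _ _ _ (@cvg_rate R) _ rA.
near=> n => p N NT.
have e_small : eps R n <= e0.
  near: n; exact: nE.
have r_small : rate R ^+ n <= rho / (2 * A).
  near: n; exact: nR.
apply: (le_trans (Bn_sqdist p K0 NT dM)).
set r := rate R ^+ n in r_small *; set h := mesh R (n + p).
have r0 : 0 <= r by rewrite exprn_ge0// rate_ge0.
have h0 : 0 <= h := mg _.
have hr : h <= r.
  apply: le_trans (mesh_le_rate R n); rewrite (mesh_exp R n p) ler_peMl//.
  by rewrite ler1n expn_gt0.
(* Early times have no uniform bound: a mass started at 0 with [delta > 0] stays of order e for a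
   time of order e. The bound [qf <= 1] is used there, over times of total length about eta. *)
have Eq j : E (fun w => qf (eps R n) (M (dyad R (n + p) j) w)) <=
    eta + (dyad R (n + p) j < eta)%R%:R.
  have [lt|ge] := ltP (dyad R (n + p) j) eta.
    rewrite (@le_trans _ _ 1)//; last by rewrite lerDr ltW.
    rewrite -[leRHS](E_cst P); apply: E_le.
    - by apply: integ_qf => //; rewrite ltW// eps_gt0.
    - exact: (integ_cst P 1).
    - by move=> w; apply: qf_le1; rewrite ltW// eps_gt0.
  by rewrite addr0; apply: He0 => //; rewrite eps_gt0.
apply: (@le_trans _ _ (\sum_(j < N * 2 ^ p) (h * (2 * (K * r) + (4 * eta + delta / 2 * r)) +
   4 * (h * (dyad R (n + p) j < eta)%R%:R)))).
  apply: ler_sum => j _.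
  have := ler_wpM2l h0 (Eq j).
  set x := E _; set y := (_)%:R; lra.
rewrite big_split /= sumr_const card_ord -mulr_sumr -[X in X + _]mulr_natl mulrA.
rewrite -/(dyad R (n + p) (N * 2 ^ p)) dyad_exp.
have := sum_mesh_lt (n + p) (N * 2 ^ p) (ltW eta0); rewrite -/h.
set S := \sum_(_ < _) _ => HS.
have HE : eta * (T + 1) = rho / 8 by rewrite /eta; field; rewrite gt_eqF.
have Hr : r * A <= rho / 2.
  have := ler_wpM2r (ltW A0) r_small.
  by have -> : rho / (2 * A) * A = rho / 2 by field; rewrite gt_eqF.
have c0 : 0 <= 2 * (K * r) + (4 * eta + delta / 2 * r).
  have d2 : 0 <= delta / 2 by rewrite divr_ge0.
  apply: addr_ge0; first by rewrite mulr_ge0// mulr_ge0.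
  by apply: addr_ge0; rewrite mulr_ge0// ltW.
have := ler_wpM2r c0 NT.
move: Hr; rewrite /A; lra.
Unshelve. all: by end_near. Qed.

(** * Lindeberg replacement of the steps by heat flow *)

Hypothesis m4 : forall T, exists2 K, 0 <= K & forall s h, 0 <= s -> 0 <= h ->
  s + h <= T -> integ P (fun w => incM s h w ^+ 4) /\
    E (fun w => incM s h w ^+ 4) <= K * h ^+ 2.
Hypothesis w4 : exists2 K, 0 <= K & forall n i,
  integ P (fun w => incW n i w ^+ 4) /\
    E (fun w => incW n i w ^+ 4) <= K * mesh R n ^+ 2.

Lemma cM_sqr_le n i w : cM n i w ^+ 2 <= (4 * eps R n)^-1.
Proof.
have e0 := eps_gt0 R n; have m0 := M_ge0 w (dg n i).
rewrite /cM exprMn (_ : 2^-1 ^+ 2 = 4^-1); last by field.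
by rewrite invfM mulrC ler_wpM2l ?invr_ge0// invsqrt_sqr_le.
Qed.

Lemma cW_sqr_le n i w : cW n i w ^+ 2 <= 1.
Proof.
have e0 := eps_gt0 R n; have m0 := M_ge0 w (dg n i).
rewrite /cW exprMn sqr_sqrtr ?(ltW e0)// -(mulfV (lt0r_neq0 e0)).
by rewrite ler_wpM2l ?(ltW e0)// invsqrt_sqr_le.
Qed.

Lemma coef_var n i w : cM n i w ^+ 2 * var n i w + cW n i w ^+ 2 * mesh R n =
  mesh R n + 2 * delta * mesh R n ^+ 2 * cM n i w ^+ 2.
Proof.
have e0 := eps_gt0 R n; have m0 := M_ge0 w (dg n i).
have me : M (dyad R n i) w + eps R n != 0 by rewrite gt_eqF// ltr_wpDl.
rewrite /cM /cW /var !exprMn sqr_sqrtr ?(ltW e0)// invsqrt_sqr//.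
by field.
Qed.

Definition Bstep n := step n (cM n) (cW n).

Lemma Bstep_var_le n i w : cM n i w ^+ 2 * var n i w + cW n i w ^+ 2 * mesh R n <=
  mesh R n * (1 + delta / 2 * (mesh R n / eps R n)).
Proof.
rewrite coef_var; have := cM_sqr_le n i w; set c := cM n i w ^+ 2.
rewrite invfM => H; have h0 := mg n.
have := ler_wpM2l (mulr_ge0 delta0 (sqr_ge0 (mesh R n))) H; lra.
Qed.

Lemma E_Bstep_sqr n i : E (fun w => Bstep n i w ^+ 2) <=
  mesh R n * (1 + delta / 2 * (mesh R n / eps R n)).
Proof.
have := E_mul_step_sqr (adM_cM n) (adW_cW n) (j := i) (G := fun=> 1) (K0 := 1) (measurable_cst _).
under eq_Rintegral do rewrite mul1r.
move=> ->; last by move=> w; rewrite normr1.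
rewrite -[leRHS](E_cst P); apply: E_le; [|exact: integ_cst|].
  under eq_fun do rewrite mul1r.
  exact: integ_stepvar (adM_cM n) (adW_cW n) i.
by move=> w; rewrite mul1r Bstep_var_le.
Qed.

(** The Lindeberg condition: summed over the cells of a unit of time, third moments are of order
    [rate R ^+ n]. The loss by eps comes from the fourth moment of the martingale part, of order
    mesh^2 / eps^2. *)
Lemma E_Bstep_cube T : exists2 K, 0 <= K & forall n i, dyad R n i.+1 <= T ->
  integ P (fun w => `|Bstep n i w| ^+ 3) /\
  E (fun w => `|Bstep n i w| ^+ 3) <= mesh R n * (rate R ^+ n * K).
Proof.
have [K K0 HK] := m4 T; have [KW KW0 HW] := w4.
exists (1 + delta + K + 8 * KW); first by rewrite !addr_ge0// mulr_ge0.
move=> n i iT.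
have h0 := mesh_gt0 R n; have e0 := eps_gt0 R n.
have iT' : dyad R n i + mesh R n <= T by rewrite -dyadS.
have [I4 E4] := HK (dyad R n i) (mesh R n) (dg _ _) (mg _) iT'.
have [J4 F4] := HW n i.
have mS : measurable_fun setT (Bstep n i).
  by case: (sqint_step (adM_cM n) (adW_cW n) i).
have IB : integ P (fun w => 8 * ((16 * eps R n ^+ 2)^-1 * xi n i w ^+ 4 + incW n i w ^+ 4)).
  by apply: integZ; apply: integD => //; exact: integZ.
have bound w : Bstep n i w ^+ 4 <= 8 * ((16 * eps R n ^+ 2)^-1 * xi n i w ^+ 4 + incW n i w ^+ 4).
  apply: le_trans (pow4D_le _ _) _; rewrite ler_wpM2l// lerD//.
    rewrite exprMn ler_wpM2r ?exprn_even_ge0//.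
    rewrite (_ : 4 = 2 * 2)%N// exprM (_ : (16 * _)^-1 = ((4 * eps R n)^-1) ^+ 2); last first.
      by field; rewrite gt_eqF.
    by rewrite lerXn2r ?nnegrE ?sqr_ge0 ?cM_sqr_le// invr_ge0 mulr_ge0// ltW.
  rewrite exprMn ler_piMl ?exprn_even_ge0//.
  by rewrite (_ : 4 = 2 * 2)%N// exprM expr_le1 ?sqr_ge0 ?cW_sqr_le.
have IX4 : integ P (fun w => Bstep n i w ^+ 4).
  apply: integ_le IB _; first exact: measurable_funX.
  by move=> w; rewrite ger0_norm ?exprn_even_ge0.
have IX2 : integ P (fun w => Bstep n i w ^+ 2) by case: (sqint_step (adM_cM n) (adW_cW n) i).
have EX4 : E (fun w => Bstep n i w ^+ 4) <=
    8 * ((16 * eps R n ^+ 2)^-1 * (K * mesh R n ^+ 2) + KW * mesh R n ^+ 2).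
  apply: le_trans (E_le IX4 IB bound) _.
  rewrite (EZ 8 (integD (integZ _ I4) J4)) (ED (integZ _ I4) J4) (EZ _ I4).
  by rewrite ler_wpM2l// lerD// ler_wpM2l// invr_ge0 mulr_ge0// sqr_ge0.
have r0 : 0 < Num.sqrt (mesh R n) / eps R n by rewrite divr_gt0// sqrtr_gt0.
have J2 : integ P (fun w => Num.sqrt (mesh R n) / eps R n * Bstep n i w ^+ 2) by exact: integZ.
have J3 : integ P (fun w => (Num.sqrt (mesh R n) / eps R n)^-1 * Bstep n i w ^+ 4) by exact: integZ.
have J23 := integD J2 J3; have ID := integZ 2^-1 J23.
have b3 w : `|Bstep n i w| ^+ 3 <= 2^-1 * (Num.sqrt (mesh R n) / eps R n * Bstep n i w ^+ 2 +
   (Num.sqrt (mesh R n) / eps R n)^-1 * Bstep n i w ^+ 4) by exact: cube_amgm.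
have IX3 : integ P (fun w => `|Bstep n i w| ^+ 3).
  apply: (integ_le _ ID); last by move=> w; rewrite ger0_norm ?exprn_ge0.
  by apply: measurable_funX; exact: measurableT_comp.
split => //; apply: le_trans (E_le IX3 ID b3) _.
rewrite (EZ _ J23) (ED J2 J3) (EZ _ IX2) (EZ _ IX4) -sqrt_mesh_eps.
apply: third_moment_arith => //; [exact: eps_le1| |exact: E_Bstep_sqr].
apply: le_trans (mesh_eps_le R n) _; apply: exprn_ile1; first exact: rate_ge0.
exact/ltW/rate_lt1.
Qed.

Lemma measurable_indic_sub t C : 0 <= t -> F t C ->
  measurable_fun setT (\1_C : Fs t -> R).
Proof.
by move=> t0 FC; apply: measurable_indic; rewrite measurable_subsig//; exact: sF.
Qed.

(** One step of [Bn] is exchanged for heat flow during one mesh. In the Taylor expansion the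
    first-order term has conditional mean 0, the second-order terms agree up to the excess of the
    conditional variance over the mesh, and the remainder is a third moment. *)
Lemma lindeberg_step T K u u1 u2 : 0 <= K -> heat_family K u u1 u2 ->
  exists2 K', 0 <= K' & forall n l t (S : Omega -> R) A, dyad R n l.+1 <= T -> 0 <= t ->
    measurable_fun setT (S : Fs (dyad R n l) -> R) -> F (dyad R n l) A ->
    `|E (fun w => \1_A w * u t (S w + Bstep n l w)) -
      E (fun w => \1_A w * u (t + mesh R n) (S w))| <= mesh R n * (rate R ^+ n * K').
Proof.
move=> K0 [Hm Hb Ht Hh]; have [K3 K30 HK3] := E_Bstep_cube T.
exists (K * (delta + K3 + 1)).
  by rewrite mulr_ge0// !addr_ge0.
move=> n l t S A lT t0 mS FA.
have [I3 E3] := HK3 n l lT.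
have h0 := mg n; set h := mesh R n in h0 E3 *.
have th0 : 0 <= t + h by exact: addr_ge0.
have mA := measurable_indic_sub (dg _ _) FA.
have mA' := adm (dg _ _) mA.
have mS' := adm (dg _ _) mS.
have mB : measurable_fun setT (Bstep n l).
  by case: (sqint_step (adM_cM n) (adW_cW n) l).
have [mu mu1 mu2] := Hm t t0; have [muh _ _] := Hm _ th0.
have I2 : integ P (fun w => Bstep n l w ^+ 2).
  by case: (sqint_step (adM_cM n) (adW_cW n) l).
have I1 : integ P (Bstep n l).
  by apply: sqint_integ; exact: (sqint_step (adM_cM n) (adW_cW n)).
pose G1 w := \1_A w * u1 t (S w); pose G2 w := \1_A w * u2 t (S w).
have bprod (z : Omega -> R) w : `|z w| <= K -> `|\1_A w * z w| <= K.
  move=> zK; rewrite normrM; apply: le_trans zK.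
  by rewrite ler_piMl// indic_le1.
have bG1 w : `|G1 w| <= K by apply: (bprod (fun w => u1 t (S w))); have [] := Hb t (S w) t0.
have bG2 w : `|G2 w| <= K by apply: (bprod (fun w => u2 t (S w))); have [] := Hb t (S w) t0.
have mG1 : measurable_fun setT (G1 : Fs (dyad R n l) -> R).
  by apply: measurable_funM => //; exact: (measurableT_comp mu1 mS).
have mG2 : measurable_fun setT (G2 : Fs (dyad R n l) -> R).
  by apply: measurable_funM => //; exact: (measurableT_comp mu2 mS).
have sG1 : sqint P G1.
  split; first exact: adm mG1.
  apply: (@integ_bounded _ _ _ _ _ (K ^+ 2)); first by apply: measurable_funX; exact: adm mG1.
  by move=> w; rewrite normrX lerXn2r// nnegrE.
pose L w := \1_A w * u t (S w + Bstep n l w).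
pose Q w := \1_A w * u (t + h) (S w).
have IL : integ P L.
  apply: (@integ_bounded _ _ _ _ _ K).
    apply: measurable_funM => //; apply: (measurableT_comp mu).
    exact: measurable_funD.
  by move=> w; apply: (bprod (fun w => u t (S w + Bstep n l w))); have [] := Hb t (S w + Bstep n l w) t0.
have IQ : integ P Q.
  apply: (@integ_bounded _ _ _ _ _ K).
    by apply: measurable_funM => //; exact: (measurableT_comp muh).
  by move=> w; apply: (bprod (fun w => u (t + h) (S w))); have [] := Hb (t + h) (S w) th0.
pose v w := cM n l w ^+ 2 * var n l w + cW n l w ^+ 2 * h.
have Iv : integ P v := integ_stepvar (adM_cM n) (adW_cW n) l.
have IG1 : integ P (fun w => G1 w * Bstep n l w).
  by apply: integ_boundedM bG1 I1; exact: adm mG1.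
have IG2 : integ P (fun w => G2 w * Bstep n l w ^+ 2).
  by apply: integ_boundedM bG2 I2; exact: adm mG2.
have IGv : integ P (fun w => G2 w * v w).
  by apply: integ_boundedM bG2 Iv; exact: adm mG2.
have IGh : integ P (fun w => G2 w * h).
  by apply: (integ_boundedM _ bG2 (integ_cst P h)); exact: adm mG2.
have E1 : E (fun w => G1 w * Bstep n l w) = 0.
  exact: (E_mul_step (adM_cM n) (adW_cW n) mG1 sG1).
have E2 : E (fun w => G2 w * Bstep n l w ^+ 2) = E (fun w => G2 w * v w).
  exact: (E_mul_step_sqr (adM_cM n) (adW_cW n) mG2 bG2).
(* The excess 2 delta h^2 cM^2 of the conditional variance over h, weighted by [u2]; it is of order
   h (h / eps). *)
pose e2 := E (fun w => G2 w * v w) - E (fun w => G2 w * h).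
pose err w := L w - Q w - G1 w * Bstep n l w - 2^-1 * (G2 w * Bstep n l w ^+ 2 - G2 w * h).
have IGG := integB IG2 IGh.
have Ierr : integ P err.
  by apply: integB; [apply: integB => //; exact: integB|exact: integZ].
have Eerr : E err = E L - E Q - 2^-1 * e2.
  rewrite /err (EB (integB (integB IL IQ) IG1) (integZ _ IGG)).
  rewrite (EB (integB IL IQ) IG1) (EB IL IQ) E1 subr0 (EZ _ IGG) (EB IG2 IGh) E2.
  by [].
have err_le w : `|err w| <= K * `|Bstep n l w| ^+ 3 + K * (h * Num.sqrt h).
  have -> : err w = \1_A w * ((u t (S w + Bstep n l w) - u t (S w) - u1 t (S w) * Bstep n l w
      - u2 t (S w) * Bstep n l w ^+ 2 / 2) - (u (t + h) (S w) - u t (S w) - h / 2 * u2 t (S w))).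
    by rewrite /err /L /Q /G1 /G2; field.
  rewrite normrM (le_trans (ler_piMl _ (indic_le1 _ _ _)))//.
  by apply: le_trans (ler_normB _ _) _; apply: lerD; [exact: Ht|exact: Hh].
have Icst := integ_cst P (K * (h * Num.sqrt h)).
have Eabs : `|E err| <= K * E (fun w => `|Bstep n l w| ^+ 3) + K * (h * Num.sqrt h).
  apply: le_trans (E_norm_le Ierr) _.
  rewrite -(EZ K I3) -[X in _ <= _ + X](E_cst P) -(ED (integZ K I3) Icst).
  apply: E_le err_le; first exact: integ_norm.
  by apply: integD => //; exact: integZ.
have e2_le : `|e2| <= K * (delta / 2 * (h * (h / eps R n))).
  rewrite /e2 -(EB IGv IGh); apply: le_trans (E_norm_le (integB IGv IGh)) _.
  rewrite -[leRHS](E_cst P); apply: E_le.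
  - exact: integ_norm (integB IGv IGh).
  - exact: integ_cst.
  - move=> w; rewrite -mulrBr normrM ler_pM// /v coef_var addrC addKr.
    have cc := cM_sqr_le n l w.
    have h2 : 0 <= 2 * delta * h ^+ 2 by rewrite !mulr_ge0// sqr_ge0.
    rewrite -/h (ger0_norm (mulr_ge0 h2 (sqr_ge0 _))).
    by apply: le_trans (ler_wpM2l h2 cc) _; rewrite invfM; lra.
have -> : E (fun w => \1_A w * u t (S w + Bstep n l w)) -
  E (fun w => \1_A w * u (t + h) (S w)) = E err + 2^-1 * e2 by rewrite Eerr subrK.
apply: le_trans (ler_normD _ _) _.
rewrite [X in _ + X]normrM (ger0_norm (_ : 0 <= 2^-1))// addrC [2^-1 * _]mulrC.
apply: (lindeberg_arith K0 h0 delta0 _ _ e2_le E3 Eabs).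
- rewrite -sqrt_mesh_eps ler_peMr ?sqrtr_ge0// invf_ge1 ?eps_gt0//.
  exact: eps_le1.
- exact: mesh_eps_le.
Qed.

Lemma BnS n N w : Bn n N.+1 w = Bn n N w + Bstep n N w.
Proof. exact: SsumS. Qed.

Lemma lindeberg T K u u1 u2 : 0 <= K -> 0 <= T -> heat_family K u u1 u2 ->
  exists2 K', 0 <= K' & forall n i k A, dyad R n (i + k) <= T -> F (dyad R n i) A ->
    `|E (fun w => \1_A w * u 0 (Bn n (i + k) w - Bn n i w)) -
      E (fun w => \1_A w * u (dyad R n k) 0)| <= rate R ^+ n * K'.
Proof.
move=> K0 T0 hu; have [K' K'0 HK'] := lindeberg_step T K0 hu.
exists (T * K'); first exact: mulr_ge0.
move=> n i k A ikT FA.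
(* [D j] interpolates: [j] steps of the sum have been taken and [k - j] meshes of heat flow remain.
   Each exchange costs mesh times [rate R ^+ n * K'], and at most T / mesh exchanges are made. *)
pose D j := E (fun w => \1_A w * u (dyad R n (k - j)) (Bn n (i + j) w - Bn n i w)).
have mBn N : measurable_fun setT (Bn n N : Fs (dyad R n N) -> R).
  exact: Ssum_ad (adM_cM n) (adW_cW n) N.
have step1 j : (j < k)%N -> `|D j.+1 - D j| <= mesh R n * (rate R ^+ n * K').
  move=> jk; rewrite /D.
  have -> : dyad R n (k - j) = dyad R n (k - j.+1) + mesh R n.
    by rewrite -dyadS subnSK.
  under eq_Rintegral do rewrite addnS BnS addrAC.
  apply: HK'.
  - by apply: le_trans ikT; rewrite ler_dyad -addnS leq_add2l.
  - exact: dg.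
  - apply: measurable_funB; first exact: mBn.
    by apply: ad_mono (mBn i) => //; rewrite ler_dyad leq_addr.
  - by apply: (Fmono (dg n i)) FA; rewrite ler_dyad leq_addr.
have tot j : (j <= k)%N -> `|D j - D 0%N| <= dyad R n j * (rate R ^+ n * K').
  elim: j => [|j ih] jk; first by rewrite subrr normr0 dyad0 mul0r.
  have -> : D j.+1 - D 0%N = (D j.+1 - D j) + (D j - D 0%N) by ring.
  apply: le_trans (ler_normD _ _) _; rewrite dyadS mulrDl addrC.
  by apply: lerD; [exact/ih/ltnW|exact: step1].
have := tot k (leqnn k); rewrite /D subnn dyad0 subn0.
under [X in `|_ - X| <= _ -> _]eq_Rintegral do rewrite addn0 subrr.
move=> H; apply: (le_trans H); rewrite mulrCA ler_wpM2l ?exprn_ge0 ?rate_ge0//.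
rewrite ler_wpM2r//; apply: le_trans ikT.
by rewrite ler_dyad leq_addl.
Qed.

(** A single subsequence serves all dyadic times, as rank [k] handles the horizon [0, k]. The rate
    16^-k is the one that [as_cvg_of_sqdist] asks for. *)
Lemma universal_subsequence : exists nn : nat -> nat,
  [/\ forall k, (nn k <= nn k.+1)%N, forall k, (k <= nn k)%N &
   forall k n p N, (nn k <= n)%N -> dyad R n N <= k%:R ->
     E (fun w => (Bn n N w - Bn (n + p) (N * 2 ^ p) w) ^+ 2) <= (16^-1) ^+ k].
Proof.
have H k : {n0 | forall n p N, (n0 <= n)%N -> dyad R n N <= k%:R ->
    E (fun w => (Bn n N w - Bn (n + p) (N * 2 ^ p) w) ^+ 2) <= (16^-1) ^+ k}.
  apply: cid; have r0 : 0 < (16^-1 : R) ^+ k by rewrite exprn_gt0// invr_gt0.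
  have [n0 _ Hn0] := Bn_cauchy (ler0n R k) r0.
  by exists n0 => n p N n0n; exact: Hn0.
pose f k := sval (H k); have Hf k := svalP (H k).
(* Partial sums of the thresholds are monotone and dominate each threshold; the added [k] makes the
   rank go to infinity. *)
exists (fun k => k + \sum_(j < k.+1) f j)%N; split.
- by move=> k; rewrite [in leqRHS]big_ord_recr /=; apply: leq_add => //; exact: leq_addr.
- by move=> k; rewrite leq_addr.
- move=> k n p N kn; apply: Hf; apply: leq_trans kn.
  by rewrite big_ord_recr /= addnA leq_addl.
Qed.

Hypothesis M_cont : forall w, {within `[0, +oo[, continuous (M ^~ w)}.

(** * Limit of the dyadic sums and its continuous version *)

Section limit.
Variable nn : nat -> nat.
Hypothesis nn_mono : forall k, (nn k <= nn k.+1)%N.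
Hypothesis nn_ge : forall k, (k <= nn k)%N.
Hypothesis nn_cauchy : forall k n p N, (nn k <= n)%N -> dyad R n N <= k%:R ->
  E (fun w => (Bn n N w - Bn (n + p) (N * 2 ^ p) w) ^+ 2) <= (16^-1) ^+ k.

Definition Bk k t w := Bn (nn k) (tr (nn k) t) w.
(** An upper limit and not a limit: it is measurable for [F t] everywhere, so adaptedness requires
    no completion by null sets. It coincides with the limit wherever that exists as a real
    number. *)
Definition Bd t w := fine (limn_esup (fun k => (Bk k t w)%:E)).

Lemma Bn_ad n N : measurable_fun setT (Bn n N : Fs (dyad R n N) -> R).
Proof. exact: Ssum_ad (adM_cM n) (adW_cW n) N. Qed.

Lemma sqint_Bn n N : sqint P (Bn n N).
Proof. exact: sqint_Ssum (adM_cM n) (adW_cW n) N. Qed.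

Lemma Bk_ad k t : 0 <= t -> measurable_fun setT (Bk k t : Fs t -> R).
Proof.
move=> t0; have /andP[le _] := tr_itv (nn k) t0.
exact: (ad_mono (dg _ _) le (@Bn_ad _ _)).
Qed.

Lemma Bd_ad t : 0 <= t -> measurable_fun setT (Bd t : Fs t -> R).
Proof.
move=> t0; apply: (measurableT_comp (fine_measurable measurableT)).
apply: measurable_fun_limn_esup => k; apply/measurable_EFinP; exact: Bk_ad.
Qed.

Lemma Bk_dyad k m i : (m <= nn k)%N -> Bk k (dyad R m i) = Bn (nn k) (i * 2 ^ (nn k - m)).
Proof. by move=> mk; rewrite /Bk tr_dyad. Qed.

Lemma dyad_level n m i : (m <= n)%N -> dyad R n (i * 2 ^ (n - m)) = dyad R m i.
Proof. by move=> mn; rewrite -{1}(subnKC mn) dyad_exp. Qed.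

Lemma Bd_cvg m i :
  {ae P, forall w, Bk k (dyad R m i) w @[k --> \oo] --> Bd (dyad R m i) w}.
Proof.
set t := dyad R m i; have t0 : 0 <= t := dg m i.
(* From this rank on, [t] is a point of the grids and lies within the horizon. *)
pose k0 := maxn m (Num.truncn t).+1.
have [_ tk] := andP (truncn_itv t0).
have : {ae P, forall w, cvgn (fun k => Bk k t w)}.
  apply: (@as_cvg_of_sqdist _ _ _ _ (fun k => Bk k t) k0) => [k|k kk].
    exact: sqint_Bn.
  have mk : (m <= nn k)%N.
    by apply: leq_trans (nn_ge k); apply: leq_trans kk; rewrite leq_maxl.
  have mk1 : (m <= nn k.+1)%N by apply: leq_trans mk (nn_mono k).
  rewrite (Bk_dyad _ mk) (Bk_dyad _ mk1).
  under eq_Rintegral do rewrite -(sqrrN (_ - _)) opprB.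
  have E1 : (i * 2 ^ (nn k.+1 - m) = i * 2 ^ (nn k - m) * 2 ^ (nn k.+1 - nn k))%N.
    by rewrite -mulnA -expnD addnC addnBA// subnK.
  have := @nn_cauchy k (nn k) (nn k.+1 - nn k) (i * 2 ^ (nn k - m)) (leqnn _).
  rewrite subnKC// -E1 dyad_level//; apply.
  apply: (@le_trans _ _ (Num.truncn t).+1%:R); first exact: ltW.
  by rewrite ler_nat; apply: leq_trans kk; rewrite leq_maxr.
apply: filterS => w cw; rewrite /Bd.
have /cvg_ex[l Hl] := cw.
have HE : (Bk k t w)%:E @[k --> \oo] --> l%:E by apply: cvg_EFin => //; exact: nearW.
by rewrite (cvg_limn_einf_sup HE).2.
Qed.

Lemma sq_dist_index m i k : dyad R m (i + k) = dyad R m i + dyad R m k.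
Proof. by rewrite /dyad natrD mulrDl. Qed.

Lemma Bd_law m i k A K u u1 u2 : 0 <= K -> heat_family K u u1 u2 ->
  continuous (u 0) -> F (dyad R m i) A ->
  E (fun w => \1_A w * u 0 (Bd (dyad R m (i + k)) w - Bd (dyad R m i) w)) =
  E (fun w => \1_A w * u (dyad R m k) 0).
Proof.
move=> K0 hu cu FA.
have mA := adm (dg _ _) (measurable_indic_sub (dg _ _) FA).
have [hm hb _ _] := hu.
have mu0 : measurable_fun setT (u 0) by have [] := hm 0 (lexx 0).
have mB t : 0 <= t -> measurable_fun setT (Bd t).
  by move=> t0; apply: (adm t0); exact: Bd_ad.
have mBk j t : 0 <= t -> measurable_fun setT (Bk j t).
  by move=> t0; apply: (adm t0); exact: Bk_ad.
set s := dyad R m i; set t := dyad R m (i + k).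
have s0 : 0 <= s := dg _ _; have t0 : 0 <= t := dg _ _.
pose X j w := \1_A w * u 0 (Bk j t w - Bk j s w).
pose Y w := \1_A w * u 0 (Bd t w - Bd s w).
have mf (g : Omega -> R) : measurable_fun setT g -> measurable_fun setT (fun w => \1_A w * u 0 (g w)).
  by move=> mg'; apply: measurable_funM => //; exact: (measurableT_comp mu0 mg').
have c1 : E (X j) @[j --> \oo] --> E Y.
  apply: (@E_bounded_cvg _ _ _ _ _ _ K).
  - by move=> j; apply: mf; apply: measurable_funB; exact: mBk.
  - by apply: mf; apply: measurable_funB; exact: mB.
  - move=> j w; rewrite normrM; have [+ _ _] := hb 0 (Bk j t w - Bk j s w) (lexx 0).
    by apply: le_trans; rewrite ler_piMl// indic_le1.
  - have := Bd_cvg m (i + k); have := Bd_cvg m i; apply: filterS2 => w cs ct.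
    apply: cvgMr.
    apply: (@continuous_cvg _ _ _ _ _ (fun k => Bk k t w - Bk k s w) (u 0)); first exact: cu.
    exact: cvgB.
have [K' K'0 HL] := lindeberg K0 t0 hu.
suff c2 : E (X j) @[j --> \oo] --> E (fun w => \1_A w * u (dyad R m k) 0).
  exact: (cvg_unique _ c1 c2).
apply/cvgrPdist_le => e e0.
have nR := @cvgr_le _ _ _ _ _ _ (@cvg_rate R) _ (_ : 0 < e / (K' + 1)).
have eK : 0 < e / (K' + 1) by rewrite divr_gt0// ltr_wpDl.
have [j0 _ Hj0] := nR _ eK.
near=> j.
have mj : (m <= nn j)%N.
  by apply: leq_trans (nn_ge j); near: j; exists m.
have E1 : ((i + k) * 2 ^ (nn j - m) = i * 2 ^ (nn j - m) + k * 2 ^ (nn j - m))%N.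
  by rewrite mulnDl.
rewrite distrC /X (Bk_dyad _ mj) (Bk_dyad _ mj) E1.
have := HL (nn j) (i * 2 ^ (nn j - m))%N (k * 2 ^ (nn j - m))%N A.
rewrite -E1 !dyad_level// => /(_ (lexx _) FA) /le_trans; apply.
have : rate R ^+ nn j <= e / (K' + 1).
  by apply: Hj0 => /=; apply: leq_trans (nn_ge j); near: j; exists j0.
move=> H; apply: (@le_trans _ _ (e / (K' + 1) * K')); first exact: ler_wpM2r.
by rewrite mulrAC ler_pdivrMr ?ltr_wpDl// ler_pM2l// lerDl.
Unshelve. all: by end_near. Qed.

Lemma Bd_normal m i k A (D : set R) : (0 < k)%N -> F (dyad R m i) A -> measurable D ->
  P (A `&` (fun w => Bd (dyad R m (i + k)) w - Bd (dyad R m i) w) @^-1` D) =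
  (P A * normal_prob 0 (Num.sqrt (dyad R m k)) D)%E.
Proof.
move=> k0 FA mD.
have mA : measurable A by exact: FM (dg _ _) _ FA.
have mB t : 0 <= t -> measurable_fun setT (Bd t).
  by move=> t0; apply: (adm t0); exact: Bd_ad.
apply: normal_law_of_logit => //.
- by apply: measurable_funB; exact: mB.
- by rewrite /dyad mulr_gt0 ?mesh_gt0// ltr0n.
move=> c j; have [f1 [f2 hf]] := @logit_smooth R j%:R (- (j%:R * c + Num.sqrt j%:R)) (ler0n _ _).
have hh := smooth_heat_family hf; rewrite -/(logit_step c j) in hh.
have K0 : 0 <= (1 + j%:R) ^+ 3 * (1 + gauss_abs3 R).
  by rewrite mulr_ge0 ?exprn_ge0 ?addr_ge0 ?gauss_abs3_ge0.
have u0 : gauss_avg (logit_step c j) 0 = logit_step c j := gauss_avg0 _.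
have cu : continuous (gauss_avg (logit_step c j) 0).
  by rewrite u0; case: hf => -[_ L] _ _ _ _; exact: lipschitz_continuous_fun L.
have := Bd_law k K0 hh cu FA; rewrite u0 => ->.
rewrite -[RHS]mulrC -EZ; last by rewrite /integ; exact: integrable_indic.
by apply: eq_Rintegral => w _; rewrite mulrC.
Qed.

Lemma Bd_pow4 m i :
  let X w := Bd (dyad R m i.+1) w - Bd (dyad R m i) w in
  integ P (fun w => X w ^+ 4) /\
  E (fun w => X w ^+ 4) = mesh R m ^+ 2 * Rintegral (normal_prob 0 1) setT (fun y : R => y ^+ 4).
Proof.
move=> X.
have mX : measurable_fun setT X.
  by apply: measurable_funB; apply: (adm (dg _ _)); exact: Bd_ad.
have h0 := mesh_gt0 R m; have s0 : 0 < Num.sqrt (mesh R m) by rewrite sqrtr_gt0.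
have FT : F (dyad R m i) setT.
  by have [F0 FC _] := sF (dg m i); have := FC _ F0; rewrite setD0.
have L (D : set R) : measurable D -> P (X @^-1` D) = normal_prob 0 (Num.sqrt (mesh R m)) (id @^-1` D).
  move=> mD; have := @Bd_normal m i 1 setT D isT FT mD.
  rewrite setTI probability_setT mul1e addn1 (_ : dyad R m 1 = mesh R m) //.
  by rewrite /dyad mul1r.
have m4' : measurable_fun setT (fun x : R => (x ^+ 4)%:E).
  by apply/measurable_EFinP; exact: measurable_funX.
have p4 (x : R) : (0 <= (x ^+ 4)%:E)%E by rewrite lee_fin exprn_even_ge0.
have := @ge0_integral_law R _ _ _ _ _ _ P (normal_prob 0 (Num.sqrt (mesh R m))) X id mX
  (@measurable_id _ _ setT) L _ p4 m4'.
rewrite (normal_scale s0 p4 m4').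
under [X in _ = X -> _]eq_integral do rewrite exprMn.
have I4 := normal_integ4 R.
rewrite (EFinE (integZ (Num.sqrt (mesh R m) ^+ 4) I4)) (EZ _ I4) => H.
have X40 w : 0 <= X w ^+ 4 by rewrite exprn_even_ge0.
have [I EX] := integ_ge0 X40 (measurable_funX 4 mX) H.
split => //; rewrite EX.
by rewrite (_ : 4 = 2 * 2)%N// exprM sqr_sqrtr ?ltW.
Qed.

(** Kolmogorov chaining with fourth powers: the K 2^n increments of level n, divided by eps, have
    fourth powers of total expectation K k4 r^n with r = (10/9)^4 / 2 < 1. These totals are
    summable, so they tend to 0 almost surely, and every increment is eventually at most eps. *)
Lemma Bd_modulus : {ae P, forall w, dyadic_modulus (Bd^~ w)}.
Proof.
have [k4 k40] : {k4 : R | 0 <= k4 & k4 = Rintegral (normal_prob 0 1) setT (fun y : R => y ^+ 4)}.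
  exists (Rintegral (normal_prob 0 1) setT (fun y : R => y ^+ 4)) => //.
  by apply: E_ge0 => y; rewrite exprn_even_ge0.
move=> k4E.
suff H (K : nat) : {ae P, forall w, exists n0 : nat, forall n j, (n0 <= n)%N -> (j < K * 2 ^ n)%N ->
    `|Bd (dyad R n j.+1) w - Bd (dyad R n j) w| <= eps R n}.
  by apply/ae_foralln.
pose Z n j w := (Bd (dyad R n j.+1) w - Bd (dyad R n j) w) ^+ 4.
pose Y n w := \sum_(j < K * 2 ^ n) (eps R n)^-1 ^+ 4 * Z n j w.
pose r : R := 2^-1 * (10 / 9) ^+ 4.
have IZ n j : integ P (Z n j) by case: (Bd_pow4 n j).
have EZ' n j : E (Z n j) = mesh R n ^+ 2 * k4 by rewrite k4E; case: (Bd_pow4 n j).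
have IY n : integ P (Y n) by apply: integ_sum => j; exact: integZ.
have EY n : E (Y n) = K%:R * k4 * r ^+ n.
  rewrite /Y E_sum; last by move=> j; exact: integZ.
  under eq_bigr do rewrite EZ// EZ'.
  have rE : r ^+ n = (2 ^+ n)^-1 * (eps R n)^-1 ^+ 4.
    rewrite /r exprMn [2^-1 ^+ n]exprVn; congr (_ * _).
    rewrite -exprM mulnC exprM /eps -[((9 / 10) ^+ n)^-1]exprVn; congr ((_ ^+ n) ^+ 4).
    by field.
  rewrite sumr_const card_ord -[LHS]mulr_natl natrM natrX rE /mesh.
  have t0 : (2 : R) ^+ n != 0 by rewrite expf_neq0.
  by field; rewrite t0 gt_eqF// eps_gt0.
have r1 : r < 1 by rewrite /r; lra.
have r0 : 0 <= r by rewrite /r; lra.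
have Y0 n w : 0 <= Y n w.
  by apply: sumr_ge0 => j _; rewrite mulr_ge0 ?exprn_even_ge0.
have B n : \sum_(k < n) E (Y k) <= K%:R * k4 * (1 - r)^-1.
  under eq_bigr do rewrite EY.
  by rewrite -mulr_sumr ler_wpM2l ?mulr_ge0// sum_geom_le.
have := as_cvg0_of_sum Y0 IY B; apply: filterS => w cw.
have /cvgrPdist_lt /(_ 1 ltr01) [n0 _ Hn0] := cw.
exists n0 => n j n0n jK; have := Hn0 n n0n; rewrite /= sub0r normrN ger0_norm// => Y1.
have e0 := eps_gt0 R n.
have : (eps R n)^-1 ^+ 4 * Z n j w <= 1.
  apply: le_trans (ltW Y1); rewrite /Y (bigD1 (Ordinal jK))//= lerDl.
  by apply: sumr_ge0 => i _; rewrite mulr_ge0 ?exprn_even_ge0.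
rewrite /Z; set x := Bd _ w - _; rewrite -exprMn => H.
have : `|(eps R n)^-1 * x| <= 1.
  rewrite leNgt; apply/negP => gt1; move: H; apply/negP; rewrite -ltNge.
  by rewrite -[ltRHS]ger0_norm ?exprn_even_ge0// normrX exprn_egt1.
by rewrite normrM normfV (gtr0_norm e0) ler_pdivrMl// mulr1.
Qed.

Definition Bt t w := fine (limn_esup (fun n => (Bd (dyad R n (tr n t)) w)%:E)).

Lemma Bt_ad t : 0 <= t -> measurable_fun setT (Bt t : Fs t -> R).
Proof.
move=> t0; apply: (measurableT_comp (fine_measurable measurableT)).
apply: measurable_fun_limn_esup => n; apply/measurable_EFinP.
have /andP[le _] := tr_itv n t0.
exact: (ad_mono (dg _ _) le (Bd_ad (dg _ _))).
Qed.

Lemma Bt_ext w t : dyadic_modulus (Bd ^~ w) -> 0 <= t -> Bt t w = dyadic_ext (Bd ^~ w) t.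
Proof.
move=> Hm t0; have H := dyadic_extP Hm t0.
have HE : (Bd (dyad R n (tr n t)) w)%:E @[n --> \oo] --> (dyadic_ext (Bd ^~ w) t)%:E.
  by apply: cvg_EFin => //; exact: nearW.
by rewrite /Bt (cvg_limn_einf_sup HE).2.
Qed.

Lemma Bd0 w : Bd 0 w = 0.
Proof.
have -> : Bd 0 w = fine (limn_esup (fun k : nat => (0 : R)%:E)).
  rewrite /Bd; congr (fine (limn_esup _)); apply/funext => k; rewrite /Bk.
  have -> : tr (nn k) (0 : R) = 0%N by rewrite /tr mul0r truncn0.
  by rewrite /Bn /Ssum big_ord0.
by rewrite (cvg_limn_einf_sup (cvg_cst (0 : \bar R))).2.
Qed.

(** The driving motion has to be a random variable at every real index; this fixes its value at
    negative times. *)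
Lemma Bt_neg t w : t <= 0 -> Bt t w = 0.
Proof.
move=> t0; rewrite /Bt.
have -> : (fun n => (Bd (dyad R n (tr n t)) w)%:E) = fun=> (0 : \bar R).
  apply/funext => n; have -> : tr n t = 0%N.
    by rewrite /tr; apply/truncn0Pn; rewrite -ltNge (le_lt_trans _ ltr01)// mulr_le0_ge0.
  by rewrite dyad0 Bd0.
by rewrite (cvg_limn_einf_sup (cvg_cst (0 : \bar R))).2.
Qed.

Lemma Bt_path : {ae P, forall w, Bt 0 w = 0 /\ {within `[0, +oo[, continuous (Bt ^~ w)}}.
Proof.
apply: filterS Bd_modulus => w Hm; split; first exact: Bt_neg.
apply: (@subspace_eq_continuous _ _ _ (dyadic_ext (Bd ^~ w))).
  by move=> t; rewrite inE /= in_itv /= andbT => t0; exact/esym/Bt_ext.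
exact: dyadic_ext_continuous.
Qed.

Lemma Bt_cvg t : 0 <= t ->
  {ae P, forall w, Bd (dyad R n (tr n t)) w @[n --> \oo] --> Bt t w}.
Proof.
move=> t0; apply: filterS Bd_modulus => w Hm; rewrite Bt_ext//.
exact: dyadic_extP.
Qed.

Lemma Bt_cvg_right t : 0 <= t ->
  {ae P, forall w, Bd (dyad R n (tr n t).+1) w @[n --> \oo] --> Bt t w}.
Proof.
move=> t0; apply: filterS Bd_modulus => w Hm; rewrite Bt_ext//.
exact: dyadic_ext_right.
Qed.

Lemma cvg_mul_comp_diff (g : R -> R) (a lu lv : R) (u v : nat -> R) : continuous g ->
  u n @[n --> \oo] --> lu -> v n @[n --> \oo] --> lv ->
  a * g (u n - v n) @[n --> \oo] --> a * g (lu - lv).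
Proof.
move=> cg cu cv; apply: cvgMr.
apply: (@continuous_cvg _ _ _ _ _ (fun n => u n - v n) g); first exact: cg.
exact: cvgB.
Qed.

Lemma Bt_test s t A (g : R -> R) : 0 <= s -> 0 <= t -> measurable A ->
  continuous g -> (forall x, `|g x| <= 1) ->
  E (fun w => \1_A w * g (Bd (dyad R n (tr n t)) w - Bd (dyad R n (tr n s).+1) w))
    @[n --> \oo] --> E (fun w => \1_A w * g (Bt t w - Bt s w)).
Proof.
move=> s0 t0 mA cg g1.
have mgf : measurable_fun setT g by exact: continuous_measurable_fun.
have mB r : 0 <= r -> measurable_fun setT (Bd r).
  by move=> r0; apply: (adm r0); exact: Bd_ad.
have mBt r : 0 <= r -> measurable_fun setT (Bt r).
  by move=> r0; apply: (adm r0); exact: Bt_ad.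
have mAf : measurable_fun setT (\1_A : Omega -> R) by exact: measurable_indic.
apply: (@E_bounded_cvg _ _ R P _ _ 1).
- move=> n; apply: measurable_funM => //; apply: (measurableT_comp mgf).
  exact: measurable_funB (mB _ (dg _ _)) (mB _ (dg _ _)).
- apply: measurable_funM => //; apply: (measurableT_comp mgf).
  exact: measurable_funB (mBt _ t0) (mBt _ s0).
- by move=> n w; rewrite normrM; apply: mulr_ile1 => //; exact: indic_le1.
- have := Bt_cvg t0; have := Bt_cvg_right s0; apply: filterS2 => w cs ct.
  exact: (@cvg_mul_comp_diff g (\1_A w) _ _ (fun n => Bd (dyad R n (tr n t)) w)
    (fun n => Bd (dyad R n (tr n s).+1) w) cg ct cs).
Qed.

(** The time [s] is approached from the right, so that [A] belongs to the sigma-algebra of the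
    dyadic starting time, and [t] from the left. Continuity of the Gaussian average in its variance
    gives t - s in the limit. *)
Lemma Bt_law s t A (D : set R) : 0 <= s -> s < t -> F s A -> measurable D ->
  P (A `&` (fun w => Bt t w - Bt s w) @^-1` D) =
  (P A * normal_prob 0 (Num.sqrt (t - s)) D)%E.
Proof.
move=> s0 st FA mD.
have t0 : 0 <= t by apply: le_trans s0 (ltW st).
have mA : measurable A by exact: FM s0 _ FA.
have mB r : 0 <= r -> measurable_fun setT (Bd r).
  by move=> r0; apply: (adm r0); exact: Bd_ad.
have mBt r : 0 <= r -> measurable_fun setT (Bt r).
  by move=> r0; apply: (adm r0); exact: Bt_ad.
have mX : measurable_fun setT (fun w => Bt t w - Bt s w).
  exact: measurable_funB (mBt t t0) (mBt s s0).
have h0 : 0 < t - s by rewrite subr_gt0.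
apply: (normal_law_of_logit mA mX h0 _ mD) => c j.
have [f1 [f2 hf]] := @logit_smooth R j%:R (- (j%:R * c + Num.sqrt j%:R)) (ler0n _ _).
have hh := smooth_heat_family hf; rewrite -/(logit_step c j) in hh.
have K0 : 0 <= (1 + j%:R) ^+ 3 * (1 + gauss_abs3 R).
  by rewrite mulr_ge0 ?exprn_ge0 ?addr_ge0 ?gauss_abs3_ge0.
have u0 : gauss_avg (logit_step c j) 0 = logit_step c j := gauss_avg0 _.
have cl : continuous (logit_step c j).
  by case: hf => -[_ L] _ _ _ _; exact: lipschitz_continuous_fun L.
have cu : continuous (gauss_avg (logit_step c j) 0) by rewrite u0.
have mAf : measurable_fun setT (\1_A : Omega -> R) by exact: measurable_indic.
pose X n w := \1_A w * logit_step c j (Bd (dyad R n (tr n t)) w - Bd (dyad R n (tr n s).+1) w).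
pose dn n := dyad R n (tr n t - (tr n s).+1).
have c1 := Bt_test s0 t0 mA cl (logit_step_le1 c j);
have [n1 Hn1] := tr_lt_tr s0 st.
have trE n : (n1 <= n)%N -> (tr n t = (tr n s).+1 + (tr n t - (tr n s).+1))%N.
  by move=> /Hn1 H; rewrite subnKC.
have cdn : dn n @[n --> \oo] --> t - s.
  have c3 : dyad R n (tr n t) - dyad R n (tr n s).+1 @[n --> \oo] --> t - s.
    by apply: cvgB; [exact: dyad_tr_cvg|exact: dyad_trS_cvg].
  apply: cvg_trans c3; apply: near_eq_cvg; exists n1 => // n /= /trE nE.
  by rewrite /dn [in LHS]nE sq_dist_index addrC addKr.
have c2 := @gauss_avg_step_cvg R c j dn (t - s) cdn.
have E1A : integ P (\1_A : Omega -> R) by exact: integrable_indic.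
have c4 : E (\1_A : Omega -> R) * gauss_avg (logit_step c j) (dn n) 0 @[n --> \oo] -->
   E (\1_A : Omega -> R) * gauss_avg (logit_step c j) (t - s) 0 by exact: cvgMr.
have c5 : E (X n) @[n --> \oo] --> E (\1_A : Omega -> R) * gauss_avg (logit_step c j) (t - s) 0.
  apply: cvg_trans c4; apply: near_eq_cvg; exists n1 => // n /= /trE nE.
  have FA' : F (dyad R n (tr n s).+1) A.
    apply: (Fmono s0) FA; rewrite dyadS; have /andP[_ a2] := tr_itv n s0; exact: ltW.
  have := Bd_law (tr n t - (tr n s).+1) K0 hh cu FA'; rewrite -nE u0 => H.
  rewrite /X H -[LHS]mulrC -(EZ _ E1A).
  by apply: eq_Rintegral => w _; rewrite mulrC.
exact: (cvg_unique _ c1 c5).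
Qed.

(** * Ito sums of sqrt M against the limit *)

Definition itoM n (p : nat -> nat) j w :=
  1 - 2 * Num.sqrt (M (dyad R n (p j)) w) * cM n j w.
(** Together with [itoM], the coefficients of the error of one step: the martingale increment minus
    2 sqrt M, frozen at index [p j], times the step of [Bn]. *)
Definition itoW n (p : nat -> nat) j w :=
  - 2 * Num.sqrt (M (dyad R n (p j)) w) * cW n j w.

Lemma measurable_sqrtM s t : 0 <= s -> s <= t ->
  measurable_fun setT ((fun w => Num.sqrt (M s w)) : Fs t -> R).
Proof.
move=> s0 st; apply: (measurableT_comp (continuous_measurable_fun (@sqrt_continuous R))).
exact: (ad_mono s0 st (M_ad s0)).
Qed.

Lemma integ_M_prod s (z : Omega -> R) : 0 <= s -> measurable_fun setT z ->
  integ P (fun w => z w ^+ 4) -> integ P (fun w => M s w * z w ^+ 2).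
Proof.
move=> s0 mz Iz; have [mM IM] := M_sq s0.
apply: (integ_le _ (integD IM Iz)); first by apply: measurable_funM => //; exact: measurable_funX.
move=> w; rewrite (ger0_norm (mulr_ge0 (M_ge0 w s0) (sqr_ge0 (z w)))).
have -> : z w ^+ 4 = (z w ^+ 2) ^+ 2 by rewrite -exprM.
by have := sqr_ge0 (M s w - z w ^+ 2); have := sqr_ge0 (M s w + z w ^+ 2);
  rewrite sqrrB sqrrD; lra.
Qed.

Lemma sqint_sqrtM_mul s t (c z : Omega -> R) (B : R) : 0 <= s -> s <= t ->
  measurable_fun setT (c : Fs t -> R) -> (forall w, `|c w| <= B) ->
  measurable_fun setT z -> integ P (fun w => z w ^+ 4) ->
  sqint P (fun w => 2 * Num.sqrt (M s w) * c w * z w).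
Proof.
move=> s0 st mc cB mz Iz; have t0 := le_trans s0 st.
have -> : (fun w => 2 * Num.sqrt (M s w) * c w * z w) =
   (fun w => c w * (2 * (Num.sqrt (M s w) * z w))) by apply/funext => w; ring.
apply: (sqint_boundedM (adm t0 mc) cB); apply: sqintZ; split.
  by apply: measurable_funM => //; exact: (adm t0 (measurable_sqrtM s0 st)).
under eq_fun do rewrite exprMn sqr_sqrtr ?M_ge0//.
exact: integ_M_prod.
Qed.

Lemma integ_xi4 n j : integ P (fun w => xi n j w ^+ 4).
Proof.
by have [K _ H] := m4 (dyad R n j + mesh R n); have [] := H _ _ (dg n j) (mg n) (lexx _).
Qed.

Section ito_coefs.
Variables (n : nat) (p : nat -> nat).
Hypothesis pj : forall j, (p j <= j)%N.

Let dp j : dyad R n (p j) <= dyad R n j. Proof. by rewrite ler_dyad. Qed.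

Lemma ito_var_le j w :
  itoM n p j w ^+ 2 * var n j w + itoW n p j w ^+ 2 * mesh R n <=
  mesh R n * (12 * `|M (dyad R n j) w - M (dyad R n (p j)) w| + 20 * eps R n) +
  2 * delta * mesh R n ^+ 2 * (2 + 2 * (M (dyad R n (p j)) w / eps R n)).
Proof. by apply: ito_coef_bound; rewrite ?M_ge0 ?eps_gt0. Qed.

Let integ_bound j : integ P (fun w =>
  mesh R n * (12 * `|M (dyad R n j) w - M (dyad R n (p j)) w| + 20 * eps R n) +
  2 * delta * mesh R n ^+ 2 * (2 + 2 * (M (dyad R n (p j)) w / eps R n))).
Proof.
have I1 := sqint_integ (M_sq (dg n j)); have I2 := sqint_integ (M_sq (dg n (p j))).
apply: integD; apply: integZ; apply: integD; try exact: integ_cst.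
  by apply: integZ; apply: integ_norm; exact: integB.
by apply: integZ; under eq_fun do rewrite mulrC; exact: integZ.
Qed.

Lemma measurable_itoM j : measurable_fun setT (itoM n p j : Fs (dyad R n j) -> R).
Proof.
apply: measurable_funB => //; apply: measurable_funM; last by case: (adM_cM n j).
by apply: measurable_funM => //; exact: measurable_sqrtM.
Qed.

Lemma measurable_itoW j : measurable_fun setT (itoW n p j : Fs (dyad R n j) -> R).
Proof.
apply: measurable_funM; last by case: (adW_cW n j).
by apply: measurable_funM => //; exact: measurable_sqrtM.
Qed.

Lemma integ_itoM j : integ P (fun w => itoM n p j w ^+ 2 * var n j w).
Proof.
have mM := adm (dg _ _) (@measurable_itoM j).
apply: (integ_le _ (integ_bound j)).
  apply: measurable_funM; first exact: measurable_funX.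
  exact: integ_meas (integ_var n j).
move=> w; rewrite ger0_norm; last by rewrite mulr_ge0 ?sqr_ge0 ?var_ge0.
by apply: le_trans (ito_var_le j w); rewrite lerDl mulr_ge0 ?sqr_ge0.
Qed.

Lemma integ_itoW j : integ P (fun w => itoW n p j w ^+ 2 * mesh R n).
Proof.
have mM := adm (dg _ _) (@measurable_itoW j).
apply: (integ_le _ (integ_bound j)).
  by apply: measurable_funM => //; exact: measurable_funX.
move=> w; rewrite ger0_norm; last by rewrite mulr_ge0 ?sqr_ge0.
by apply: le_trans (ito_var_le j w); rewrite lerDr mulr_ge0 ?sqr_ge0 ?var_ge0.
Qed.

Lemma adM_itoM : adM n (itoM n p).
Proof.
move=> j; split; [exact: measurable_itoM| |exact: integ_itoM].
have [mc [B cB]] := adb_cM n j.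
have -> : (fun w => itoM n p j w * xi n j w) =
  (fun w => xi n j w - 2 * Num.sqrt (M (dyad R n (p j)) w) * cM n j w * xi n j w).
  by apply/funext => w; rewrite /itoM; ring.
apply: sqintB; first exact: sqint_xi.
apply: (sqint_sqrtM_mul (dg _ _) (dp j) mc cB); last exact: integ_xi4.
by case: (sqint_xi n j).
Qed.

Lemma adW_itoW : adW n (itoW n p).
Proof.
move=> j; split; [exact: measurable_itoW| |exact: integ_itoW].
have [mc [B cB]] := adb_cW n j.
have -> : (fun w => itoW n p j w * incW n j w) =
  (fun w => - (2 * Num.sqrt (M (dyad R n (p j)) w) * cW n j w * incW n j w)).
  by apply/funext => w; rewrite /itoW; ring.
apply: sqintN; apply: (sqint_sqrtM_mul (dg _ _) (dp j) mc cB).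
  by case: (sqint_incW n j).
by have [K _ H] := w4; have [] := H n j.
Qed.

Lemma ito_step_le T K1 eta j : 0 <= K1 -> 0 <= eta ->
  (forall s h, 0 <= s -> 0 <= h -> s + h <= T -> E (fun w => `|M (s + h) w - M s w|) <= K1 * Num.sqrt h) ->
  dyad R n j <= T -> dyad R n j <= dyad R n (p j) + eta ->
  E (fun w => itoM n p j w ^+ 2 * var n j w + itoW n p j w ^+ 2 * mesh R n) <=
  mesh R n * (12 * K1 * Num.sqrt eta + 20 * eps R n + 2 * delta * (2 + 2 * (E (M 0) + delta * T)) * rate R ^+ n).
Proof.
move=> K10 eta0 HK jT je.
have I1 := sqint_integ (M_sq (dg n j)); have I2 := sqint_integ (M_sq (dg n (p j))).
have J1 := integ_norm (integB I1 I2).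
have J2 : integ P (fun w => M (dyad R n (p j)) w / eps R n).
  by under eq_fun do rewrite mulrC; exact: integZ.
have J3 := integD (integZ 12 J1) (integ_cst P (20 * eps R n)).
have J4 := integD (integ_cst P 2) (integZ 2 J2).
apply: le_trans (E_le (integD (integ_itoM j) (integ_itoW j)) (integ_bound j) (ito_var_le j)) _.
rewrite (ED (integZ (mesh R n) J3) (integZ (2 * delta * mesh R n ^+ 2) J4)) (EZ _ J3) (EZ _ J4).
rewrite (ED (integZ 12 J1) (integ_cst P (20 * eps R n))) (ED (integ_cst P 2) (integZ 2 J2)) (EZ 12 J1) (EZ 2 J2).
rewrite !(E_cst P).
have E1 : E (fun w => `|M (dyad R n j) w - M (dyad R n (p j)) w|) <= K1 * Num.sqrt eta.
  have d0 : 0 <= dyad R n j - dyad R n (p j) by rewrite subr_ge0.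
  have := HK _ _ (dg n (p j)) d0; rewrite subrKC => /(_ jT) /le_trans; apply.
  by rewrite ler_wpM2l// ler_wsqrtr// lerBlDl.
have E2 : E (fun w => M (dyad R n (p j)) w / eps R n) = (E (M 0) + delta * dyad R n (p j)) / eps R n.
  by under eq_Rintegral do rewrite mulrC; rewrite (EZ _ I2) EM// mulrC.
rewrite E2; have h0 := mg n; have e0 := eps_gt0 R n.
have A0 : 0 <= E (M 0) by apply: E_ge0 => w; exact: M_ge0.
have pT : dyad R n (p j) <= T by exact: le_trans (dp j) jT.
have r1 := mesh_le_rate R n; have r2 := mesh_eps_le R n.
set A := E (M 0) in A0 *; set s := dyad R n (p j) in pT *.
set h := mesh R n in h0 r1 r2 *; set e := eps R n in e0 r2 *; set q := rate R ^+ n in r1 r2 *.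
have s0 : 0 <= s := dg _ _.
have B1 : h * (A + delta * s) / e <= (A + delta * T) * q.
  rewrite mulrAC mulrC ler_pM ?mulr_ge0 ?addr_ge0 ?mulr_ge0// ?invr_ge0 ?(ltW e0)//.
  by rewrite lerD2l ler_wpM2l.
have d2 : 0 <= 2 * delta by rewrite mulr_ge0.
have B2 : h * (2 + 2 * ((A + delta * s) / e)) <= (2 + 2 * (A + delta * T)) * q by lra.
have B3 := ler_wpM2l h0 (ler_wpM2l d2 B2).
have B4 := ler_wpM2l h0 E1.
lra.
Qed.

End ito_coefs.

(** Errors of different cells are orthogonal, so their variances add. Freezing the integrand over a
    width eta costs sqrt eta per unit of time, and the rest vanishes with the level. *)
Lemma ito_grid T : 0 <= T -> exists2 K, 0 <= K & forall n N p eta, dyad R n N <= T ->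
  (forall j, (p j <= j)%N) -> 0 <= eta ->
  (forall j, (j < N)%N -> dyad R n j <= dyad R n (p j) + eta) ->
  E (fun w => Ssum n (itoM n p) (itoW n p) N w ^+ 2) <=
  K * (Num.sqrt eta + (eps R n + rate R ^+ n)).
Proof.
move=> T0; have [K1 K10 HK] := E_dist_M T.
have A0 : 0 <= E (M 0) by apply: E_ge0 => w; exact: M_ge0.
pose C := 2 * delta * (2 + 2 * (E (M 0) + delta * T)).
have C0 : 0 <= C by rewrite !mulr_ge0// addr_ge0// mulr_ge0// addr_ge0// mulr_ge0.
exists (T * (12 * K1 + 20 + C)); first by rewrite mulr_ge0// !addr_ge0// mulr_ge0.
move=> n N p eta NT pj eta0 Hp.
rewrite (Ssum_isometry (adM_itoM n pj) (adW_itoW n pj)).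
set B := 12 * K1 * Num.sqrt eta + 20 * eps R n + C * rate R ^+ n.
have e0 := ltW (eps_gt0 R n); have s0 := sqrtr_ge0 eta.
have q0 : 0 <= rate R ^+ n by rewrite exprn_ge0// rate_ge0.
have B1 : 0 <= 12 * K1 * Num.sqrt eta by rewrite !mulr_ge0.
have B2 : 0 <= C * rate R ^+ n by rewrite mulr_ge0.
have B0 : 0 <= B by rewrite addr_ge0// addr_ge0// mulr_ge0.
apply: (@le_trans _ _ (\sum_(j < N) mesh R n * B)).
  apply: ler_sum => j _; apply: (ito_step_le pj K10 eta0 HK); last exact: Hp.
  by apply: le_trans NT; rewrite ler_dyad ltnW.
rewrite sumr_const card_ord -[leLHS]mulr_natl mulrA -/(dyad R n N).
apply: (@le_trans _ _ (T * B)); first by rewrite ler_wpM2r.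
rewrite -mulrA ler_wpM2l//.
have h1 : 0 <= 12 * K1 * (eps R n + rate R ^+ n) by rewrite mulr_ge0 ?mulr_ge0 ?addr_ge0.
have h2 : 0 <= C * (Num.sqrt eta + eps R n) by rewrite mulr_ge0 ?addr_ge0.
rewrite /B; lra.
Qed.

(** Exhibits the error of a coarse Ito sum as one sum over fine cells, to which the isometry
    applies. *)
Lemma ito_block n (b : nat -> nat) k w : b 0%N = 0%N -> (forall i, (b i <= b i.+1)%N) ->
  Ssum n (itoM n (block_start b k)) (itoW n (block_start b k)) (b k) w =
  M (dyad R n (b k)) w - M 0 w - delta * dyad R n (b k) -
  \sum_(i < k) 2 * Num.sqrt (M (dyad R n (b i)) w) * (Bn n (b i.+1) w - Bn n (b i) w).
Proof.
move=> b0 bS; pose f (s j : nat) := 2 * Num.sqrt (M (dyad R n s) w) * Bstep n j w.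
have -> : Ssum n (itoM n (block_start b k)) (itoW n (block_start b k)) (b k) w =
   \sum_(j < b k) (xi n j w - f (block_start b k j) j).
  by apply: eq_bigr => j _; rewrite /f /step /itoM /itoW /Bstep /step; ring.
rewrite sumrB; congr (_ - _).
  elim: (b k) => [|N ih]; first by rewrite big_ord0 dyad0 subrr mulr0 subrr.
  by rewrite big_ord_recr /= ih xiE dyadS; ring.
rewrite (block_sum b0 bS f); apply: eq_bigr => i _.
rewrite /f -mulr_sumr; congr (_ * _).
rewrite -(telescope_sumr (fun j => Bn n j w) (bS i)); apply: eq_big_nat => j _.
by rewrite BnS addrAC subrr add0r.
Qed.

Lemma measurable_M t : 0 <= t -> measurable_fun setT (M t).
Proof. by move=> t0; exact: adm (M_ad t0). Qed.

(** The truncation allows bounded convergence along almost sure limits and still controls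
    convergence in probability. *)
Definition trunc_sqr (x : R) : R := Num.min (x ^+ 2) 1.

Lemma trunc_sqr_bound x : `|trunc_sqr x| <= 1.
Proof. by rewrite ger0_norm ?ge_min ?lexx ?orbT// le_min sqr_ge0 ler01. Qed.

Lemma measurable_trunc_sqr (z : Omega -> R) : measurable_fun setT z ->
  measurable_fun setT (fun w => trunc_sqr (z w)).
Proof. by move=> mz; apply: measurable_minr => //; exact: measurable_funX. Qed.

Lemma cvg_trunc_sqr (u : nat -> R) l : u n @[n --> \oo] --> l ->
  trunc_sqr (u n) @[n --> \oo] --> trunc_sqr l.
Proof.
move=> ul; apply: (@continuous_cvg _ _ _ _ _ (fun n => u n ^+ 2) (fun x => Num.min x 1)).
  by apply: (@continuous_min _ R) => //; exact: cvg_cst.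
by rewrite expr2; under eq_fun do rewrite expr2; exact: cvgM.
Qed.

Section ito_err.
Variables (b : nat -> nat) (N m : nat).
Hypotheses (b0 : b 0%N = 0%N) (bS : forall i, (b i <= b i.+1)%N).

Definition ito_err (B : R -> Omega -> R) w :=
  M (dyad R m (b N)) w - M 0 w - delta * dyad R m (b N) -
  \sum_(i < N) 2 * Num.sqrt (M (dyad R m (b i)) w) *
     (B (dyad R m (b i.+1)) w - B (dyad R m (b i)) w).

Lemma measurable_ito_err B : (forall t, 0 <= t -> measurable_fun setT (B t)) ->
  measurable_fun setT (ito_err B).
Proof.
move=> mB; apply: measurable_funB.
  by apply: measurable_funB => //; apply: measurable_funB; exact: measurable_M.
apply: measurable_sum => i; apply: measurable_funM.
  apply: measurable_funM => //.
  exact: (measurableT_comp (continuous_measurable_fun (@sqrt_continuous R)) (measurable_M (dg _ _))).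
exact: measurable_funB (mB _ (dg _ _)) (mB _ (dg _ _)).
Qed.

Lemma ito_err_Bk k w : (m <= nn k)%N ->
  let c i := (b i * 2 ^ (nn k - m))%N in
  ito_err (Bk k) w = Ssum (nn k) (itoM (nn k) (block_start c N)) (itoW (nn k) (block_start c N)) (c N) w.
Proof.
move=> mk c; rewrite ito_block; last 2 first.
- by rewrite /c b0.
- by move=> i; rewrite leq_mul2r bS orbT.
rewrite /ito_err /c !(dyad_level _ mk); congr (_ - _); apply: eq_bigr => i _.
by rewrite !(dyad_level _ mk) !(Bk_dyad _ mk).
Qed.

(** Letting [k] tend to infinity on a fixed coarse grid removes the terms in eps and rate and leaves
    only the width of the grid. *)
Lemma ito_err_limit T K eta : 0 <= K ->
  (forall n N p eta, dyad R n N <= T ->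
    (forall j, (p j <= j)%N) -> 0 <= eta ->
    (forall j, (j < N)%N -> dyad R n j <= dyad R n (p j) + eta) ->
    E (fun w => Ssum n (itoM n p) (itoW n p) N w ^+ 2) <=
    K * (Num.sqrt eta + (eps R n + rate R ^+ n))) ->
  dyad R m (b N) <= T -> 0 <= eta ->
  (forall i, dyad R m (b i.+1) <= dyad R m (b i) + eta) ->
  E (fun w => trunc_sqr (ito_err Bd w)) <= K * Num.sqrt eta.
Proof.
move=> K0 HK NT eta0 Heta.
have mBk k : measurable_fun setT (ito_err (Bk k)).
  by apply: measurable_ito_err => t t0; apply: (adm t0); exact: Bk_ad.
have mBd : measurable_fun setT (ito_err Bd).
  by apply: measurable_ito_err => t t0; apply: (adm t0); exact: Bd_ad.
have c1 : E (fun w => trunc_sqr (ito_err (Bk k) w)) @[k --> \oo] --> E (fun w => trunc_sqr (ito_err Bd w)).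
  apply: (@E_bounded_cvg _ _ R P _ _ 1).
  - by move=> k; exact: measurable_trunc_sqr.
  - exact: measurable_trunc_sqr.
  - by move=> k w; exact: trunc_sqr_bound.
  - have : {ae P, forall w, forall i : nat, Bk k (dyad R m i) w @[k --> \oo] --> Bd (dyad R m i) w}.
      by apply/ae_foralln => i; exact: Bd_cvg.
    apply: filterS => w H; apply: cvg_trunc_sqr; apply: cvgB; first exact: cvg_cst.
    refine (@cvg_sum_ord R N (fun i k => 2 * Num.sqrt (M (dyad R m (b i)) w) * (Bk k (dyad R m (b i.+1)) w - Bk k (dyad R m (b i)) w))
      (fun i => 2 * Num.sqrt (M (dyad R m (b i)) w) * (Bd (dyad R m (b i.+1)) w - Bd (dyad R m (b i)) w)) _) => i.
    by apply: cvgMr; apply: cvgB; exact: H.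
have c2 : K * (Num.sqrt eta + (eps R (nn k) + rate R ^+ nn k)) @[k --> \oo] --> K * (Num.sqrt eta + (0 + 0)).
  apply: cvgMr; apply: cvgD; first exact: cvg_cst.
  have nny : (fun k => nn k) @ \oo --> \oo.
    exact: cvg_ge_id.
  apply: cvgD.
    exact: (@cvg_comp _ _ _ nn (eps R) _ _ _ nny (@cvg_eps R)).
  exact: (@cvg_comp _ _ _ nn (fun n => rate R ^+ n) _ _ _ nny (@cvg_rate R)).
rewrite addr0 addr0 in c2.
apply: (ler_cvg_to c1 c2); near=> k.
have mk : (m <= nn k)%N by apply: leq_trans (nn_ge k); near: k; exists m.
pose c i := (b i * 2 ^ (nn k - m))%N.
have c0 : c 0%N = 0%N by rewrite /c b0.
have cS i : (c i <= c i.+1)%N by rewrite leq_mul2r bS orbT.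
apply: (@le_trans _ _ (E (fun w => Ssum (nn k) (itoM (nn k) (block_start c N))
    (itoW (nn k) (block_start c N)) (c N) w ^+ 2))); last first.
  apply: HK => //; first by rewrite /c dyad_level.
    by move=> j; exact: block_start_le.
  move=> j jc; have [i [-> ci cj]] := block_startP c0 jc.
  apply: (@le_trans _ _ (dyad R (nn k) (c i.+1))); first by rewrite ler_dyad ltnW.
  by rewrite /c !dyad_level.
apply: E_le.
- by apply: integ_bounded (measurable_trunc_sqr (mBk k)) _ => w; exact: trunc_sqr_bound.
- have pj j : (block_start c N j <= j)%N by exact: block_start_le.
  by case: (sqint_Ssum (adM_itoM (nn k) pj) (adW_itoW (nn k) pj) (c N)).
- by move=> w; rewrite ito_err_Bk// /trunc_sqr ge_min lexx.
Unshelve. all: by end_near. Qed.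

End ito_err.

Local Notation sqrtM := (fun u w => Num.sqrt (M u w)).

Lemma measurable_Bt t : 0 <= t -> measurable_fun setT (Bt t).
Proof. by move=> t0; apply: (adm t0); exact: Bt_ad. Qed.

Lemma grid_ge0 (y : R) i N : 0 <= y -> 0 <= y * i%:R / N%:R.
Proof. by move=> y0; rewrite divr_ge0 ?mulr_ge0. Qed.

Lemma measurable_ito_sum y N : 0 <= y -> measurable_fun setT (ito_sum sqrtM Bt y N).
Proof.
move=> y0; apply: measurable_sum => i; apply: measurable_funM.
  exact: (measurableT_comp (continuous_measurable_fun (@sqrt_continuous R)) (measurable_M (grid_ge0 _ _ y0))).
exact: measurable_funB (measurable_Bt (grid_ge0 _ _ y0)) (measurable_Bt (grid_ge0 _ _ y0)).
Qed.

Definition ito_defect y N w := M y w - M 0 w - delta * y - 2 * ito_sum sqrtM Bt y N w.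

Lemma measurable_ito_defect y N : 0 <= y -> measurable_fun setT (ito_defect y N).
Proof.
move=> y0; apply: measurable_funB.
  by apply: measurable_funB => //; apply: measurable_funB; exact: measurable_M.
by apply: measurable_funM => //; exact: measurable_ito_sum.
Qed.

Lemma ito_defect_le y : 0 < y -> exists2 K, 0 <= K & forall N, (0 < N)%N ->
  E (fun w => trunc_sqr (ito_defect y N w)) <= K * Num.sqrt (2 * y / N%:R).
Proof.
move=> yp; have y0 := ltW yp; have [K K0 HK] := ito_grid y0.
exists K => // N N0.
have Nn : N%:R != 0 :> R by rewrite pnatr_eq0 -lt0n.
(* The points y i / N need not be dyadic: they are rounded down at level m, and m tends to infinity
   with N fixed. *)
pose b m i := tr m (y * i%:R / N%:R).
have bN m : b m N = tr m y by rewrite /b mulfK.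
have b0 m : b m 0%N = 0%N by rewrite /b mulr0 mul0r /tr mul0r truncn0.
have bS m i : (b m i <= b m i.+1)%N.
  apply: le_truncn; rewrite ler_wpM2r// ler_wpM2r// ?invr_ge0// ler_wpM2l//.
  by rewrite ler_nat.
have c1 : E (fun w => trunc_sqr (ito_err (b m) N m Bd w)) @[m --> \oo] -->
   E (fun w => trunc_sqr (ito_defect y N w)).
  apply: (@E_bounded_cvg _ _ R P _ _ 1).
  - move=> m; apply: measurable_trunc_sqr; apply: measurable_ito_err => t t0.
    by apply: (adm t0); exact: Bd_ad.
  - by apply: measurable_trunc_sqr; exact: measurable_ito_defect.
  - by move=> k w; exact: trunc_sqr_bound.
  - have : {ae P, forall w, forall i : nat, Bd (dyad R m (b m i)) w @[m --> \oo] --> Bt (y * i%:R / N%:R) w}.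
      by apply/ae_foralln => i; exact/Bt_cvg/grid_ge0.
    apply: filterS => w HB; apply: cvg_trunc_sqr.
    have cM' t : 0 <= t -> M (dyad R m (tr m t)) w @[m --> \oo] --> M t w.
      move=> t0; have HH := @within_cvg_seq R (M ^~ w) (fun m => dyad R m (tr m t)) t
        (@M_cont w) t0 (fun m => dg m _) (dyad_tr_cvg t0).
      exact: HH.
    rewrite /ito_defect /ito_err mulr_sumr.
    apply: cvgB.
      apply: cvgB; first apply: cvgB.
      + by under eq_fun do rewrite bN; exact: cM'.
      + exact: cvg_cst.
      + by under eq_fun do rewrite bN; apply: cvgMr; exact: dyad_tr_cvg.
    have -> : \sum_(i < N) 2 * (Num.sqrt (M (y * i%:R / N%:R) w) *
        (Bt (y * i.+1%:R / N%:R) w - Bt (y * i%:R / N%:R) w)) =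
      \sum_(i < N) 2 * Num.sqrt (M (y * i%:R / N%:R) w) *
        (Bt (y * i.+1%:R / N%:R) w - Bt (y * i%:R / N%:R) w).
      by apply: eq_bigr => i _; rewrite mulrA.
    refine (@cvg_sum_ord R N (fun i m => 2 * Num.sqrt (M (dyad R m (b m i)) w) * (Bd (dyad R m (b m i.+1)) w - Bd (dyad R m (b m i)) w))
      (fun i => 2 * Num.sqrt (M (y * i%:R / N%:R) w) * (Bt (y * i.+1%:R / N%:R) w - Bt (y * i%:R / N%:R) w)) _) => i.
    apply: cvgM; last by apply: cvgB; exact: HB.
    apply: cvgMr; apply: (@continuous_cvg _ _ _ _ _ (fun m => M (dyad R m (b m i)) w) Num.sqrt).
      exact: sqrt_continuous.
    exact/cM'/grid_ge0.
apply: (ler_cvg_to c1 (cvg_cst _)).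
(* Once the mesh is below y / N, rounding widens a cell to at most 2 y / N. *)
have yN : 0 < y / N%:R by rewrite divr_gt0// ltr0n.
have [n1 Hn1] := eps_lt yN; exists n1 => // m /= /Hn1 Hm.
have mh := le_lt_trans (mesh_eps R m) Hm.
apply: (ito_err_limit (b0 m) (bS m) K0 HK).
- by rewrite bN; have /andP[] := tr_itv m y0.
- by rewrite divr_ge0// mulr_ge0.
- move=> i; have /andP[a1 _] := tr_itv m (grid_ge0 i.+1 N y0).
  have /andP[_ a2] := tr_itv m (grid_ge0 i N y0); apply: (le_trans a1).
  have -> : y * i.+1%:R / N%:R = y * i%:R / N%:R + y / N%:R by rewrite -natr1; field.
  rewrite -mulrA; lra.
Qed.

Lemma ito_cvg y : 0 <= y ->
  is_ito_integral P sqrtM Bt y (fun w => (M y w - M 0 w - delta * y) / 2).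
Proof.
move=> y0; split.
  apply: measurable_funM => //.
  by apply: measurable_funB => //; apply: measurable_funB; exact: measurable_M.
move=> e e0; have [yE|yn] := eqVneq y 0.
  rewrite [X in X @ _ --> _](_ : _ = fun=> 0%E); first exact: cvg_cst.
  apply/funext => N; rewrite (_ : [set w | _] = set0) ?measure0//.
  apply/seteqP; split => // w /=; rewrite yE /ito_sum big1 ?sub0r.
    by rewrite subrr mulr0 subr0 mul0r oppr0 normr0 leNgt e0.
  by move=> i _; rewrite !mul0r subrr mulr0.
have yp : 0 < y by rewrite lt_neqAle eq_sym yn.
have [K K0 HK] := ito_defect_le yp.
(* On the event in question the defect is at least 2 e in absolute value, so its truncated square is
   at least this constant. *)
pose c := Num.min (4 * e ^+ 2) 1.
have c0 : 0 < c by rewrite lt_min ltr01 mulr_gt0// exprn_gt0.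
pose S N := [set w | e <= `|ito_sum sqrtM Bt y N w - (M y w - M 0 w - delta * y) / 2|].
have mS N : measurable (S N).
  have -> : S N = (fun w => `|ito_sum sqrtM Bt y N w - (M y w - M 0 w - delta * y) / 2|) @^-1` `[e, +oo[.
    by apply/seteqP; split => w /=; rewrite in_itv /= andbT.
  have mf : measurable_fun setT (fun w => `|ito_sum sqrtM Bt y N w - (M y w - M 0 w - delta * y) / 2|).
    apply: measurableT_comp; first exact: normr_measurable.
    apply: measurable_funB; first exact: measurable_ito_sum.
    apply: measurable_funM => //.
    by apply: measurable_funB => //; apply: measurable_funB; exact: measurable_M.
  by rewrite -[X in measurable X]setTI; apply: mf => //; exact: measurable_itv.
have SE N : (0 < N)%N -> (P (S N) <= (c^-1 * (K * Num.sqrt (2 * y / N%:R)))%:E)%E.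
  move=> N0; rewrite -(E_indic P (mS N)) lee_fin ler_pdivlMl//.
  apply: le_trans (HK N N0).
  have I1 : integ P (\1_(S N) : Omega -> R) by exact: integrable_indic.
  rewrite -(EZ c I1); apply: E_le; first exact: integZ.
    apply: (@integ_bounded _ _ _ _ _ 1); last by move=> w; exact: trunc_sqr_bound.
    by apply: measurable_trunc_sqr; exact: measurable_ito_defect.
  move=> w; rewrite indicE; case: (boolP (w \in S N)) => [/set_mem Sw|_]; last first.
    by rewrite mulr0 le_min sqr_ge0 ler01.
  rewrite mulr1 /trunc_sqr le_min !ge_min lexx orbT andbT; apply/orP; left.
  have -> : ito_defect y N w = - 2 * (ito_sum sqrtM Bt y N w - (M y w - M 0 w - delta * y) / 2).
    by rewrite /ito_defect; field.
  rewrite exprMn sqrrN -natrX ler_pM2l// -(real_normK (num_real (_ - _))).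
  by rewrite lerXn2r ?nnegrE// ltW.
have c1 : (c^-1 * (K * Num.sqrt (2 * y / N%:R)))%:E @[N --> \oo] --> 0%E.
  apply: cvg_EFin; first exact: nearW.
  rewrite -(mulr0 (c^-1)); apply: cvgMr; rewrite -(mulr0 K); apply: cvgMr.
  rewrite -[X in _ --> X](sqrtr0 R).
  apply: (@continuous_cvg _ _ _ _ _ (fun N => 2 * y / N%:R) Num.sqrt); first exact: sqrt_continuous.
  rewrite -(mulr0 (2 * y)); apply: cvgMr.
  by rewrite -cvg_shiftS; exact: cvg_harmonic.
apply: (squeeze_cvge _ (cvg_cst 0%E) c1).
near=> N; rewrite measure_ge0 /=; apply: SE; near: N; by exists 1%N.
Unshelve. all: by end_near. Qed.

End limit.

Theorem driving_noise : exists B : R -> Omega -> R,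
  [/\ forall t, 0 <= t -> measurable_fun setT (B t : Fs t -> R),
      forall t w, t <= 0 -> B t w = 0,
      {ae P, forall w, B 0 w = 0 /\ {within `[0, +oo[, continuous (B ^~ w)}},
      forall s t A (D : set R), 0 <= s -> s < t -> F s A -> measurable D ->
        P (A `&` (fun w => B t w - B s w) @^-1` D) =
        (P A * normal_prob 0 (Num.sqrt (t - s)) D)%E &
      forall y, 0 <= y -> is_ito_integral P (fun u w => Num.sqrt (M u w)) B y
        (fun w => (M y w - M 0 w - delta * y) / 2)].
Proof.
have [nn [nnS nn_id nnC]] := universal_subsequence.
exists (Bt nn); split.
- by move=> t; exact: Bt_ad.
- by move=> t w; exact: Bt_neg.
- exact: Bt_path.
- by move=> s t A D; exact: Bt_law.
- by move=> y; exact: ito_cvg.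
Qed.

End sde.

(** * Independent normal variables from one uniform variable *)

Section rays.
Variable R : realType.

Lemma measure_eq_rays_prob (m1 m2 : {measure set (measurableTypeR R) -> \bar R}) :
  (forall a : R, m1 `]a, +oo[%classic = m2 `]a, +oo[%classic) ->
  (m1 setT < +oo)%E -> forall C : set R, measurable C -> m1 C = m2 C.
Proof.
move=> H F; apply: measure_eq_rays => // c; apply: le_lt_trans F.
by apply: le_measure; rewrite ?inE.
Qed.

Lemma halving_eq0 (T : Type) (H : T -> R) (f1 f2 : T -> T) : (forall x, `|H x| <= 2) ->
  (forall x, H x = (H (f1 x) + H (f2 x)) / 2) ->
  (forall x, H (f1 x) = 0 \/ H (f2 x) = 0) -> forall x, H x = 0.
Proof.
move=> H2 rec out.
have bound n x : `|H x| <= 2 * 2^-1 ^+ n.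
  elim: n x => [|n ih] x; first by rewrite expr0 mulr1.
  rewrite rec exprSr mulrA normrM (ger0_norm (_ : 0 <= 2^-1))// ler_wpM2r//.
  by case: (out x) => ->; rewrite ?add0r ?addr0.
move=> x; apply/eqP; rewrite -normr_le0.
have c : 2 * 2^-1 ^+ n @[n --> \oo] --> (2 * 0 : R).
  by apply: cvgMr; apply: cvg_expr; rewrite ger0_norm//; lra.
rewrite mulr0 in c; apply: (ler_cvg_to (cvg_cst _) c).
by apply: nearW => n; exact: bound.
Qed.

(** The probability that a uniform variable on [0, 1] exceeds [a]. *)
Definition tail_unif (a : R) : R := Num.max 0 (Num.min 1 (1 - a)).

Lemma tail_unif_halving a :
  tail_unif a = (tail_unif (2 * a) + tail_unif (2 * a - 1)) / 2.
Proof.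
rewrite /tail_unif /Num.max /Num.min.
by repeat (case: ifP => /=); move=> *; lra.
Qed.

Lemma tail_unif_neg a : a < 0 -> tail_unif a = 1.
Proof.
by move=> a0; rewrite /tail_unif /Num.max /Num.min; repeat (case: ifP => /=); move=> *; lra.
Qed.

Lemma tail_unif_ge1 a : 1 <= a -> tail_unif a = 0.
Proof.
by move=> a0; rewrite /tail_unif /Num.max /Num.min; repeat (case: ifP => /=); move=> *; lra.
Qed.

Lemma tail_unif01 a : 0 <= tail_unif a <= 1.
Proof.
by rewrite /tail_unif /Num.max /Num.min; repeat (case: ifP => /=); move=> *; lra.
Qed.

Lemma tail_unif_unique (G1 : R -> R) : (forall a, `|G1 a| <= 1) ->
  (forall a, a < 0 -> G1 a = 1) -> (forall a, 1 <= a -> G1 a = 0) ->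
  (forall a, G1 a = (G1 (2 * a) + G1 (2 * a - 1)) / 2) -> forall a, G1 a = tail_unif a.
Proof.
move=> G1b Gn Gp Grec a; apply/eqP; rewrite -subr_eq0; apply/eqP.
apply: (@halving_eq0 R (fun a => G1 a - tail_unif a) (fun a => 2 * a) (fun a => 2 * a - 1)).
- move=> x; apply: le_trans (ler_normB _ _) _; have /andP[u0 u1] := tail_unif01 x.
  by rewrite (_ : 2 = 1 + 1)// lerD// ger0_norm.
- by move=> x; rewrite Grec (tail_unif_halving x); field.
- move=> x; have [x1|x1] := leP 1 (2 * x); first by left; rewrite Gp// tail_unif_ge1// subrr.
  by right; rewrite Gn ?tail_unif_neg ?subrr//; lra.
Qed.

(* A joint tail satisfying the digit recursion is the tail of two independent
   uniform variables: of [2 a] and [2 a - 1] only one lies in [0, 1), so the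
   error contracts by 1/2 at each step. *)
Lemma tail_unif_unique2 (G : R -> R -> R) : (forall a b, `|G a b| <= 1) ->
  (forall a b, b < 0 -> G a b = tail_unif a) ->
  (forall a b, 1 <= b -> G a b = 0) ->
  (forall a b, G a b = (G b (2 * a) + G b (2 * a - 1)) / 2) ->
  forall a b, G a b = tail_unif a * tail_unif b.
Proof.
move=> G1 Gn Gp Grec a b; apply/eqP; rewrite -subr_eq0; apply/eqP.
apply: (@halving_eq0 (R * R) (fun x => G x.1 x.2 - tail_unif x.1 * tail_unif x.2)
  (fun x => (x.2, 2 * x.1)) (fun x => (x.2, 2 * x.1 - 1)) _ _ _ (a, b)) => -[x y] /=.
- apply: le_trans (ler_normB _ _) _.
  have /andP[u0 u1] := tail_unif01 x; have /andP[v0 v1] := tail_unif01 y.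
  by rewrite (_ : 2 = 1 + 1)// lerD// ger0_norm ?mulr_ge0// mulr_ile1.
- by rewrite Grec (tail_unif_halving x); field.
- have [x1|x1] := leP 1 (2 * x); first by left; rewrite Gp// (tail_unif_ge1 x1) mulr0 subrr.
  have x2 : 2 * x - 1 < 0 by lra.
  by right; rewrite Gn// (tail_unif_neg x2) mulr1 subrr.
Qed.

End rays.

(** * Even and odd binary digits of a uniform variable *)

Section digits.
Variable R : realType.
Local Notation lam := (@uniform_prob R 0 1 ltr01).

(** On [0, 1], the leading binary digit; [shift_digit] is the doubling map, and [even_digits]
    reassembles the digits of index 0, 2, 4, ... into a number of [0, 1]. *)
Definition digit (u : R) : R := (2^-1 <= u)%R%:R.
Definition shift_digit (u : R) : R := 2 * u - digit u.
Definition digit_sum n (u : R) : R :=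
  \sum_(k < n) 2^-1 ^+ k.+1 * digit (iter k.*2 shift_digit u).

Definition even_digits (u : R) : R := limn (fun n => digit_sum n u).
Definition odd_digits (u : R) : R := even_digits (shift_digit u).

Lemma digit01 u : 0 <= digit u <= 1.
Proof. by rewrite /digit; case: (2^-1 <= u)%R => /=; rewrite ?mulr1n ?mulr0n ?lexx ?ler01. Qed.

Lemma measurable_digit : measurable_fun setT digit.
Proof.
rewrite (_ : digit = \1_(`[2^-1, +oo[)); first exact: measurable_indic.
by apply/funext => u; rewrite indicE mem_setE in_itv /= andbT.
Qed.

Lemma measurable_shift_digit : measurable_fun setT shift_digit.
Proof. by apply: measurable_funB; [exact: measurable_funM|exact: measurable_digit]. Qed.

Lemma measurable_iter_shift k : measurable_fun setT (iter k shift_digit).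
Proof.
elim: k => [|k ih]; first exact: measurable_id.
exact: (measurableT_comp measurable_shift_digit ih).
Qed.

Lemma measurable_digit_sum n : measurable_fun setT (digit_sum n).
Proof.
apply: measurable_sum => k; apply: measurable_funM => //.
exact: (measurableT_comp measurable_digit (measurable_iter_shift _)).
Qed.

Lemma digit_sum_nd u : nondecreasing_seq (fun n => digit_sum n u).
Proof.
apply/nondecreasing_seqP => n; rewrite /digit_sum big_ord_recr /= lerDl; apply: mulr_ge0; first exact: exprn_ge0.
by have /andP[] := digit01 (iter n.*2 shift_digit u).
Qed.

Lemma digit_sum_le n u : digit_sum n u <= 1 - 2^-1 ^+ n.
Proof.
elim: n => [|n ih]; first by rewrite /digit_sum big_ord0 expr0 subrr.
rewrite /digit_sum big_ord_recr /= -/(digit_sum n u).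
have /andP[_ d1] := digit01 (iter n.*2 shift_digit u).
have h0 : 0 <= 2^-1 ^+ n.+1 :> R by rewrite exprn_ge0.
have := ler_wpM2l h0 d1; have : 2^-1 ^+ n = 2 * 2^-1 ^+ n.+1 :> R by rewrite exprS mulrA divff ?mul1r.
by move: ih; lra.
Qed.

Lemma digit_sum_cvg u : digit_sum n u @[n --> \oo] --> even_digits u.
Proof.
apply: nondecreasing_is_cvgn; first exact: digit_sum_nd.
exists 1 => _ [n _ <-]; apply: le_trans (digit_sum_le n u) _.
by rewrite gerBl exprn_ge0.
Qed.

Lemma even_digits01 u : 0 <= even_digits u <= 1.
Proof.
apply/andP; split.
  apply: (ler_cvg_to (cvg_cst 0) (@digit_sum_cvg u)); apply: nearW => n.
  apply: sumr_ge0 => k _; apply: mulr_ge0; first exact: exprn_ge0.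
  by have /andP[] := digit01 (iter k.*2 shift_digit u).
apply: (ler_cvg_to (@digit_sum_cvg u) (cvg_cst (1 : R))); apply: nearW => n.
by apply: le_trans (digit_sum_le n u) _; rewrite gerBl exprn_ge0.
Qed.

Lemma measurable_even_digits : measurable_fun setT even_digits.
Proof.
apply: (measurable_fun_cvg (fun n => @measurable_digit_sum n)) => u _.
exact: digit_sum_cvg.
Qed.

Lemma measurable_odd_digits : measurable_fun setT odd_digits.
Proof. exact: (measurableT_comp measurable_even_digits measurable_shift_digit). Qed.

Lemma even_digits_rec u : even_digits u = (digit u + odd_digits (shift_digit u)) / 2.
Proof.
have c1 : digit_sum n.+1 u @[n --> \oo] --> even_digits u.
  by rewrite (@cvg_shiftS _ (fun n => digit_sum n u) _); exact: digit_sum_cvg.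
have E n : digit_sum n.+1 u = (digit u + digit_sum n (shift_digit (shift_digit u))) / 2.
  rewrite /digit_sum big_ord_recl /= expr1 mulrC mulrDl; congr (_ + _).
  rewrite mulr_suml; apply: eq_bigr => k _; rewrite /bump /= add1n -iterSr -iterSr.
  by rewrite exprS -doubleS; ring.
have EE : (fun n => digit_sum n.+1 u) = (fun n => (digit u + digit_sum n (shift_digit (shift_digit u))) / 2).
  by apply/funext => n; exact: E.
rewrite EE in c1.
have c2 : (digit u + digit_sum n (shift_digit (shift_digit u))) / 2 @[n --> \oo] -->
    (digit u + odd_digits (shift_digit u)) / 2.
  by apply: cvgMl; apply: cvgD; [exact: cvg_cst|exact: digit_sum_cvg].
exact: (cvg_unique _ c1 c2).
Qed.

Lemma unif_itv (A : set R) : measurable A -> lam A = lebesgue_measure (A `&` `[0, 1]).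
Proof.
move=> mA; rewrite /uniform_prob integral_uniform_pdf.
rewrite (eq_integral (fun=> 1%E)); last first.
  move=> x; rewrite inE /= in_itv /= => -[_ x01]; rewrite /uniform_pdf x01 subr0 invr1.
  by [].
by rewrite integral_cst ?mul1e//; exact: measurableI.
Qed.

Lemma lebesgue_half (A : set R) (b : R) : measurable A ->
  (lebesgue_measure ((fun x => 2 * x + b)%R @^-1` A) = (2^-1)%:E * lebesgue_measure A)%E.
Proof.
move=> mA; rewrite (lebesgue_affine b (ltr0n R 2) mA) muleA -EFinM mulVf ?mul1e//.
Qed.

Lemma unif_digit0 (A : set R) : measurable A ->
  lam ([set u | u < 2^-1] `&` shift_digit @^-1` A) = ((2^-1)%:E * lam A)%E.
Proof.
move=> mA.
have m1 : measurable ([set u : R | u < 2^-1] `&` shift_digit @^-1` A).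
  apply: measurableI; last by rewrite -[X in measurable X]setTI; exact: measurable_shift_digit.
  by rewrite (_ : [set u | _] = `]-oo, 2^-1[%classic)//; apply/seteqP; split => x /=; rewrite in_itv.
rewrite !unif_itv//.
have -> : [set u : R | u < 2^-1] `&` shift_digit @^-1` A `&` `[0, 1]%classic =
    (fun x => 2 * x + 0) @^-1` (A `&` `[0, 1[%classic).
  apply/seteqP; split => u /=; rewrite !in_itv /= addr0 /shift_digit /digit.
    move=> [[u2 Au] /andP[u0 _]]; move: Au; rewrite leNgt u2 /= subr0 => Au.
    by split => //; apply/andP; split; lra.
  move=> [Au /andP[u0 u1]]; have u2 : u < 2^-1 by lra.
  by rewrite leNgt u2 /= subr0; split => //; apply/andP; split; lra.
rewrite lebesgue_half; last by apply: measurableI.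
congr (_ * _)%E.
(* The half u < 1/2 is mapped into [0, 1[, so the point 1, of measure 0, has to be discarded. *)
have -> : A `&` `[0, 1]%classic = (A `&` `[0, 1[%classic) `|` (A `&` [set 1]).
  rewrite -setIUr; congr (_ `&` _); apply/seteqP; split => u /=; rewrite !in_itv /=.
    move=> /andP[u0]; rewrite le_eqVlt => /orP[/eqP ->|u1]; [by right|left].
    by rewrite u0.
  by move=> [/andP[-> /ltW]//|->]; rewrite ler01 lexx.
rewrite measureU; last 3 first.
- exact: measurableI.
- by apply: measurableI.
- apply/seteqP; split => u //= [[_]]; rewrite in_itv /= => /andP[_ u1] [_ uE].
  by move: u1; rewrite uE ltxx.
rewrite [X in (_ + X)%E](_ : _ = 0%E) ?adde0//.
apply/eqP; rewrite eq_le measure_ge0 andbT.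
apply: (@le_trans _ _ (lebesgue_measure [set (1 : R)])); last by rewrite lebesgue_measure_set1.
by apply: le_measure; rewrite ?inE//; exact: measurableI.
Qed.

Lemma unif_digit1 (A : set R) : measurable A ->
  lam ([set u | 2^-1 <= u] `&` shift_digit @^-1` A) = ((2^-1)%:E * lam A)%E.
Proof.
move=> mA.
have m1 : measurable ([set u : R | 2^-1 <= u] `&` shift_digit @^-1` A).
  apply: measurableI; last by rewrite -[X in measurable X]setTI; exact: measurable_shift_digit.
  rewrite (_ : [set u | _] = `[2^-1, +oo[%classic)//.
  by apply/seteqP; split => x /=; rewrite in_itv /= andbT.
rewrite !unif_itv//.
have -> : [set u : R | 2^-1 <= u] `&` shift_digit @^-1` A `&` `[0, 1]%classic =
    (fun x => 2 * x + - 1) @^-1` (A `&` `[0, 1]%classic).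
  apply/seteqP; split => u /=; rewrite !in_itv /= /shift_digit /digit.
    move=> [[u2 Au] /andP[u0 u1]]; move: Au; rewrite u2 => Au.
    by split => //; apply/andP; split; lra.
  move=> [Au /andP[u0 u1]]; have u2 : 2^-1 <= u by lra.
  by rewrite u2; split => //; apply/andP; split; lra.
by rewrite lebesgue_half//; exact: measurableI.
Qed.

Let joint (a b : R) := even_digits @^-1` `]a, +oo[ `&` odd_digits @^-1` `]b, +oo[.

Let mpre (f : R -> R) (a : R) : measurable_fun setT f -> measurable (f @^-1` `]a, +oo[%classic).
Proof. by move=> mf; rewrite -[X in measurable X]setTI; apply: mf => //; exact: measurable_itv. Qed.

Let mjoint a b : measurable (joint a b).
Proof. by apply: measurableI; apply: mpre; [exact: measurable_even_digits|exact: measurable_odd_digits]. Qed.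

Let split_half (A : set R) : measurable A ->
  lam A = (lam ([set u | u < 2^-1]%R `&` A) + lam ([set u | 2^-1 <= u]%R `&` A))%E.
Proof.
move=> mA.
have m0 : measurable [set u : R | u < 2^-1].
  by rewrite (_ : [set u | _] = `]-oo, 2^-1[%classic)//; apply/seteqP; split => x /=; rewrite in_itv.
have m1 : measurable [set u : R | 2^-1 <= u].
  rewrite (_ : [set u | _] = `[2^-1, +oo[%classic)//.
  by apply/seteqP; split => x /=; rewrite in_itv /= andbT.
rewrite -measureU; last 3 first.
- exact: measurableI.
- exact: measurableI.
- by apply/seteqP; split => u //= [[u0 _] [u1 _]]; move: u1; rewrite leNgt u0.
rewrite -setIUl (_ : _ `|` _ = setT) ?setTI//.
by apply/seteqP; split => u //= _; case: (ltP u 2^-1) => ?; [left|right].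
Qed.

(** The even digits of u are its leading digit followed by the odd digits of the shifted u, and the
    odd digits of u are the even digits of the shifted u: the shift exchanges the two thresholds. *)
Lemma joint_rec a b : fine (lam (joint a b)) =
  (fine (lam (joint b (2 * a))) + fine (lam (joint b (2 * a - 1)))) / 2.
Proof.
have E0 : [set u : R | u < 2^-1] `&` joint a b =
    [set u | u < 2^-1] `&` shift_digit @^-1` joint b (2 * a).
  apply/seteqP; split => u /= [u2]; rewrite /joint /= !in_itv /= !andbT (even_digits_rec u);
    rewrite /digit leNgt u2 /= ?mulr0n ?add0r ltr_pdivlMr// (mulrC a) -/(odd_digits u);
    by move=> [H1 H2]; split.
have E1 : [set u : R | 2^-1 <= u] `&` joint a b =
    [set u | 2^-1 <= u] `&` shift_digit @^-1` joint b (2 * a - 1).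
  apply/seteqP; split => u /= [u2]; rewrite /joint /= !in_itv /= !andbT (even_digits_rec u);
    rewrite /digit u2 /= ?mulr1n ltr_pdivlMr// (mulrC a) ltrBlDl -/(odd_digits u);
    by move=> [H1 H2]; split.
rewrite (split_half (mjoint a b)) E0 E1 unif_digit0// unif_digit1//.
have f0 := fin_num_measure lam _ (mjoint b (2 * a)); have f1 := fin_num_measure lam _ (mjoint b (2 * a - 1)).
by rewrite -(fineK f0) -(fineK f1) -!EFinM -EFinD /=; field.
Qed.

Let lam01 (A : set R) : measurable A -> `|fine (lam A)| <= 1.
Proof.
move=> mA; rewrite ger0_norm ?fine_ge0// -lee_fin fineK ?fin_num_measure//.
exact: probability_le1.
Qed.

Lemma even_digits_tail a : fine (lam (even_digits @^-1` `]a, +oo[%classic)) = tail_unif a.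
Proof.
have mE x : measurable (even_digits @^-1` `]x, +oo[%classic) by apply: mpre; exact: measurable_even_digits.
(* A threshold of -1 is no condition, since the digit sums are nonnegative; the joint tail thus
   contains the marginal ones. *)
have jE x : joint x (-1) = even_digits @^-1` `]x, +oo[%classic.
  apply/seteqP; split => u; rewrite /joint /= !in_itv /= !andbT; first by case.
  move=> ->; split => //; have /andP[h _] := even_digits01 (shift_digit u).
  by apply: lt_le_trans h; rewrite oppr_lt0.
have jO x : joint (-1) x = odd_digits @^-1` `]x, +oo[%classic.
  apply/seteqP; split => u; rewrite /joint /= !in_itv /= !andbT; first by case.
  move=> ->; split => //; have /andP[h _] := even_digits01 u.
  by apply: lt_le_trans h; rewrite oppr_lt0.
(* The doubling map preserves the uniform law, so odd and even digits have the same law. *)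
have HO x : lam (odd_digits @^-1` `]x, +oo[%classic) = lam (even_digits @^-1` `]x, +oo[%classic).
  rewrite (split_half (mpre x measurable_odd_digits)) /odd_digits.
  have -> : (fun u => even_digits (shift_digit u)) @^-1` `]x, +oo[ =
    shift_digit @^-1` (even_digits @^-1` `]x, +oo[%classic) by [].
  rewrite unif_digit0; last exact: mE. rewrite unif_digit1; last exact: mE. rewrite -muleDl ?fin_num_measure//; last exact: mE.
  by rewrite -EFinD (_ : 2^-1 + 2^-1 = 1)%R ?mul1e//; lra.
apply: (@tail_unif_unique R (fun a => fine (lam (even_digits @^-1` `]a, +oo[%classic)))) => //.
- by move=> x; exact: lam01.
- move=> x x0; rewrite (_ : _ @^-1` _ = setT) ?probability_setT//.
  apply/seteqP; split => u //= _; rewrite in_itv /= andbT.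
  by have /andP[h _] := even_digits01 u; exact: lt_le_trans h.
- move=> x x1; rewrite (_ : _ @^-1` _ = set0) ?measure0//.
  apply/seteqP; split => u //=; rewrite in_itv /= andbT => xu.
  by have /andP[_ h] := even_digits01 u; have := lt_le_trans xu (le_trans h x1); rewrite ltxx.
- move=> x; rewrite -jE joint_rec !jO !HO.
  by [].
Qed.

Lemma unif_tail a : fine (lam `]a, +oo[%classic) = tail_unif a.
Proof.
rewrite unif_itv//.
have [a0|a0] := ltP a 0.
  rewrite (_ : _ `&` _ = `[0, 1]%classic) ?lebesgue_measure_itv/= ?lte_fin ?ltr01 ?oppr0 ?addr0 ?tail_unif_neg// ?sube0//.
  by apply/seteqP; split => u /=; rewrite !in_itv /= andbT; [case|move=> /andP[u0 ->]; rewrite u0 (lt_le_trans a0 u0)].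
rewrite (_ : _ `&` _ = `]a, 1]%classic); last first.
  apply/seteqP; split => u /=; rewrite !in_itv /= andbT; first by move=> [-> /andP[_ ->]].
  by move=> /andP[au ->]; rewrite au (le_trans a0 (ltW au)).
rewrite lebesgue_measure_itv/= lte_fin; have [a1|a1] := ltP a 1.
  by rewrite /= /tail_unif /Num.max /Num.min; repeat (case: ifP => /=); move=> *; lra.
by rewrite tail_unif_ge1.
Qed.

Lemma joint_tail a b : fine (lam (joint a b)) = tail_unif a * tail_unif b.
Proof.
apply: (@tail_unif_unique2 R (fun a b => fine (lam (joint a b)))).
- by move=> x y; exact: lam01.
- move=> x y y0; rewrite -even_digits_tail; congr (fine (lam _)).
  apply/seteqP; split => u; rewrite /joint /= !in_itv /= !andbT; first by case.
  move=> ->; split => //; have /andP[h _] := even_digits01 (shift_digit u).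
  exact: lt_le_trans h.
- move=> x y y1; rewrite (_ : joint x y = set0) ?measure0//.
  apply/seteqP; split => u; rewrite /joint /= !in_itv /= !andbT// => -[_ yu].
  have /andP[_ h] := even_digits01 (shift_digit u).
  by have := lt_le_trans yu (le_trans h y1); rewrite ltxx.
- exact: joint_rec.
Qed.

(** Rays are extended to Borel sets one coordinate at a time, each time by uniqueness of finite
    measures. *)
Lemma digits_independent (A B : set R) : measurable A -> measurable B ->
  lam (even_digits @^-1` A `&` odd_digits @^-1` B) = (lam A * lam B)%E.
Proof.
have mpreE D : measurable D -> measurable (even_digits @^-1` D).
  by move=> mD; rewrite -[X in measurable X]setTI; apply: measurable_even_digits.
have mpreO D : measurable D -> measurable (odd_digits @^-1` D).
  by move=> mD; rewrite -[X in measurable X]setTI; apply: measurable_odd_digits.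
have step1 a D : measurable D ->
    lam (even_digits @^-1` `]a, +oo[ `&` odd_digits @^-1` D) = (lam `]a, +oo[%classic * lam D)%E.
  move=> mD.
  have mI : measurable (even_digits @^-1` `]a, +oo[%classic) by exact: mpreE.
  pose m1 : {measure set (measurableTypeR R) -> \bar R} := pushforward (mrestr lam mI) (odd_digits : measurableTypeR R -> measurableTypeR R).
  have t0 : 0 <= tail_unif a by have /andP[] := tail_unif01 a.
  pose m2 : {measure set (measurableTypeR R) -> \bar R} := mscale (NngNum t0) lam.
  have E x : m1 measurable_odd_digits `]x, +oo[%classic = m2 `]x, +oo[%classic.
    rewrite (_ : m1 _ _ = lam (joint a x)); last by rewrite /joint setIC.
    rewrite (_ : m2 _ = ((tail_unif a)%:E * lam `]x, +oo[%classic)%E)//.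
    rewrite -(fineK (fin_num_measure lam _ (mjoint a x))) joint_tail.
    by rewrite -(fineK (fin_num_measure lam _ (measurable_itv `]x, +oo[))) unif_tail EFinM.
  have F : (m1 measurable_odd_digits setT < +oo)%E.
    rewrite /m1 /pushforward /mrestr; apply: le_lt_trans (ltry 1).
    exact: (probability_le1 lam (measurableI _ _ (mpreO _ measurableT) mI)).
  rewrite setIC; apply: etrans (measure_eq_rays_prob E F mD) _.
  rewrite (_ : m2 _ = ((tail_unif a)%:E * lam D)%E)//.
  by rewrite -(fineK (fin_num_measure lam _ (measurable_itv `]a, +oo[))) unif_tail.
move=> mA mB.
have mI : measurable (odd_digits @^-1` B) by exact: mpreO.
pose m1 : {measure set (measurableTypeR R) -> \bar R} := pushforward (mrestr lam mI) (even_digits : measurableTypeR R -> measurableTypeR R).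
have fB := fin_num_measure lam _ mB.
have t0 : 0 <= fine (lam B) by exact: fine_ge0.
pose m2 : {measure set (measurableTypeR R) -> \bar R} := mscale (NngNum t0) lam.
have E x : m1 measurable_even_digits `]x, +oo[%classic = m2 `]x, +oo[%classic.
  by apply: etrans (step1 x _ mB) _; rewrite (_ : m2 _ = ((fine (lam B))%:E * lam `]x, +oo[%classic)%E)// fineK// muleC.
have F : (m1 measurable_even_digits setT < +oo)%E.
  rewrite /m1 /pushforward /mrestr; apply: le_lt_trans (ltry 1).
  exact: (probability_le1 lam (measurableI _ _ (mpreE _ measurableT) mI)).
apply: etrans (measure_eq_rays_prob E F mA) _.
rewrite (_ : m2 _ = ((fine (lam B))%:E * lam A)%E)//.
by rewrite fineK// muleC.
Qed.

End digits.

(** * A normal variable from a uniform one *)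

Section quantile.
Variable R : realType.
Local Notation N := (@normal_prob R 0 1).
Local Notation lam := (@uniform_prob R 0 1 ltr01).

Let Phi (x : R) : R := fine (N `]-oo, x]%classic).

Let X : {RV N >-> R} := MeasurableFun.Pack (MeasurableFun.Class (isMeasurableFun.Build _ _ (measurableTypeR R) R (@idfun R) (@measurable_id _ R setT))).

Let cdfE x : cdf X x = (Phi x)%:E.
Proof. by rewrite /Phi fineK// fin_num_measure. Qed.

Let Phi_nd x y : x <= y -> Phi x <= Phi y.
Proof. by move=> xy; rewrite -lee_fin -!cdfE; exact: cdf_nondecreasing. Qed.

Let Phi01 x : 0 <= Phi x <= 1.
Proof. by rewrite -!lee_fin -cdfE cdf_ge0 cdf_le1. Qed.

Let Phi_right x u : Phi x < u -> exists2 y, x < y & Phi y < u.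
Proof.
move=> xu; have c : Phi y @[y --> x^'+] --> Phi x.
  apply: fine_cvg; rewrite -cdfE; exact: (@cdf_right_continuous _ _ _ _ X x).
have [y [xy yu]] : exists y, x < y /\ Phi y < u.
  apply: (@filter_ex _ (x^'+)); apply: filterS2 (nbhs_right_gt x) (cvgr_lt _ c _ xu).
  by move=> y xy yu; split.
by exists y.
Qed.

Let Phi_low u : 0 < u -> exists y, Phi y < u.
Proof.
move=> u0; have c : Phi y @[y --> -oo] --> (0 : R) by apply: fine_cvg; exact: (cvg_cdfNy0 X).
exact: (filter_ex (cvgr_lt _ c _ u0)).
Qed.

Let Phi_high u : u < 1 -> exists y, u <= Phi y.
Proof.
move=> u1; have c : Phi y @[y --> +oo] --> (1 : R) by apply: fine_cvg; exact: (cvg_cdfy1 X).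
exact: (filter_ex (cvgr_ge _ c _ u1)).
Qed.

Definition normal_quantile (u : R) : R := inf [set x | u <= Phi x].

(** Right continuity of [Phi] makes the infimum a minimum, and its limits at both infinities make
    the set nonempty and bounded below. *)
Lemma normal_quantileP u x : 0 < u < 1 -> (normal_quantile u <= x) = (u <= Phi x).
Proof.
move=> /andP[u0 u1]; have [y0 y0u] := Phi_low u0; have [y1 y1u] := Phi_high u1.
have hl y : Phi y < u -> lbound [set x | u <= Phi x] y.
  by move=> yu z /= zu; rewrite leNgt; apply/negP => /ltW /Phi_nd zy; move: (le_lt_trans zy yu); rewrite ltNge zu.
apply/idP/idP => [qx|ux]; last by apply: ge_inf => //; exists y0; exact: hl.
rewrite leNgt; apply/negP => xu; have [y xy yu] := Phi_right xu.
have := lb_le_inf (ex_intro _ y1 y1u : nonempty _) (hl _ yu).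
by move=> /le_trans /(_ qx); rewrite leNgt xy.
Qed.

Let uE (x u : R) : 0 < u < 1 -> (x < normal_quantile u) = (Phi x < u).
Proof. by move=> u01; rewrite ltNge normal_quantileP// -ltNge. Qed.

(* Outside ]0, 1[ the infimum is a junk value, hence the restriction. *)
Definition normal_of_unif (u : R) : R := if (0 < u < 1) then normal_quantile u else 0.

Lemma measurable_normal_of_unif : measurable_fun setT normal_of_unif.
Proof.
have E (x : R) : normal_of_unif @^-1` `]x, +oo[%classic =
    (`]0, 1[ `&` `]Phi x, +oo[) `|` ((~` `]0, 1[) `&` [set _ | x < 0]).
  apply/seteqP; split => u; rewrite /normal_of_unif /= !in_itv /= !andbT.
    by case: ifPn => u01 xu; [left; rewrite -uE|right; split => //; apply/negP].
  by move=> [[u01]|[/negP/negbTE -> //]]; rewrite u01 uE.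
apply: (measurability _ (@RGenOInfty.measurableE R)) => //.
move=> _ [_ [x ->] <-]; rewrite setTI E; apply: measurableU.
  by apply: measurableI; exact: measurable_itv.
apply: measurableI; first by apply: measurableC; exact: measurable_itv.
case: (boolP (x < 0)) => x0.
  by rewrite (_ : [set _ | _] = setT)//; apply/seteqP; split.
by rewrite (_ : [set _ | _] = set0)//; apply/seteqP; split.
Qed.

Lemma normal_of_unif_law (A : set R) : measurable A -> lam (normal_of_unif @^-1` A) = N A.
Proof.
have mp D : measurable D -> measurable (normal_of_unif @^-1` D).
  by move=> mD; rewrite -[X in measurable X]setTI; exact: measurable_normal_of_unif.
have mq : measurable_fun setT (normal_of_unif : measurableTypeR R -> measurableTypeR R).
  exact: measurable_normal_of_unif.
pose m1 : {measure set (measurableTypeR R) -> \bar R} :=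
  pushforward lam (normal_of_unif : measurableTypeR R -> measurableTypeR R).
suff E x : m1 mq `]x, +oo[%classic = N `]x, +oo[%classic.
  move=> mA; apply: (@measure_eq_rays_prob R (m1 mq) N E _ _ mA).
  by apply: le_lt_trans (ltry 1); exact: (probability_le1 lam (mp _ measurableT)).
set B := normal_of_unif @^-1` `]x, +oo[%classic.
have mB : measurable B by exact: mp.
have fB : lam B \is a fin_num by exact: fin_num_measure.
have -> : m1 mq `]x, +oo[%classic = lam B by [].
have NE : N `]x, +oo[%classic = (1 - Phi x)%:E.
  rewrite -setCitvl probability_setC; last exact: measurable_itv.
  by rewrite /Phi EFinB fineK// fin_num_measure//; exact: measurable_itv.
have /andP[p0 p1] := Phi01 x.
(* Only lower bounds are proved, for [B] and for its complement; they add up to 1, so both are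
   equalities. *)
have up : ((1 - Phi x)%:E <= lam B)%E.
  rewrite unif_itv//; apply: (@le_trans _ _ (lebesgue_measure `]Phi x, 1[%classic)).
    rewrite lebesgue_measure_itv/= lte_fin; case: ltP => // p1'.
    by rewrite lee_fin; lra.
  apply: le_measure; rewrite ?inE; [exact: measurable_itv| |].
    by apply: measurableI; [exact: mB|exact: measurable_itv].
  move=> u /=; rewrite !in_itv /= => /andP[pu u1].
  have u01 : 0 < u < 1 by rewrite u1 (le_lt_trans p0 pu).
  split; first by rewrite /B /= /normal_of_unif u01 in_itv /= andbT uE.
  by rewrite (ltW u1) (ltW (le_lt_trans p0 pu)).
have lo : ((Phi x)%:E <= lam (~` B))%E.
  rewrite unif_itv; last exact: measurableC.
  apply: (@le_trans _ _ (lebesgue_measure `]0, Phi x[%classic)).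
    rewrite lebesgue_measure_itv/= lte_fin; case: ltP => // p1'; first by rewrite lee_fin oppr0 addr0.
  apply: le_measure; rewrite ?inE; [exact: measurable_itv| |].
    by apply: measurableI; [exact: measurableC|exact: measurable_itv].
  move=> u /=; rewrite !in_itv /= => /andP[u0 up'].
  have u01 : 0 < u < 1 by rewrite u0 (lt_le_trans up' p1).
  split; last by rewrite (ltW u0) (le_trans (ltW up') p1).
  by rewrite /B /= /normal_of_unif u01 in_itv /= andbT uE//; apply/negP; rewrite -leNgt ltW.
have {}lo : ((Phi x)%:E <= 1 - (fine (lam B))%:E)%E.
  suff <- : lam (~` B) = (1 - (fine (lam B))%:E)%E by [].
  by rewrite fineK//; exact: (probability_setC lam mB).
move: up lo; rewrite NE -(fineK fB) -EFinB !lee_fin => up lo.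
by congr EFin; apply/eqP; rewrite eq_le up andbT; lra.
Qed.

End quantile.

Section pairing.
Variable R : realType.
Context d (T : measurableType d) (m : probability T R) (e o : T -> T).
Hypotheses (me : measurable_fun setT e) (mo : measurable_fun setT o).
Hypothesis ind : forall A B, measurable A -> measurable B ->
  m (e @^-1` A `&` o @^-1` B) = (m A * m B)%E.

Lemma pairing_law (F : T * T -> \bar R) : (forall z, 0 <= F z)%E -> measurable_fun setT F ->
  (\int[m]_u F (e u, o u) = \int[m]_v \int[m]_w F (v, w))%E.
Proof.
move=> F0 mF.
have mX : measurable_fun setT (fun u => (e u, o u)) by exact: measurable_fun_pair.
have H C : measurable C -> m ((fun u => (e u, o u)) @^-1` C) = (m \x m)%E C.
  move=> mC; pose m1 : {measure set (T * T) -> \bar R} := pushforward m (fun u => (e u, o u)).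
  rewrite -[LHS]/(m1 mX C); symmetry; apply: product_measure_unique => // A B mA mB; exact: ind.
rewrite (@ge0_integral_law R _ _ _ _ _ _ m (m \x m)%E (fun u => (e u, o u)) id mX (@measurable_id _ _ setT) H F F0 mF).
exact: fubini_tonelli1.
Qed.

End pairing.

Lemma ge0_integral_mul (R : realType) d1 d2 (T1 : measurableType d1) (T2 : measurableType d2)
    (m1 : {measure set T1 -> \bar R}) (m2 : {measure set T2 -> \bar R})
    (f : T1 -> \bar R) (g : T2 -> \bar R) :
  (forall x, 0 <= f x)%E -> measurable_fun setT f ->
  (forall y, 0 <= g y)%E -> measurable_fun setT g ->
  (\int[m1]_x \int[m2]_y (f x * g y) = (\int[m1]_x f x) * \int[m2]_y g y)%E.
Proof.
move=> f0 mf g0 mg.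
under eq_integral do rewrite (ge0_integralZl m2 measurableT mg (fun y _ => g0 y) (f0 _)).
by rewrite (ge0_integralZr m1 measurableT mf (fun y _ => f0 y))//; exact: integral_ge0.
Qed.

(** * Splitting one source into two independent copies *)

Section gauss_split.
Variable R : realType.
Local Notation N := (@normal_prob R 0 1).
Local Notation lam := (@uniform_prob R 0 1 ltr01).
Local Notation q := (@normal_of_unif R).
Local Notation e := (@even_digits R).
Local Notation o := (@odd_digits R).
Local Notation T := (measurableTypeR R * measurableTypeR R)%type.
Let c : R := (Num.sqrt 2)^-1.

Definition gauss_unif : probability T R := (N \x lam)%E.

Definition split1 (z : T) : T := (c * z.1 + c * q (e z.2), e (o z.2)).
Definition split2 (z : T) : T := (c * z.1 - c * q (e z.2), o (o z.2)).

Let mqe : measurable_fun setT (fun z : T => c * q (e z.2)).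
Proof.
apply: measurable_funM => //; apply: (measurableT_comp (@measurable_normal_of_unif R)).
exact: (measurableT_comp (@measurable_even_digits R)).
Qed.

Lemma measurable_split1 : measurable_fun setT split1.
Proof.
apply: measurable_fun_pair; first by apply: measurable_funD => //; exact: measurable_funM.
apply: (measurableT_comp (@measurable_even_digits R)).
exact: (measurableT_comp (@measurable_odd_digits R)).
Qed.

Lemma measurable_split2 : measurable_fun setT split2.
Proof.
apply: measurable_fun_pair; first by apply: measurable_funB => //; exact: measurable_funM.
apply: (measurableT_comp (@measurable_odd_digits R)).
exact: (measurableT_comp (@measurable_odd_digits R)).
Qed.

Let c_gt0 : 0 < c. Proof. by rewrite invr_gt0 sqrtr_gt0. Qed.

Let cc : c ^+ 2 + c ^+ 2 = 1.
Proof. by rewrite /c exprVn sqr_sqrtr//; field. Qed.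

Lemma split_sum z : (split1 z).1 + (split2 z).1 = Num.sqrt 2 * z.1.
Proof.
rewrite /split1 /split2 /= addrACA subrr addr0 -mulrDl; congr (_ * _).
have s0 : Num.sqrt 2 != 0 :> R by rewrite gt_eqF// sqrtr_gt0.
apply: (mulfI s0); rewrite mulrDr /c divff// -expr2 sqr_sqrtr//; lra.
Qed.

(** The odd digits are integrated out first; their own even and odd halves are independent and give
    the product of [a] and [b]. The even digits supply a second normal variable, and the orthogonal
    map preserves the law of the pair of normal variables. *)
Let split_section (f g : T -> \bar R) : (forall z, 0 <= f z)%E -> measurable_fun setT f ->
  (forall z, 0 <= g z)%E -> measurable_fun setT g ->
  (\int[gauss_unif]_z (f (split1 z) * g (split2 z)) =
   (\int[gauss_unif]_z f z) * \int[gauss_unif]_z g z)%E.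
Proof.
move=> f0 mf g0 mg.
have mfx x : measurable_fun setT (fun w => f (x, w)) by exact: (measurableT_comp mf (pair1_measurable x)).
have mgx x : measurable_fun setT (fun w => g (x, w)) by exact: (measurableT_comp mg (pair1_measurable x)).
have ind := @digits_independent R.
have me := @measurable_even_digits R; have mo := @measurable_odd_digits R.
have mq := @measurable_normal_of_unif R.
pose a x := (\int[lam]_w f (x, w))%E; pose b x := (\int[lam]_w g (x, w))%E.
have a0 x : (0 <= a x)%E by exact: integral_ge0.
have b0 x : (0 <= b x)%E by exact: integral_ge0.
have ma : measurable_fun setT a by exact: measurable_integral2.
have mb : measurable_fun setT b by exact: measurable_integral2.
have inner x y : (\int[lam]_w (f (x, e w) * g (y, o w)) = a x * b y)%E.
  rewrite (@pairing_law R _ _ lam e o me mo ind (fun z => f (x, z.1) * g (y, z.2))%E).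
  - exact: (ge0_integral_mul lam lam (fun z => f0 (x, z)) (mfx x) (fun z => g0 (y, z)) (mgx y)).
  - by move=> z; exact: mule_ge0.
  - by apply: emeasurable_funM; [exact: (measurableT_comp (mfx x))|exact: (measurableT_comp (mgx y))].
have mid x : measurable_fun setT (fun v : R => c * x + c * q v).
  by apply: measurable_funD => //; exact: measurable_funM.
have mid' x : measurable_fun setT (fun v : R => c * x - c * q v).
  by apply: measurable_funB => //; exact: measurable_funM.
have middle x : (\int[lam]_u (f (split1 (x, u)) * g (split2 (x, u))) =
    \int[N]_y (a (c * x + c * y)%R * b (c * x - c * y)%R))%E.
  rewrite /split1 /split2 /=.
  rewrite (@pairing_law R _ _ lam e o me mo ind
    (fun z => f (c * x + c * q z.1, e z.2)%R * g (c * x - c * q z.1, o z.2)%R)%E) /=; last 2 first.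
  - by move=> z; exact: mule_ge0.
  - apply: emeasurable_funM.
      apply: (measurableT_comp mf); apply: measurable_fun_pair.
        exact: (measurableT_comp (mid x)).
      exact: (measurableT_comp me).
    apply: (measurableT_comp mg); apply: measurable_fun_pair.
      exact: (measurableT_comp (mid' x)).
    exact: (measurableT_comp mo).
  under eq_integral do rewrite inner.
  apply: (@ge0_integral_law R _ _ _ _ _ _ lam N q id mq (@measurable_id _ _ setT)
    (@normal_of_unif_law R) (fun y => a (c * x + c * y)%R * b (c * x - c * y)%R)%E).
  - by move=> y; exact: mule_ge0.
  - apply: emeasurable_funM.
      by apply: (measurableT_comp ma); apply: measurable_funD => //; exact: measurable_funM.
    by apply: (measurableT_comp mb); apply: measurable_funB => //; exact: measurable_funM.
have fub (h : T -> \bar R) : (forall z, 0 <= h z)%E -> measurable_fun setT h ->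
    (\int[gauss_unif]_z h z = \int[N]_x \int[lam]_u h (x, u))%E.
  by move=> h0 mh; exact: fubini_tonelli1.
rewrite !fub//; last 2 first.
- by move=> z; exact: mule_ge0.
- apply: emeasurable_funM; first exact: (measurableT_comp mf measurable_split1).
  exact: (measurableT_comp mg measurable_split2).
under eq_integral do rewrite middle.
rewrite (@normal_rotation R c c (fun z => a z.1 * b z.2)%E c_gt0 cc).
- exact: (ge0_integral_mul N N a0 ma b0 mb).
- by move=> z; exact: mule_ge0.
- by apply: emeasurable_funM; exact: measurableT_comp.
Qed.

Lemma split_independent A B : measurable A -> measurable B ->
  gauss_unif (split1 @^-1` A `&` split2 @^-1` B) = (gauss_unif A * gauss_unif B)%E.
Proof.
move=> mA mB.
have mi (D : set T) : measurable D -> measurable_fun setT (fun z => (\1_D z : R)%:E).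
  by move=> mD; apply/measurable_EFinP; exact: measurable_indic.
have i0 (D : set T) z : (0 <= (\1_D z : R)%:E)%E by rewrite lee_fin.
have iE (D : set T) : measurable D -> (\int[gauss_unif]_z (\1_D z)%:E = gauss_unif D)%E.
  by move=> mD; exact: (@integral_indic_preimage _ _ _ _ _ gauss_unif id D (@measurable_id _ _ setT) mD).
rewrite -(iE A mA) -(iE B mB) -(split_section (i0 A) (mi A mA) (i0 B) (mi B mB)).
have mp : measurable_fun setT (fun z : T => (split1 z, split2 z)).
  by apply: measurable_fun_pair; [exact: measurable_split1|exact: measurable_split2].
have := @integral_indic_preimage R _ _ _ _ gauss_unif _ (A `*` B) mp (measurableX mA mB).
rewrite [RHS](_ : _ = gauss_unif (split1 @^-1` A `&` split2 @^-1` B))// => <-.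
apply: eq_integral => z _; rewrite -EFinM; congr EFin; rewrite !indicE -natrM mulnb; congr (_%:R).
by rewrite in_setX.
Qed.

Lemma gauss_unif_normal (A : set R) : measurable A -> gauss_unif (fst @^-1` A) = N A.
Proof.
move=> mA; rewrite (_ : _ @^-1` _ = A `*` setT); last by apply/seteqP; split => z //= [].
transitivity (N A * lam setT)%E; first exact: product_measure1E.
by rewrite (probability_setT lam) mule1.
Qed.

End gauss_split.

Lemma finite_measure_eq (R : realType) d (T : measurableType d)
    (m1 m2 : {measure set T -> \bar R}) (G : set (set T)) :
  G `<=` measurable -> setI_closed G -> G setT -> (m1 setT < +oo)%E ->
  (forall C, G C -> m1 C = m2 C) -> forall C, <<s G >> C -> m1 C = m2 C.
Proof.
move=> mG GI GT fin H C GC.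
apply: (@g_sigma_algebra_measure_unique _ R T G mG (fun=> setT) (fun=> GT) _ m1 m2) => //.
by rewrite bigcup_const.
Qed.

(** * Dyadic Brownian motion on a binary tree of sources *)

Section tree.
Context (R : realType) d (T : measurableType d) (P : probability T R) (p1 p2 : T -> T).
Hypotheses (mp1 : measurable_fun setT p1) (mp2 : measurable_fun setT p2).
Hypothesis ind : forall A B, measurable A -> measurable B ->
  P (p1 @^-1` A `&` p2 @^-1` B) = (P A * P B)%E.

(* [node n i] is the source attached to the [i]-th dyadic interval of level
   [n]; its two images under [p1], [p2] feed the two halves of this interval. *)
Fixpoint node n i : T -> T :=
  if n is m.+1 then (if odd i then p2 else p1) \o node m i./2 else p1 \o iter i p2.

Lemma measurable_node n i : measurable_fun setT (node n i).
Proof.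
elim: n i => [|n ih] i /=.
  apply: (measurableT_comp mp1); elim: i => [|i ih]; first exact: measurable_id.
  exact: (measurableT_comp mp2 ih).
by case: (odd i); [exact: (measurableT_comp mp2)|exact: (measurableT_comp mp1)].
Qed.

Let mpre (f : T -> T) A : measurable_fun setT f -> measurable A -> measurable (f @^-1` A).
Proof. by move=> mf mA; rewrite -[X in measurable X]setTI; exact: mf. Qed.

Definition cylinder n N (A : nat -> set T) : set T :=
  \big[setI/setT]_(j < N) (node n j @^-1` A j).

Lemma measurable_cylinder n N A : (forall j, measurable (A j)) -> measurable (cylinder n N A).
Proof.
by move=> mA; apply: bigsetI_measurable => j _; apply: mpre => //; exact: measurable_node.
Qed.

Lemma cylinder_widen n M N A : (M <= N)%N ->
  cylinder n M A = cylinder n N (fun j => if (j < M)%N then A j else setT).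
Proof.
move=> MN; rewrite /cylinder (big_ord_widen N (fun j => node n j @^-1` A j))// big_mkcond.
by apply: eq_bigr => j _; case: (j < M)%N; rewrite ?preimage_setT.
Qed.

Let preimage_bigI (f : T -> T) N (B : nat -> set T) :
  f @^-1` (\big[setI/setT]_(j < N) B j) = \big[setI/setT]_(j < N) (f @^-1` B j).
Proof.
by elim: N => [|N ih]; rewrite ?big_ord0 ?preimage_setT// !big_ord_recr preimage_setI ih.
Qed.

Lemma cylinder_double n N A : cylinder n.+1 N.*2 A =
  cylinder n N (fun i => p1 @^-1` A i.*2 `&` p2 @^-1` A i.*2.+1).
Proof.
elim: N => [|N ih]; first by rewrite /cylinder !big_ord0.
rewrite doubleS /cylinder !big_ord_recr /= -/(cylinder n.+1 N.*2 A) ih /= odd_double /=.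
by rewrite uphalf_double doubleK -setIA preimage_setI.
Qed.

(** At level 0 the successive nodes are split off one at a time by [p2]; at each further level a
    node is replaced by its two independent images. *)
Lemma cylinder_prob n N A : (forall j, measurable (A j)) ->
  P (cylinder n N A) = (\prod_(j < N) P (A j))%E.
Proof.
elim: n N A => [|n ih] N A mA.
  elim: N A mA => [|N ih] A mA; first by rewrite /cylinder !big_ord0 probability_setT.
  rewrite /cylinder !big_ord_recl -(ih (fun j => A j.+1))// -ind//; last exact: measurable_cylinder.
  congr (P (_ `&` _)); rewrite /cylinder (preimage_bigI p2 N (fun j => node 0 j @^-1` A j.+1)).
  apply: eq_bigr => j _; rewrite lift0 (_ : node 0 j.+1 = node 0 j \o p2)//.
  by apply/funext => z; congr (p1 _); exact: iterSr.
have even M B : (forall j, measurable (B j)) ->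
    P (cylinder n.+1 M.*2 B) = (\prod_(j < M.*2) P (B j))%E.
  move=> mB; rewrite cylinder_double ih; last by move=> j; apply: measurableI; exact: mpre.
  elim: M => [|M IH]; first by rewrite !big_ord0.
  by rewrite doubleS !big_ord_recr /= IH ind// muleA.
have NN : (N <= N.*2)%N by rewrite -addnn leq_addr.
(* The [N] cells are completed to [N.*2] by trivial conditions, so that cells come in pairs of
   siblings. *)
rewrite (cylinder_widen _ _ NN) even; last by move=> j; case: ifP.
rewrite (big_ord_widen N.*2 (fun j => P (A j)))// [RHS]big_mkcond.
by apply: eq_bigr => j _; case: ifP; rewrite ?probability_setT.
Qed.

Definition cylinders n i : set (set T) :=
  [set C | exists2 A, (forall j, measurable (A j)) & C = cylinder n i A].

Definition past n i : set (set T) := <<s cylinders n i >>.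

Let cylinders_measurable n i : cylinders n i `<=` measurable.
Proof. by move=> _ [A mA ->]; exact: measurable_cylinder. Qed.

Lemma past_measurable n i : past n i `<=` measurable.
Proof.
by apply: smallest_sub; [exact: sigma_algebra_measurable|exact: cylinders_measurable].
Qed.

Let cylinders_setI n i : setI_closed (cylinders n i).
Proof.
move=> _ _ [A mA ->] [B mB ->]; exists (fun j => A j `&` B j).
  by move=> j; exact: measurableI.
by rewrite /cylinder -big_split; apply: eq_bigr => j _; rewrite preimage_setI.
Qed.

Let cylinders_setT n i : cylinders n i setT.
Proof.
exists (fun=> setT) => //; rewrite /cylinder; elim: i => [|i ih]; first by rewrite big_ord0.
by rewrite big_ord_recr /= preimage_setT setIT.
Qed.

Lemma past_node n i j A : (j < i)%N -> measurable A -> past n i (node n j @^-1` A).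
Proof.
move=> ji mA; apply: sub_sigma_algebra; exists (fun k => if k == j then A else setT).
  by move=> k; case: ifP.
rewrite /cylinder (bigD1 (Ordinal ji))//= eqxx big1 ?setIT// => k.
by rewrite -val_eqE /= => /negbTE ->; rewrite preimage_setT.
Qed.

Lemma node_law n i A : measurable A -> P (node n i @^-1` A) = P A.
Proof.
move=> mA; pose B k := if k == i then A else setT.
have mB k : measurable (B k) by rewrite /B; case: ifP.
have := cylinder_prob n i.+1 mB; rewrite /cylinder !big_ord_recr /= /B eqxx.
rewrite !big1 ?setTI ?mul1e//.
  by move=> k _; rewrite (ltn_eqF (ltn_ord k)) probability_setT.
by move=> k _; rewrite (ltn_eqF (ltn_ord k)) preimage_setT.
Qed.

Lemma past_independent n i C D : past n i C -> measurable D ->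
  P (C `&` node n i @^-1` D) = (P C * P D)%E.
Proof.
move=> pC mD.
have mN : measurable (node n i @^-1` D) by apply: mpre => //; exact: measurable_node.
have f0 : 0 <= fine (P D) by exact: fine_ge0.
pose m1 : {measure set T -> \bar R} := mrestr P mN.
pose m2 : {measure set T -> \bar R} := mscale (NngNum f0) P.
have M2 B : m2 B = (P B * P D)%E.
  by rewrite muleC -[X in (X * _)%E](fineK (fin_num_measure P _ mD)).
rewrite -M2 -[LHS]/(m1 C).
apply: (finite_measure_eq (@cylinders_measurable n i) (@cylinders_setI n i) (cylinders_setT n i) _ _ pC).
  apply: (@le_lt_trans _ _ 1%E); last exact: ltry.
  by apply: probability_le1; exact: measurableI.
move=> _ [A mA ->]; rewrite M2 /m1 /= /mrestr.
pose B k := if k == i then D else A k.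
have mB k : measurable (B k) by rewrite /B; case: ifP.
have := cylinder_prob n i.+1 mB; rewrite {1}/cylinder !big_ord_recr /= /B eqxx.
rewrite (_ : \big[_/_]_(_ < i) _ = cylinder n i A) => [->|].
  rewrite cylinder_prob//; congr (_ * _)%E; apply: eq_bigr => k _.
  by rewrite (ltn_eqF (ltn_ord k)).
by apply: eq_bigr => k _; rewrite (ltn_eqF (ltn_ord k)).
Qed.

Lemma past_sigma n i : sigma_algebra setT (past n i).
Proof. exact: smallest_sigma_algebra. Qed.

(** A finer node is a function of its ancestor, so the past at a coarse level contains the past at
    finer levels. *)
Lemma past_refine n p k j A : (j < k * 2 ^ p)%N -> measurable A ->
  past n k (node (n + p) j @^-1` A).
Proof.
elim: p j A => [|p ih] j A; first by rewrite expn0 muln1 addn0; exact: past_node.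
rewrite addnS expnS mulnCA => jk mA /=.
have jp : (j./2 < k * 2 ^ p)%N by rewrite ltn_half_double -mul2n.
by case: (odd j); apply: (ih _ (_ @^-1` A)) => //; exact: mpre.
Qed.

Variable g : T -> R.
Hypothesis mg : measurable_fun setT g.
Hypothesis g_law : forall A, measurable A -> P (g @^-1` A) = normal_prob 0 1 A.
Hypothesis g_sum : forall z, g (p1 z) + g (p2 z) = Num.sqrt 2 * g z.

Definition noise n i z : R := Num.sqrt (mesh R n) * g (node n i z).
Definition walk n i z : R := \sum_(j < i) noise n j z.

Lemma walk_double n i z : walk n.+1 i.*2 z = walk n i z.
Proof.
rewrite /walk; elim: i => [|i ih]; first by rewrite !big_ord0.
rewrite doubleS !big_ord_recr /= ih -addrA; congr (_ + _).
rewrite /noise /= odd_double uphalf_double doubleK /= -mulrDr g_sum mulrA; congr (_ * _).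
by rewrite (meshS R n) sqrtrM// mulrC.
Qed.

Lemma walk_refine n p i z : walk (n + p) (i * 2 ^ p) z = walk n i z.
Proof.
elim: p => [|p ih]; first by rewrite expn0 muln1 addn0.
by rewrite addnS expnS mulnCA mul2n walk_double.
Qed.

(** Refinement does not change the walk, so at a dyadic time the sequence is eventually constant. *)
Definition dyadic_bm (t : R) (z : T) : R := limn (fun n => walk n (tr n t) z).

Lemma dyadic_bmE n i z : dyadic_bm (dyad R n i) z = walk n i z.
Proof.
apply: cvg_lim => //; apply: cvg_near_cst; near=> m.
have nm : (n <= m)%N by near: m; exact: nbhs_infty_ge.
by rewrite tr_dyad// -{1}(subnKC nm) walk_refine.
Unshelve. all: by end_near. Qed.

(** [past n i] grows as the level gets coarser, because a node carries the randomness of all its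
    descendants. Intersecting over all dyadic times from [t] on gives a family that singles out no
    level and is monotone in [t]. *)
Definition bm_filtration (t : R) : set (set T) :=
  [set C | forall n i, t <= dyad R n i -> past n i C].

Lemma bm_filtration_sigma t : sigma_algebra setT (bm_filtration t).
Proof.
split.
- by move=> n i _; have [] := past_sigma n i.
- by move=> A FA n i ti; have [_ h _] := past_sigma n i; apply: h; exact: FA.
- by move=> A FA n i ti; have [_ _ h] := past_sigma n i; apply: h => k; exact: FA.
Qed.

Lemma bm_filtration_measurable t : bm_filtration t `<=` measurable.
Proof.
move=> C /(_ 0%N (Num.truncn `|t|).+1) h; apply: (@past_measurable 0%N (Num.truncn `|t|).+1).
apply: h; rewrite /dyad /mesh expr0 invr1 mulr1; apply: le_trans (ler_norm t) _.
by have /andP[_ /ltW] := truncn_itv (normr_ge0 t).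
Qed.

Lemma bm_filtration_mono s t : s <= t -> bm_filtration s `<=` bm_filtration t.
Proof. by move=> st C h n i ti; apply: h; exact: le_trans ti. Qed.

Lemma bm_filtration_past n i : bm_filtration (dyad R n i) `<=` past n i.
Proof. by move=> C; apply. Qed.

Lemma past_walk n i m k : dyad R n i <= dyad R m k ->
  measurable_fun setT (walk n i : subsig (past m k) -> R).
Proof.
(* The walk is rewritten at a level fine enough for both indices, where it involves only nodes below
   the index [k]. *)
move=> nk; pose N := maxn n m.
have nN : (n <= N)%N := leq_maxl _ _; have mN : (m <= N)%N := leq_maxr _ _.
have le : (i * 2 ^ (N - n) <= k * 2 ^ (N - m))%N.
  have := dyad_exp R n (N - n) i; have := dyad_exp R m (N - m) k.
  by rewrite !subnKC// -(ler_dyad R N) => -> ->.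
rewrite (_ : walk n i = fun z => \sum_(j < i * 2 ^ (N - n)) noise N j z); last first.
  by apply/funext => z; rewrite -(walk_refine n (N - n)) subnKC.
apply: measurable_sum => j; apply: measurable_funM => //.
move=> _ D mD; rewrite setTI measurable_subsig; last exact: past_sigma.
rewrite -[X in past m k X](_ : node N j @^-1` (g @^-1` D) = _)//.
rewrite -{1}(subnKC mN); apply: past_refine.
  by apply: leq_trans le; exact: ltn_ord.
by rewrite -[X in measurable X]setTI; exact: mg.
Qed.

Lemma dyadic_bm_adapted n i : measurable_fun setT
  (dyadic_bm (dyad R n i) : subsig (bm_filtration (dyad R n i)) -> R).
Proof.
move=> _ D mD; rewrite setTI measurable_subsig; last exact: bm_filtration_sigma.
move=> m k ik; have := past_walk ik measurableT mD.
rewrite setTI measurable_subsig; last exact: past_sigma.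
by congr (past m k _); apply/seteqP; split => z /=; rewrite dyadic_bmE.
Qed.

Lemma dyadic_bm_incr n i z :
  dyadic_bm (dyad R n i.+1) z - dyadic_bm (dyad R n i) z = noise n i z.
Proof. by rewrite !dyadic_bmE /walk big_ord_recr /= addrAC subrr add0r. Qed.

Lemma noise_independent n i C (h : measurableTypeR R -> \bar R) : past n i C ->
  (forall x, 0 <= h x)%E -> measurable_fun setT h ->
  (\int[P]_z ((\1_C z)%:E * h (g (node n i z))) = P C * \int[normal_prob 0 1]_x h x)%E.
Proof.
move=> pC h0 mh; have mC := past_measurable pC.
have PC : (fine (P C))%:E = P C by rewrite fineK// fin_num_measure.
have c0 : (0 <= (fine (P C))%:E)%E by rewrite lee_fin fine_ge0.
rewrite -PC -(ge0_integralZl (normal_prob 0 1) measurableT mh (fun x _ => h0 x) c0).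
have mgn : measurable_fun setT (fun z => g (node n i z)).
  exact: (measurableT_comp mg (@measurable_node n i)).
have mgpre (D : set R) : measurable D -> measurable (g @^-1` D).
  by move=> mD; rewrite -[X in measurable X]setTI; exact: mg.
apply: (@ge0_integral_transfer R _ _ _ _ _ _ P (normal_prob 0 1) (fun z => g (node n i z)) id
  (fun z => (\1_C z)%:E) (fun=> (fine (P C))%:E) mgn (@measurable_id _ _ setT)) => //.
- by apply/measurable_EFinP; exact: measurable_indic.
- move=> D mD.
  have m1D : measurable_fun setT (fun x : measurableTypeR R => (\1_D x : R)%:E).
    by apply/measurable_EFinP; exact: measurable_indic.
  rewrite (ge0_integralZl (normal_prob 0 1) measurableT m1D _ c0)//.
  rewrite (@integral_indic_preimage _ _ _ _ _ (normal_prob 0 1) id D (@measurable_id _ _ setT) mD).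
  rewrite PC; transitivity (P C * P (g @^-1` D))%E; last by congr (_ * _)%E; exact: (g_law mD).
  rewrite -(past_independent pC (mgpre D mD)).
  under eq_integral do rewrite -EFinM.
  have mCD : measurable (C `&` node n i @^-1` (g @^-1` D)).
    by apply: measurableI => //; rewrite -[X in measurable X]setTI; apply: mgn.
  transitivity (\int[P]_z (\1_(C `&` node n i @^-1` (g @^-1` D)) z)%:E)%E.
    by apply: eq_integral => z _; rewrite /= indicI.
  exact: (@integral_indic_preimage R _ _ _ _ P id _ (@measurable_id _ _ setT) mCD).
Qed.

Local Notation E f := (Rintegral P setT f).
Local Notation EN f := (Rintegral (normal_prob 0 1) setT f).

Lemma noise_integ n i (h : R -> R) : integ (normal_prob 0 1) h ->
  integ P (fun z => h (g (node n i z))).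
Proof.
move=> Ih; have mh := integ_meas Ih.
have mgn : measurable_fun setT (fun z => g (node n i z)).
  exact: (measurableT_comp mg (@measurable_node n i)).
apply/integrableP; split; first by apply/measurable_EFinP; exact: (measurableT_comp mh mgn).
have pT : past n i setT by have [h0 hC _] := past_sigma n i; rewrite -setC0 -setTD; exact: hC.
have mah : measurable_fun setT (fun x => `|(h x)%:E|%E).
  by apply: measurableT_comp => //; exact/measurable_EFinP.
have := noise_independent pT (fun x => abse_ge0 (h x)%:E) mah.
rewrite probability_setT mul1e => EE; have /integrableP[_] := Ih; rewrite -EE; apply: le_lt_trans.
by rewrite le_eqVlt; apply/orP; left; apply/eqP; apply: eq_integral => z _; rewrite indicT mul1e.
Qed.

Lemma E_noise_independent n i C (h : R -> R) : past n i C -> integ (normal_prob 0 1) h ->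
  E (fun z => \1_C z * h (g (node n i z))) = fine (P C) * EN h.
Proof.
move=> pC Ih; have mh := integ_meas Ih; have mC := past_measurable pC.
have pos (k : R -> R) : integ (normal_prob 0 1) k -> (forall x, 0 <= k x) ->
    E (fun z => \1_C z * k (g (node n i z))) = fine (P C) * EN k.
  move=> Ik k0; have mk := integ_meas Ik; apply: EFin_inj.
  rewrite -EFinE; last by apply: integ_indicM => //; exact: noise_integ.
  rewrite EFinM fineK ?fin_num_measure// -(EFinE Ik).
  rewrite -(noise_independent pC (fun x => k0 x : (0 <= (k x)%:E)%E)); last exact/measurable_EFinP.
  by apply: eq_integral => z _; rewrite EFinM.
pose hp x := Num.max (h x) 0; pose hm x := Num.max (- h x) 0.
have hE x : h x = hp x - hm x.
  by rewrite /hp /hm; case: (leP (h x) 0); case: (leP (- h x) 0); lra.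
have Ip : integ (normal_prob 0 1) hp.
  apply: (integ_le _ (integ_norm Ih)); first exact: measurable_maxr.
  by move=> x; rewrite ger0_norm ?le_max ?lexx ?orbT// ge_max ler_norm normr_ge0.
have Im : integ (normal_prob 0 1) hm.
  apply: (integ_le _ (integ_norm Ih)); first by apply: measurable_maxr => //; exact: measurableT_comp.
  by move=> x; rewrite ger0_norm ?le_max ?lexx ?orbT// ge_max -normrN ler_norm normr_ge0.
have h0p x : 0 <= hp x by rewrite le_max lexx orbT.
have h0m x : 0 <= hm x by rewrite le_max lexx orbT.
under eq_Rintegral do rewrite hE mulrBr.
rewrite EB; [|by apply: integ_indicM => //; exact: noise_integ..].
rewrite !pos// -mulrBr -EB//; congr (_ * _).
by apply: eq_Rintegral => x _; rewrite hE.
Qed.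

End tree.

(** * Images of laws and product spaces *)

Section transfer.
Context (R : realType) d1 d2 (O1 : measurableType d1) (O2 : measurableType d2).
Variables (P1 : probability O1 R) (P2 : probability O2 R) (X : O1 -> O2).
Hypotheses (mX : measurable_fun setT X).
Hypothesis lawX : forall A, measurable A -> P1 (X @^-1` A) = P2 A.

Let transfer (f : O2 -> \bar R) : (forall x, 0 <= f x)%E -> measurable_fun setT f ->
  (\int[P1]_w f (X w) = \int[P2]_x f x)%E.
Proof.
exact: (@ge0_integral_law R _ _ _ _ _ _ P1 P2 X id mX (@measurable_id _ _ setT) lawX).
Qed.

Lemma integ_law f : integ P2 f -> integ P1 (fun w => f (X w)).
Proof.
move=> If; have mf := integ_meas If; apply/integrableP; split.
  by apply/measurable_EFinP; exact: (measurableT_comp mf mX).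
have ma : measurable_fun setT (fun x => `|(f x)%:E|%E).
  by apply: measurableT_comp => //; exact/measurable_EFinP.
have /integrableP[_] := If; apply: le_lt_trans.
by rewrite -(transfer (fun x => abse_ge0 (f x)%:E) ma).
Qed.

Lemma E_law f : integ P2 f ->
  Rintegral P1 setT (fun w => f (X w)) = Rintegral P2 setT f.
Proof.
move=> If; have mf := integ_meas If.
have pos (k : O2 -> R) : integ P2 k -> (forall x, 0 <= k x) ->
    Rintegral P1 setT (fun w => k (X w)) = Rintegral P2 setT k.
  move=> Ik k0; have mk := integ_meas Ik; apply: EFin_inj.
  rewrite -!EFinE//; last exact: integ_law.
  by rewrite (transfer (fun x => k0 x : (0 <= (k x)%:E)%E))//; exact/measurable_EFinP.
pose hp x := Num.max (f x) 0; pose hm x := Num.max (- f x) 0.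
have hE x : f x = hp x - hm x.
  by rewrite /hp /hm; case: (leP (f x) 0); case: (leP (- f x) 0); lra.
have Ip : integ P2 hp.
  apply: (integ_le _ (integ_norm If)); first exact: measurable_maxr.
  by move=> x; rewrite ger0_norm ?le_max ?lexx ?orbT// ge_max ler_norm normr_ge0.
have Im : integ P2 hm.
  apply: (integ_le _ (integ_norm If)); first by apply: measurable_maxr => //; exact: measurableT_comp.
  by move=> x; rewrite ger0_norm ?le_max ?lexx ?orbT// ge_max -normrN ler_norm normr_ge0.
have h0p x : 0 <= hp x by rewrite le_max lexx orbT.
have h0m x : 0 <= hm x by rewrite le_max lexx orbT.
under eq_Rintegral do rewrite hE.
rewrite EB; [|exact: integ_law..].
by rewrite !pos// -EB//; apply: eq_Rintegral => x _; rewrite hE.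
Qed.

Lemma sqint_law f : sqint P2 f -> sqint P1 (fun w => f (X w)).
Proof.
move=> [mf If]; split; first exact: (measurableT_comp mf mX).
exact: (integ_law If).
Qed.

End transfer.

Section product.
Context (R : realType) d1 d2 (O1 : measurableType d1) (O2 : measurableType d2).
Variables (P1 : probability O1 R) (P2 : probability O2 R).
Local Notation P := (P1 \x P2)%E.

Lemma fst_law A : measurable A -> P (fst @^-1` A) = P1 A.
Proof.
move=> mA; rewrite (_ : _ @^-1` _ = A `*` setT); last by apply/seteqP; split => z //= [].
transitivity (P1 A * P2 setT)%E; first exact: product_measure1E.
by rewrite (probability_setT P2) mule1.
Qed.

Lemma snd_law A : measurable A -> P (snd @^-1` A) = P2 A.
Proof.
move=> mA; rewrite (_ : _ @^-1` _ = setT `*` A); last by apply/seteqP; split => z //= [].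
transitivity (P1 setT * P2 A)%E; first exact: product_measure1E.
by rewrite (probability_setT P1) mul1e.
Qed.

Lemma E_fst_section h k : integ P h -> (forall w, integ P2 (fun z => h (w, z))) ->
  (forall w, Rintegral P2 setT (fun z => h (w, z)) = k w) ->
  Rintegral P setT h = Rintegral P1 setT k.
Proof.
move=> Ih Is H; rewrite /Rintegral; congr fine.
rewrite -(integral12_prod_meas1 Ih); apply: eq_integral => w _.
by rewrite -H -EFinE.
Qed.

Lemma E_snd_section h k : integ P h -> (forall z, integ P1 (fun w => h (w, z))) ->
  (forall z, Rintegral P1 setT (fun w => h (w, z)) = k z) ->
  Rintegral P setT h = Rintegral P2 setT k.
Proof.
move=> Ih Is H; rewrite /Rintegral; congr fine.
rewrite -(integral21_prod_meas1 Ih); apply: eq_integral => w _.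
by rewrite -H -EFinE.
Qed.

End product.

(** * The product of two filtrations *)

Section product_filtration.
Context (R : realType) d1 d2 (O1 : measurableType d1) (O2 : measurableType d2).
Variables (F1 : R -> set (set O1)) (F2 : R -> set (set O2)).
Hypotheses (hF1 : filtration F1) (hF2 : filtration F2).

(** Defined by sections and not by generators: integrating first over one factor leaves a section
    that lies in the filtration of that factor. *)
Definition prod_filtration (t : R) : set (set (O1 * O2)) :=
  [set C | [/\ measurable C, forall w, F2 t [set z | C (w, z)] &
              forall z, F1 t [set w | C (w, z)]]].

Lemma prod_filtrationP : filtration prod_filtration.
Proof.
have [s1 m1 i1] := hF1; have [s2 m2 i2] := hF2; split.
- move=> t t0; split.
  + split=> [|w|z]; first exact: measurable0.
      by have [h _ _] := s2 t t0.
    by have [h _ _] := s1 t t0.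
  + move=> A [mA A2 A1]; split=> [|w|z]; first by rewrite setTD; exact: measurableC.
      by have [_ h _] := s2 t t0; have := h _ (A2 w); rewrite !setTD.
    by have [_ h _] := s1 t t0; have := h _ (A1 z); rewrite !setTD.
  + move=> A FA; split=> [|w|z].
    * by apply: bigcupT_measurable => n; have [] := FA n.
    * by have [_ _ h] := s2 t t0; apply: (h (fun n => [set z | A n (w, z)])) => n; have [] := FA n.
    * by have [_ _ h] := s1 t t0; apply: (h (fun n => [set w | A n (w, z)])) => n; have [] := FA n.
- by move=> t t0 A [].
- by move=> s t s0 st A [mA A2 A1]; split=> // x; [exact: i2 (A2 x)|exact: i1 (A1 x)].
Qed.

Let setT_F1 t : 0 <= t -> F1 t setT.
Proof. by move=> t0; have [s1 _ _] := hF1; have [h0 hC _] := s1 t t0; rewrite -setC0 -setTD; exact: hC. Qed.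

Let setT_F2 t : 0 <= t -> F2 t setT.
Proof. by move=> t0; have [s1 _ _] := hF2; have [h0 hC _] := s1 t t0; rewrite -setC0 -setTD; exact: hC. Qed.

Lemma prod_filtration_fst t A : 0 <= t -> F1 t A -> prod_filtration t (fst @^-1` A).
Proof.
move=> t0 FA; have [_ m1 _] := hF1; split => // [|w].
  by rewrite -[X in measurable X]setTI; apply: measurable_fst => //; exact: m1 FA.
have [Aw|Aw] := pselect (A w).
  by rewrite (_ : [set _ | _] = setT); [exact: setT_F2|apply/seteqP; split].
by rewrite (_ : [set _ | _] = set0); [have [s2 _ _] := hF2; have [] := s2 t t0|apply/seteqP; split].
Qed.

Lemma prod_filtration_snd t A : 0 <= t -> F2 t A -> prod_filtration t (snd @^-1` A).
Proof.
move=> t0 FA; have [_ m2 _] := hF2; split => // [|w].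
  by rewrite -[X in measurable X]setTI; apply: measurable_snd => //; exact: m2 FA.
have [Aw|Aw] := pselect (A w).
  by rewrite (_ : [set _ | _] = setT); [exact: setT_F1|apply/seteqP; split].
by rewrite (_ : [set _ | _] = set0); [have [s2 _ _] := hF1; have [] := s2 t t0|apply/seteqP; split].
Qed.

Lemma adapted_fst t (f : O1 -> R) : 0 <= t -> measurable_fun setT (f : subsig (F1 t) -> R) ->
  measurable_fun setT (f \o fst : subsig (prod_filtration t) -> R).
Proof.
move=> t0 mf _ D mD; have := mf measurableT D mD; rewrite !setTI.
have [s1 _ _] := hF1; have [s _ _] := prod_filtrationP.
rewrite !measurable_subsig; [|exact: s|exact: s1].
exact: prod_filtration_fst.
Qed.

Lemma adapted_snd t (f : O2 -> R) : 0 <= t -> measurable_fun setT (f : subsig (F2 t) -> R) ->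
  measurable_fun setT (f \o snd : subsig (prod_filtration t) -> R).
Proof.
move=> t0 mf _ D mD; have := mf measurableT D mD; rewrite !setTI.
have [s1 _ _] := hF2; have [s _ _] := prod_filtrationP.
rewrite !measurable_subsig; [|exact: s|exact: s1].
exact: prod_filtration_snd.
Qed.

End product_filtration.

(** * The mass process with an independent noise *)

Section noisy_extension.
Context (R : realType) d (Omega : measurableType d) (P : probability Omega R).
Variables (delta : R) (F : R -> set (set Omega)) (M : R -> Omega -> R).
Hypotheses (delta0 : 0 <= delta) (hF : filtration F).
Hypothesis M_ad : forall t, 0 <= t -> measurable_fun setT (M t : subsig (F t) -> R).
Hypothesis M_ge0 : forall t w, 0 <= t -> 0 <= M t w.
Hypothesis M_sq : forall t, 0 <= t -> sqint P (M t).
Local Notation E f := (Rintegral P setT f).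
Hypothesis m1 : forall s h C, 0 <= s -> 0 <= h -> F s C ->
  E (fun w => \1_C w * incM delta M s h w) = 0.
Hypothesis m2 : forall s h C, 0 <= s -> 0 <= h -> F s C ->
  E (fun w => \1_C w * incM delta M s h w ^+ 2) =
  E (fun w => \1_C w * (4 * M s w * h + 2 * delta * h ^+ 2)).
Hypothesis M_small : forall eta : R, 0 < eta -> exists2 e0 : R, 0 < e0 &
  forall e u, 0 < e <= e0 -> eta <= u -> E (fun w => qf e (M u w)) <= eta.
Hypothesis m4 : forall T, exists2 K, 0 <= K & forall s h, 0 <= s -> 0 <= h -> s + h <= T ->
  integ P (fun w => incM delta M s h w ^+ 4) /\
  E (fun w => incM delta M s h w ^+ 4) <= K * h ^+ 2.
Hypothesis M_cont : forall w, {within `[0, +oo[, continuous (M ^~ w)}.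

Local Notation T := (measurableTypeR R * measurableTypeR R)%type.
Local Notation nu := (gauss_unif R).
Local Notation s1 := (@split1 R).
Local Notation s2 := (@split2 R).
Let g (z : T) : R := z.1.
Local Notation P' := (P \x nu)%E.
Local Notation E' f := (Rintegral P' setT f).

Let ms1 := @measurable_split1 R.
Let ms2 := @measurable_split2 R.
Let mg : measurable_fun setT g. Proof. exact: measurable_fst. Qed.
Let g_law A : measurable A -> nu (g @^-1` A) = normal_prob 0 1 A.
Proof. exact: gauss_unif_normal. Qed.
Let g_sum z : g (s1 z) + g (s2 z) = Num.sqrt 2 * g z.
Proof. exact: split_sum. Qed.

Let F2 : R -> set (set T) := bm_filtration s1 s2.
Let hF2 : filtration F2.
Proof.
split; first by move=> t _; exact: bm_filtration_sigma.
  by move=> t _; exact: (bm_filtration_measurable ms1 ms2).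
by move=> s t _; exact: bm_filtration_mono.
Qed.

Let F' := prod_filtration F F2.
Let M' t (w : Omega * T) := M t w.1.
Let W t (w : Omega * T) := dyadic_bm s1 s2 g t w.2.

Let incWE n i w : incW W n i w = Num.sqrt (mesh R n) * g (node s1 s2 n i w.2).
Proof. exact: (dyadic_bm_incr g_sum). Qed.

Let mfst : measurable_fun setT (fst : Omega * T -> Omega). Proof. exact: measurable_fst. Qed.
Let msnd : measurable_fun setT (snd : Omega * T -> T). Proof. exact: measurable_snd. Qed.

Let secO s C z : 0 <= s -> F' s C -> F s [set w | C (w, z)].
Proof. by move=> _ []. Qed.

Let inc_sq s h : 0 <= s -> 0 <= h -> sqint P (incM delta M s h).
Proof.
move=> s0 h0; apply: sqintB; last exact: sqint_cst.
by apply: sqintB; apply: M_sq => //; exact: addr_ge0.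
Qed.

Let indic_sec2 (C : set (Omega * T)) w z : \1_C (w, z) = \1_[set z | C (w, z)] z :> R.
Proof. by []. Qed.

Let indic_sec1 (C : set (Omega * T)) w z : \1_C (w, z) = \1_[set w | C (w, z)] w :> R.
Proof. by []. Qed.

Let Fm s C : 0 <= s -> F s C -> measurable C.
Proof. by have [_ h _] := hF => s0; exact: h. Qed.

(** Integrates over the original space first, with the noise fixed: the sections of [C] lie in
    [F s], where the hypothesis applies. *)
Let ext_snd s C (f f2 : Omega -> R) : 0 <= s -> F' s C -> integ P f -> integ P f2 ->
  (forall D, F s D -> E (fun w => \1_D w * f w) = E (fun w => \1_D w * f2 w)) ->
  E' (fun w => \1_C w * f w.1) = E' (fun w => \1_C w * f2 w.1).
Proof.
move=> s0 FC If If2 H; have [mC _ _] := FC.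
have aux k : integ P k -> E' (fun w => \1_C w * k w.1) =
    Rintegral nu setT (fun z => E (fun w => \1_[set w | C (w, z)] w * k w)).
  move=> Ik; apply: (E_snd_section (h := fun w => \1_C w * k w.1)) => //.
    by apply: integ_indicM => //; exact: (integ_law mfst (fst_law P nu)).
  by move=> z; apply: integ_indicM => //; apply: (Fm s0); exact: (secO z s0).
rewrite !aux//; apply: eq_Rintegral => z _; apply: H; exact: secO.
Qed.

Let m1' s h C : 0 <= s -> 0 <= h -> F' s C ->
  E' (fun w => \1_C w * incM delta M' s h w) = 0.
Proof.
move=> s0 h0 FC.
rewrite (@ext_snd s C (incM delta M s h) (fun=> 0) s0 FC).
- by under eq_Rintegral do rewrite mulr0; exact: E_cst.
- exact/sqint_integ/inc_sq.
- exact: integ_cst.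
- by move=> D FD; rewrite m1//; under eq_Rintegral do rewrite mulr0; rewrite E_cst.
Qed.

Let m2' s h C : 0 <= s -> 0 <= h -> F' s C ->
  E' (fun w => \1_C w * incM delta M' s h w ^+ 2) =
  E' (fun w => \1_C w * (4 * M' s w * h + 2 * delta * h ^+ 2)).
Proof.
move=> s0 h0 FC.
apply: (@ext_snd s C (fun w => incM delta M s h w ^+ 2)
  (fun w => 4 * M s w * h + 2 * delta * h ^+ 2) s0 FC).
- by have [] := inc_sq s0 h0.
- apply: integD; last exact: integ_cst.
  have -> : (fun w => 4 * M s w * h) = (fun w => (4 * h) * M s w) by apply/funext => w; ring.
  by apply: integZ; apply: sqint_integ; exact: M_sq.
- by move=> D FD; exact: m2.
Qed.

Let mnode n i : measurable_fun setT (node s1 s2 n i : T -> T).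
Proof. exact: measurable_node. Qed.

Let gn n i (w : Omega * T) : measurableTypeR R := g (node s1 s2 n i w.2).

Let mgn n i : measurable_fun setT (gn n i).
Proof. by apply: (measurableT_comp mg); exact: (measurableT_comp (mnode n i)). Qed.

Let gn_law n i A : measurable A -> P' (gn n i @^-1` A) = normal_prob 0 1 A.
Proof.
move=> mA; have mgA : measurable (g @^-1` A) by rewrite -[X in measurable X]setTI; exact: mg.
have mnA : measurable (node s1 s2 n i @^-1` (g @^-1` A)).
  by rewrite -[X in measurable X]setTI; exact: mnode.
transitivity (nu (node s1 s2 n i @^-1` (g @^-1` A))); first exact: (snd_law P nu mnA).
rewrite (node_law ms1 ms2 (@split_independent R) n i mgA); exact: g_law.
Qed.

Let sq_noise n i : sqint P' (gn n i).
Proof.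
split; first exact: mgn.
by apply: (integ_law (mgn n i) (@gn_law n i) (f := fun x => x ^+ 2)); exact: normal_integ_pow.
Qed.

Let W_sq n i : sqint P' (W (dyad R n i)).
Proof.
have -> : W (dyad R n i) = fun w => \sum_(j < i) (Num.sqrt (mesh R n) * gn n j w).
  by apply/funext => w; rewrite /W (dyadic_bmE g_sum).
apply: (@sqint_sum _ _ _ P' 'I_i (index_enum 'I_i) (fun j w => Num.sqrt (mesh R n) * gn n j w)) => j.
by apply: sqintZ; exact: sq_noise.
Qed.

Let mpast n i (C : set (Omega * T)) w : F' (dyad R n i) C -> past s1 s2 n i [set z | C (w, z)].
Proof. by move=> [_ /(_ w) h _]; exact: (bm_filtration_past h). Qed.

Let F'm s C : F' s C -> measurable C. Proof. by case. Qed.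

Let inoise n i (h : R -> R) : integ (normal_prob 0 1) h -> integ nu (fun z => h (g (node s1 s2 n i z))).
Proof. exact: (noise_integ ms1 ms2 (@split_independent R) mg g_law). Qed.

(** Integrates over the noise first: the section of [C] lies in the past of the node, hence is
    independent of its normal variable. *)
Let ext_fst n i C (k : Omega -> R) (h : R -> R) : F' (dyad R n i) C ->
  sqint P k -> integ (normal_prob 0 1) h -> integ (normal_prob 0 1) (fun x => h x ^+ 2) ->
  E' (fun w => \1_C w * (k w.1 * h (gn n i w))) =
  E (fun w => fine (nu [set z | C (w, z)]) * Rintegral (normal_prob 0 1) setT h * k w).
Proof.
move=> FC Sk Ih Ih2.
have mC w : measurable [set z | C (w, z)].
  by apply: (past_measurable ms1 ms2); exact: (mpast w FC).
apply: (E_fst_section (h := fun w => \1_C w * (k w.1 * h (gn n i w)))).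
- apply: integ_indicM; first exact: (F'm FC).
  apply: sqint_integM; first exact: (sqint_law mfst (fst_law P nu)).
  apply: (sqint_law (mgn n i) (@gn_law n i)); split; [exact: (integ_meas Ih)|exact: Ih2].
- move=> w; apply: (integ_indicM (mC w)).
  exact: (integZ (k w) (inoise n i Ih)).
- move=> w; pose f z := \1_[set z | C (w, z)] z * h (g (node s1 s2 n i z)).
  have If : integ nu f by apply: (integ_indicM (mC w)); exact: (inoise n i Ih).
  transitivity (Rintegral nu setT (fun z => k w * f z)).
    by apply: eq_Rintegral => z _; rewrite /f mulrCA.
  rewrite (EZ (k w) If) /f.
  rewrite (E_noise_independent ms1 ms2 (@split_independent R) mg g_law (mpast w FC) Ih).
  by rewrite mulrC.
Qed.

Let N_integ (k : nat) : (k <= 4)%N -> integ (normal_prob 0 1) (fun x : R => x ^+ k).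
Proof. exact: normal_integ_pow. Qed.

Let id_integ : integ (normal_prob 0 1) (@id R).
Proof. by have := @N_integ 1 isT; under eq_fun do rewrite expr1. Qed.

Let w1' n i C : F' (dyad R n i) C -> E' (fun w => \1_C w * incW W n i w) = 0.
Proof.
move=> FC.
transitivity (E' (fun w => \1_C w * (Num.sqrt (mesh R n) * id (gn n i w)))).
  by apply: eq_Rintegral => w _; rewrite incWE.
rewrite (@ext_fst n i C (fun=> Num.sqrt (mesh R n)) id FC).
- under eq_Rintegral do rewrite normal_mean mulr0 mul0r.
  exact: E_cst.
- exact: sqint_cst.
- exact: id_integ.
- exact: (@N_integ 2).
Qed.

Let w2' n i C : F' (dyad R n i) C ->
  E' (fun w => \1_C w * incW W n i w ^+ 2) = E' (fun w => \1_C w * mesh R n).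
Proof.
move=> FC.
transitivity (E' (fun w => \1_C w * (mesh R n * gn n i w ^+ 2))).
  by apply: eq_Rintegral => w _; rewrite incWE exprMn sqr_sqrtr// mesh_ge0.
rewrite (@ext_fst n i C (fun=> mesh R n) (fun x => x ^+ 2) FC).
- transitivity (E' (fun w => \1_C w * (mesh R n * (fun=> 1) (gn n i w)))); last first.
    by apply: eq_Rintegral => w _; rewrite mulr1.
  rewrite (@ext_fst n i C (fun=> mesh R n) (fun=> 1) FC).
  + apply: eq_Rintegral => w _; rewrite normal_var.
    by rewrite (_ : Rintegral _ _ _ = 1) ?mulr1//; exact: E_cst.
  + exact: sqint_cst.
  + exact: integ_cst.
  + by under eq_fun do rewrite expr1n; exact: integ_cst.
- exact: sqint_cst.
- exact: (@N_integ 2).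
- by under eq_fun do rewrite -exprM; exact: (@N_integ 4).
Qed.

Let w3' n i C : F' (dyad R n i) C ->
  E' (fun w => \1_C w * (incM delta M' (dyad R n i) (mesh R n) w * incW W n i w)) = 0.
Proof.
move=> FC; pose k w := Num.sqrt (mesh R n) * incM delta M (dyad R n i) (mesh R n) w.
transitivity (E' (fun w => \1_C w * (k w.1 * id (gn n i w)))).
  by apply: eq_Rintegral => w _; rewrite incWE /k; congr (_ * _); rewrite mulrCA mulrA.
rewrite (@ext_fst n i C k id FC).
- under eq_Rintegral do rewrite normal_mean mulr0 mul0r.
  exact: E_cst.
- by apply: sqintZ; apply: inc_sq; [exact: dyad_ge0|exact: mesh_ge0].
- exact: id_integ.
- exact: (@N_integ 2).
Qed.

Let w4' : exists2 K, 0 <= K & forall n i,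
  integ P' (fun w => incW W n i w ^+ 4) /\ E' (fun w => incW W n i w ^+ 4) <= K * mesh R n ^+ 2.
Proof.
exists (Rintegral (normal_prob 0 1) setT (fun x : R => x ^+ 4)).
  by apply: E_ge0 => x; rewrite (_ : 4 = 2 * 2)%N// exprM sqr_ge0.
move=> n i; have I4 := integ_law (mgn n i) (@gn_law n i) (@N_integ 4 isT).
have E4 := E_law (mgn n i) (@gn_law n i) (@N_integ 4 isT).
have -> : (fun w => incW W n i w ^+ 4) = (fun w => mesh R n ^+ 2 * gn n i w ^+ 4).
  apply/funext => w; rewrite incWE exprMn; congr (_ * _).
  by rewrite (_ : 4 = 2 * 2)%N// exprM sqr_sqrtr// mesh_ge0.
by split; [exact: integZ|rewrite EZ// E4 mulrC].
Qed.

Let M_sq' t : 0 <= t -> sqint P' (M' t).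
Proof. by move=> t0; apply: (sqint_law mfst (fst_law P nu)); exact: M_sq. Qed.

Let M_small' eta : 0 < eta -> exists2 e0 : R, 0 < e0 &
  forall e u, 0 < e <= e0 -> eta <= u -> E' (fun w => qf e (M' u w)) <= eta.
Proof.
move=> eta0; have [e0 e00 H] := M_small eta0; exists e0 => // e u e01 eu.
have u0 : 0 <= u by apply: le_trans eu; exact: ltW.
have e1 : 0 <= e by have /andP[/ltW] := e01.
have mM : measurable_fun setT (M u) by have [] := M_sq u0.
rewrite (E_law mfst (fst_law P nu) (f := fun w => qf e (M u w))); first exact: H.
apply: (@integ_bounded _ _ _ _ _ 1) => [|w]; first exact: (measurableT_comp (measurable_qf e1)).
by rewrite ger0_norm ?qf_ge0// qf_le1.
Qed.

Let m4' T' : exists2 K, 0 <= K & forall s h, 0 <= s -> 0 <= h -> s + h <= T' ->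
  integ P' (fun w => incM delta M' s h w ^+ 4) /\
  E' (fun w => incM delta M' s h w ^+ 4) <= K * h ^+ 2.
Proof.
have [K K0 H] := m4 T'; exists K => // s h s0 h0 sh; have [I4 B4] := H s h s0 h0 sh.
split; first exact: (integ_law mfst (fst_law P nu) I4).
by have -> := E_law mfst (fst_law P nu) I4.
Qed.

Theorem noisy_extension : exists (d' : measure_display) (O' : measurableType d')
    (Q : probability O' R) (X : O' -> Omega) (G : R -> set (set O')) (B : R -> O' -> R),
  [/\ measurable_fun setT X /\ (forall A, measurable A -> Q (X @^-1` A) = P A),
      filtration G /\ (forall t A, 0 <= t -> F t A -> G t (X @^-1` A)),
      (forall t, 0 <= t -> measurable_fun setT (B t : subsig (G t) -> R)) /\
        (forall t w, t <= 0 -> B t w = 0),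
      {ae Q, forall w, B 0 w = 0 /\ {within `[0, +oo[, continuous (B ^~ w)}} /\
      (forall s t A D, 0 <= s -> s < t -> G s A -> measurable D ->
         Q (A `&` (fun w => B t w - B s w) @^-1` D) = (Q A * normal_prob 0 (Num.sqrt (t - s)) D)%E) &
      forall y, 0 <= y -> is_ito_integral Q (fun u w => Num.sqrt (M u (X w))) B y
        (fun w => (M y (X w) - M 0 (X w) - delta * y) / 2)].
Proof.
have [B [Bad B0 Bc Bn Bi]] := @driving_noise _ _ R P' delta F' M' W delta0
  (prod_filtrationP hF hF2) (fun t t0 => adapted_fst hF hF2 t0 (M_ad t0))
  (fun t w t0 => M_ge0 w.1 t0) M_sq' m1' m2'
  (fun n i => adapted_snd hF hF2 (dyad_ge0 R n i) (@dyadic_bm_adapted R _ T s1 s2 ms1 ms2 g mg g_sum n i))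
  W_sq w1' w2' w3' M_small' m4' w4' (fun w => @M_cont w.1).
exists _, _, P', fst, F', B; split => //.
- by split=> // A mA; exact: fst_law.
- by split; [exact: prod_filtrationP|move=> t A; exact: prod_filtration_fst].
Qed.

End noisy_extension.

(** * The total mass of an interval partition *)

Section intpart_mass.
Variable R : realType.
Implicit Types b c : intpart R.
Local Notation mu := (@lebesgue_measure R).

Lemma block_lt b U : blocks b U -> U.1 < U.2.
Proof. by case: (intpartP b) => _ H _ _ /H []. Qed.

Lemma block_ge0 b U : blocks b U -> 0 <= U.1.
Proof. by case: (intpartP b) => _ H _ _ /H []. Qed.

Lemma block_le b U : blocks b U -> U.2 <= mass b.
Proof. by case: (intpartP b) => _ H _ _ /H []. Qed.

Lemma mass_ge0 b : 0 <= mass b.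
Proof. by case: (intpartP b). Qed.

Lemma leb_gt0 b U : blocks b U -> 0 < leb U.
Proof. by move=> /block_lt; rewrite subr_gt0. Qed.

Lemma block_measure (U : R * R) : U.1 < U.2 -> mu (block_set U) = (leb U)%:E.
Proof. by move=> U12; rewrite lebesgue_measure_itv/= lte_fin U12 -EFinB. Qed.

Lemma blocks_disjoint b U V : blocks b U -> blocks b V -> U != V ->
  block_set U `&` block_set V = set0.
Proof. by case: (intpartP b) => _ _ H _; exact: H. Qed.

Lemma blocks_enum b : exists (K : set nat) (f : nat -> R * R), set_bij K (blocks b) f.
Proof.
have cb : countable (blocks b).
  (* Extended by the whole line to degenerate pairs, so that every [B U] is open and nonempty. *)
  pose B (U : R * R) := if U.1 < U.2 then block_set U else setT.
  have BE U : blocks b U -> B U = block_set U by move=> /block_lt U12; rewrite /B U12.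
  apply: (separated_open_countable (B := B)).
  - by move=> U; rewrite /B; case: ifP => _; [exact: interval_open|exact: openT].
  - move=> U; rewrite /B; case: ifPn => [U12|_]; last by exists 0.
    by exists ((U.1 + U.2) / 2); rewrite /block_set /= in_itv /=; apply/andP; split; lra.
  - apply/trivIsetP => U V bU bV UV; rewrite !BE//; exact: (blocks_disjoint bU bV UV).
have /countable_bijP[K] := cb.
by rewrite card_eq_sym => /card_set_bijP[f fb]; exists K, f.
Qed.

(** Blocks are disjoint and cover [0, mass b] up to a null set, so countable additivity applies.
    Masses of scaled, shifted and concatenated partitions are computed through this sum. *)
Lemma mass_esum b : (\esum_(U in blocks b) (leb U)%:E)%E = (mass b)%:E.
Proof.
have [K [f fb]] := blocks_enum b; have [fK fi fs] := fb.
have bf i : K i -> blocks b (f i) by move=> Ki; exact: fK.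
rewrite (reindex_esum K (blocks b) f)//.
transitivity (\esum_(i in K) mu (block_set (f i)))%E.
  by apply: eq_esum => i Ki; rewrite block_measure//; exact: (block_lt (bf i Ki)).
transitivity (mu (\bigcup_(i in K) block_set (f i))).
  rewrite measure_bigcup//.
  - by rewrite nneseries_esum// set_mem_set.
  - by move=> i _; exact: measurable_itv.
  - apply/trivIsetP => i j Ki Kj ij; apply: (blocks_disjoint (bf i Ki) (bf j Kj)).
    by apply: contra_neq ij; apply: fi; rewrite inE.
have -> : \bigcup_(i in K) block_set (f i) = \bigcup_(U in blocks b) block_set U.
  apply/seteqP; split => x [i Ki xi]; first by exists (f i) => //; exact: bf.
  by have [j Kj ji] := fs i Ki; exists j => //; rewrite ji.
case: (intpartP b) => M0 H _ N.
have sub : \bigcup_(U in blocks b) block_set U `<=` `[0, mass b]%classic.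
  move=> x [U /H[U0 U12 UM]]; rewrite /block_set /= !in_itv /= => /andP[xU Ux].
  by rewrite (le_trans U0 (ltW xU)) (le_trans (ltW Ux) UM).
have mB : measurable (\bigcup_(U in blocks b) block_set U).
  have -> : \bigcup_(U in blocks b) block_set U = \bigcup_(i in K) block_set (f i).
    apply/seteqP; split => x [i Ki xi]; last by exists (f i) => //; exact: bf.
    by have [j Kj ji] := fs i Ki; exists j => //; rewrite ji.
  by apply: bigcup_measurable => i _; exact: measurable_itv.
transitivity (mu `[0, mass b]%classic).
  rewrite -[in RHS](setDUK sub) measureU//.
  - by rewrite [X in (_ + X)%E]N adde0.
  - by apply: measurableD => //; exact: measurable_itv.
  - by rewrite setDIK.
rewrite lebesgue_measure_itv/= lte_fin; case: ltgtP M0 => // [M0 _|<- _]//.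
by rewrite oppr0 adde0.
Qed.

Lemma sum_leb_le b (s : seq (R * R)) : uniq s -> (forall U, U \in s -> blocks b U) ->
  \sum_(U <- s) leb U <= mass b.
Proof.
move=> us sb; rewrite -lee_fin -mass_esum; apply: esum_ge; exists [set` s].
  by split=> //; exact: finite_seq.
by rewrite -sumEFin fsbig_seq.
Qed.

Lemma correspondence_uniq b c s : correspondence b c s ->
  uniq (map fst s) /\ uniq (map snd s).
Proof.
move=> [_ s1 s2]; split.
  apply: (sorted_uniq (leT := fun U V : R * R => U.1 < V.1)).
  - by move=> x y z; exact: lt_trans.
  - by move=> x; rewrite ltxx.
  - by rewrite sorted_map.
apply: (sorted_uniq (leT := fun U V : R * R => U.1 < V.1)).
- by move=> x y z; exact: lt_trans.
- by move=> x; rewrite ltxx.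
- by rewrite sorted_map.
Qed.

(** If [mass b] is the larger, the matched lengths in [b] add up to at most those in [c] plus the
    gap, hence to at most [mass c] plus the gap, and the third of the four terms of the distortion
    dominates the difference. The other case is symmetric. *)
Lemma mass_distortion alpha b c s : correspondence b c s ->
  `|mass b - mass c| <= distortion alpha b c s.
Proof.
move=> hs; have [u1 u2] := correspondence_uniq hs; have [H _ _] := hs.
set g := \sum_(p <- s) `|leb p.1 - leb p.2|.
have S1 : \sum_(p <- s) leb p.1 <= mass b.
  rewrite -(big_map fst xpredT) sum_leb_le// => U /mapP[p ps ->].
  by have [] := H p ps.
have S2 : \sum_(p <- s) leb p.2 <= mass c.
  rewrite -(big_map snd xpredT) sum_leb_le// => U /mapP[p ps ->].
  by have [] := H p ps.
have g1 : \sum_(p <- s) leb p.1 - \sum_(p <- s) leb p.2 <= g.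
  by rewrite -sumrB; apply: ler_sum => p _; exact: ler_norm.
have g2 : \sum_(p <- s) leb p.2 - \sum_(p <- s) leb p.1 <= g.
  by rewrite -sumrB; apply: ler_sum => p _; rewrite distrC ler_norm.
rewrite /distortion -/g !le_max; apply/orP; right.
have [bc|bc] := leP (mass b) (mass c); apply/orP; [right|left].
  by rewrite ler0_norm; lra.
by rewrite gtr0_norm; lra.
Qed.

(** The measurability of the mass and the continuity of the mass process both rest on this. *)
Lemma mass_ipdist alpha (x y : ipspace alpha) : `|mass x - mass y| <= @ipdist R alpha x y.
Proof.
apply: lb_le_inf; first by exists (distortion alpha x y [::]), [::].
by move=> _ [s hs <-]; exact: mass_distortion.
Qed.

Lemma esum_setU (I : choiceType) (A B : set I) (a : I -> \bar R) :
  (forall i, (A `|` B) i -> 0 <= a i)%E -> A `&` B = set0 ->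
  (\esum_(i in A `|` B) a i = \esum_(i in A) a i + \esum_(i in B) a i)%E.
Proof.
move=> a0 AB; rewrite (esumID A)//; congr (_ + _)%E; congr (esum _ _).
  by apply/seteqP; split => x; [case|move=> Ax; split => //; left].
apply/seteqP; split => x; first by move=> [[Ax|//] nAx].
move=> Bx; split; [by right|move=> Ax].
by rewrite -[False]/(set0 x) -AB.
Qed.

Lemma esum_shift x (A : set (R * R)) :
  (\esum_(U in shift_blocks x A) (leb U)%:E = \esum_(U in A) (leb U)%:E)%E.
Proof.
rewrite esum_image.
  by apply: eq_esum => U _; rewrite /leb /=; congr EFin; ring.
by move=> [u1 u2] [v1 v2] _ _ /= [/addrI -> /addrI ->].
Qed.

Lemma esum_scale (c : R) b : 0 < c ->
  (\esum_(U in scale_blocks c (blocks b)) (leb U)%:E)%E = (c * mass b)%:E.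
Proof.
move=> c0; rewrite esum_image; last first.
  have cn : c != 0 by rewrite gt_eqF.
  by move=> [u1 u2] [v1 v2] _ _ /= [/(mulfI cn) -> /(mulfI cn) ->].
have [K [f fb]] := blocks_enum b; have [fK fi fs] := fb.
rewrite EFinM -mass_esum !(reindex_esum K (blocks b) f)//.
have k0 i : i \in K -> (0 <= (leb (f i))%:E)%E.
  by rewrite inE => /fK /leb_gt0 /ltW; rewrite lee_fin.
rewrite -[in RHS](set_mem_set K) -nneseries_esum// -nneseriesZl//.
rewrite -[in LHS](set_mem_set K) -nneseries_esum//.
  by apply: eq_eseriesr => i _; rewrite -EFinM /leb /=; congr EFin; ring.
by move=> i /k0; rewrite !lee_fin /leb /= -mulrBr => ?; rewrite mulr_ge0// ltW.
Qed.

Lemma blocks_left_inj b U V : blocks b U -> blocks b V -> U.1 = V.1 -> U = V.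
Proof.
move=> bU bV UV; apply: contrapT => /eqP nUV.
have := blocks_disjoint bU bV nUV; apply/eqP/set0P.
have U12 := block_lt bU; have V12 := block_lt bV.
exists ((U.1 + Num.min U.2 V.2) / 2).
have m1 : U.1 < Num.min U.2 V.2 by rewrite lt_min U12 UV V12.
have m2 : Num.min U.2 V.2 <= U.2 by rewrite ge_min lexx.
have m3 : Num.min U.2 V.2 <= V.2 by rewrite ge_min lexx orbT.
by split; rewrite /block_set /= in_itv /= ?UV; apply/andP; split; rewrite -?UV; lra.
Qed.

(** * Mass of a concatenation *)

Section concat.
Variables (b : intpart R) (g : R * R -> intpart R).
Hypothesis fin : (\esum_(U in blocks b) (mass (g U))%:E < +oo)%E.
Local Notation off := (concat_offset (blocks b) (fun V => mass (g V))).

Let fin_off (A : set (R * R)) : A `<=` blocks b -> (\esum_(V in A) (mass (g V))%:E)%E \is a fin_num.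
Proof.
move=> Ab; rewrite ge0_fin_numE; last by apply: esum_ge0 => V _; rewrite lee_fin mass_ge0.
apply: le_lt_trans fin; rewrite (esumID A (blocks b)) ?(setIidr Ab); last first.
  by move=> V _; rewrite lee_fin mass_ge0.
by rewrite leeDl//; apply: esum_ge0 => V _; rewrite lee_fin mass_ge0.
Qed.

Lemma concat_offset_ge0 U : 0 <= off U.
Proof. by apply/fine_ge0/esum_ge0 => V _; rewrite lee_fin mass_ge0. Qed.

Lemma concat_offset_lt U V : blocks b U -> blocks b V -> U.1 < V.1 ->
  off U + mass (g U) <= off V.
Proof.
move=> bU bV UV; rewrite -lee_fin EFinD /concat_offset.
rewrite !fineK; last 2 first.
- by apply: fin_off => W [].
- by apply: fin_off => W [].
have -> : (mass (g U))%:E = (\esum_(W in [set U]) (mass (g W))%:E)%E.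
  by rewrite esum_set1// lee_fin mass_ge0.
rewrite -esum_setU; last 2 first.
- by move=> W _; rewrite lee_fin mass_ge0.
- by apply/seteqP; split => // W [[_ +] WU]; rewrite WU ltxx.
set A := (_ `|` _); set B := [set W | _].
have AB : A `<=` B by move=> W [[bW WU]|->]; split => //; exact: lt_trans UV.
rewrite (esumID A B) ?(setIidr AB); last by move=> W _; rewrite lee_fin mass_ge0.
by rewrite leeDl//; apply: esum_ge0 => W _; rewrite lee_fin mass_ge0.
Qed.

Lemma concat_disjoint U V W : blocks b U -> blocks b V ->
  shift_blocks (off U) (blocks (g U)) W -> shift_blocks (off V) (blocks (g V)) W -> U = V.
Proof.
have key U' V' : blocks b U' -> blocks b V' -> U'.1 < V'.1 ->
    shift_blocks (off U') (blocks (g U')) W -> ~ shift_blocks (off V') (blocks (g V')) W.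
  move=> bU bV UV [A gA <-] [B gB [E1 E2]].
  have := concat_offset_lt bU bV UV; have := block_le gA; have := block_lt gA.
  have := block_ge0 gB; lra.
move=> bU bV HU HV; have [UV|UV|UV] := ltgtP U.1 V.1.
- by case: (key U V).
- by case: (key V U).
- exact: (blocks_left_inj bU bV).
Qed.

(** Pieces coming from different blocks share no block, because the offsets separate them, so the
    sum over the union is an iterated sum. *)
Lemma esum_concat :
  (\esum_(U in concat_blocks (blocks b) g) (leb U)%:E = \esum_(U in blocks b) (mass (g U))%:E)%E.
Proof.
pose J U := shift_blocks (off U) (blocks (g U)).
transitivity (\esum_(U in blocks b) \esum_(V in J U) (leb V)%:E)%E; last first.
  by apply: eq_esum => U _; rewrite esum_shift mass_esum.
rewrite esum_esum; last first.
  by move=> U V bU [W gW <-]; rewrite lee_fin /leb /=; have := block_lt gW; lra.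
apply: (reindex_esum (blocks b `*`` J) (concat_blocks (blocks b) g) snd) => //; split.
- by move=> [U V] [/= bU JV]; exists U.
- move=> [U V] [U' V'] /= /set_mem[/= bU JV] /set_mem[/= bU' JV'] VV'.
  by rewrite VV' in JV *; rewrite (concat_disjoint bU bU' JV JV').
- by move=> V [U bU JV]; exists (U, V).
Qed.

End concat.

End intpart_mass.

Lemma measurable_mass (R : realType) (alpha : R) :
  measurable_fun setT (fun x : ipspace alpha => mass x : R).
Proof.
apply: (measurability _ (@RGenOInfty.measurableE R)) => //.
move=> _ [_ [r ->] <-]; rewrite setTI; apply: sub_sigma_algebra => x /=.
rewrite in_itv /= andbT => rx; exists (mass x - r); first by rewrite subr_gt0.
move=> y xy; rewrite /= in_itv /= andbT.
have := le_lt_trans (mass_ipdist x y) xy; rewrite ltr_norml => /andP[_]; lra.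
Qed.

Lemma sigma_of_measurable d1 d2 (Omega : measurableType d1) (T : measurableType d2) (X : Omega -> T) :
  measurable_fun setT X -> sigma_of X `<=` measurable.
Proof. by move=> mX _ [C mC <-]; exact: mX. Qed.

(** * Laplace transforms of the transition kernels *)

Section independent_product.
Context (R : realType) d (Omega : measurableType d) (P : probability Omega R).
Variables (I : eqType) (D : set I) (E : I -> set (set Omega)).
Hypothesis ind : mutually_independent P D E.
Hypothesis mE : forall i, D i -> E i `<=` measurable.
Variable f : I -> Omega -> \bar R.
Hypothesis f0 : forall i w, (0 <= f i w)%E.
Hypothesis fE : forall i C, D i -> measurable C -> E i (f i @^-1` C).

Let mf i : D i -> measurable_fun setT (f i).
Proof. by move=> Di _ C mC; rewrite setTI; apply: (mE Di); exact: fE. Qed.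

Let mprod (s : seq I) : (forall i, i \in s -> D i) ->
  measurable_fun setT (fun w => \prod_(i <- s) f i w)%E.
Proof.
elim: s => [|i s ih] Ds.
  by under eq_fun do rewrite big_nil; exact: measurable_cst.
under eq_fun do rewrite big_cons; apply: emeasurable_funM.
  by apply: mf; apply: Ds; rewrite mem_head.
by apply: ih => j js; apply: Ds; rewrite inE js orbT.
Qed.

Let bigcap_indic (t : seq I) (A : I -> set Omega) w :
  (\prod_(i <- t) (\1_(A i) w : R)%:E)%E = (\1_(\bigcap_(i in [set i | i \in t]) A i) w : R)%:E.
Proof.
elim: t => [|i t ih]; first by rewrite big_nil (_ : \bigcap_(_ in _) _ = setT) ?indicT// -subTset => x _ j.
rewrite big_cons ih -EFinM; congr EFin.
rewrite (_ : \bigcap_(j in [set j | j \in i :: t]) A j =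
  A i `&` \bigcap_(j in [set j | j \in t]) A j) ?indicI//.
apply/seteqP; split => x.
  by move=> H; split; [apply: H; rewrite /= mem_head|move=> j jt; apply: H; rewrite /= inE jt orbT].
by move=> [Ai H] j /=; rewrite inE => /orP[/eqP ->|jt] //; exact: H.
Qed.

(** Indicators are exchanged for functions one index at a time: [s] lists the indices that carry a
    function, [t] those that carry an event. *)
Lemma independent_prod_aux (s t : seq I) (A : I -> set Omega) : uniq (s ++ t) ->
  (forall i, i \in s -> D i) -> (forall i, i \in t -> D i /\ E i (A i)) ->
  (\int[P]_w (\prod_(i <- s) f i w * \prod_(i <- t) (\1_(A i) w : R)%:E) =
   (\prod_(i <- s) \int[P]_w f i w) * \prod_(i <- t) P (A i))%E.
Proof.
elim: s t A => [|i s ih] t A.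
  rewrite /= => ut _ At; rewrite big_nil mul1e -(ind ut At).
  under eq_integral do rewrite big_nil mul1e bigcap_indic.
  apply: (@integral_indic_preimage R _ _ _ _ P id _ (@measurable_id _ _ setT)).
  apply: fin_bigcap_measurable; first exact: finite_seq.
  by move=> j jt; have [Dj Ej] := At j jt; exact: (mE Dj).
move=> /= /andP[ist ust] Ds At.
have Di : D i by apply: Ds; rewrite mem_head.
have Ds' j : j \in s -> D j by move=> js; apply: Ds; rewrite inE js orbT.
pose h w := (\prod_(i <- s) f i w * \prod_(i <- t) (\1_(A i) w : R)%:E)%E.
pose c := ((\prod_(i <- s) \int[P]_w f i w) * \prod_(i <- t) P (A i))%E.
have mh : measurable_fun setT h.
  apply: emeasurable_funM.
    exact: mprod.
  rewrite (_ : (fun _ => _) = (fun w => (\1_(\bigcap_(i in [set i | i \in t]) A i) w : R)%:E)).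
    apply/measurable_EFinP/measurable_indic/fin_bigcap_measurable; first exact: finite_seq.
    by move=> j jt; have [Dj Ej] := At j jt; exact: (mE Dj).
  by apply/funext => w; rewrite bigcap_indic.
have h0 w : (0 <= h w)%E by apply: mule_ge0; apply: prode_ge0 => // j _; rewrite lee_fin.
have c0 : (0 <= c)%E by apply: mule_ge0; apply: prode_ge0 => // j _; exact: integral_ge0.
(* The transfer wants a test function that is nonnegative on all extended reals; [abse] replaces the
   identity and agrees with it on the values of [f i]. *)
transitivity (\int[P]_w (h w * abse (f i w)))%E.
  by apply: eq_integral => w _; rewrite gee0_abs// big_cons /h -muleA muleC.
transitivity (\int[P]_w (c * abse (f i w)))%E.
  apply: (@ge0_integral_transfer R _ _ _ _ _ _ P P (f i) (f i) h (fun=> c) (mf Di) (mf Di) h0 mh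
    (fun _ => c0) (measurable_cst c) _ abse (fun x => abse_ge0 x)) => // C mC.
  have mfC : measurable (f i @^-1` C) by rewrite -[X in measurable X]setTI; exact: (mf Di).
  have m1C : measurable_fun setT (fun w => (\1_C (f i w) : R)%:E).
    by apply/measurable_EFinP; apply: (measurableT_comp (measurable_indic mC)); exact: mf.
  rewrite (ge0_integralZl P measurableT m1C (fun w _ => _) c0)//.
  rewrite (integral_indic_preimage P (mf Di) mC).
  pose A' j := if j == i then f i @^-1` C else A j.
  have A'E j : j \in t -> A' j = A j.
    move=> jt; rewrite /A'; case: eqP => // ji; move: ist; rewrite mem_cat -ji jt orbT.
    by [].
  have := ih (i :: t) A'; rewrite big_cons /= /A' eqxx => H.
  transitivity ((\prod_(i <- s) \int[P]_w f i w) * (P (f i @^-1` C) * \prod_(j <- t) P (A' j)))%E.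
    rewrite -H; last 3 first.
    - rewrite -cat_rcons -cats1 -catA uniq_catCA /=.
      by rewrite ist ust.
    - exact: Ds'.
    - move=> j; rewrite inE => /orP[/eqP ->|jt]; first by rewrite eqxx; split => //; exact: fE.
      by have := At j jt; rewrite -{1}(A'E j jt).
    apply: eq_integral => w _; rewrite big_cons eqxx /h -muleA; congr (_ * _)%E.
    rewrite muleC; congr (_ * _)%E.
    by apply: eq_big_seq => j jt; rewrite -/(A' j) (A'E j jt).
  rewrite /c muleCA muleC; congr (_ * _ * _)%E.
  by apply: eq_big_seq => j jt; rewrite (A'E j jt).
under eq_integral do rewrite gee0_abs//.
rewrite (ge0_integralZl P measurableT (mf Di) (fun w _ => f0 i w) c0) big_cons /c.
by rewrite muleC muleA.
Qed.

Lemma independent_prod (s : seq I) : uniq s -> (forall i, i \in s -> D i) ->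
  (\int[P]_w (\prod_(i <- s) f i w) = \prod_(i <- s) \int[P]_w f i w)%E.
Proof.
move=> us Ds; have := @independent_prod_aux s [::] (fun=> setT).
rewrite cats0 big_nil mule1 => <- //.
by apply: eq_integral => w _; rewrite big_nil mule1.
Qed.

End independent_product.

(** * Laplace transform of a gamma variable *)

Section gamma_laplace.
Context (R : realType) d (Omega : measurableType d) (P : probability Omega R).
Variables (B : {RV P >-> R}) (a r : R).
Hypotheses (r0 : 0 < r) (lawB : has_law P B (gamma_law a r)).
Local Notation leb := (@lebesgue_measure R).

Let dens c x : R := (if 0 < x then x `^ (a - 1) * expR (- (c * x)) else 0).
Let k : R := r `^ a / Gamma a.

Let Gamma_ge0 : 0 <= Gamma a.
Proof.
apply: fine_ge0; apply: integral_ge0 => x _; rewrite lee_fin.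
by rewrite mulr_ge0 ?powR_ge0 ?expR_ge0.
Qed.

Let k0 : 0 <= k. Proof. by rewrite mulr_ge0 ?invr_ge0// powR_ge0. Qed.

Let mdens c : measurable_fun setT (dens c).
Proof.
apply: measurable_fun_ifT => //.
  exact: measurable_fun_ltr.
apply: measurable_funM; first exact: measurable_powR.
by apply: measurableT_comp => //; apply: measurableT_comp => //; exact: measurable_funM.
Qed.

Let dens0 c x : 0 <= dens c x.
Proof. by rewrite /dens; case: ifP => // _; rewrite mulr_ge0 ?powR_ge0 ?expR_ge0. Qed.

Let integral_law (f : R -> \bar R) : (forall x, 0 <= f x)%E -> measurable_fun setT f ->
  (\int[P]_w f (B w) = \int[leb]_x ((k * dens r x)%:E * f x))%E.
Proof.
move=> f0 mf; have mB : measurable_fun setT B by [].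
apply: (@ge0_integral_density R _ _ _ _ _ _ P leb B id mB (@measurable_id _ _ setT)) => //.
- by move=> x; rewrite lee_fin mulr_ge0.
- by apply/measurable_EFinP; apply: measurable_funM; [exact: measurable_cst|exact: mdens].
move=> C mC; transitivity (gamma_law a r C); first exact: lawB.
rewrite /gamma_law.
rewrite [LHS]integral_mkcond. apply: eq_integral => x _; rewrite patchE.
rewrite indicE -EFinM in_setI; case: (boolP (x \in C)) => xC; last by rewrite mulr0.
rewrite mulr1 /= mem_setE in_itv /= andbT /dens; case: ifP => x0; last by rewrite mulr0.
by rewrite /k; congr EFin; ring.
Qed.

Let I c : \bar R := (\int[leb]_x (dens c x)%:E)%E.

Let I_scale c : 0 < c -> I c = (((r / c) `^ a)%:E * I r)%E.
Proof.
move=> c0; have rc : 0 < r / c by rewrite divr_gt0.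
have d0 x : (0 <= (dens c x)%:E)%E by rewrite lee_fin.
have md : measurable_fun setT (fun x => (dens c x)%:E) by apply/measurable_EFinP; exact: mdens.
have rcn : r / c != 0 by rewrite gt_eqF.
rewrite /I (ge0_integral_affine 0 rcn d0 md).
have E x : (dens c (r / c * x + 0))%:E = (((r / c) `^ (a - 1))%:E * (dens r x)%:E)%E.
  rewrite -EFinM addr0 /dens pmulr_rgt0//; case: ifP => x0; last by rewrite mulr0.
  rewrite powRM ?(ltW rc) ?(ltW x0)// // [in RHS]mulrA; congr EFin; congr (_ * expR _).
  by field; rewrite gt_eqF.
under eq_integral do rewrite E.
rewrite ge0_integralZl//; last 3 first.
- apply/measurable_EFinP; exact: mdens.
- by move=> x _; rewrite lee_fin.
- by rewrite lee_fin powR_ge0.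
rewrite muleA -EFinM; congr (_%:E * _)%E.
rewrite gtr0_norm// -{1}(powRr1 (ltW rc)) -powRD ?rcn ?implybT//.
by congr (_ `^ _); ring.
Qed.

Let kI : (k%:E * I r = 1)%E.
Proof.
have P1 : (\int[P]_w (cst 1 w) = 1)%E by rewrite integral_cst// mul1e; exact: probability_setT.
rewrite -[RHS]P1 (@integral_law (cst 1%E) (fun x => lee01) (measurable_cst 1%E)).
rewrite /I -ge0_integralZl//.
- by apply: eq_integral => x _; rewrite mule1 EFinM.
- apply/measurable_EFinP; exact: mdens.
- by move=> x _; rewrite lee_fin.
Qed.

(** The value of [Gamma] is never computed: the constant normalises a probability law, and the
    integral with rate r + lam is a scaled copy of the one with rate r. *)
Lemma gamma_laplace lam : 0 <= lam ->
  (\int[P]_w (expR (- lam * B w))%:E = ((r / (r + lam)) `^ a)%:E)%E.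
Proof.
move=> lam0; have rl : 0 < r + lam by rewrite ltr_wpDr.
rewrite (integral_law (f := fun x => (expR (- lam * x))%:E)).
- transitivity (k%:E * I (r + lam))%E; last by rewrite I_scale// muleCA kI mule1.
  rewrite /I -ge0_integralZl//.
  + apply: eq_integral => x _; rewrite -!EFinM; congr EFin; rewrite /dens; case: ifP => _; last by rewrite !(mulr0, mul0r).
    have -> : expR (- ((r + lam) * x)) = expR (- (r * x)) * expR (- lam * x).
      by rewrite -expRD; congr expR; ring.
    by ring.
  + apply/measurable_EFinP; exact: mdens.
  + by move=> x _; rewrite lee_fin.
- by move=> x; rewrite lee_fin expR_ge0.
- by apply/measurable_EFinP; apply: measurableT_comp => //; exact: measurable_funM.
Qed.

Lemma gamma_gt0 : {ae P, forall w, 0 < B w}.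
Proof.
have mN : measurable [set x : R | x <= 0].
  by rewrite (_ : [set _ | _] = `]-oo, 0]%classic)//; apply/seteqP; split => x /=; rewrite in_itv.
exists (B @^-1` [set x | x <= 0]); split; first exact: measurable_funPTI.
  rewrite lawB// /gamma_law (_ : _ `&` _ = set0) ?integral_set0//.
  by apply/seteqP; split => x //= []; rewrite in_itv /= andbT => /le_lt_trans h /h; rewrite ltxx.
by move=> w /= /negP; rewrite -leNgt.
Qed.

End gamma_laplace.

(** * Laplace transform of the offspring of one block *)

Section mu_laplace.
Context (R : realType) (alpha : R).
Hypothesis pdip_mass1 : forall (nu : {measure set (ipspace alpha) -> \bar R}),
  is_PDIP nu -> nu [set x | mass x != 1] = 0%E.

(** The factor ((r + lam) / r)^alpha of [L] is cancelled by the gamma variable [B]. With z = exp (b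
    r^2 / (r + lam)) there remains exp (- b r) + (1 - exp (- b r)) (z - 1) / (exp (b r) - 1), which
    equals exp (- b r) z; its exponent is linear in b. *)
Lemma mu_laplace b r (nu : {measure set (ipspace alpha) -> \bar R}) lam :
  0 < b -> 0 < r -> 0 <= lam -> is_mu b r nu ->
  (\int[nu]_x (expR (- lam * mass x))%:E = (expR (- (b * (r * lam / (r + lam)))))%:E)%E.
Proof.
move=> b0 r0 lam0 [dO [Om [P [L [B [g [G]]]]]]].
move=> [[Lpos Llap] [Blaw gP] ind Gb nuE].
have rl : 0 < r + lam by rewrite ltr_wpDr.
have ebr : 1 < expR (b * r) by rewrite -expR0 ltr_expR mulr_gt0.
have enbr : expR (- (b * r)) = (expR (b * r))^-1 by rewrite expRN.
have enbr1 : expR (- (b * r)) < 1 by rewrite enbr invf_lt1// (lt_trans ltr01).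
have a0 : 0 <= expR (- (b * r)) by exact: expR_ge0.
have c0 : 0 <= 1 - expR (- (b * r)) by rewrite subr_ge0 ltW.
pose f (x : ipspace alpha) := (expR (- lam * mass x))%:E.
have f0 x : (0 <= f x)%E by rewrite lee_fin expR_ge0.
have mf : measurable_fun setT f.
  apply/measurable_EFinP; apply: measurableT_comp => //; apply: measurable_funM => //.
  exact: measurable_mass.
have mG : measurable_fun setT (G : Om -> ipspace alpha) by [].
have step : (\int[nu]_x f x = (expR (- (b * r)))%:E + (1 - expR (- (b * r)))%:E * \int[P]_w f (G w))%E.
  pose m1 : {measure set (ipspace alpha) -> \bar R} :=
    mscale (NngNum a0) (dirac (ipspace_empty alpha)).
  pose m2 : {measure set (ipspace alpha) -> \bar R} := mscale (NngNum c0) (pushforward P G).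
  have H A : measurable A -> nu A = (measure_add m1 (m2 mG)) A by move=> mA; rewrite measure_addE nuE.
  rewrite (eq_measure_integral (measure_add m1 (m2 mG))); last by move=> A mA _; exact: H.
  rewrite ge0_integral_measure_add// /m1 /m2 !ge0_integral_mscale//=.
  congr (_ + _ * _)%E.
    by rewrite integral_dirac// diracE mem_setT mul1e /f /= mulr0 expR0 mule1.
  exact: ge0_integral_pushforward.
have massG : {ae P, forall w, mass (G w) = L w + B w}.
  have mN : measurable [set x : ipspace alpha | mass x != 1].
    have -> : [set x : ipspace alpha | mass x != 1] = (fun x => mass x : R) @^-1` ~` [set 1].
      by apply/seteqP; split => x /=; [move/eqP|move=> h; apply/eqP].
    by rewrite -[X in measurable X]setTI; apply: measurable_mass => //; apply: measurableC.
  have g1 : {ae P, forall w, mass (g w) = 1}.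
    exists (g @^-1` [set x | mass x != 1]); split => //.
    - exact: measurable_funPTI.
    - exact: (pdip_mass1 gP).
    - by move=> w /= /eqP.
  apply: filterS2 (filterI Lpos g1) (filterI Gb (gamma_gt0 Blaw)) => w [Lw gw] [Gw Bw].
  apply: EFin_inj; rewrite -mass_esum Gw esum_setU.
  - rewrite esum_set1; last by rewrite lee_fin /leb /= subr0 ltW.
    by rewrite esum_shift esum_scale// gw mulr1 /leb /= subr0 -EFinD.
  - move=> U [->|[V [V' gV <-] <-]]; rewrite lee_fin /leb /=; first by rewrite subr0 ltW.
    by have := mulr_ge0 (ltW Bw) (ltW (leb_gt0 gV)); rewrite /leb; lra.
  - apply/seteqP; split => // U [->] [V [V' gV <-]] [E1 _].
    have := block_ge0 gV; have := mulr_ge0 (ltW Bw) (block_ge0 gV); lra.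
pose i0 : 'I_3 := @Ordinal 3 0 isT; pose i1 : 'I_3 := @Ordinal 3 1 isT.
pose e (x : R) : \bar R := (expR (- lam * x))%:E.
have me : measurable_fun setT e.
  by apply/measurable_EFinP; apply: measurableT_comp => //; exact: measurable_funM.
pose F (i : 'I_3) : Om -> \bar R := nth (cst 1%E) [:: e \o L; e \o B; cst 1%E] i.
pose E (i : 'I_3) := nth set0 [:: sigma_of L; sigma_of B; sigma_of g] i.
have mE i : setT i -> E i `<=` measurable.
  by case: i => -[|[|[|//]]] ? _; exact: sigma_of_measurable.
have F0 i w : (0 <= F i w)%E.
  by case: i => -[|[|[|//]]] ?; rewrite /F /= ?lee_fin ?expR_ge0 ?ler01.
have FE i C : setT i -> measurable C -> E i (F i @^-1` C).
  have meC : measurable C -> measurable (e @^-1` C).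
    by move=> mC; rewrite -[X in measurable X]setTI; exact: me.
  case: i => -[|[|[|//]]] ? _ mC.
  - by exists (e @^-1` C); [exact: meC|rewrite setTI].
  - by exists (e @^-1` C); [exact: meC|rewrite setTI].
  - have [C1|C1] := pselect (C 1%E).
      by exists setT => //; rewrite setTI preimage_setT; apply/seteqP; split.
    by exists set0 => //; rewrite setTI preimage_set0; apply/seteqP; split.
have prod : (\int[P]_w f (G w) = (\int[P]_w e (L w)) * \int[P]_w e (B w))%E.
  transitivity (\int[P]_w (\prod_(i <- [:: i0; i1]) F i w))%E; last first.
    rewrite (independent_prod ind mE F0 FE)//; first by rewrite !big_cons big_nil mule1.
  apply: ge0_ae_eq_integral => //.
  - exact: (measurableT_comp mf mG).
  - under eq_fun do rewrite !big_cons big_nil mule1.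
    by apply: emeasurable_funM; exact: measurableT_comp.
  - by move=> w _; exact: prode_ge0.
  apply: filterS massG => w Gw _.
  by rewrite !big_cons big_nil mule1 /F /= /f Gw mulrDr expRD EFinM.
have LE : (\int[P]_w e (L w) = (((r + lam) / r) `^ alpha *
    ((expR (b * r ^+ 2 / (r + lam)) - 1) / (expR (b * r) - 1)))%:E)%E.
  by rewrite -(Llap lam lam0) unlock.
have BE := gamma_laplace r0 Blaw lam0.
rewrite -/f step prod LE BE -!EFinM -EFinD; congr EFin.
have pw : ((r + lam) / r) `^ alpha * (r / (r + lam)) `^ alpha = 1.
  rewrite -powRM ?divr_ge0 ?ltW// (_ : _ * _ = 1) ?powR1//.
  by field; rewrite !gt_eqF.
have x0 : expR (b * r) != 0 by rewrite gt_eqF// expR_gt0.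
have -> : expR (- (b * (r * lam / (r + lam)))) =
    expR (b * r ^+ 2 / (r + lam)) * (expR (b * r))^-1.
  by rewrite -expRN -expRD; congr expR; field; rewrite gt_eqF.
set q := ((r + lam) / r) `^ alpha in pw *; set q' := (r / (r + lam)) `^ alpha in pw *.
set z := expR (b * r ^+ 2 / (r + lam)); rewrite enbr.
set x := expR (b * r) in ebr x0 *.
rewrite (_ : q * _ * q' = (q * q') * ((z - 1) / (x - 1))); last by ring.
rewrite pw mul1r.
by field; rewrite x0 subr_eq0 gt_eqF.
Qed.

End mu_laplace.

(** * Stable paths jump in every interval *)

Section jump_free_path.
Variable R : realType.
Variables (y : R -> R) (q : R).
Hypothesis q0 : 0 < q.
Hypothesis y_mono : forall s t, 0 <= s -> s <= t -> y s <= y t.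
Hypothesis y_right : forall t, 0 <= t -> y u @[u --> t^'+] --> y t.
Hypothesis no_jump : forall s, 0 < s <= q -> ~ lim (y u @[u --> s^'-]) < y s.

Let continuous_at x e : 0 <= x <= q -> 0 < e ->
  exists2 r, 0 < r & forall z, 0 <= z <= q -> `|z - x| < r -> `|y z - y x| < e.
Proof.
move=> /andP[x0 xq] e0.
have [r1 r10 H1] : exists2 r, 0 < r & forall z, x < z -> z < x + r -> y z < y x + e.
  have yx : y x < y x + e by rewrite ltrDl.
  have [r /= r0 H] := cvgr_lt _ (y_right x0) _ yx.
  exists r => // z xz zr; apply: H => //=; rewrite ltr0_norm ?subr_lt0//; lra.
have [r2 r20 H2] : exists2 r, 0 < r & forall z, 0 <= z -> z < x -> x - r < z -> y x - e < y z.
  have [->|xn] := eqVneq x 0.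
    by exists 1 => // z z0 z1; move: (lt_le_trans z1 z0); rewrite ltxx.
  have xp : 0 < x by rewrite lt_neqAle eq_sym xn.
  have c : y u @[u --> x^'-] --> lim (y u @[u --> x^'-]).
    apply: nondecreasing_at_left_is_cvgr.
      near=> b => s t /andP[bs sx] /andP[bt tx] st; apply: y_mono => //.
      apply: le_trans (ltW bs); near: b; exact: nbhs_left_ge.
    near=> b; exists (y x) => _ [s /= + <-]; rewrite in_itv /= => /andP[bs sx].
    apply: y_mono; last exact: ltW.
    apply: le_trans (ltW bs); near: b; exact: nbhs_left_ge.
  have l0 : y x - e < lim (y u @[u --> x^'-]).
    have := @no_jump x; rewrite xp xq => /(_ isT)/negP; rewrite -leNgt.
    by apply: lt_le_trans; rewrite gtrBl.
  have [r /= r0 H] := cvgr_gt _ c _ l0.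
  exists r => // z z0 zx xr; apply: H => //=; rewrite gtr0_norm ?subr_gt0//; lra.
exists (Num.min r1 r2); first by rewrite lt_min r10.
move=> z /andP[z0 zq]; rewrite lt_min !ltr_distl => /andP[/andP[a1 a2] /andP[b1 b2]].
have [zx|zx|->] := ltgtP z x; last by rewrite addrC; lra.
  have := H2 _ z0 zx b1; have := y_mono z0 (ltW zx).
  by move=> h1 h2; apply/andP; split; lra.
have := H1 _ zx a2; have := y_mono x0 (ltW zx).
by move=> h1 h2; apply/andP; split; lra.
Unshelve. all: by end_near. Qed.

(** Without jumps the path is continuous on [0, q]: left limits exist by monotonicity and are not
    below the value. Compactness makes the continuity uniform. *)
Lemma jump_free_uniform e : 0 < e -> exists2 r, 0 < r &
  forall x z, 0 <= x <= q -> 0 <= z <= q -> `|z - x| < r -> `|y z - y x| < e.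
Proof.
move=> e0; have := @segment_compact R 0 q.
move=> /compact_near_coveringP /near_covering_withinP.
move=> /(_ R (0 : R)^'+ (fun r x => forall z, 0 <= z <= q -> `|z - x| < r -> `|y z - y x| < e) _).
case.
  move=> x; rewrite /= in_itv /= => x01; have e2 : 0 < e / 2 by rewrite divr_gt0.
  have [r r0 H] := continuous_at x01 e2; have r2 : 0 < r / 2 by rewrite divr_gt0.
  near=> x' r' => /=; rewrite in_itv /= => x'01 z z01 zx'.
  have rr' : r' < r / 2 by near: r'; exact: nbhs_right_lt.
  have xx' : `|x' - x| < r / 2.
    by rewrite distrC; near: x'; apply/nbhs_ballP; exists (r / 2).
  have A1 := H x' x'01; have A2 := H z z01.
  have B1 : `|y x' - y x| < e / 2 by apply: A1; lra.
  have B2 : `|y z - y x| < e / 2.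
    apply: A2; have := ler_normD (z - x') (x' - x).
    rewrite addrA subrK; lra.
  have := ler_normB (y z - y x) (y x' - y x).
  rewrite opprB addrA subrK; lra.
move=> r /= r0 H; exists (r / 2); first by rewrite divr_gt0.
move=> x z x01 z01 zx; apply: (H (r / 2)) => //=.
- by rewrite sub0r normrN gtr0_norm ?divr_gt0//; lra.
- by rewrite divr_gt0.
Unshelve. all: by end_near. Qed.

End jump_free_path.

Lemma prod_ge_1_sum (R : realType) n (a : nat -> R) : (forall i, 0 <= a i <= 1) ->
  1 - \sum_(i < n) a i <= \prod_(i < n) (1 - a i) <= 1.
Proof.
move=> a01; elim: n => [|n /andP[ih ih1]]; first by rewrite !big_ord0 subr0 lexx.
have p0 : 0 <= \prod_(i < n) (1 - a i) by apply: prodr_ge0 => i _; have /andP[] := a01 i; lra.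
rewrite !big_ord_recr /=; have /andP[h0 h1] := a01 n.
set p := \prod_(_ < _) _ in ih ih1 p0 *; set s := \sum_(_ < _) _ in ih *.
have : 0 <= (1 - p) * a n by rewrite mulr_ge0// subr_ge0.
have : 0 <= p * a n by rewrite mulr_ge0.
by move=> ? ?; apply/andP; split; nra.
Qed.

Lemma archi_le0 (R : realType) (p c : R) : (forall n : nat, p * n%:R <= c) -> p <= 0.
Proof.
move=> H; rewrite leNgt; apply/negP => p0.
have c0 : 0 <= c by have := H 0%N; rewrite mulr0.
have := H (Num.truncn (c / p)).+1; rewrite mulrC -ler_pdivlMr// leNgt.
by have /andP[_ ->] := truncn_itv (divr_ge0 c0 (ltW p0)).
Qed.

(* It is 1 - O(x^2) at 0, so its product over a fine mesh exceeds 1/2 along a path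
   without jumps, whereas for stable increments the product of its means is
   exponentially small in [lam ^ alpha]. *)
Definition jump_test (R : realType) (lam x : R) : R := 1 - (1 - expR (- lam * x)) ^+ 2.

Lemma jump_testE (R : realType) (lam x : R) :
  jump_test lam x = 2 * expR (- lam * x) - expR (- (2 * lam) * x).
Proof.
have -> : expR (- (2 * lam) * x) = expR (- lam * x) ^+ 2.
  by rewrite expr2 -expRD; congr expR; ring.
by rewrite /jump_test; ring.
Qed.

Lemma jump_test01 (R : realType) (lam x : R) : 0 <= lam -> 0 <= x -> 0 <= jump_test lam x <= 1.
Proof.
move=> l0 x0; have e0 := expR_ge0 (- lam * x).
have e1 : expR (- lam * x) <= 1 by rewrite -expR0 ler_expR mulNr oppr_le0 mulr_ge0.
rewrite /jump_test; set z := expR _ in e0 e1 *.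
by apply/andP; split; nra.
Qed.

Section jump_free_product.
Variable R : realType.
Variables (y : R -> R) (q : R).
Hypothesis q0 : 0 < q.
Hypothesis y_mono : forall s t, 0 <= s -> s <= t -> y s <= y t.
Hypothesis y_right : forall t, 0 <= t -> y u @[u --> t^'+] --> y t.
Hypothesis no_jump : forall s, 0 < s <= q -> ~ lim (y u @[u --> s^'-]) < y s.

Lemma jump_free_product lam : 0 <= lam -> exists m, forall n, (m <= n)%N ->
  2^-1 <= \prod_(i < n.+1) jump_test lam (y (q * i.+1%:R / n.+1%:R) - y (q * i%:R / n.+1%:R)).
Proof.
move=> l0; pose V := y q - y 0; have V0 : 0 <= V by rewrite subr_ge0 y_mono// ltW.
(* With increments below [e] and total increase [V], the losses (lam x_i)^2 add up to at most lam^2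
   e V, which this choice keeps below 1/2. *)
pose e := (2 * (lam ^+ 2 * (V + 1) + 1))^-1.
have l2 : 0 <= lam ^+ 2 by exact: sqr_ge0.
have d0 : 0 < lam ^+ 2 * (V + 1) + 1 by rewrite ltr_wpDl// mulr_ge0// addr_ge0.
have e0 : 0 < e by rewrite invr_gt0 mulr_gt0.
have [r r0 H] := jump_free_uniform y_mono y_right no_jump e0.
exists (Num.truncn (q / r)) => n mn.
have n0 : 0 < n.+1%:R :> R by [].
pose t i : R := q * i%:R / n.+1%:R.
have t0 i : 0 <= t i by rewrite divr_ge0// mulr_ge0// ltW.
have tS i : t i.+1 - t i = q / n.+1%:R by rewrite /t -natr1; field; rewrite gt_eqF.
have qn : q / n.+1%:R < r.
  rewrite ltr_pdivrMr// -ltr_pdivrMl// mulrC.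
  have /andP[_ h] := truncn_itv (ltW (divr_gt0 q0 r0)).
  by apply: lt_le_trans h _; rewrite ler_nat.
have tSle i : t i <= t i.+1 by rewrite -subr_ge0 tS divr_ge0// ltW.
have tq i : (i <= n.+1)%N -> t i <= q by move=> i1; rewrite ler_pdivrMr// ler_pM2l// ler_nat.
pose x i := y (t i.+1) - y (t i).
have x0 i : 0 <= x i by rewrite subr_ge0 y_mono.
have xe i : (i < n.+1)%N -> x i < e.
  move=> i1; have := H (t i) (t i.+1); rewrite !t0 !tq//; last exact: ltnW.
  move=> /(_ isT isT); rewrite tS gtr0_norm ?divr_gt0// => /(_ qn).
  by rewrite -/(x i) (ger0_norm (x0 i)).
have Sx : \sum_(i < n.+1) x i = V.
  rewrite -(big_mkord xpredT x) (telescope_sumr (fun i => y (t i)))// /V /t mulr0 mul0r.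
  by rewrite -mulrA divff ?mulr1// gt_eqF.
pose a i := if (i < n.+1)%N then (1 - expR (- lam * x i)) ^+ 2 else 0.
have E1 i : 0 <= 1 - expR (- lam * x i) <= lam * x i.
  have := expR_ge1Dx (- lam * x i); have : expR (- lam * x i) <= 1.
    by rewrite -expR0 ler_expR mulNr oppr_le0 mulr_ge0.
  by move=> ? ?; apply/andP; split; lra.
have E2 i : 1 - expR (- lam * x i) <= 1 by rewrite gerBl expR_ge0.
have a01 i : 0 <= a i <= 1.
  rewrite /a; case: ifP => _; last by rewrite lexx ler01.
  rewrite sqr_ge0 /=; have /andP[h _] := E1 i; exact: exprn_ile1.
have -> : \prod_(i < n.+1) jump_test lam (y (q * i.+1%:R / n.+1%:R) - y (q * i%:R / n.+1%:R)) =
    \prod_(i < n.+1) (1 - a i).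
  by apply: eq_bigr => i _; rewrite /a ltn_ord.
have /andP[h _] := @prod_ge_1_sum R n.+1 a a01; apply: le_trans h.
have : \sum_(i < n.+1) a i <= \sum_(i < n.+1) lam ^+ 2 * e * x i.
  apply: ler_sum => i _; rewrite /a ltn_ord.
  have /andP[h0 h1] := E1 i; apply: (@le_trans _ _ ((lam * x i) ^+ 2)).
    by rewrite lerXn2r ?nnegrE// mulr_ge0.
  rewrite exprMn -mulrA ler_wpM2l// expr2 ler_wpM2r// ltW//; exact: xe.
rewrite -mulr_sumr Sx => h.
have : lam ^+ 2 * e * V <= 2^-1.
  rewrite /e mulrAC ler_pdivrMr ?mulr_gt0//.
  rewrite mulrA mulVf ?mul1r//; have := mulr_ge0 l2 V0; lra.
lra.
Qed.

End jump_free_product.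

Section subordinator.
Context (R : realType) (alpha : R) d (Omega : measurableType d) (P : probability Omega R).
Variable Y : R -> {RV P >-> R}.
Hypotheses (alpha01 : 0 < alpha < 1) (hY : stable_subordinator alpha Y).
Local Notation E f := (Rintegral P setT f).

Let incr s t (w : Omega) : R := Y t w - Y s w.

Let mincr s t : measurable_fun setT (incr s t).
Proof. exact: measurable_funB. Qed.

Lemma subordinator_laplace s t lam : 0 <= s -> s <= t -> 0 <= lam ->
  (\int[P]_w (expR (- lam * incr s t w))%:E = (expR (- ((t - s) * lam `^ alpha)))%:E)%E.
Proof.
move=> s0 st lam0; have [_ _ law lap] := hY.
have ts : 0 <= t - s by rewrite subr_ge0.
rewrite -(lap _ _ ts lam0) unlock.
have mY : measurable_fun setT (Y (t - s)) by [].
apply: (@ge0_integral_law R _ _ _ _ _ _ P P (incr s t) (Y (t - s)) (mincr s t) mY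
  (fun C mC => law _ _ s0 st C mC) (fun x => (expR (- lam * x))%:E)).
- by move=> x; rewrite lee_fin expR_ge0.
- by apply/measurable_EFinP; apply: measurableT_comp => //; exact: measurable_funM.
Qed.

(* [Y] is only almost surely monotone; clamping the increments makes the test
   function range in [0, 1] everywhere. *)
Let jt (lam x : R) : R := jump_test lam (Num.max x 0).

Let mono : {ae P, forall w, forall s t, 0 <= s -> s <= t -> Y s w <= Y t w}.
Proof. by have [h _ _ _] := hY; apply: filterS h => w []. Qed.

Let mjt lam : measurable_fun setT (jt lam).
Proof.
apply: measurable_funB => //; apply: measurable_funX; apply: measurable_funB => //.
by apply: measurableT_comp => //; apply: measurable_funM => //; exact: measurable_maxr.
Qed.

Let jt01 lam x : 0 <= lam -> 0 <= jt lam x <= 1.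
Proof. by move=> l0; apply: jump_test01; rewrite ?le_max ?lexx ?orbT. Qed.

Lemma jump_test_mean s t lam : 0 <= s -> s <= t -> 0 <= lam ->
  (\int[P]_w (jt lam (incr s t w))%:E =
   (2 * expR (- ((t - s) * lam `^ alpha)) - expR (- ((t - s) * (2 * lam) `^ alpha)))%:E)%E.
Proof.
move=> s0 st l0; have l2 : 0 <= 2 * lam by rewrite mulr_ge0.
transitivity (\int[P]_w (2 * expR (- lam * incr s t w) - expR (- (2 * lam) * incr s t w))%:E)%E.
  apply: ae_eq_integral => //.
  - by apply/measurable_EFinP; exact: (measurableT_comp (mjt lam) (mincr s t)).
  - apply/measurable_EFinP; apply: measurable_funB; first apply: measurable_funM => //.
      by apply: measurableT_comp => //; exact: measurable_funM.
    by apply: measurableT_comp => //; exact: measurable_funM.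
  - apply: filterS mono => w mw _; rewrite /jt max_l ?jump_testE// subr_ge0; exact: mw.
have fin l : 0 <= l -> integ P (fun w => expR (- l * incr s t w)).
  move=> l0'; apply/integrableP; split.
    by apply/measurable_EFinP; apply: measurableT_comp => //; exact: measurable_funM.
  under eq_integral do rewrite gee0_abs ?lee_fin ?expR_ge0//.
  by rewrite subordinator_laplace// ltry.
have fE l : 0 <= l -> E (fun w => expR (- l * incr s t w)) = expR (- ((t - s) * l `^ alpha)).
  by move=> l0'; apply: EFin_inj; rewrite -EFinE ?subordinator_laplace//; exact: fin.
rewrite EFinE; last by apply: integB; [apply: integZ; exact: fin|exact: fin].
by rewrite EB ?EZ ?fE//; [exact: fin|apply: integZ; exact: fin|exact: fin].
Qed.

Let G s := \bigcup_(t in `[0, s]%classic) sigma_of (Y t).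

Let mG s t : 0 <= t -> t <= s -> measurable_fun setT (Y t : g_sigma_algebraType (G s) -> R).
Proof.
move=> t0 ts _ C mC; apply: sub_sigma_algebra; exists t; first by rewrite /= in_itv /= t0.
by exists C.
Qed.

Let indep (E1 E2 : set (set Omega)) (f1 f2 : Omega -> \bar R) :
  independent P E1 E2 -> E1 `<=` measurable -> E2 `<=` measurable ->
  (forall w, 0 <= f1 w)%E -> (forall w, 0 <= f2 w)%E ->
  (forall C, measurable C -> E1 (f1 @^-1` C)) -> (forall C, measurable C -> E2 (f2 @^-1` C)) ->
  (\int[P]_w (f1 w * f2 w) = (\int[P]_w f1 w) * \int[P]_w f2 w)%E.
Proof.
move=> ind m1 m2 f10 f20 h1 h2.
pose EE (b : bool) := if b then E1 else E2; pose f (b : bool) := if b then f1 else f2.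
have mu : mutually_independent P [set: bool] EE.
  move=> s A us As.
  have {}As b : b \in s -> EE b (A b) by move=> /As[].
  have mA b : b \in s -> measurable (A b) by move=> /As; case: b; [exact: m1|exact: m2].
  have cons b t : \bigcap_(i in [set i | i \in b :: t]) A i = A b `&` \bigcap_(i in [set i | i \in t]) A i.
    apply/seteqP; split => x.
      by move=> H; split; [apply: H; rewrite /= mem_head|move=> j js; apply: H; rewrite /= inE js orbT].
    by move=> [Ai H] j /=; rewrite inE => /orP[/eqP ->|js] //; exact: H.
  have nil : \bigcap_(i in [set i | i \in [::]]) A i = setT by rewrite -subTset => x _ j.
  move: us As mA; case: s => [|b [|c s]] /= us As mA.
  - by rewrite nil big_nil probability_setT.
  - by rewrite cons nil setIT big_seq1.
  - move: us; case: s As mA => [|e s] As mA; last first.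
      by rewrite !inE !negb_or => /and4P[]; case: b {As mA}; case: c; case: e.
    rewrite inE andbT => bc; rewrite !cons nil setIT !big_cons big_nil mule1.
    have := As b; have := As c; rewrite !inE !eqxx !orbT => /(_ isT) hc /(_ isT) hb.
    move: bc hb hc; case: b {As mA}; case: c => // _ hb hc; first exact: ind.
    by rewrite setIC muleC ind.
have mEE b : setT b -> EE b `<=` measurable by case: b.
have f0 b w : (0 <= f b w)%E by case: b.
have fE b C : setT b -> measurable C -> EE b (f b @^-1` C) by case: b => _; [exact: h1|exact: h2].
have := independent_prod mu mEE f0 fE (s := [:: true; false]) isT (fun _ _ => Logic.I).
rewrite !big_cons big_nil mule1 /= => <-.
by apply: eq_integral => w _; rewrite !big_cons big_nil mule1.
Qed.

Let grid h i : R := h * i%:R.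

(** The last increment is independent of the path before it, so its factor splits off. *)
Lemma jump_test_prod h n lam : 0 <= h -> 0 <= lam ->
  (\int[P]_w (\prod_(i < n) jt lam (incr (grid h i) (grid h i.+1) w))%:E =
   ((2 * expR (- (h * lam `^ alpha)) - expR (- (h * (2 * lam) `^ alpha))) ^+ n)%:E)%E.
Proof.
move=> h0 l0; have g0 i : 0 <= grid h i by rewrite mulr_ge0.
have gS i : grid h i <= grid h i.+1 by rewrite ler_wpM2l// ler_nat.
have gh i : grid h i.+1 - grid h i = h by rewrite /grid -natr1; ring.
have gle i j : (i <= j)%N -> grid h i <= grid h j by move=> ij; rewrite ler_wpM2l// ler_nat.
have gle0 s : G s `<=` measurable.
  by move=> C [t _ tC]; apply: (sigma_of_measurable _ tC).
elim: n => [|n ih].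
  under eq_integral do rewrite big_ord0.
  by rewrite integral_cst// mul1e expr0; exact: probability_setT.
under eq_integral do rewrite big_ord_recr /= EFinM.
pose f1 w := (\prod_(i < n) jt lam (incr (grid h i) (grid h i.+1) w))%:E.
pose f2 w := (jt lam (incr (grid h n) (grid h n.+1) w))%:E.
have [_ ind _ _] := hY.
rewrite (indep (f1 := f1) (f2 := f2) (ind _ _ (g0 n) (gS n))).
- by rewrite ih jump_test_mean// gh -EFinM exprSr.
- by apply: smallest_sub; [exact: sigma_algebra_measurable|exact: gle0].
- by apply: sigma_of_measurable; exact: mincr.
- by move=> w; rewrite lee_fin; apply: prodr_ge0 => i _; have /andP[] := jt01 (incr (grid h i) (grid h i.+1) w) l0.
- by move=> w; rewrite lee_fin; have /andP[] := jt01 (incr (grid h n) (grid h n.+1) w) l0.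
- move=> C mC.
  have : measurable_fun setT (f1 : g_sigma_algebraType (G (grid h n)) -> \bar R).
    apply/measurable_EFinP; apply: measurable_prod => i _.
    by apply: (measurableT_comp (mjt lam)); apply: measurable_funB; apply: mG => //; apply: gle;
      [exact: ltn_ord|exact: ltnW].
  by move=> /(_ measurableT C mC); rewrite setTI.
- move=> C mC; have mj : measurable_fun setT (fun x => (jt lam x)%:E) by exact/measurable_EFinP.
  exists ((fun x => (jt lam x)%:E) @^-1` C); last by rewrite setTI.
  by rewrite -[X in measurable X]setTI; exact: mj.
Qed.

Let flat lam q n : set Omega :=
  [set w | 2^-1 <= \prod_(i < n.+1) jt lam (incr (grid (q / n.+1%:R) i) (grid (q / n.+1%:R) i.+1) w)].

Let mprodj lam h n : measurable_fun setT (fun w => \prod_(i < n) jt lam (incr (grid h i) (grid h i.+1) w)).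
Proof. by apply: measurable_prod => i _; exact: (measurableT_comp (mjt lam) (mincr _ _)). Qed.

Let mflat lam q n : measurable (flat lam q n).
Proof.
have -> : flat lam q n = (fun w => \prod_(i < n.+1) jt lam
    (incr (grid (q / n.+1%:R) i) (grid (q / n.+1%:R) i.+1) w)) @^-1` `[2^-1, +oo[%classic.
  by apply/seteqP; split => w /=; rewrite in_itv /= andbT.
by rewrite -[X in measurable X]setTI; apply: mprodj.
Qed.

(** The first-order rate: the mean of the jump test over a short time h is about 1 - kappa h
    lam^alpha. It is positive because alpha < 1. *)
Let kappa : R := 2 - 2 `^ alpha.

Let kappa_gt0 : 0 < kappa.
Proof.
have l2 : 0 < ln 2 :> R by rewrite ln_gt0 ?ltr1n.
rewrite subr_gt0 /powR ifF; last by rewrite gt_eqF.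
rewrite -[ltRHS](@lnK R 2) ?posrE// ltr_expR gtr_pMl//.
by have /andP[] := alpha01.
Qed.

(** Parametrised by M = lam^alpha. One factor has mean at most 1 - h kappa M + 2 (h M)^2, so the
    product over n + 1 cells has mean at most exp (- q kappa M + 2 (q M)^2 / (n + 1)). The condition
    on n bounds the last term by 1, and Markov's inequality at level 1/2 gives the factor 2. *)
Let flat_prob M q n : 0 <= M -> 0 < q -> 2 * (q * M) ^+ 2 <= n.+1%:R ->
  (P (flat (M `^ alpha^-1) q n) <= (2 * expR (1 - q * kappa * M))%:E)%E.
Proof.
move=> M0 q0 nM; set lam := M `^ alpha^-1; have l0 : 0 <= lam by exact: powR_ge0.
have /andP[a0 _] := alpha01.
have lE : lam `^ alpha = M by rewrite /lam -powRrM mulVf ?powRr1// gt_eqF.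
have n0 : 0 < n.+1%:R :> R by [].
set h := q / n.+1%:R; have h0 : 0 <= h by rewrite divr_ge0// ltW.
pose F w := \prod_(i < n.+1) jt lam (incr (grid h i) (grid h i.+1) w).
have EF : (\int[P]_w (F w)%:E)%E = _ := jump_test_prod n.+1 h0 l0.
set c := _ - _ in EF.
have F0 w : 0 <= F w by apply: prodr_ge0 => i _; have /andP[] := jt01 (incr (grid h i) (grid h i.+1) w) l0.
have step : ((2^-1)%:E * P (flat lam q n) <= (c ^+ n.+1)%:E)%E.
  rewrite -EF.
  have -> : ((2^-1)%:E * P (flat lam q n) = \int[P]_w (2^-1 * \1_(flat lam q n) w)%:E)%E.
    have i0 : (0 <= (2^-1 : R)%:E)%E by rewrite lee_fin invr_ge0.
    have m1 : measurable_fun setT (fun w => (\1_(flat lam q n) w : R)%:E).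
      by apply/measurable_EFinP; exact: measurable_indic.
    under eq_integral do rewrite EFinM.
    rewrite (ge0_integralZl P measurableT m1 _ i0)//.
    by rewrite integral_indic// setIT.
  apply: ge0_le_integral => //.
  - by apply/measurable_EFinP; apply: measurable_funM => //; exact: measurable_indic.
  - by apply/measurable_EFinP; exact: mprodj.
  - move=> w _; rewrite lee_fin indicE; case: (boolP (w \in _)) => [/set_mem|] wF; last by rewrite mulr0.
    by rewrite mulr1.
have cb : c ^+ n.+1 <= expR (1 - q * kappa * M).
  have hM : 0 <= h * M by exact: mulr_ge0.
  have cE : c <= 1 - h * kappa * M + 2 * (h * M) ^+ 2.
    rewrite /c powRM// lE.
    have /andP[e1 _] := exp_quad hM.
    have h2 : 0 <= h * (2 `^ alpha * M) by rewrite mulr_ge0// mulr_ge0// powR_ge0.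
    have /andP[_ e2] := exp_quad h2.
    by rewrite /kappa; lra.
  have c1 : c <= expR (- (h * kappa * M) + 2 * (h * M) ^+ 2).
    by apply: le_trans (expR_ge1Dx _); lra.
  have c0 : 0 <= c.
    rewrite /c; have e0 := expR_ge0 (- (h * lam `^ alpha)).
    have : expR (- (h * (2 * lam) `^ alpha)) <= expR (- (h * lam `^ alpha)).
      rewrite ler_expR lerN2 ler_wpM2l//; apply: ge0_ler_powR; rewrite ?nnegrE ?(ltW a0)//; lra.
    lra.
  apply: (@le_trans _ _ (expR (- (h * kappa * M) + 2 * (h * M) ^+ 2) ^+ n.+1)).
    by rewrite lerXn2r ?nnegrE ?expR_ge0.
  rewrite -expRM_natl ler_expR mulrDr.
  have -> : n.+1%:R * - (h * kappa * M) = - (q * kappa * M) by rewrite /h; field; rewrite gt_eqF.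
  have -> : n.+1%:R * (2 * (h * M) ^+ 2) = 2 * (q * M) ^+ 2 / n.+1%:R.
    by rewrite /h; field; rewrite gt_eqF.
  by rewrite addrC lerD2r ler_pdivrMr// mul1r.
rewrite -(fineK (fin_num_measure P _ (mflat lam q n))) in step *.
move: step; rewrite -EFinM !lee_fin; lra.
Qed.

Let limit_flat M q := \bigcup_m \bigcap_(n in [set n | (m <= n)%N]) flat (M `^ alpha^-1) q n.

Let mlimit_flat M q : measurable (limit_flat M q).
Proof. by apply: bigcupT_measurable => m; apply: bigcap_measurable; [exists m => /=|move=> n _; exact: mflat]. Qed.

Let limit_flat_prob M q : 0 <= M -> 0 < q ->
  (P (limit_flat M q) <= (2 * expR (1 - q * kappa * M))%:E)%E.
Proof.
move=> M0 q0; set F := fun m => \bigcap_(n in [set n | (m <= n)%N]) flat (M `^ alpha^-1) q n.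
have mF m : measurable (F m) by apply: bigcap_measurable; [exists m => /=|move=> n _; exact: mflat].
have c : P (F m) @[m --> \oo] --> P (limit_flat M q).
  apply: nondecreasing_cvg_mu => //; first exact: bigcupT_measurable.
  by move=> m n mn; apply/subsetPset => w Fm k /= nk; apply: Fm => /=; exact: leq_trans nk.
rewrite -(cvg_lim _ c)//; apply: lime_le; first by apply/cvg_ex; exists (P (limit_flat M q)).
apply: nearW => m.
pose n := maxn m (Num.truncn (2 * (q * M) ^+ 2)).
apply: (@le_trans _ _ (P (flat (M `^ alpha^-1) q n))).
  apply: le_measure; rewrite ?inE; [exact: mF|exact: mflat|].
  by move=> w; apply; rewrite /= leq_maxl.
apply: flat_prob => //.
have x0 : 0 <= 2 * (q * M) ^+ 2 by rewrite mulr_ge0// sqr_ge0.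
have /andP[_ h] := truncn_itv x0.
by apply: le_trans (ltW h) _; rewrite ler_nat ltnS leq_maxr.
Qed.

(** A jump-free path passes the test on all fine meshes for every M = k, and the probability of this
    is at most 2 exp (1 - q kappa k) for each k, hence 0. *)
Lemma subordinator_jump q : 0 < q ->
  {ae P, forall w, exists2 s, 0 < s <= q & lim (Y u w @[u --> s^'-]) < Y s w}.
Proof.
move=> q0; pose N := \bigcap_k limit_flat k%:R q.
have mN : measurable N by exact: bigcapT_measurable.
have fN := fin_num_measure P _ mN.
have PN : P N = 0%E.
  rewrite -(fineK fN); congr EFin; apply/eqP; rewrite eq_le fine_ge0// andbT.
  have qk : 0 < q * kappa by exact: mulr_gt0.
  rewrite -(pmulr_lle0 _ qk); apply: (@archi_le0 _ _ (2 * expR 1)) => k.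
  have h : fine (P N) <= 2 * expR (1 - q * kappa * k%:R).
    rewrite -lee_fin fineK//; apply: le_trans (limit_flat_prob (ler0n _ k) q0); apply: le_measure; rewrite ?inE//.
    by move=> w; apply.
  have k0 : 0 <= q * kappa * k%:R by rewrite mulr_ge0// ltW.
  rewrite -mulrA; apply: (@le_trans _ _ (2 * expR (1 - q * kappa * k%:R) * (q * kappa * k%:R))).
    exact: ler_wpM2r.
  rewrite -mulrA ler_wpM2l// expRD -mulrA -[leRHS]mulr1 ler_wpM2l ?expR_ge0//.
  rewrite expRN mulrC ler_pdivrMr ?expR_gt0// mul1r.
  by apply: le_trans (expR_ge1Dx _); lra.
have aeN : {ae P, forall w, ~ N w} by exists N; split => // w /contrapT.
have [h _ _ _] := hY; apply: filterS2 aeN h => w nN [_ ymono yright].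
apply: contrapT => nj; apply: nN => k _.
have nojump s : 0 < s <= q -> ~ lim (Y u w @[u --> s^'-]) < Y s w by move=> sq h'; apply: nj; exists s.
have l0 : 0 <= k%:R `^ alpha^-1 :> R by exact: powR_ge0.
have [m H] := jump_free_product q0 ymono yright nojump l0.
exists m => // n /= mn; rewrite /flat /=.
have := H n mn; congr (_ <= _); apply: eq_bigr => i _.
have n0 : 0 < n.+1%:R :> R by [].
have gE j : grid (q / n.+1%:R) j = q * j%:R / n.+1%:R by rewrite /grid mulrAC.
rewrite /jt /incr !gE max_l// subr_ge0; apply: ymono.
  by rewrite divr_ge0// mulr_ge0// ltW.
by rewrite ler_pM2r ?invr_gt0// ler_pM2l// ler_nat.
Qed.

(** Ensures that the passage set above [Z] is not empty; the infimum of an empty set would be the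
    default 0. The bound P (Y_n <= K) <= exp (K - n) comes from the Laplace transform at 1. *)
Lemma subordinator_unbounded (Z : Omega -> R) : {ae P, forall w, exists n : nat, Z w < Y n%:R w}.
Proof.
pose B (K n : nat) := [set w | Y n%:R w <= K%:R].
have mB K n : measurable (B K n).
  have -> : B K n = Y n%:R @^-1` `]-oo, K%:R]%classic.
    by apply/seteqP; split => w /=; rewrite in_itv.
  exact: measurable_funPTI.
have PB K n : (P (B K n) <= (expR (K%:R - n%:R))%:E)%E.
  have n0 : 0 <= n%:R :> R by [].
  have [Y0 _ _ lap] := hY; have := lap n%:R 1 n0 ler01.
  rewrite powR1 mulr1 unlock => E1.
  rewrite expRD EFinM -E1.
  have eK : (0%:E <= (expR (K%:R : R))%:E)%E by rewrite lee_fin expR_ge0.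
  rewrite -(ge0_integralZl P measurableT _ _ eK); last 2 first.
  - by apply/measurable_EFinP; apply: measurableT_comp => //; exact: measurable_funM.
  - by move=> w _; rewrite lee_fin expR_ge0.
  rewrite -[X in (P X <= _)%E]setIT -integral_indic//.
  apply: ge0_le_integral => //.
  - by apply/measurable_EFinP; exact: measurable_indic.
  - apply/measurable_EFinP; apply: measurable_funM => //.
    by apply: measurableT_comp => //; exact: measurable_funM.
  - move=> w _; rewrite lee_fin indicE -expRD; case: (boolP (w \in _)) => [/set_mem wB|_]; last exact: expR_ge0.
    apply: (@le_trans _ _ 1) => //; rewrite -[leLHS]expR0 ler_expR.
    by move: wB; rewrite /B /= mulN1r subr_ge0.
pose N K := \bigcap_n B K n.
have mN K : measurable (N K) by exact: bigcapT_measurable.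
have PN K : P (N K) = 0%E.
  have fN := fin_num_measure P _ (mN K).
  rewrite -(fineK fN); congr EFin; apply/eqP; rewrite eq_le fine_ge0// andbT.
  apply: (@archi_le0 _ _ (expR K%:R)) => n.
  have : fine (P (N K)) <= expR (K%:R - n%:R).
    rewrite -lee_fin fineK//; apply: le_trans (PB K n); apply: le_measure; rewrite ?inE//.
    by move=> w; apply.
  move=> hp; apply: (@le_trans _ _ (expR (K%:R - n%:R) * n%:R)); first exact: ler_wpM2r.
  rewrite expRD -mulrA -[leRHS]mulr1 ler_wpM2l ?expR_ge0//.
  rewrite expRN mulrC ler_pdivrMr ?expR_gt0// mul1r.
  by apply: le_trans (expR_ge1Dx _); lra.
have aeN : {ae P, forall w, forall K, ~ N K w}.
  by apply/ae_foralln => K; exists (N K); split; [exact: mN|exact: PN|move=> w /contrapT].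
apply: filterS aeN => w nN; apply: contrapT => nZ.
apply: (nN (Num.truncn `|Z w|).+1) => n _; rewrite /B /= leNgt; apply/negP => h.
apply: nZ; exists n; apply: le_lt_trans h; apply: le_trans (ler_norm _) _.
by have /andP[_ /ltW] := truncn_itv (normr_ge0 (Z w)).
Qed.

End subordinator.

(** Scaling by the inverse mass gives mass 1 as soon as the mass is positive, and one jump before
    the passage time makes it positive. A mass 0 would be scaled by the default inverse 0. *)
Lemma pdip_mass1 (R : realType) (alpha : R) (nu : {measure set (ipspace alpha) -> \bar R}) :
  0 < alpha < 1 -> is_PDIP nu -> nu [set x | mass x != 1] = 0%E.
Proof.
move=> a01 [dO [Om [P [Y [Z [r [G]]]]]]].
move=> [hY [r0 Zlaw] _ aeG Glaw].
have mN : measurable [set x : ipspace alpha | mass x != 1].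
  have -> : [set x : ipspace alpha | mass x != 1] = (fun x => mass x : R) @^-1` ~` [set 1].
    by apply/seteqP; split => x /=; [move/eqP|move=> h; apply/eqP].
  by rewrite -[X in measurable X]setTI; apply: measurable_mass => //; apply: measurableC.
have Zpos : {ae P, forall w, 0 < Z w}.
  have mZ : measurable [set x : R | x <= 0].
    by rewrite (_ : [set _ | _] = `]-oo, 0]%classic)//; apply/seteqP; split => x /=; rewrite in_itv.
  exists (Z @^-1` [set x | x <= 0]); split; first exact: measurable_funPTI.
    rewrite Zlaw// /exponential_prob.
    set D := [set x : R | x <= 0] in mZ *.
    transitivity (\int[lebesgue_measure]_(x in D) (0 : \bar R))%E; last exact: integral0.
    apply: ae_eq_integral => //.
      apply/measurable_EFinP; apply: measurable_funTS; exact: measurable_exponential_pdf.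
    exists [set (0 : R)]; split => //; first exact: lebesgue_measure_set1.
    move=> x /= /not_implyP[x0 nx]; apply/eqP; rewrite eq_le x0 /= leNgt; apply/negP => xl.
    by apply: nx; rewrite lt0_exponential_pdf.
  by move=> w /= /negP; rewrite -leNgt.
have jumps : {ae P, forall w, forall p : nat, exists2 s, 0 < s <= p.+1%:R^-1 &
    lim (Y u w @[u --> s^'-]) < Y s w}.
  by apply/ae_foralln => p; apply: (subordinator_jump a01 hY); rewrite invr_gt0.
have unb := subordinator_unbounded hY Z.
have [h _ _ _] := hY.
have key : {ae P, forall w, mass (G w) = 1}.
  apply: filterS2 (filterI aeG (filterI Zpos h)) (filterI jumps unb).
  move=> w [[b bE GE] [Z0 [Y0 ymono yright]]] [J [n Zn]].
  (* The path starts at 0 and is right-continuous, and Z > 0, so the passage time is at least some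
     eta > 0; a jump is then found before eta. *)
  have [eta eta0 Heta] : exists2 e, 0 < e & forall u, 0 < u -> u < e -> Y u w < Z w.
    have c := yright 0 (lexx _); rewrite Y0 in c.
    have [e /= e0 H] := cvgr_lt _ c _ Z0; exists e => // u u0 ue; apply: H => //=.
    by rewrite sub0r normrN gtr0_norm.
  set S := inf [set s | 0 < s /\ Z w < Y s w].
  have etaS : eta <= S.
    apply: lb_le_inf.
      exists n%:R; split => //; rewrite lt_neqAle ler0n andbT eq_sym.
      by apply: contraTneq Zn => ->; rewrite Y0 -leNgt ltW.
    move=> s [s0 Zs]; rewrite leNgt; apply/negP => se.
    by have := lt_trans (Heta _ s0 se) Zs; rewrite ltxx.
  have [p pe] : exists p : nat, p.+1%:R^-1 < eta.
    exists (Num.truncn eta^-1); rewrite invf_plt ?posrE//.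
    have e0 : 0 <= eta^-1 by rewrite invr_ge0 ltW.
    by have /andP[] := truncn_itv e0.
  have [s /andP[s0 sp] js] := J p.
  have bU : blocks b (lim (Y u w @[u --> s^'-]), Y s w).
    rewrite bE; exists s; split => //; rewrite s0 /=; apply: lt_le_trans etaS.
    exact: le_lt_trans sp pe.
  have m0 : 0 < mass b.
    apply: lt_le_trans (sum_leb_le (s := [:: (lim (Y u w @[u --> s^'-]), Y s w)]) isT _).
      by rewrite big_seq1 subr_gt0.
    by move=> U; rewrite inE => /eqP ->.
  by apply: EFin_inj; rewrite -mass_esum GE esum_scale ?invr_gt0// mulVf// gt_eqF.
rewrite -Glaw//; have [N [mN' PN sub]] := key.
apply/eqP; rewrite eq_le measure_ge0 andbT -PN; apply: le_measure; rewrite ?inE//.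
  exact: measurable_funPTI.
by move=> w /= /eqP h'; apply: sub.
Qed.

(** Exponentials of partial sums are bounded by 1, so the transform of the infinite sum is the limit
    of the finite products. [V] is the immigrating mass and [v] its transform; [V] is clamped
    because it is nonnegative only almost surely while the bound must hold everywhere. *)
Lemma series_laplace (R : realType) d (Omega : measurableType d) (P : probability Omega R)
    (K : set nat) (X : nat -> Omega -> R) (V T : Omega -> R) (c : nat -> R) (m lam theta v : R) :
  0 <= lam -> (forall i, measurable_fun setT (X i)) -> measurable_fun setT V -> measurable_fun setT T ->
  (forall i w, 0 <= X i w) -> (forall w, 0 <= T w) ->
  (forall i, K i -> 0 <= c i) ->
  (forall n, (\int[P]_w (expR (- lam * Num.max (V w) 0) *
       \prod_(i < n | nat_of_ord i \in K) expR (- lam * X i w))%:E)%E =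
     (v * \prod_(i < n | nat_of_ord i \in K) expR (- (theta * c i)))%:E) ->
  {ae P, forall w, 0 <= V w /\ (T w)%:E = ((V w)%:E + \sum_(i <oo | i \in K) (X i w)%:E)%E} ->
  (\sum_(i <oo | i \in K) (c i)%:E)%E = m%:E ->
  (\int[P]_w (expR (- lam * T w))%:E = (v * expR (- (theta * m)))%:E)%E.
Proof.
move=> l0 mX mV mT X0 T0 c0 H ae cm.
pose S n w := expR (- lam * Num.max (V w) 0) * \prod_(i < n | nat_of_ord i \in K) expR (- lam * X i w).
have e1 x : 0 <= x -> 0 <= expR (- lam * x) <= 1.
  by move=> x0; rewrite expR_ge0 -expR0 ler_expR mulNr oppr_le0 mulr_ge0.
have mS n : measurable_fun setT (S n).
  apply: measurable_funM.
    by apply: measurableT_comp => //; apply: measurable_funM => //; exact: measurable_maxr.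
  have -> : (fun w => \prod_(i < n | nat_of_ord i \in K) expR (- lam * X i w)) =
      (fun w => \prod_(i < n) (if nat_of_ord i \in K then expR (- lam * X i w) else 1)).
    by apply/funext => w; rewrite big_mkcond.
  apply: measurable_prod => i _; case: (nat_of_ord i \in K) => //.
  by apply: measurableT_comp => //; exact: measurable_funM.
have S01 n w : 0 <= S n w <= 1.
  have p01 : 0 <= \prod_(i < n | nat_of_ord i \in K) expR (- lam * X i w) <= 1.
    apply/andP; split; first by apply: prodr_ge0 => i _; exact: expR_ge0.
    by apply: prodr_ile1 => i _; exact: e1.
  have v0 : 0 <= Num.max (V w) 0 by rewrite le_max lexx orbT.
  have /andP[h1 h2] := e1 _ v0.
  have /andP[p1 p2] := p01; by rewrite /S mulr_ge0//= mulr_ile1.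
have SE n w : S n w = expR (- lam * (Num.max (V w) 0 + \sum_(i < n | nat_of_ord i \in K) X i w)).
  by rewrite /S mulrDr expRD; congr (_ * _); rewrite mulr_sumr expR_sum.
have partial n (a : nat -> R) : (\sum_(0 <= i < n | i \in K) (a i)%:E)%E =
    (\sum_(i < n | nat_of_ord i \in K) a i)%:E by rewrite big_mkord sumEFin.
have sumcvg (a : nat -> R) (l : R) : (forall i, i \in K -> 0 <= a i) ->
    (\sum_(i <oo | i \in K) (a i)%:E)%E = l%:E ->
    \sum_(i < n | nat_of_ord i \in K) a i @[n --> \oo] --> l.
  move=> a0 al.
  have h : cvgn (fun n => \sum_(0 <= i < n | i \in K) (a i)%:E)%E.
    by apply: is_cvg_nneseries_cond => i _ /a0; rewrite lee_fin.
  have h2 : (fun n => \sum_(0 <= i < n | i \in K) (a i)%:E)%E @ \oo --> l%:E by rewrite -al; exact: h.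
  have E : (fun n => \sum_(0 <= i < n | i \in K) (a i)%:E)%E =
      (fun n => (\sum_(i < n | nat_of_ord i \in K) a i)%:E).
    by apply/funext => n; exact: partial.
  by rewrite E in h2; exact: (fine_cvg h2).
have cS : {ae P, forall w, S n w @[n --> \oo] --> expR (- lam * T w)}.
  apply: filterS ae => w [V0 TE].
  have XE : (\sum_(i <oo | i \in K) (X i w)%:E)%E = (T w - V w)%:E.
    by rewrite EFinB TE addeAC subee ?add0e//.
  under eq_fun do rewrite SE max_l//.
  have := sumcvg (fun i => X i w) _ (fun i _ => X0 i w) XE => h.
  have h2 : V w + \sum_(i < n | nat_of_ord i \in K) X i w @[n --> \oo] --> T w.
    by rewrite [X in _ --> X](_ : _ = V w + (T w - V w)); [apply: cvgD => //; exact: cvg_cst|ring].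
  exact: (@cvg_comp _ _ _ _ expR _ _ _ (@cvgMr _ _ _ _ _ (- lam) _ h2) (@continuous_expR R (- lam * T w))).
have c1 : (\int[P]_w (S n w)%:E)%E @[n --> \oo] --> (\int[P]_w (expR (- lam * T w))%:E)%E.
  have mT' : measurable_fun setT (fun w => expR (- lam * T w)).
    by apply: measurableT_comp => //; exact: measurable_funM.
  have S1 n w : `|S n w| <= 1 by have /andP[s0 s1] := S01 n w; rewrite ger0_norm.
  have T1 w : `|expR (- lam * T w)| <= 1.
    by have /andP[s0 s1] := e1 _ (T0 w); rewrite ger0_norm.
  have fin (f : Omega -> R) : measurable_fun setT f -> (forall w, `|f w| <= 1) ->
      (\int[P]_w (f w)%:E)%E = (Rintegral P setT f)%:E.
    move=> mf f1; rewrite /Rintegral fineK//.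
    apply: (integrable_fin_num measurableT).
    by apply: (@integ_bounded _ _ _ P f 1).
  rewrite fin// (_ : (fun n => \int[P]_w (S n w)%:E)%E = (fun n => (Rintegral P setT (S n))%:E)).
    apply: cvg_EFin; first exact: nearW.
    exact: (E_bounded_cvg mS mT' S1 cS).
  by apply/funext => n; exact: fin.
have c2 : (\int[P]_w (S n w)%:E)%E @[n --> \oo] --> (v * expR (- (theta * m)))%:E.
  under eq_fun do rewrite H.
  have -> : (fun n => (v * \prod_(i < n | nat_of_ord i \in K) expR (- (theta * c i)))%:E) =
      (fun n => (v * expR (- theta * \sum_(i < n | nat_of_ord i \in K) c i))%:E).
    apply/funext => n; congr (v * _)%:E; rewrite mulr_sumr expR_sum.
    by apply: eq_bigr => i _; rewrite mulNr.
  apply: cvg_EFin; first exact: nearW.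
  apply: cvgMr; rewrite -mulNr.
  have h : \sum_(i < n | nat_of_ord i \in K) c i @[n --> \oo] --> m.
    by apply: sumcvg => // i /set_mem /c0.
  exact: (@cvg_comp _ _ _ _ expR _ _ _ (@cvgMr _ _ _ _ _ (- theta) _ h) (@continuous_expR R (- theta * m))).
exact: (cvg_unique _ c1 c2).
Qed.

(** Equal to r / (r + lam) for the rate r = 1 / (2 h) of the kernels. *)
Definition laplace_factor (R : realType) (h lam : R) : R := (1 + 2 * h * lam)^-1.

(* The Laplace transform of the mass at time [h] of an evolution with
   dimension [2 * a] started from mass [m]. *)
Definition mass_laplace (R : realType) (h m a lam : R) : R :=
  laplace_factor h lam `^ a * expR (- (m / (2 * h) * (1 - laplace_factor h lam))).

(** * Laplace transform of the mass under both kernels *)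

Section kernel_laplace.
Context (R : realType) (alpha y : R) (b : ipspace alpha).
Variable nu : {measure set (ipspace alpha) -> \bar R}.
Hypotheses (alpha01 : 0 < alpha < 1) (y0 : 0 < y).

Let r : R := (2 * y)^-1.
Let r0 : 0 < r. Proof. by rewrite invr_gt0 mulr_gt0. Qed.

Let theta_eq lam : 0 <= lam -> r * lam / (r + lam) * mass b =
  mass b / (2 * y) * (1 - laplace_factor y lam).
Proof.
move=> l0; rewrite /laplace_factor /r; field.
have yl : 0 <= 2 * y * lam by rewrite mulr_ge0// mulr_ge0// ltW.
by rewrite !gt_eqF//; lra.
Qed.

Let factor_eq lam : 0 <= lam -> r / (r + lam) = laplace_factor y lam.
Proof.
move=> l0; rewrite /laplace_factor /r; field.
have yl : 0 <= 2 * y * lam by rewrite mulr_ge0// mulr_ge0// ltW.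
by rewrite !gt_eqF//; lra.
Qed.

Let law_integral d (Omega : measurableType d) (P : probability Omega R)
    (G : {RV P >-> ipspace alpha}) (f : ipspace alpha -> \bar R) : has_law P G nu ->
  (forall x, 0 <= f x)%E -> measurable_fun setT f ->
  (\int[nu]_x f x = \int[P]_w f (G w))%E.
Proof.
move=> law f0 mf; have mG : measurable_fun setT (G : Omega -> ipspace alpha) by [].
by rewrite (@ge0_integral_law R _ _ _ _ _ _ P nu G id mG (@measurable_id _ _ setT) law).
Qed.

Let mexp lam : measurable_fun setT (fun x : ipspace alpha => (expR (- lam * mass x))%:E).
Proof.
apply/measurable_EFinP; apply: measurableT_comp => //; apply: measurable_funM => //.
exact: measurable_mass.
Qed.

Let mu_lap := @mu_laplace R alpha (fun nu => @pdip_mass1 R alpha nu alpha01).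

Section offspring.
Context d (Omega : measurableType d) (P : probability Omega R).
Variables (g : R * R -> {RV P >-> ipspace alpha}) (K : set nat) (f : nat -> R * R).
Hypothesis gmu : forall U, blocks b U -> is_mu (leb U) r (distribution P (g U)).
Hypothesis fb : set_bij K (blocks b) f.

Lemma offspring_laplace lam i : 0 <= lam -> K i ->
  (\int[P]_w (expR (- lam * mass (g (f i) w)))%:E =
   (expR (- (r * lam / (r + lam) * leb (f i))))%:E)%E.
Proof.
move=> l0 Ki; have [fK _ _] := fb; have bf : blocks b (f i) by exact: fK.
have := mu_lap (leb_gt0 bf) r0 l0 (gmu bf).
rewrite (mulrC (leb _)) => <-.
have mg : measurable_fun setT (g (f i) : Omega -> ipspace alpha) by [].
apply: (@ge0_integral_law R _ _ _ _ _ _ P (distribution P (g (f i))) (g (f i)) id mg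
  (@measurable_id _ _ setT) (fun C mC => erefl _) (fun x => (expR (- lam * mass x))%:E)) => //.
Qed.

Definition block_list n := [seq f i | i <- iota 0 n & i \in K].

Lemma block_list_uniq n : uniq (block_list n).
Proof.
have [_ fi _] := fb; rewrite map_inj_in_uniq ?filter_uniq ?iota_uniq// => i j.
by rewrite !mem_filter => /andP[iK _] /andP[jK _]; exact: fi.
Qed.

Lemma block_list_blocks n U : U \in block_list n -> blocks b U.
Proof.
have [fK _ _] := fb.
by move=> /mapP[i]; rewrite mem_filter => /andP[/set_mem iK _] ->; exact: fK.
Qed.

Lemma block_list_big (T : Type) (op : T -> T -> T) (x0 : T) n (F : R * R -> T) :
  \big[op/x0]_(U <- block_list n) F U = \big[op/x0]_(i < n | nat_of_ord i \in K) F (f i).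
Proof. by rewrite big_map big_filter -{1}(subn0 n) -/(index_iota 0 n) big_mkord. Qed.

Lemma mass_series w : (\esum_(U in blocks b) (mass (g U w))%:E)%E =
  (\sum_(i <oo | i \in K) (mass (g (f i) w))%:E)%E.
Proof.
rewrite (reindex_esum K (blocks b) f)// nneseries_esum ?set_mem_set//.
by move=> i _; rewrite lee_fin mass_ge0.
Qed.

Lemma leb_series : (\sum_(i <oo | i \in K) (leb (f i))%:E)%E = (mass b)%:E.
Proof.
have [fK _ _] := fb.
rewrite -mass_esum (reindex_esum K (blocks b) f)// nneseries_esum ?set_mem_set//.
by move=> i /set_mem /fK /leb_gt0 /ltW; rewrite lee_fin.
Qed.

End offspring.

(** The offspring of the blocks are independent and the exponents are linear in the block lengths,
    so the product depends on the initial state through its total mass only. *)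
Lemma kappa1_laplace lam : 0 <= lam -> is_kappa1 y b nu ->
  (\int[nu]_x (expR (- lam * mass x))%:E = (mass_laplace y (mass b) 0 lam)%:E)%E.
Proof.
move=> l0 [_ /(_ y0)] [dO [Om [P [g [G]]]]] [gmu ind fin Gb law].
rewrite (law_integral law _ (mexp lam)); last by move=> x; rewrite lee_fin expR_ge0.
have [K [f fb]] := blocks_enum b; have [fK fi fs] := fb.
rewrite /mass_laplace powRr0 mul1r -theta_eq// -[X in X%:E]mul1r.
have mM (Y : {RV P >-> ipspace alpha}) : measurable_fun setT (fun w => mass (Y w) : R).
  exact: (measurableT_comp (@measurable_mass R alpha)).
apply: (@series_laplace R _ Om P K (fun i w => mass (g (f i) w)) (cst 0)
  (fun w => mass (G w)) (fun i => leb (f i))) => //.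
- by move=> i w; exact: mass_ge0.
- by move=> w; exact: mass_ge0.
- by move=> i /fK /leb_gt0 /ltW.
- move=> n.
  transitivity (\int[P]_w (\prod_(U <- block_list K f n) (expR (- lam * mass (g U w)))%:E))%E.
    apply: eq_integral => w _; rewrite maxxx mulr0 expR0 mul1r prodEFin.
    by rewrite (block_list_big K f).
  rewrite (independent_prod ind); first last.
  - by move=> U; exact: (block_list_blocks fb).
  - exact: (block_list_uniq fb).
  - move=> U C _ mC; have := mexp lam measurableT mC; rewrite setTI => mE.
    by exists ((fun x : ipspace alpha => (expR (- lam * mass x))%:E) @^-1` C) => //; rewrite setTI.
  - by move=> U w; rewrite lee_fin expR_ge0.
  - by move=> U _; exact: sigma_of_measurable.
  rewrite (block_list_big K f) mul1r -prodEFin; apply: eq_bigr => i /set_mem iK.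
  exact: (offspring_laplace gmu fb).
- apply: filterS2 fin Gb => w finw Gw; split => //.
  by rewrite add0e -(mass_series g fb) -mass_esum Gw esum_concat.
- exact: leb_series.
Qed.

(** As for type 1, with the independent gamma mass of the immigration contributing the Laplace
    factor to the power alpha. *)
Lemma kappa0_laplace lam : 0 <= lam -> is_kappa0 y b nu ->
  (\int[nu]_x (expR (- lam * mass x))%:E = (mass_laplace y (mass b) alpha lam)%:E)%E.
Proof.
move=> l0 [_ /(_ y0)] [dO [Om [P [B [g0 [g [G]]]]]]] [[Blaw g0P] gmu ind fin law].
rewrite (law_integral law _ (mexp lam)); last by move=> x; rewrite lee_fin expR_ge0.
have [K [f fb]] := blocks_enum b; have [fK fi fs] := fb.
rewrite /mass_laplace -theta_eq// -factor_eq//.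
have mM (Y : {RV P >-> ipspace alpha}) : measurable_fun setT (fun w => mass (Y w) : R).
  exact: (measurableT_comp (@measurable_mass R alpha)).
have mN : measurable [set x : ipspace alpha | mass x != 1].
  have -> : [set x : ipspace alpha | mass x != 1] = (fun x => mass x : R) @^-1` ~` [set 1].
    by apply/seteqP; split => x /=; [move/eqP|move=> h; apply/eqP].
  by rewrite -[X in measurable X]setTI; apply: measurable_mass => //; apply: measurableC.
have g1 : {ae P, forall w, mass (g0 w) = 1}.
  exists (g0 @^-1` [set x | mass x != 1]); split => //.
  - exact: measurable_funPTI.
  - exact: (pdip_mass1 alpha01 g0P).
  - by move=> w /= /eqP.
have Bpos := gamma_gt0 Blaw.
apply: (@series_laplace R _ Om P K (fun i w => mass (g (f i) w)) B
  (fun w => mass (G w)) (fun i => leb (f i))) => //.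
- by move=> i w; exact: mass_ge0.
- by move=> w; exact: mass_ge0.
- by move=> i /fK /leb_gt0 /ltW.
- move=> n.
  pose s : seq (bool + R * R) := inl true :: [seq inr U | U <- block_list K f n].
  (* The index [inl false], of the immigrating partition, gets the factor 1: its mass is almost
     surely 1, so the immigrating mass is [B] alone. *)
  pose F (i : bool + R * R) (w : Om) : \bar R := match i with
    | inl true => (expR (- lam * Num.max (B w) 0))%:E
    | inl false => 1%E
    | inr U => (expR (- lam * mass (g U w)))%:E end.
  have mB1 : measurable_fun setT (fun x : R => (expR (- lam * Num.max x 0))%:E).
    apply/measurable_EFinP; apply: measurableT_comp => //; apply: measurable_funM => //.
    exact: measurable_maxr.
  transitivity (\int[P]_w (\prod_(i <- s) F i w))%E.
    apply: eq_integral => w _; rewrite EFinM /s big_cons big_map /= (block_list_big K f).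
    by rewrite -prodEFin.
  rewrite (independent_prod ind); first last.
  - move=> i; rewrite inE => /orP[/eqP -> //|/mapP[U Us ->]]; exact: (block_list_blocks fb Us).
  - rewrite /s cons_uniq; apply/andP; split; first by apply/negP => /mapP[].
    by rewrite map_inj_uniq ?(block_list_uniq fb)// => U V [].
  - move=> [[]|U] C _ mC.
    + exists ((fun x : R => (expR (- lam * Num.max x 0))%:E) @^-1` C); last by rewrite setTI.
      by rewrite -[X in measurable X]setTI; exact: mB1.
    + have [C1|C1] := pselect (C 1%E).
        by exists setT => //; rewrite setTI preimage_setT; apply/seteqP; split.
      by exists set0 => //; rewrite setTI preimage_set0; apply/seteqP; split.
    + have := mexp lam measurableT mC; rewrite setTI => mE.
      by exists ((fun x : ipspace alpha => (expR (- lam * mass x))%:E) @^-1` C) => //; rewrite setTI.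
  - by move=> [[]|U] w /=; rewrite lee_fin ?expR_ge0.
  - by move=> [[]|U] _; exact: sigma_of_measurable.
  rewrite /s big_cons big_map EFinM (block_list_big K f) -prodEFin; congr (_ * _)%E; last first.
    by apply: eq_bigr => i /set_mem iK; exact: (offspring_laplace gmu fb).
  rewrite -(gamma_laplace r0 Blaw l0) /F; apply: ae_eq_integral => //.
  - by apply: (measurableT_comp mB1).
  - by apply/measurable_EFinP; apply: measurableT_comp => //; exact: measurable_funM.
  - by apply: filterS Bpos => w B0 _; rewrite max_l// ltW.
- apply: filterS2 (filterI g1 Bpos) fin => w [gw Bw] [finw Gw]; split; first exact: ltW.
  rewrite -(mass_series g fb) -mass_esum Gw gw mulr1 esum_setU.
  + by rewrite esum_scale// gw mulr1 esum_shift esum_concat.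
  + move=> U [[V gV <-]|[V [W bW [V' gV' <-]] <-]]; rewrite lee_fin /leb /=.
      by have := mulr_ge0 (ltW Bw) (ltW (leb_gt0 gV)); rewrite /leb; lra.
    by have := block_lt gV'; lra.
  + apply/seteqP; split => // U [[V gV <-] [V1 [W bW [V' gV' <-]] [E1 E2]]].
    have := ler_wpM2l (ltW Bw) (block_le gV); rewrite gw mulr1.
    have V12 : B w * V.1 < B w * V.2 by rewrite ltr_pM2l// (block_lt gV).
    have := @concat_offset_ge0 R b (fun U => g U w) W; have := block_ge0 gV'.
    by move: E1 E2 V12; rewrite /=; lra.
- exact: leb_series.
Qed.

End kernel_laplace.

(** * Moments of the mass under the kernels *)

Section laplace_moments.
Context (R : realType).
Implicit Types (h m a lam : R).

(* [mom h m j a] is (-1)^j times the j-th derivative of [mass_laplace h m a]. *)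
Fixpoint mom h m (j : nat) a lam : R :=
  if j is j'.+1 then 2 * h * a * mom h m j' (a + 1) lam + m * mom h m j' (a + 2) lam
  else mass_laplace h m a lam.

Lemma laplace_factor_gt0 h lam : 0 <= h -> 0 <= lam -> 0 < laplace_factor h lam.
Proof. by move=> h0 l0; rewrite invr_gt0 ltr_wpDr// !mulr_ge0. Qed.

Lemma laplace_factor_le1 h lam : 0 <= h -> 0 <= lam -> laplace_factor h lam <= 1.
Proof.
move=> h0 l0; rewrite /laplace_factor invf_le1 ?lerDl ?mulr_ge0//.
by rewrite ltr_wpDr// !mulr_ge0.
Qed.

Lemma mass_laplace0 h m a : mass_laplace h m a 0 = 1.
Proof.
by rewrite /mass_laplace /laplace_factor mulr0 addr0 invr1 powR1 subrr mulr0 oppr0 expR0 mulr1.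
Qed.

(** The Laplace factor v satisfies v' = - 2 h v^2, so differentiation raises the exponent a by 1 or
    by 2: the family is closed under derivatives, which is what the recursion [mom] records. *)
Lemma derive_mass_laplace h m a lam : 0 < h -> 0 <= lam ->
  is_derive (lam : R) (1 : R) (mass_laplace h m a)
    (- (2 * h * a * mass_laplace h m (a + 1) lam + m * mass_laplace h m (a + 2) lam)).
Proof.
move=> h0 l0; have v0 := laplace_factor_gt0 (ltW h0) l0.
set v := laplace_factor h lam in v0 *.
have d0 : is_derive (lam : R) (1 : R) (fun x : R => 1 + 2 * h * x) (2 * h).
  have := @is_deriveD _ _ _ (fun=> (1 : R)) (fun x : R => (2 * h) * x) lam (1 : R) (0 : R) (2 * h) (is_derive_cst _ _ _) _.
  rewrite add0r; apply.
  have := @is_deriveZ _ _ _ id (2 * h) lam 1 1 (is_derive_id _ _).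
  by rewrite /GRing.scale/= mulr1.
have n0 : 1 + 2 * h * lam != 0 by rewrite gt_eqF// ltr_wpDr// !mulr_ge0// ltW.
have dv : is_derive (lam : R) (1 : R) (laplace_factor h) (- 2 * h * v ^+ 2).
  have := @is_deriveV _ (fun x : R => 1 + 2 * h * x) lam _ _ n0 d0; rewrite /laplace_factor.
  rewrite (_ : _ *: _ = - 2 * h * v ^+ 2)//.
  by rewrite /GRing.scale/= /v /laplace_factor exprVn; ring.
have dp : is_derive (lam : R) (1 : R) ((fun x => x `^ a) \o laplace_factor h)
    (a * v `^ (a - 1) * (- 2 * h * v ^+ 2)).
  by apply: is_derive1_comp; exact: is_derive1_powR.
have de0 : is_derive (lam : R) (1 : R) (fun x : R => - (m / (2 * h) * (1 - laplace_factor h x)))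
    (- m * v ^+ 2).
  have d1 := @is_deriveB _ _ _ (fun=> (1 : R)) (laplace_factor h) lam (1 : R) (0 : R) _ (is_derive_cst _ _ _) dv.
  have := is_deriveN (@is_deriveZ _ _ _ _ (m / (2 * h)) lam 1 _ d1).
  set D := (X in is_derive _ _ _ X -> _).
  suff -> : D = - m * v ^+ 2 by [].
  by rewrite /D /GRing.scale/=; field; rewrite gt_eqF.
have de : is_derive (lam : R) (1 : R)
    (expR \o (fun x : R => - (m / (2 * h) * (1 - laplace_factor h x))))
    (expR (- (m / (2 * h) * (1 - v))) * (- m * v ^+ 2)).
  by apply: is_derive1_comp.
have := is_deriveM dp de; rewrite /mass_laplace -/v.
set D := (X in is_derive _ _ _ X -> _).
suff -> : D = - (2 * h * a * (v `^ (a + 1) * expR (- (m / (2 * h) * (1 - v)))) +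
   m * (v `^ (a + 2) * expR (- (m / (2 * h) * (1 - v))))) by [].
have vD (b c : R) : v `^ (b + c) = v `^ b * v `^ c by rewrite powRD// (gt_eqF v0) implybT.
have -> : v `^ (a + 1) = v `^ (a - 1) * v ^+ 2.
  by rewrite -powR_mulrn ?(ltW v0)// -vD; congr (_ `^ _); ring.
have -> : v `^ (a + 2) = v `^ a * v ^+ 2 by rewrite vD -powR_mulrn ?(ltW v0).
by rewrite /D /GRing.scale/= /v; ring.
Qed.

Lemma derive_mom h m j a lam : 0 < h -> 0 <= lam ->
  is_derive (lam : R) (1 : R) (mom h m j a) (- mom h m j.+1 a lam).
Proof.
move=> h0 l0; elim: j a => [|j ih] a; first exact: derive_mass_laplace.
have := is_deriveD (@is_deriveZ _ _ _ _ (2 * h * a) lam 1 _ (ih (a + 1)))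
  (@is_deriveZ _ _ _ _ m lam 1 _ (ih (a + 2))).
set D := (X in is_derive _ _ _ X -> _).
suff -> : D = - mom h m j.+2 a lam by [].
by rewrite /D [mom _ _ j.+2 _ _]/= -/mom /GRing.scale/=; ring.
Qed.

Lemma derive_seq_cvg (f : R -> R) (x df : R) : is_derive x (1 : R) f df ->
  (f (x + mesh R n) - f x) / mesh R n @[n --> \oo] --> df.
Proof.
move=> [fx <-].
have h : h^-1 *: ((f \o shift x) (h *: 1) - f x) @[h --> 0^'] --> 'D_1 f x by exact: fx.
have := (cvgr_dnbhsP _ _ _).1 h (mesh R) _; rewrite /GRing.scale/=.
move=> H; have {H} := H (conj (fun n => lt0r_neq0 (mesh_gt0 R n)) (@cvg_mesh R)).
by under eq_fun do rewrite mulr1 mulrC [mesh _ _ + x]addrC.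
Qed.

Context d (T : measurableType d) (P : probability T R).
Variables (X : T -> R) (h m : R).
Hypotheses (mX : measurable_fun setT X) (X0 : forall w, 0 <= X w) (h0 : 0 < h).
Local Notation E f := (Rintegral P setT f).

Lemma integ_of_fin (f : T -> R) c : measurable_fun setT f -> (forall w, 0 <= f w) ->
  (\int[P]_w (f w)%:E = c%:E)%E -> integ P f /\ E f = c.
Proof.
move=> mf f0 fc; have I : integ P f.
  apply/integrableP; split; first exact/measurable_EFinP.
  rewrite (eq_integral (fun w => (f w)%:E)) ?fc ?ltry// => w _.
  by rewrite /= ger0_norm.
by split => //; apply: EFin_inj; rewrite -EFinE.
Qed.

Section order_a.
Variable a : R.
Hypothesis HX : forall lam, 0 <= lam ->
  (\int[P]_w (expR (- lam * X w))%:E = (mass_laplace h m a lam)%:E)%E.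

Let mexp lam : measurable_fun setT (fun w => expR (- lam * X w)).
Proof. by apply: measurableT_comp => //; exact: measurable_funM. Qed.

Let mXe j lam : measurable_fun setT (fun w => X w ^+ j * expR (- lam * X w)).
Proof. by apply: measurable_funM => //; exact: measurable_funX. Qed.

(** Differentiation under the integral by monotone convergence: the difference quotients along the
    steps [mesh R k] increase. Integrability of the next power is a result and not an assumption,
    down to lam = 0. *)
Lemma laplace_moment j lam : 0 <= lam ->
  (\int[P]_w (X w ^+ j * expR (- lam * X w))%:E = (mom h m j a lam)%:E)%E.
Proof.
elim: j lam => [|j ih] lam l0.
  by rewrite -[RHS]HX//; apply: eq_integral => w _; rewrite expr0 mul1r.
pose f k w := X w ^+ j * (expR (- lam * X w) - expR (- (lam + mesh R k) * X w)) / mesh R k.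
have fE k w : f k w = X w ^+ j * expR (- lam * X w) * ((1 - expR (- mesh R k * X w)) / mesh R k).
  by rewrite /f opprD mulrDl expRD; ring.
have q1 k w : 0 < expR (- mesh R k * X w) <= 1.
  by rewrite expR_gt0/= -expR0 ler_expR mulNr oppr_le0 mulr_ge0// mesh_ge0.
have f0 k w : 0 <= f k w.
  rewrite fE mulr_ge0 ?mulr_ge0 ?exprn_ge0 ?expR_ge0 ?invr_ge0 ?mesh_ge0//.
  by have /andP[_ ?] := q1 k w; rewrite subr_ge0.
have mf k : measurable_fun setT (f k).
  rewrite (_ : f k = fun w => (mesh R k)^-1 *
     (X w ^+ j * expR (- lam * X w) - X w ^+ j * expR (- (lam + mesh R k) * X w))); last first.
    by apply/funext => w; rewrite /f; ring.
  by apply: measurable_funM => //; exact: measurable_funB.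
(* Halving the step: with q = exp (- u X) the claim is (1 - q^2) / (2 u) <= (1 - q) / u, true since
   q <= 1. *)
have fmono w : {homo f ^~ w : k l / (k <= l)%N >-> k <= l}.
  apply: homo_leq => [//||k]; first exact: le_trans.
  rewrite !fE ler_wpM2l ?mulr_ge0 ?exprn_ge0 ?expR_ge0//.
  rewrite meshS; have /andP[p0 p1] := q1 k.+1 w; have u0 := mesh_gt0 R k.+1.
  rewrite (_ : expR (- (2 * mesh R k.+1) * X w) = expR (- mesh R k.+1 * X w) ^+ 2); last first.
    by rewrite expr2 -expRD; congr expR; ring.
  set q := expR _ in p0 p1 *.
  rewrite invfM [2^-1 * _]mulrC mulrA [_ / _ / 2]mulrAC ler_wpM2r ?invr_ge0 ?(ltW u0)//.
  by nra.
have flim w : f k w @[k --> \oo] --> X w ^+ j.+1 * expR (- lam * X w).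
  have : is_derive (0 : R) (1 : R) (fun x => expR (- X w * x)) (- X w).
    have dl : is_derive (0 : R) (1 : R) (fun x => - X w * x) (- X w).
      have := @is_deriveZ _ _ _ id (- X w) (0 : R) (1 : R) (1 : R) (is_derive_id _ _).
      by rewrite /GRing.scale/= mulr1.
    have := @is_derive1_comp _ expR (fun x => - X w * x) 0 _ _ (is_derive_expR _) dl.
    by rewrite mulr0 expR0 mul1r.
  move=> /derive_seq_cvg c.
  have := @cvgMr _ _ _ _ _ (- (X w ^+ j * expR (- lam * X w))) (- X w) c.
  rewrite (_ : _ * - X w = X w ^+ j.+1 * expR (- lam * X w)); last by rewrite exprS; ring.
  move=> /(_ _) cc; have {}cc := cc _; apply: cvg_trans cc; apply: near_eq_cvg; apply: nearW => k.
  rewrite fE add0r mulr0 expR0 (_ : - X w * mesh R k = - mesh R k * X w); last by ring.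
  by ring.
have Ij lam' : 0 <= lam' -> integ P (fun w => X w ^+ j * expR (- lam' * X w)) /\
    E (fun w => X w ^+ j * expR (- lam' * X w)) = mom h m j a lam'.
  move=> l0'; apply: integ_of_fin => // [w|]; last exact: ih.
  by rewrite mulr_ge0 ?exprn_ge0 ?expR_ge0.
have fint k : (\int[P]_w (f k w)%:E = (- ((mom h m j a (lam + mesh R k) - mom h m j a lam) / mesh R k))%:E)%E.
  have l1 : 0 <= lam + mesh R k by rewrite addr_ge0// mesh_ge0.
  have [I1 <-] := Ij _ l1; have [I2 <-] := Ij _ l0.
  have -> : f k = (fun w => (mesh R k)^-1 * (X w ^+ j * expR (- lam * X w) -
     X w ^+ j * expR (- (lam + mesh R k) * X w))).
    by apply/funext => w; rewrite /f; ring.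
  rewrite (EFinE (integZ _ (integB I2 I1))) EZ ?EB//; last exact: integB.
  by congr EFin; ring.
have c1 := @cvg_monotone_convergence _ _ _ P setT measurableT (fun k w => (f k w)%:E)
  (fun k => (measurable_EFinP _ _).2 (mf k)) (fun k w _ => f0 k w : (0 <= (f k w)%:E)%E)
  (fun w _ k l kl => fmono w k l kl : ((f k w)%:E <= (f l w)%:E)%E).
have c2 : (\int[P]_w (f k w)%:E)%E @[k --> \oo] --> (mom h m j.+1 a lam)%:E.
  under eq_fun do rewrite fint.
  apply: cvg_EFin; first exact: nearW.
  rewrite -[mom h m j.+1 a lam]opprK; apply: cvgN.
  exact: derive_seq_cvg (derive_mom m j a h0 l0).
rewrite -(cvg_unique _ c1 c2)//; apply: eq_integral => w _ /=.
apply/esym/cvg_lim => //; apply: cvg_EFin; first exact: nearW.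
exact: flim.
Qed.

Hypothesis m0 : 0 <= m.
Hypothesis a0 : 0 <= a.

Let X01 lam w : 0 <= lam -> 0 <= expR (- lam * X w) <= 1.
Proof. by move=> l0; rewrite expR_ge0 -expR0 ler_expR mulNr oppr_le0 mulr_ge0. Qed.

Let laplaceE lam : 0 <= lam -> integ P (fun w => expR (- lam * X w)) /\
  E (fun w => expR (- lam * X w)) = mass_laplace h m a lam.
Proof. by move=> l0; apply: integ_of_fin; [exact: mexp|by move=> w; exact: expR_ge0|exact: HX]. Qed.

Let pos : set T := [set w | 0 < X w].
Let mpos : measurable pos.
Proof.
rewrite (_ : pos = X @^-1` `]0, +oo[%classic); last first.
  by apply/seteqP; split => w; rewrite /pos /= in_itv/= andbT.
by rewrite -[_ @^-1` _]setTI; exact: mX.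
Qed.

Let posE w : (w \in pos) = (0 < X w).
Proof. by apply/idP/idP; rewrite inE. Qed.

(** For 0 < X <= sqrt e the exponential is at least exp (-1) >= 1/4 while [qf] is at most 1; for X >
    sqrt e the value of [qf] is at most sqrt e. *)
Let qf_laplace e (lam := (Num.sqrt e)^-1) : 0 < e ->
  E (fun w => qf e (X w)) <= 4 * E (fun w => \1_pos w * expR (- lam * X w)) + Num.sqrt e.
Proof.
move=> e0; have s0 : 0 < Num.sqrt e by rewrite sqrtr_gt0.
have l0 : 0 <= lam by rewrite invr_ge0 ltW.
have [I _] := laplaceE l0.
have I1 := integ_indicM mpos I.
rewrite -EZ// -[leRHS](_ : E (fun w => 4 * (\1_pos w * expR (- lam * X w)) + cst (Num.sqrt e) w) = _); last first.
  by rewrite ED ?E_cst//; [exact: integZ|exact: integ_cst].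
apply: E_le; first 1 last.
- by apply: integD; [exact: integZ|exact: integ_cst].
- move=> w; rewrite /qf indicE posE /=; case: ltP => x0; last by rewrite mul0r mulr0 add0r ltW.
  rewrite mul1r.
  have se : Num.sqrt e ^+ 2 = e by rewrite sqr_sqrtr// ltW.
  have xe : 0 < X w + e by rewrite addr_gt0.
  case: (lerP (X w) (Num.sqrt e)) => hx.
    have q1 : e / (X w + e) <= 1 by rewrite ler_pdivrMr// mul1r lerDr ltW.
    suff : 4^-1 <= expR (- lam * X w) by move=> ?; nra.
    have : - 1 <= - lam * X w.
      by rewrite mulNr lerN2 /lam mulrC ler_pdivrMr// mul1r.
    rewrite -ler_expR; apply: le_trans.
    have -> : - 1 = - 2^-1 + - 2^-1 :> R by field.
    rewrite expRD; have := expR_ge1Dx (- 2^-1 : R).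
    by set z := expR _; nra.
  have h1 : e / (X w + e) <= Num.sqrt e.
    by rewrite ler_pdivrMr// -{1}se expr2 ler_wpM2l ?(ltW s0)//; lra.
  by apply: (le_trans h1); rewrite lerDr mulr_ge0 ?expR_ge0.
- apply: (@integ_bounded _ _ _ _ _ 1) => [|w].
    exact: (measurableT_comp (measurable_qf (ltW e0))).
  by rewrite ger0_norm ?qf_ge0 ?qf_le1// ltW.
Qed.

(** As lam tends to infinity the Laplace transform decreases to the probability of the value 0. *)
Let atom0 : a = 0 -> expR (- (m / (2 * h))) <= E (\1_(~` pos)).
Proof.
move=> az; have c : E (fun w => expR (- n%:R * X w)) @[n --> \oo] --> E (\1_(~` pos)).
  apply: (@E_bounded_cvg _ _ _ _ _ _ 1).
  - by move=> n; exact: mexp.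
  - by apply: measurable_indic; exact: measurableC.
  - by move=> n w; have /andP[x0 x1] := X01 w (ler0n R n); rewrite ger0_norm.
  - apply: aeW => w; rewrite indicE.
    case: (boolP (w \in ~` pos)) => [|]; rewrite ?notin_setE ?inE /pos/=.
      move=> /negP; rewrite -leNgt => x0.
      have -> : X w = 0 by apply/le_anti; rewrite x0 X0.
      by under eq_fun do rewrite mulr0 expR0; exact: cvg_cst.
    move=> /contrapT x0.
    have c : geometric 1 (expR (- X w)) n @[n --> \oo] --> (0 : R).
      by apply: cvg_geometric; rewrite ger0_norm ?expR_ge0// -expR0 ltr_expR oppr_lt0.
    apply: cvg_trans c; apply: near_eq_cvg; apply: nearW => n /=.
    by rewrite mul1r -expRM_natl -mulr_natl mulrN mulNr.
apply: (ler_cvg_to (cvg_cst _) c); apply: nearW => n.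
have [_ ->] := laplaceE (ler0n R n).
rewrite /mass_laplace az powRr0 mul1r ler_expR lerN2 ler_piMr//.
  by rewrite divr_ge0// mulr_ge0// ltW.
by rewrite gerBl ltW// laplace_factor_gt0// ltW.
Qed.

(** For a > 0 there is no atom at 0: the transform is at most a positive power of the Laplace
    factor, which vanishes as lam tends to infinity. *)
Lemma mass_qf_pos (e eta : R) : 0 < e -> 0 < eta -> eta <= h -> 0 < a ->
  E (fun w => qf e (X w)) <= 4 * laplace_factor eta (Num.sqrt e)^-1 `^ a + Num.sqrt e.
Proof.
move=> e0 eta0 eh a_gt0; have s0 : 0 < Num.sqrt e by rewrite sqrtr_gt0.
have l0 : 0 <= (Num.sqrt e)^-1 by rewrite invr_ge0 ltW.
have Q : E (fun w => qf e (X w)) <= 4 * E (fun w => \1_pos w * expR (- (Num.sqrt e)^-1 * X w)) + Num.sqrt e.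
  exact: qf_laplace.
apply: (le_trans Q); rewrite lerD2r ler_pM2l//.
have [I Ie] := laplaceE l0.
apply: (@le_trans _ _ (mass_laplace h m a (Num.sqrt e)^-1)).
  rewrite -Ie; apply: E_le => [||w]; [exact: integ_indicM|by []|].
  have /andP[x0 x1] := X01 w l0.
  by rewrite indicE; case: (_ \in _); rewrite ?mul1r ?mul0r.
have v0 := laplace_factor_gt0 (ltW h0) l0; have v1 := laplace_factor_le1 (ltW h0) l0.
apply: (@le_trans _ _ (laplace_factor h (Num.sqrt e)^-1 `^ a)).
  rewrite /mass_laplace ler_piMr ?powR_ge0// -[leRHS]expR0 ler_expR oppr_le0 mulr_ge0 ?subr_ge0//.
  by rewrite divr_ge0// mulr_ge0// ltW.
apply: ge0_ler_powR; rewrite ?nnegrE ?(ltW v0)//.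
  by apply/ltW/laplace_factor_gt0 => //; exact: ltW.
rewrite /laplace_factor lef_pV2 ?posrE ?ltr_wpDr ?mulr_ge0 ?(ltW h0) ?(ltW eta0)//.
by rewrite lerD2l ler_wpM2r// ler_pM2l.
Qed.

(** For a = 0 extinction may put an atom at 0, where [qf] vanishes by definition; once it is
    subtracted, the transform at lam = 1 / sqrt e is of order sqrt e. *)
Lemma mass_qf_zero (e eta : R) : 0 < e -> 0 < eta -> eta <= h -> a = 0 ->
  E (fun w => qf e (X w)) <= (m / eta ^+ 2 + 1) * Num.sqrt e.
Proof.
move=> e0 eta0 eh az; have s0 : 0 < Num.sqrt e by rewrite sqrtr_gt0.
set lam := (Num.sqrt e)^-1.
have l0 : 0 < lam by rewrite invr_gt0.
have Q : E (fun w => qf e (X w)) <= 4 * E (fun w => \1_pos w * expR (- lam * X w)) + Num.sqrt e.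
  exact: qf_laplace.
apply: (le_trans Q); rewrite [leRHS]mulrDl mul1r lerD2r.
have [I Ie] := laplaceE (ltW l0).
have -> : E (fun w => \1_pos w * expR (- lam * X w)) = mass_laplace h m a lam - E (\1_(~` pos)).
  have Ia : integ P (\1_(~` pos) : T -> R).
    apply: (@integ_bounded _ _ _ P (\1_(~` pos)) 1); last exact: indic_le1.
    by apply: measurable_indic; exact: measurableC.
  rewrite -Ie -(EB I Ia).
  congr Rintegral; apply/funext => w; rewrite !indicE in_setC.
  case: (boolP (w \in pos)) => wp /=; first by rewrite mul1r subr0.
  rewrite mul0r; move: wp; rewrite notin_setE /pos/= => /negP; rewrite -leNgt => x0.
  have -> : X w = 0 by apply/le_anti; rewrite x0 X0.
  by rewrite mulr0 expR0 subrr.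
have h1 := atom0 az; set v := laplace_factor h lam.
have v0 : 0 < v := laplace_factor_gt0 (ltW h0) (ltW l0).
have mh0 : 0 <= m / (2 * h) by rewrite divr_ge0// mulr_ge0// ltW.
have h2 : mass_laplace h m a lam <= expR (- (m / (2 * h))) + m / (2 * h) * v.
  rewrite /mass_laplace az powRr0 mul1r -/v.
  set A := m / (2 * h) in mh0 *; set y := A * v.
  have y0 : 0 <= y by rewrite mulr_ge0// ltW.
  have := expR_ge1Dx (- y); set E1 := expR (- (A * (1 - v))).
  have -> : expR (- A) = E1 * expR (- y) by rewrite -expRD; congr expR; rewrite /y; ring.
  have E10 : 0 <= E1 by exact: expR_ge0.
  have E11 : E1 <= 1.
    by rewrite -expR0 ler_expR oppr_le0 mulr_ge0// subr_ge0 laplace_factor_le1// ltW.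
  by move: (expR (- y)) => z; nra.
have v2 : v <= Num.sqrt e / (2 * h).
  rewrite /v /laplace_factor -[Num.sqrt e]invrK -invfM lef_pV2 ?posrE ?mulr_gt0//.
    by rewrite -/lam [lam * _]mulrC lerDr.
  by rewrite ltr_wpDr// !mulr_ge0// ltW.
apply: (@le_trans _ _ (4 * (m / (2 * h) * (Num.sqrt e / (2 * h))))).
  rewrite ler_pM2l//; apply: (@le_trans _ _ (m / (2 * h) * v)); first by lra.
  by rewrite ler_wpM2l.
have -> : 4 * (m / (2 * h) * (Num.sqrt e / (2 * h))) = m / h ^+ 2 * Num.sqrt e.
  by field; rewrite gt_eqF.
rewrite ler_wpM2r ?(ltW s0)// ler_wpM2l// lef_pV2 ?posrE ?exprn_gt0//.
by rewrite ler_pXn2r ?nnegrE// ltW.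
Qed.

End order_a.
End laplace_moments.

Lemma mass_qf_small (R : realType) (m a eta : R) : 0 <= m -> 0 <= a -> 0 < eta ->
  exists2 e0 : R, 0 < e0 & forall d (T : measurableType d) (P : probability T R) (X : T -> R) (e h : R),
    0 < e <= e0 -> eta <= h -> measurable_fun setT X -> (forall w, 0 <= X w) ->
    (forall lam, 0 <= lam -> (\int[P]_w (expR (- lam * X w))%:E = (mass_laplace h m a lam)%:E)%E) ->
    Rintegral P setT (fun w => qf e (X w)) <= eta.
Proof.
move=> m0 a0 eta0; have [az|an0] := eqVneq a 0.
  pose r := eta / (m / eta ^+ 2 + 1).
  have c0 : 0 < m / eta ^+ 2 + 1 by rewrite ltr_wpDl// divr_ge0// exprn_ge0// ltW.
  have r0 : 0 < r by rewrite divr_gt0.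
  exists (r ^+ 2); first by rewrite exprn_gt0.
  move=> d T P X e h /andP[e0 er] eh mX X0 HX.
  have h0 : 0 < h by exact: lt_le_trans eh.
  have Q := mass_qf_zero mX X0 h0 HX m0 e0 eta0 eh az.
  apply: (le_trans Q).
  rewrite mulrC -ler_pdivlMr// -/r -(ger0_norm (ltW r0)) -sqrtr_sqr.
  exact: ler_wsqrtr.
have a_gt0 : 0 < a by rewrite lt_def an0.
(* Here 4 c^a = eta / 2, and sqrt e <= 2 eta c brings the Laplace factor below c; the other half of
   eta is left to the term sqrt e. *)
pose c := (eta / 8) `^ a^-1.
have c0 : 0 < c by rewrite powR_gt0// divr_gt0.
pose r := Num.min (2 * eta * c) (eta / 2).
have r0 : 0 < r by rewrite lt_min !mulr_gt0//= divr_gt0.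
exists (r ^+ 2); first by rewrite exprn_gt0.
move=> d T P X e h /andP[e0 er] eh mX X0 HX.
have h0 : 0 < h by exact: lt_le_trans eh.
have s0 : 0 < Num.sqrt e by rewrite sqrtr_gt0.
have : Num.sqrt e <= r by rewrite -(ger0_norm (ltW r0)) -sqrtr_sqr ler_wsqrtr.
rewrite le_min => /andP[s1 s2].
have Q := mass_qf_pos mX X0 h0 HX m0 a0 e0 eta0 eh a_gt0.
apply: (le_trans Q).
suff : laplace_factor eta (Num.sqrt e)^-1 `^ a <= eta / 8 by move=> ?; lra.
have -> : eta / 8 = c `^ a by rewrite /c -powRrM mulVf// powRr1// divr_ge0// ltW.
have l0 : 0 < (Num.sqrt e)^-1 by rewrite invr_gt0.
apply: ge0_ler_powR; rewrite ?nnegrE ?(ltW c0)//.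
  by apply/ltW/laplace_factor_gt0; exact: ltW.
apply: (@le_trans _ _ (2 * eta * (Num.sqrt e)^-1)^-1).
  rewrite /laplace_factor lef_pV2 ?posrE ?mulr_gt0//; first by rewrite lerDr.
  by rewrite ltr_wpDr// !mulr_ge0// ltW.
rewrite invfM invrK mulrC ler_pdivrMr ?mulr_gt0//.
by rewrite mulrC.
Qed.

(** * The mass process *)

Section kernel_at.
Context (R : realType) d d' (S : measurableType d) (T : measurableType d')
  (k : R.-pker S ~> T) (x : S).

(** A copy of [k x] on which the structure of probability is declared, as the moment lemmas
    require. *)
Definition kernel_at : set T -> \bar R := k x.

HB.instance Definition _ := Measure.copy kernel_at (k x : {measure set T -> \bar R}).
HB.instance Definition _ := Measure_isProbability.Build _ _ _ kernel_at (prob_kernel x).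
End kernel_at.

Lemma laplace_moment_pker (R : realType) d d' (S : measurableType d) (T : measurableType d')
    (k : R.-pker S ~> T) (x : S) (X : T -> R) (h m a : R) j :
  measurable_fun setT X -> (forall w, 0 <= X w) -> 0 < h ->
  (forall lam, 0 <= lam -> (\int[k x]_w (expR (- lam * X w))%:E = (mass_laplace h m a lam)%:E)%E) ->
  (\int[k x]_w (X w ^+ j)%:E = (mom h m j a 0)%:E)%E.
Proof.
move=> mX X0 h0 HX.
rewrite -(@laplace_moment _ _ _ (kernel_at k x) X h m mX X0 h0 a HX j 0 (lexx 0)).
by apply: eq_integral => w _; rewrite oppr0 mul0r expR0 mulr1.
Qed.

Section mass_process.
Context (R : realType) (alpha : R) (kappa : R -> R.-pker (ipspace alpha) ~> (ipspace alpha)).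
Context d (Omega : measurableType d) (P : probability Omega R).
Variables (X : R -> {RV P >-> ipspace alpha}) (b0 : ipspace alpha) (a : R).
Local Notation E f := (Rintegral P setT f).
Hypothesis a0 : 0 <= a.
Hypothesis kappa_laplace : forall y b lam, 0 < y -> 0 <= lam ->
  (\int[kappa y b]_x (expR (- lam * mass x))%:E = (mass_laplace y (mass b) a lam)%:E)%E.
Hypothesis X_start : {ae P, forall w, X 0 w = b0}.
Hypothesis X_cont : forall w, ip_path_continuous (X ^~ w).
Variable F : R -> set (set Omega).
Hypotheses (hF : filtration F) (X_ad : adapted F X).
Hypothesis strong_markov : forall (tau : Omega -> \bar R) (y : R) (A : set Omega)
  (C : set (ipspace alpha)), stopping_time F tau -> 0 <= y -> measurable C ->
  stopped_events F tau A -> (forall w, A w -> (tau w < +oo)%E) ->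
  P (A `&` [set w | C (X (fine (tau w) + y) w)]) =
  (\int[P]_(w in A) kappa y (X (fine (tau w)) w) C)%E.

Let M t w := mass (X t w).
Let delta := 2 * a.

Let mmass : measurable_fun setT (fun x : ipspace alpha => mass x : R).
Proof. exact: measurable_mass. Qed.

Lemma mass_process_ge0 t w : 0 <= M t w.
Proof. exact: mass_ge0. Qed.

Lemma mass_process_meas t : measurable_fun setT (M t).
Proof. by apply: (measurableT_comp mmass); exact: measurable_funP. Qed.

Lemma mass_process_adapted t : 0 <= t -> measurable_fun setT (M t : subsig (F t) -> R).
Proof.
have [sF _ _] := hF.
move=> t0 _ B mB; rewrite setTI (measurable_subsig (sF _ t0)).
apply: (X_ad t0); exists ((fun x : ipspace alpha => mass x : R) @^-1` B); last by rewrite setTI.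
by rewrite -[_ @^-1` _]setTI; exact: mmass.
Qed.

Lemma mass_process_continuous w : {within `[0, +oo[, continuous (M ^~ w)}.
Proof.
apply/subspace_continuousP => t /=; rewrite in_itv/= andbT => t0.
apply/cvgrPdist_lt => e e0; have [eta eta0 H] := X_cont w t0 e0.
rewrite near_withinE; apply/nbhs_ballP; exists eta => //= s.
rewrite /ball/= => ts; rewrite in_itv/= andbT => s0.
apply: le_lt_trans (mass_ipdist _ _) _; apply: H => //.
by rewrite distrC.
Qed.

(** The strong Markov property at the constant stopping time [s]. *)
Lemma markov s h A C : 0 <= s -> 0 <= h -> F s A -> measurable C ->
  P (A `&` [set w | C (X (s + h) w)]) = (\int[P]_(w in A) kappa h (X s w) C)%E.
Proof.
move=> s0 h0 FA mC; have [sF FM Fmono] := hF.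
have H t : 0 <= t -> F t setT /\ F t set0.
  move=> t0; have [F0 FC _] := sF _ t0; split => //.
  by have := FC _ F0; rewrite setD0.
have st : stopping_time F (fun=> s%:E).
  split=> [w|t t0]; first by rewrite lee_fin.
  case: (leP s t) => st; have [hT h_0] := H _ t0.
    suff -> : [set w : Omega | (s%:E <= t%:E)%E] = setT by [].
    by apply/seteqP; split => // w _ /=; rewrite lee_fin.
  suff -> : [set w : Omega | (s%:E <= t%:E)%E] = set0 by [].
  by apply/seteqP; split => // w /=; rewrite lee_fin leNgt st.
have se : stopped_events F (fun=> s%:E) A.
  split=> [|t t0]; first exact: (FM s).
  case: (leP s t) => st'; have [hT h_0] := H _ t0.
    rewrite (_ : A `&` _ = A); first exact: (Fmono s t).
    by apply/seteqP; split => [w []//|w Aw]; split => //=; rewrite lee_fin.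
  rewrite (_ : A `&` _ = set0)//; apply/seteqP; split => // w [_] /=.
  by rewrite lee_fin leNgt st'.
by rewrite (strong_markov st h0 mC se)// => w _; exact: ltry.
Qed.

Lemma markov_integral s h A (f : ipspace alpha -> \bar R) : 0 <= s -> 0 <= h -> F s A ->
  (forall x, 0 <= f x)%E -> measurable_fun setT f ->
  (\int[P]_w ((\1_A w)%:E * f (X (s + h) w)) =
   \int[P]_w ((\1_A w)%:E * \int[kappa h (X s w)]_x f x))%E.
Proof.
move=> s0 h0 FA f0 mf; have [sF FM Fmono] := hF; have mA := FM _ s0 _ FA.
have i0 w : (0 <= (\1_A w : R)%:E)%E by rewrite lee_fin.
have mi : measurable_fun setT (fun w => (\1_A w : R)%:E).
  by apply/measurable_EFinP/measurable_indic.
have mk U : measurable U -> measurable_fun setT (fun w => kappa h (X s w) U).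
  move=> mU; apply: (measurableT_comp (measurable_kernel (kappa h) U mU)).
  exact: measurable_funP.
have mX t : measurable_fun setT (X t) by exact: measurable_funP.
have := nnfunctional_eq (nnfunctional_comp P (mX (s + h)) i0 mi)
  (nnfunctional_kernel P (k := fun w => kappa h (X s w)) mk i0 mi).
move=> Q; apply: Q f0 mf => C mC.
have -> : (\int[P]_w ((\1_A w)%:E * (\1_C (X (s + h) w))%:E) =
    P (A `&` [set w | C (X (s + h) w)]))%E.
  rewrite -[A `&` _]setIT -integral_indic//; last first.
    by apply: measurableI => //; rewrite -[[set w | _]]setTI; exact: mX.
  have e w : (w \in [set w | C (X (s + h) w)]) = (X (s + h) w \in C) by apply/idP/idP; rewrite !inE.
  apply: eq_integral => w _; rewrite -EFinM !indicE in_setI e.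
  by case: (w \in A); case: (_ \in C); rewrite ?mulr1 ?mulr0 ?mul0r.
rewrite markov// [LHS]integral_mkcond; apply: eq_integral => w _.
rewrite integral_indic// setIT patchE indicE.
by case: (w \in A); rewrite ?mul1e ?mul0e.
Qed.

Let cond (s h : R) (f : ipspace alpha -> \bar R) (g : Omega -> \bar R) (G : Omega -> R) : 0 <= s -> 0 <= h ->
  (forall x, 0 <= f x)%E -> measurable_fun setT f ->
  (forall w, 0 <= g w)%E -> measurable_fun setT g ->
  (forall w, \int[kappa h (X s w)]_x f x = g w)%E ->
  (forall w, 0 <= G w) -> measurable_fun setT (G : subsig (F s) -> R) ->
  (\int[P]_w (f (X (s + h) w) * (G w)%:E) = \int[P]_w (g w * (G w)%:E))%E.
Proof.
move=> s0 h0 f0 mf g0 mg fg G0 mG; have [sF FM Fmono] := hF.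
have mid := measurable_id_subsig (sF _ s0) (FM _ s0).
have mfX : measurable_fun setT (fun w => f (X (s + h) w)).
  by apply: (measurableT_comp mf); exact: measurable_funP.
apply: (@ge0_integral_transfer _ _ _ _ _ _ (subsig (F s)) P P id id _ _ mid mid
  (fun w => f0 (X (s + h) w)) mfX g0 mg _ (fun w => (G w)%:E)).
- move=> C mC; have FC : F s C by rewrite -(measurable_subsig (sF _ s0)).
  under eq_integral do rewrite muleC.
  rewrite (markov_integral s0 h0 FC f0 mf); apply: eq_integral => w _.
  by rewrite fg muleC.
- by move=> w; rewrite lee_fin.
- exact/measurable_EFinP.
Qed.

Let integ_ge0 (f g : Omega -> R) : measurable_fun setT g -> (forall w, 0 <= f w) -> (forall w, 0 <= g w) ->
  (\int[P]_w (f w)%:E = \int[P]_w (g w)%:E)%E -> integ P f -> integ P g /\ E f = E g.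
Proof.
move=> mg f0 g0 e If; have := integ_of_fin mg g0 (etrans (esym e) (EFinE If)).
by move=> [].
Qed.

Lemma mom_ge0 (h m : R) j c : 0 <= h -> 0 <= m -> 0 <= c -> 0 <= mom h m j c 0.
Proof.
move=> h0 m0; elim: j c => [|j ih] c c0 /=; first by rewrite mass_laplace0.
by rewrite addr_ge0 ?mulr_ge0// ih// addr_ge0.
Qed.

Lemma mom0 (m : R) j c : mom 0 m j c 0 = m ^+ j.
Proof.
by elim: j c => [|j ih] c /=; rewrite ?mass_laplace0// !ih mulr0 !mul0r add0r exprS.
Qed.

Let measurable_mom h j c : measurable_fun setT (fun m : R => mom h m j c 0).
Proof.
elim: j c => [|j ih] c /=.
  by rewrite (_ : (fun m => _) = cst 1)//; apply/funext => m; rewrite mass_laplace0.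
apply: measurable_funD; first exact: measurable_funM.
exact: measurable_funM.
Qed.

Lemma cond_moment s h j (G : Omega -> R) : 0 <= s -> 0 <= h ->
  (forall w, 0 <= G w) -> measurable_fun setT (G : subsig (F s) -> R) ->
  integ P (fun w => G w * M (s + h) w ^+ j) ->
  integ P (fun w => G w * mom h (M s w) j a 0) /\
  E (fun w => G w * M (s + h) w ^+ j) = E (fun w => G w * mom h (M s w) j a 0).
Proof.
move=> s0 h0 G0 mG I; have [sF FM Fmono] := hF.
(* At h = 0 the formula for the transform divides by 0, so this case is treated apart. *)
have [hz|hn] := eqVneq h 0.
  suff -> : (fun w => G w * mom h (M s w) j a 0) = (fun w => G w * M (s + h) w ^+ j) by [].
  by apply/funext => w; rewrite hz addr0 mom0.
have hp : 0 < h by rewrite lt_def hn.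
apply: integ_ge0 => //.
- apply: measurable_funM; first exact: (subsig_meas (sF _ s0) (FM _ s0) mG).
  exact: (measurableT_comp (measurable_mom _ _ _) (mass_process_meas s)).
- by move=> w; rewrite mulr_ge0// exprn_ge0// mass_process_ge0.
- by move=> w; rewrite mulr_ge0// mom_ge0// mass_process_ge0.
under eq_integral do rewrite mulrC EFinM.
under [RHS]eq_integral do rewrite mulrC EFinM.
apply: (@cond s h (fun x => (mass x ^+ j)%:E) (fun w => (mom h (M s w) j a 0)%:E)) => //.
- by move=> x; rewrite lee_fin exprn_ge0// mass_ge0.
- by apply/measurable_EFinP; exact: measurable_funX.
- by move=> w; rewrite lee_fin mom_ge0// mass_process_ge0.
- apply/measurable_EFinP.
  exact: (measurableT_comp (measurable_mom _ _ _) (mass_process_meas s)).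
- move=> w; apply: laplace_moment_pker => //; first exact: mass_ge0.
  by move=> lam l0; exact: kappa_laplace.
Qed.

Lemma mass_process_laplace u lam : 0 < u -> 0 <= lam ->
  (\int[P]_w (expR (- lam * M u w))%:E = (mass_laplace u (mass b0) a lam)%:E)%E.
Proof.
move=> u0 l0; have [sF FM Fmono] := hF.
have FT : F 0 setT by have [F0 FC _] := sF _ (lexx 0); have := FC _ F0; rewrite setD0.
have := @markov_integral 0 u setT (fun x => (expR (- lam * mass x))%:E) (lexx 0) (ltW u0) FT.
rewrite add0r => H.
transitivity (\int[P]_w ((\1_(setT : set Omega) w : R)%:E * (expR (- lam * mass (X u w)))%:E))%E.
  by apply: eq_integral => w _; rewrite indicT mul1e.
rewrite H; first last.
- apply/measurable_EFinP; apply: measurableT_comp => //.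
  exact: measurable_funM.
- by move=> x; rewrite lee_fin expR_ge0.
transitivity (\int[P]_w (mass_laplace u (mass b0) a lam)%:E)%E; last first.
  transitivity ((mass_laplace u (mass b0) a lam)%:E * 1)%E; last by rewrite mule1.
  by rewrite integral_cst//; congr (_ * _)%E; exact: probability_setT.
apply: ae_eq_integral => //.
- under eq_fun do rewrite indicT mul1e kappa_laplace//.
  apply/measurable_EFinP; rewrite /mass_laplace.
  apply: measurable_funM => //; apply: measurableT_comp => //.
  apply: measurableT_comp => //; apply: measurable_funM => //; apply: measurable_funM => //.
  exact: (mass_process_meas 0).
- by apply: filterS X_start => w e _; rewrite indicT mul1e kappa_laplace// e.
Qed.

Lemma mass_process_moment u j : 0 <= u ->
  integ P (fun w => M u w ^+ j) /\ E (fun w => M u w ^+ j) = mom u (mass b0) j a 0.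
Proof.
move=> u0; have mj : measurable_fun setT (fun w => M u w ^+ j).
  by apply: measurable_funX; exact: mass_process_meas.
apply: integ_of_fin => //; first by move=> w; rewrite exprn_ge0// mass_process_ge0.
have [uz|un] := eqVneq u 0; last first.
  have up : 0 < u by rewrite lt_def un.
  rewrite -(@laplace_moment _ _ _ P (M u) u (mass b0) (mass_process_meas u)
    (mass_process_ge0 u) up a (fun lam l0 => mass_process_laplace up l0) j 0 (lexx 0)).
  by apply: eq_integral => w _; rewrite oppr0 mul0r expR0 mulr1.
transitivity (\int[P]_w (mass b0 ^+ j)%:E)%E.
  apply: ae_eq_integral => //; first exact/measurable_EFinP.
  by apply: filterS X_start => w e _; rewrite /M uz e.
rewrite uz mom0; transitivity ((mass b0 ^+ j)%:E * 1)%E; last by rewrite mule1.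
by rewrite integral_cst//; congr (_ * _)%E; exact: probability_setT.
Qed.

Lemma mass_process_sqint u : 0 <= u -> sqint P (M u).
Proof.
by move=> u0; split; [exact: mass_process_meas|exact: (mass_process_moment 2 u0).1].
Qed.

Section increments.
Variables (s h : R) (C : set Omega).
Hypotheses (s0 : 0 <= s) (h0 : 0 <= h) (FC : F s C).

Let c w := M s w + delta * h.
Let Z w := M (s + h) w.
Let G k w : R := \1_C w * c w ^+ k.

Let sF : sigma_algebra setT (F s). Proof. by have [H _ _] := hF; exact: H. Qed.
Let FM : F s `<=` measurable. Proof. by have [_ H _] := hF; exact: H. Qed.
Let mC : measurable C. Proof. exact: FM. Qed.
Let d0 : 0 <= delta * h. Proof. by rewrite !mulr_ge0. Qed.
Let c0 w : 0 <= c w. Proof. by rewrite addr_ge0// mass_process_ge0. Qed.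
Let Z0 w : 0 <= Z w. Proof. exact: mass_process_ge0. Qed.

Let G0 k w : 0 <= G k w.
Proof. by rewrite mulr_ge0// exprn_ge0. Qed.

Let mG k : measurable_fun setT (G k : subsig (F s) -> R).
Proof.
apply: measurable_funM.
  by apply: measurable_indic; rewrite (measurable_subsig sF).
apply: measurable_funX; apply: measurable_funD => //.
exact: mass_process_adapted.
Qed.

(** Whatever the degrees, the product is dominated by the fourth power of 1 + c + Z >= 1. *)
Let integ_GZ k j : (k + j <= 4)%N -> integ P (fun w => G k w * Z w ^+ j).
Proof.
move=> kj; have s1 : 0 <= s + h by rewrite addr_ge0.
have I := integD (integD (integ_cst P (64 * (1 + delta * h) ^+ 4))
  (integZ 64 (mass_process_moment 4 s0).1)) (integZ 64 (mass_process_moment 4 s1).1).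
apply: (integ_le _ I).
  apply: measurable_funM; first exact: (subsig_meas sF FM (mG k)).
  by apply: measurable_funX; exact: mass_process_meas.
move=> w; rewrite ger0_norm ?mulr_ge0 ?exprn_ge0//.
set t := 1 + c w + Z w.
have t1 : 1 <= t by rewrite /t -addrA lerDl addr_ge0.
have : G k w * Z w ^+ j <= t ^+ 4.
  apply: (@le_trans _ _ (t ^+ k * t ^+ j)); last first.
    by rewrite -exprD ler_weXn2l.
  apply: ler_pM; rewrite ?exprn_ge0//.
    apply: (@le_trans _ _ (c w ^+ k)).
      rewrite /G ler_piMl ?exprn_ge0//; exact: le_trans (ler_norm _) (indic_le1 _ _).
    by rewrite lerXn2r ?nnegrE ?(le_trans ler01 t1)// /t addrAC lerDr addr_ge0.
  by rewrite lerXn2r ?nnegrE ?(le_trans ler01 t1)// /t lerDr addr_ge0.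
move=> /le_trans; apply.
have -> : t = (1 + delta * h) + M s w + Z w by rewrite /t /c; ring.
have h1 := pow4D_le (1 + delta * h + M s w) (Z w).
have h2 := pow4D_le (1 + delta * h) (M s w).
have h3 : 0 <= Z w ^+ 4 by rewrite exprn_ge0.
by rewrite /= -/(Z w); lra.
Qed.

(** The increment is Z - c with c known at time s, so its powers are binomial sums of powers of c
    and Z. Replacing each power of Z by its conditional moment reduces the moment formulas to
    polynomial identities. *)
Let lin (n : nat) (cf : nat -> R) (e : nat -> nat) : (forall j, (j < n)%N -> (e j + j <= 4)%N) ->
  let f1 w := \sum_(j < n) cf j * (G (e j) w * Z w ^+ j) in
  let f2 w := \sum_(j < n) cf j * (G (e j) w * mom h (M s w) j a 0) in
  [/\ integ P f1, integ P f2 & E f1 = E f2].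
Proof.
move=> en; have T j : (j < n)%N -> integ P (fun w => G (e j) w * mom h (M s w) j a 0) /\
    E (fun w => G (e j) w * Z w ^+ j) = E (fun w => G (e j) w * mom h (M s w) j a 0).
  by move=> jn; apply: cond_moment => //; apply: integ_GZ; exact: en.
have I1 (j : 'I_n) : integ P (fun w => cf j * (G (e j) w * Z w ^+ j)).
  by apply: integZ; apply: integ_GZ; exact: en.
have I2 (j : 'I_n) : integ P (fun w => cf j * (G (e j) w * mom h (M s w) j a 0)).
  by apply: integZ; have [] := T j (ltn_ord j).
split; [exact: integ_sum|exact: integ_sum|].
rewrite !E_sum//; apply: eq_bigr => j _; have [I e'] := T j (ltn_ord j).
by rewrite !EZ ?e'//; apply: integ_GZ; exact: en.
Qed.

Let momE := (mass_laplace0 h).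

Lemma mass_process_m1 : E (fun w => \1_C w * incM delta M s h w) = 0.
Proof.
have [_ _] := @lin 2 (nth 0 [:: -1; 1]) (nth 0%N [:: 1%N; 0%N]) (fun j => ltac:(by case: j => [|[|]])).
have -> : (fun w => \sum_(j < 2) nth 0 [:: -1; 1] j * (G (nth 0%N [:: 1%N; 0%N] j) w * Z w ^+ j)) =
   (fun w => \1_C w * incM delta M s h w).
  by apply/funext => w; rewrite !big_ord_recr big_ord0 /= /G /Z /c /incM; ring.
move=> ->; rewrite -[RHS](E_cst P 0); congr Rintegral; apply/funext => w.
by rewrite !big_ord_recr big_ord0 /= !momE /G /c /delta; ring.
Qed.

Lemma mass_process_m2 : E (fun w => \1_C w * incM delta M s h w ^+ 2) =
  E (fun w => \1_C w * (4 * M s w * h + 2 * delta * h ^+ 2)).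
Proof.
have [_ _] := @lin 3 (nth 0 [:: 1; -2; 1]) (nth 0%N [:: 2; 1; 0]%N) (fun j => ltac:(by case: j => [|[|[|]]])).
have -> : (fun w => \sum_(j < 3) nth 0 [:: 1; -2; 1] j * (G (nth 0%N [:: 2; 1; 0]%N j) w * Z w ^+ j)) =
   (fun w => \1_C w * incM delta M s h w ^+ 2).
  by apply/funext => w; rewrite !big_ord_recr big_ord0 /= /G /Z /c /incM; ring.
move=> ->; congr Rintegral; apply/funext => w.
by rewrite !big_ord_recr big_ord0 /= !momE /G /c /delta; ring.
Qed.

Lemma mass_process_m4 : let f w := \1_C w * (48 * delta * h ^+ 4 + 192 * M s w * h ^+ 3 +
     3 * (2 * delta * h ^+ 2 + 4 * M s w * h) ^+ 2) in
  [/\ integ P (fun w => \1_C w * incM delta M s h w ^+ 4), integ P f &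
  E (fun w => \1_C w * incM delta M s h w ^+ 4) = E f].
Proof.
have := @lin 5 (nth 0 [:: 1; -4; 6; -4; 1]) (nth 0%N [:: 4; 3; 2; 1; 0]%N)
  (fun j => ltac:(by case: j => [|[|[|[|[|]]]]])).
have -> : (fun w => \sum_(j < 5) nth 0 [:: 1; -4; 6; -4; 1] j * (G (nth 0%N [:: 4; 3; 2; 1; 0]%N j) w * Z w ^+ j)) =
   (fun w => \1_C w * incM delta M s h w ^+ 4).
  by apply/funext => w; rewrite !big_ord_recr big_ord0 /= /G /Z /c /incM; ring.
have -> : (fun w => \sum_(j < 5) nth 0 [:: 1; -4; 6; -4; 1] j *
      (G (nth 0%N [:: 4; 3; 2; 1; 0]%N j) w * mom h (M s w) j a 0)) =
    (fun w => \1_C w * (48 * delta * h ^+ 4 + 192 * M s w * h ^+ 3 +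
     3 * (2 * delta * h ^+ 2 + 4 * M s w * h) ^+ 2)); last by [].
apply/funext => w.
by rewrite !big_ord_recr big_ord0 /= !momE /G /c /delta; ring.
Qed.

End increments.

Lemma mass_process_fourth T : exists2 K, 0 <= K & forall s h, 0 <= s -> 0 <= h -> s + h <= T ->
  integ P (fun w => incM delta M s h w ^+ 4) /\
  E (fun w => incM delta M s h w ^+ 4) <= K * h ^+ 2.
Proof.
have b00 : 0 <= mass b0 := mass_ge0 b0.
have d0 : 0 <= delta by rewrite mulr_ge0.
pose T' := Num.max T 0; have T0 : 0 <= T' by rewrite le_max lexx orbT.
(* [k1] and [k2] bound the first two moments of M on [0, T']. *)
pose k1 := mass b0 + delta * T'.
pose k2 := k1 ^+ 2 + 4 * mass b0 * T' + 2 * delta * T' ^+ 2.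
exists (48 * delta * T' ^+ 2 + 192 * T' * k1 + 3 * (8 * delta ^+ 2 * T' ^+ 2 + 32 * k2)).
  have : 0 <= k1 by rewrite addr_ge0// mulr_ge0.
  move=> k10.
  have k20 : 0 <= k2 by rewrite /k2 addr_ge0// ?mulr_ge0 ?exprn_ge0// addr_ge0 ?exprn_ge0 ?mulr_ge0.
  have p1 : 0 <= delta * T' ^+ 2 by rewrite mulr_ge0 ?exprn_ge0.
  have p2 : 0 <= T' * k1 by rewrite mulr_ge0.
  have p3 : 0 <= delta ^+ 2 * T' ^+ 2 by rewrite mulr_ge0 ?exprn_ge0.
  by lra.
move=> s h s0 h0 shT; have [sF FM _] := hF.
have FT : F s setT by have [F0 FC _] := sF _ s0; have := FC _ F0; rewrite setD0.
have [I If Ee] := mass_process_m4 s0 h0 FT.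
have E1 : (fun w => \1_setT w * incM delta M s h w ^+ 4) = (fun w => incM delta M s h w ^+ 4).
  by apply/funext => w; rewrite indicT mul1r.
rewrite E1 in I Ee; split => //; rewrite Ee.
have sT : s <= T' by rewrite le_max (le_trans _ shT)// lerDl.
have hT : h <= T' by rewrite le_max (le_trans _ shT)// lerDr.
have [J1 e1] := mass_process_moment 1 s0; have [J2 e2] := mass_process_moment 2 s0.
pose g w := h ^+ 2 * ((48 * delta * T' ^+ 2 + 3 * 8 * delta ^+ 2 * T' ^+ 2) +
  (192 * T' * M s w ^+ 1 + 96 * M s w ^+ 2)).
have Ic := integ_cst P (48 * delta * T' ^+ 2 + 3 * 8 * delta ^+ 2 * T' ^+ 2).
have I12 := integD (integZ (192 * T') J1) (integZ 96 J2).
have Ig : integ P g by exact: (integZ (h ^+ 2) (integD Ic I12)).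
apply: (@le_trans _ _ (E g)).
  apply: E_le => // w; rewrite indicT mul1r /g expr1.
  have m0 := mass_process_ge0 s w; set m := M s w in m0 *.
  have -> : 48 * delta * h ^+ 4 + 192 * m * h ^+ 3 + 3 * (2 * delta * h ^+ 2 + 4 * m * h) ^+ 2 =
    h ^+ 2 * (48 * delta * h ^+ 2 + 192 * m * h + 3 * (2 * delta * h + 4 * m) ^+ 2) by ring.
  rewrite ler_wpM2l ?exprn_ge0//.
  have q1 : h ^+ 2 <= T' ^+ 2 by rewrite lerXn2r ?nnegrE.
  have q2 : delta * h ^+ 2 <= delta * T' ^+ 2 by rewrite ler_wpM2l.
  have q3 : m * h <= m * T' by rewrite ler_wpM2l.
  have q4 : delta ^+ 2 * h ^+ 2 <= delta ^+ 2 * T' ^+ 2 by rewrite ler_wpM2l ?exprn_ge0.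
  have q5 : (2 * delta * h + 4 * m) ^+ 2 <= 2 * (4 * (delta ^+ 2 * h ^+ 2) + 16 * m ^+ 2).
    by have := sqr_ge0 (2 * delta * h - 4 * m); nra.
  by lra.
have -> : E g = h ^+ 2 * ((48 * delta * T' ^+ 2 + 3 * 8 * delta ^+ 2 * T' ^+ 2) +
    (192 * T' * mom s (mass b0) 1 a 0 + 96 * mom s (mass b0) 2 a 0)).
  rewrite /g (EZ _ (integD Ic I12)) (ED Ic I12) E_cst (ED (integZ _ J1) (integZ _ J2)).
  by rewrite !EZ// e1 e2.
rewrite mulrC ler_wpM2r ?exprn_ge0//.
have l1 : mom s (mass b0) 1 a 0 <= k1.
  rewrite /= !mass_laplace0 /k1 /delta.
  have q : a * s <= a * T' by rewrite ler_wpM2l.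
  by lra.
have l2 : mom s (mass b0) 2 a 0 <= k2.
  have -> : mom s (mass b0) 2 a 0 = (mass b0 + delta * s) ^+ 2 + 4 * mass b0 * s + 2 * delta * s ^+ 2.
    by rewrite /= !mass_laplace0 /delta; ring.
  apply: lerD; first apply: lerD.
  - rewrite lerXn2r ?nnegrE ?addr_ge0 ?mulr_ge0//.
    by rewrite /k1 lerD2l ler_wpM2l.
  - by rewrite ler_wpM2l// mulr_ge0.
  - by rewrite ler_wpM2l ?mulr_ge0// lerXn2r ?nnegrE.
have l3 : T' * mom s (mass b0) 1 a 0 <= T' * k1 by rewrite ler_wpM2l.
by lra.
Qed.

Lemma mass_process_small eta : 0 < eta -> exists2 e0 : R, 0 < e0 &
  forall e u, 0 < e <= e0 -> eta <= u -> E (fun w => qf e (M u w)) <= eta.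
Proof.
move=> eta0; have [e0 e00 H] := mass_qf_small (mass_ge0 b0) a0 eta0.
exists e0 => // e u ee eu; have u0 : 0 < u by exact: lt_le_trans eu.
apply: (H _ _ P (M u) e u) => //; first exact: mass_process_meas.
- exact: mass_process_ge0.
- by move=> lam; exact: mass_process_laplace.
Qed.

End mass_process.

(** * Absorption at zero *)

Section absorption.
Context (R : realType) d (Omega : measurableType d) (P : probability Omega R).
Variables (F : R -> set (set Omega)) (M : R -> Omega -> R).
Local Notation E f := (Rintegral P setT f).
Hypothesis hF : filtration F.
Hypothesis M_ad : forall t, 0 <= t -> measurable_fun setT (M t : subsig (F t) -> R).
Hypothesis M_ge0 : forall t w, 0 <= t -> 0 <= M t w.
Hypothesis M_sq : forall t, 0 <= t -> sqint P (M t).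
Hypothesis M_cont : forall w, {within `[0, +oo[, continuous (M ^~ w)}.
Hypothesis m1 : forall s h C, 0 <= s -> 0 <= h -> F s C ->
  E (fun w => \1_C w * incM 0 M s h w) = 0.

Let M_meas t : 0 <= t -> measurable_fun setT (M t).
Proof.
by move=> t0; have [sF FM _] := hF; exact: (subsig_meas (sF _ t0) (FM _ t0) (M_ad t0)).
Qed.

Let below t eps : set Omega := [set w | M t w < eps].

Let below_F t eps : 0 <= t -> F t (below t eps).
Proof.
move=> t0; have [sF _ _] := hF; rewrite -(measurable_subsig (sF _ t0)).
rewrite (_ : below t eps = (M t : subsig (F t) -> R) @^-1` `]-oo, eps[%classic); last first.
  by apply/seteqP; split => w; rewrite /below /= in_itv.
by rewrite -[_ @^-1` _]setTI; exact: M_ad.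
Qed.

(* Stopping the nonnegative martingale [M] at its first visit below [eps] along
   [u 0 <= u 1 <= ...] bounds the probability that
   [M] is later above [c]; this replaces the strong Markov property at the zero. *)
Let first_below (u : nat -> R) eps i : set Omega :=
  below (u i) eps `&` ~` (\bigcup_(j in [set j | (j < i)%N]) below (u j) eps).

Let sum_first u eps n w : \sum_(i < n) \1_(first_below u eps i) w =
  (has (fun j => M (u j) w < eps) (iota 0 n))%:R :> R.
Proof.
elim: n => [|n ih]; first by rewrite big_ord0.
have e : iota 0 n.+1 = iota 0 n ++ [:: n] by rewrite -[in LHS]addn1 iotaD.
rewrite e has_cat big_ord_recr ih [has _ [:: _]]/= orbF /= indicE.
have -> : (w \in first_below u eps n) =
    (M (u n) w < eps) && ~~ has (fun j => M (u j) w < eps) (iota 0 n).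
  apply/idP/andP; rewrite inE /first_below /below/=.
    move=> [h1 h2]; split => //; apply/hasPn => j; rewrite mem_iota add0n => /andP[_ jn].
    by apply/negP => hj; apply: h2; exists j.
  move=> [h1 /hasPn h2]; split => // -[j /= jn hj].
  by have := h2 j; rewrite mem_iota add0n /= jn => /(_ isT); rewrite hj.
by case: (has _ _); case: (M (u n) w < eps); rewrite ?addr0 ?add0r.
Qed.

Let visit (u : nat -> R) n eps t c : set Omega :=
  [set w | has (fun j => M (u j) w < eps) (iota 0 n) /\ c <= M t w].

Let measurable_visit u n eps t c : (forall i, 0 <= u i) -> 0 <= t -> measurable (visit u n eps t c).
Proof.
move=> u0 t0; have [_ FM _] := hF.
rewrite (_ : visit u n eps t c = (\bigcup_(j in [set j | (j < n)%N]) below (u j) eps) `&`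
    (M t) @^-1` `[c, +oo[%classic); last first.
  apply/seteqP; split => w; rewrite /visit /below /= in_itv/= andbT.
    by move=> [/hasP[j]]; rewrite mem_iota add0n => /andP[_ jn] h1 h2; split => //; exists j.
  move=> [[j /= jn h1] h2]; split => //; apply/hasP; exists j => //.
  by rewrite mem_iota add0n.
apply: measurableI; last by rewrite -[_ @^-1` _]setTI; exact: M_meas.
by apply: bigcup_measurable => j _; apply: (FM (u j)) => //; exact: below_F.
Qed.

(** On the event of a first visit at time u i, the expectation of M at t equals that at u i, which
    is at most eps times the probability of the event. Summing over i and applying Markov's
    inequality at level c gives eps / c. *)
Lemma visit_le u n eps t c : (forall i, 0 <= u i) -> (forall i j, (i <= j)%N -> u i <= u j) ->
  (forall i, u i <= t) -> 0 <= eps -> 0 < c ->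
  (P (visit u n eps t c) <= (eps / c)%:E)%E.
Proof.
move=> u0 umono ut eps0 c0; have [sF FM Fm] := hF.
have t0 : 0 <= t by exact: le_trans (ut 0%N).
have mV := measurable_visit n eps c u0 t0.
have CF i : F (u i) (first_below u eps i).
  rewrite -(measurable_subsig (sF _ (u0 i))); apply: measurableI.
    by rewrite (measurable_subsig (sF _ (u0 i))); exact: below_F.
  apply: measurableC; apply: bigcup_measurable => j /= ji.
  rewrite (measurable_subsig (sF _ (u0 i))); apply: (Fm (u j)); [exact: u0| |exact: below_F].
  by apply: umono; exact: ltnW.
have mC i : measurable (first_below u eps i) by apply: (FM (u i)) => //; exact: CF.
have It s : 0 <= s -> integ P (M s) by move=> s0; apply: sqint_integ; exact: M_sq.
have I1 i s : 0 <= s -> integ P (fun w => \1_(first_below u eps i) w * M s w).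
  by move=> s0; apply: integ_indicM => //; exact: It.
have mart i : E (fun w => \1_(first_below u eps i) w * M t w) =
    E (fun w => \1_(first_below u eps i) w * M (u i) w).
  have := m1 (u0 i) (_ : 0 <= t - u i) (CF i); rewrite subr_ge0 => /(_ (ut i)).
  rewrite (_ : (fun w => _) = fun w => \1_(first_below u eps i) w * M t w -
      \1_(first_below u eps i) w * M (u i) w); last first.
    apply/funext => w; rewrite /incM (_ : u i + (t - u i) = t); last by ring.
    by ring.
  by rewrite EB ?I1// => /subr0_eq.
have IV : integ P (\1_(visit u n eps t c) : Omega -> R).
  by apply: (@integ_bounded _ _ _ P _ 1); [exact: measurable_indic|exact: indic_le1].
have IC i : integ P (\1_(first_below u eps i) : Omega -> R).
  by apply: (@integ_bounded _ _ _ P _ 1); [exact: measurable_indic|exact: indic_le1].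
rewrite -E_indic// lee_fin ler_pdivlMr// mulrC -EZ//.
apply: (@le_trans _ _ (E (fun w => \sum_(i < n) \1_(first_below u eps i) w * M t w))).
  apply: E_le; [exact: integZ|by apply: integ_sum => i; exact: I1|move=> w].
  rewrite -mulr_suml sum_first indicE; have Mt := M_ge0 w t0.
  case: (boolP (w \in _)) => [|_]; last by rewrite mulr0 mulr_ge0.
  by rewrite inE => -[-> h]; rewrite mulr1 mul1r.
rewrite E_sum; last by move=> i; exact: I1.
apply: (@le_trans _ _ (\sum_(i < n) E (fun w => eps * \1_(first_below u eps i) w))).
  apply: ler_sum => i _; rewrite mart; apply: E_le; [exact: I1|exact: integZ|move=> w].
  rewrite indicE; case: (boolP (w \in _)) => [|_]; last by rewrite mul0r mulr0.
  by rewrite inE => -[/ltW h _]; rewrite mul1r mulr1.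
rewrite -E_sum; last by move=> i; exact: integZ.
rewrite -[leRHS](E_cst P); apply: E_le; [by apply: integ_sum => i; exact: integZ|exact: integ_cst|].
move=> w; rewrite -mulr_sumr sum_first /cst; case: (has _ _); rewrite ?mulr1//.
by rewrite mulr0.
Qed.

(** Capping the index keeps all points in [0, t]; the grids are nested, so that visits increase with
    n. *)
Let grid t n i : R := t * ((minn i (2 ^ n))%:R * mesh R n).

Let grid_ge0 t n i : 0 <= t -> 0 <= grid t n i.
Proof. by move=> t0; rewrite !mulr_ge0// mesh_ge0. Qed.

Let grid_le t n i : 0 <= t -> grid t n i <= t.
Proof.
move=> t0; rewrite /grid ler_piMr// /mesh ler_pdivrMr ?exprn_gt0// mul1r -natrX ler_nat.
exact: geq_minr.
Qed.

Let grid_mono t n i j : 0 <= t -> (i <= j)%N -> grid t n i <= grid t n j.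
Proof.
move=> t0 ij; rewrite /grid ler_wpM2l// ler_wpM2r ?mesh_ge0// ler_nat.
by rewrite leq_min geq_minr andbT (leq_trans (geq_minl _ _)).
Qed.

Let gridS t n i : grid t n i = grid t n.+1 i.*2.
Proof.
have e : minn i.*2 (2 ^ n.+1) = (minn i (2 ^ n) * 2)%N.
  by rewrite muln2 /minn expnS mul2n ltn_double; case: ifP.
by rewrite /grid e [mesh R n]meshS natrM; ring.
Qed.

Let bad t c k : set Omega := \bigcup_n visit (grid t n) (2 ^ n).+1 k.+1%:R^-1 t c.

Let bad_null t c : 0 <= t -> 0 < c -> P (\bigcap_k bad t c k) = 0.
Proof.
move=> t0 c0; have g0 n i : 0 <= grid t n i by exact: grid_ge0.
have mV n k : measurable (visit (grid t n) (2 ^ n).+1 k.+1%:R^-1 t c).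
  exact: measurable_visit.
have mb k : measurable (bad t c k) by exact: bigcup_measurable.
have bk k : (P (bad t c k) <= (k.+1%:R^-1 / c)%:E)%E.
  have cv : P (visit (grid t n) (2 ^ n).+1 k.+1%:R^-1 t c) @[n --> \oo] --> P (bad t c k).
    apply: nondecreasing_cvg_mu; [by move=> n; exact: mV|exact: mb|].
    apply: homo_leq => [?|? ? ?|n]; [exact: lexx|exact: le_trans|].
    apply/subsetPset => w [/hasP[j]]; rewrite mem_iota add0n => /andP[_ jn] hj h2; split => //.
    apply/hasP; exists j.*2; last by rewrite -gridS.
    by rewrite mem_iota add0n /= expnS mul2n ltnS leq_double -ltnS.
  apply: (cvge_le _ cv); apply: nearW => n; apply: visit_le => //.
  - by move=> i j; exact: grid_mono.
  - by move=> i; exact: grid_le.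
apply/eqP; rewrite eq_le measure_ge0 andbT; apply/lee_addgt0Pr => e e0; rewrite add0e.
have [k /andP[_ hk]] : exists k, 0 < k.+1%:R^-1 / c <= e.
  exists (Num.truncn (e * c)^-1); rewrite divr_gt0//=.
  rewrite ler_pdivrMr// -[leRHS]invrK lef_pV2 ?posrE ?invr_gt0 ?mulr_gt0//.
  by apply/ltW/truncnS_gt.
apply: (@le_trans _ _ (P (bad t c k))); first last.
  by apply: (le_trans (bk k)); rewrite lee_fin.
apply: le_measure; rewrite ?inE//; last by move=> w; apply.
by apply: bigcap_measurable => //; exists 0%N.
Qed.

Lemma near_continuity w y e : 0 <= y -> 0 < e -> exists2 eta : R, 0 < eta &
  forall s, 0 <= s -> `|s - y| < eta -> `|M s w - M y w| < e.
Proof.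
move=> y0 e0; have /subspace_continuousP/(_ y) := @M_cont w.
rewrite /= in_itv/= y0 => /(_ isT)/cvgrPdist_lt/(_ e e0); rewrite near_withinE => /nbhs_ballP[eta /= eta0 H].
exists eta => // s s0 sy; rewrite distrC; apply: H; last by rewrite /= in_itv/= s0.
by rewrite /ball/= distrC.
Qed.

(** By continuity a zero at [y] forces a value below 1 / (k + 1) at the last point not after [y] of
    a fine enough grid. *)
Let zero_bad t c w y : 0 <= y <= t -> M y w = 0 -> c <= M t w -> (\bigcap_k bad t c k) w.
Proof.
move=> /andP[y0 yt] My ct k _; have e0 : 0 < k.+1%:R^-1 :> R by rewrite invr_gt0.
have [eta eta0 H] := near_continuity w y0 e0.
have [t1|t1] := leP t 0.
  exists 0%N => //; split => //; apply/hasP; exists 0%N => //.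
  have -> : grid t 0 0 = y by rewrite /grid min0n mul0r mulr0; apply/le_anti; rewrite y0 (le_trans yt).
  by rewrite My.
have c1 : t * mesh R n @[n --> \oo] --> (0 : R) by rewrite -(mulr0 t); apply: cvgMr; exact: cvg_mesh.
have := cvgr_lt _ c1 _ eta0 => -[n _ /(_ n (leqnn n)) /= hn].
exists n => //; split => //; pose z := y / t * 2 ^+ n; pose j := Num.truncn z.
have z0 : 0 <= z by rewrite mulr_ge0// divr_ge0// ltW.
have zn : z <= (2 ^ n)%:R by rewrite natrX ler_piMl ?exprn_ge0// ler_pdivrMr// mul1r.
have /andP[j1 j2] := truncn_itv z0.
have jn : (j <= 2 ^ n)%N by rewrite -(ler_nat R); exact: le_trans zn.
apply/hasP; exists j; first by rewrite mem_iota add0n /= ltnS.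
have yE : y = t * (z * mesh R n).
  by rewrite /z /mesh mulfK ?expf_neq0// mulrC divfK// gt_eqF.
have gE : grid t n j = t * (j%:R * mesh R n) by rewrite /grid (minn_idPl jn).
have m0 := mesh_gt0 R n.
have h1 : grid t n j <= y by rewrite gE yE ler_pM2l// ler_pM2r.
have h2 : y < grid t n j + t * mesh R n.
  have -> : grid t n j + t * mesh R n = t * (j.+1%:R * mesh R n) by rewrite gE -natr1; ring.
  by rewrite yE ltr_pM2l// ltr_pM2r.
have := H (grid t n j) (grid_ge0 n j (ltW t1)) _; rewrite ler0_norm ?subr_le0// My subr0.
have g0 := M_ge0 w (grid_ge0 n j (ltW t1)); rewrite ger0_norm//; apply.
by rewrite opprB ltrBlDl; apply: (lt_trans h2); rewrite ltrD2l.
Qed.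

(** Null sets are removed only for rational end times and levels 1 / (k + 1), which are countably
    many; continuity of the path reaches all times. *)
Lemma absorbed_at_zero : {ae P, forall w, forall y t, 0 <= y -> y <= t -> M y w = 0 -> M t w = 0}.
Proof.
have aeN : {ae P, forall w, forall k (q : rat), 0 <= q ->
    ~ (\bigcap_i bad (ratr q) k.+1%:R^-1 i) w}.
  apply/ae_foralln => k.
  suff : {ae P, forall w, forall n, if (choice.unpickle n : option rat) is Some q then
      (0 <= q) -> ~ (\bigcap_i bad (ratr q) k.+1%:R^-1 i) w else True}.
    by apply: filterS => w h q q0; have := h (choice.pickle q); rewrite choice.pickleK => /(_ q0).
  apply/ae_foralln => n; case: (choice.unpickle n : option rat) => [q|]; last exact: aeW.
  have [q0|q0] := leP 0 q; last by apply: aeW.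
  have r0 : 0 <= ratr q :> R by rewrite ler0q.
  have k0 : 0 < k.+1%:R^-1 :> R by rewrite invr_gt0.
  exists (\bigcap_i bad (ratr q) k.+1%:R^-1 i); split.
  - apply: bigcap_measurable => [|i _]; first by exists 0%N.
    by apply: bigcup_measurable => n' _; apply: measurable_visit => // j; exact: grid_ge0.
  - exact: bad_null.
  - by move=> w /= /not_implyP[_] /contrapT.
apply: filterS aeN => w H y t y0 yt My.
have rat0 (q : rat) : y <= ratr q -> M (ratr q) w = 0.
  move=> yq; have r0 : 0 <= ratr q :> R by exact: le_trans yq.
  apply/eqP; rewrite eq_le M_ge0// andbT leNgt; apply/negP => Mp.
  pose k := Num.truncn (M (ratr q) w)^-1.
  apply: (H k q); first by rewrite -(ler0q R).
  apply: (@zero_bad _ _ _ y) => //; first by rewrite y0.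
  rewrite -[leRHS]invrK lef_pV2 ?posrE ?invr_gt0//.
  by apply/ltW/truncnS_gt.
apply/eqP; apply: contraT => Mt; have t0 := le_trans y0 yt.
have Mp : 0 < `|M t w| by rewrite normr_gt0.
have [eta eta0 He] := near_continuity w t0 Mp.
have te : t < t + eta by rewrite ltrDl.
have [q] := rat_in_itvoo te; rewrite in_itv/= => /andP[tq qe].
have := He (ratr q) (le_trans t0 (ltW tq)) _; rewrite rat0 ?sub0r ?normrN ?ltxx//; last first.
  exact: le_trans (ltW tq).
by apply; rewrite ger0_norm ?subr_ge0 ?(ltW tq)// ltrBlDl.
Qed.

(** The lifetime is an infimum, so only times strictly after [y] are known to follow a zero;
    continuity brings the conclusion back to [y]. *)
Lemma besq_lifetime_absorbed : {ae P, forall w, forall y, 0 <= y ->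
  (besq_lifetime 0 (M ^~ w) <= y%:E)%E -> M y w = 0}.
Proof.
apply: filterS absorbed_at_zero => w H y y0; rewrite /besq_lifetime ltxx => hy.
have later t : y < t -> M t w = 0.
  move=> yt; have yt' : (y%:E < t%:E)%E by rewrite lte_fin.
  have /ereal_inf_lt[_ [z [z0 Mz] <-]] := le_lt_trans hy yt'; rewrite lte_fin => zt.
  by apply: (H z) => //; exact: ltW.
apply/eqP; apply: contraT => Mt.
have Mp : 0 < `|M y w| by rewrite normr_gt0.
have [eta eta0 He] := near_continuity w y0 Mp.
have h2 : y < y + eta / 2 by rewrite ltrDl divr_gt0.
have := He (y + eta / 2) (ltW (le_lt_trans y0 h2)) _; rewrite later// sub0r normrN ltxx.
by apply; rewrite addrAC subrr add0r ger0_norm ?divr_ge0 ?ltW// ltr_pdivrMr// ltr_pMr// ltr1n.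
Qed.

End absorption.

(** * The mass process as a squared Bessel process *)

Lemma ae_preimage (R : realType) d1 d2 (O1 : measurableType d1) (O2 : measurableType d2)
    (P1 : probability O1 R) (P2 : probability O2 R) (X : O1 -> O2) (phi : O2 -> Prop) :
  measurable_fun setT X -> (forall A, measurable A -> P1 (X @^-1` A) = P2 A) ->
  {ae P2, forall w, phi w} -> {ae P1, forall w, phi (X w)}.
Proof.
move=> mX XP [N [mN N0 NP]]; exists (X @^-1` N); split.
- by rewrite -[_ @^-1` _]setTI; exact: mX.
- by rewrite XP.
- by move=> w /= nphi; exact: NP.
Qed.

Lemma sigma_of_subsig (R : realType) d (Omega : measurableType d) (F : set (set Omega)) (f : Omega -> R) :
  sigma_algebra setT F -> measurable_fun setT (f : subsig F -> R) -> sigma_of f `<=` F.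
Proof.
move=> sF mf A [B mB <-]; rewrite -(measurable_subsig sF).
exact: mf.
Qed.

(** Common to both types: the kernels enter only through the Laplace transform of the mass. The
    solution is the mass read through the projection [pi] of the noisy extension, which preserves
    its law. *)
Lemma besq_of_mass_laplace (R : realType) (alpha a : R)
    (kappa : R -> R.-pker (ipspace alpha) ~> (ipspace alpha))
    d (Omega : measurableType d) (P : probability Omega R)
    (X : R -> {RV P >-> ipspace alpha}) (b0 : ipspace alpha) :
  0 <= a ->
  (forall y b lam, 0 < y -> 0 <= lam ->
    (\int[kappa y b]_x (expR (- lam * mass x))%:E = (mass_laplace y (mass b) a lam)%:E)%E) ->
  continuous_hunt_process kappa X b0 ->
  is_BESQ (2 * a) (mass b0) P (fun y w => mass (X y w)).
Proof.
move=> a0 kL [X0 Xc [F [hF _ Xad SM]]].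
pose M t w := mass (X t w).
have M0 t w : 0 <= M t w by exact: mass_process_ge0.
have mM t : measurable_fun setT (M t) by exact: mass_process_meas.
have Mad t : 0 <= t -> measurable_fun setT (M t : subsig (F t) -> R).
  exact: (mass_process_adapted hF Xad).
have Mc w : {within `[0, +oo[, continuous (M ^~ w)} by exact: mass_process_continuous.
have Msq t : 0 <= t -> sqint P (M t).
  exact: (mass_process_sqint kL X0 hF SM).
have m1 s h C : 0 <= s -> 0 <= h -> F s C ->
    Rintegral P setT (fun w => \1_C w * incM (2 * a) M s h w) = 0.
  exact: (mass_process_m1 a0 kL X0 hF Xad SM).
have d0 : 0 <= 2 * a by rewrite mulr_ge0.
have [d' [Om [Q [pi [G [B [[mpi Qpi] [hG FG] [Bad B0] [Bae Binc] Bito]]]]]]] :=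
  noisy_extension d0 hF Mad (fun t w _ => M0 t w) Msq m1
  (fun s h C => mass_process_m2 a0 kL X0 hF Xad SM (s := s) (h := h) (C := C))
  (mass_process_small a0 kL X0 hF SM)
  (mass_process_fourth a0 kL X0 hF Xad SM) Mc.
have [sG GM _] := hG.
have mB t : measurable_fun setT (B t).
  have [t0|t0] := leP 0 t; first exact: (subsig_meas (sG _ t0) (GM _ t0) (Bad _ t0)).
  by rewrite (_ : B t = cst 0)//; apply/funext => w; rewrite B0// ltW.
have mZ t : measurable_fun setT (fun w => M t (pi w)) by exact: (measurableT_comp (mM t) mpi).
pose Bv t : {RV Q >-> R} := HB.pack (B t) (isMeasurableFun.Build _ _ _ _ (B t) (mB t)).
pose Zv t : {RV Q >-> R} := HB.pack (fun w => M t (pi w))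
  (isMeasurableFun.Build _ _ _ _ (fun w => M t (pi w)) (mZ t)).
have GT s : 0 <= s -> G s setT.
  by move=> s0; have [G0 GC _] := sG _ s0; have := GC _ G0; rewrite setD0.
have Blaw s t D : 0 <= s -> s < t -> measurable D ->
    Q ((fun w => B t w - B s w) @^-1` D) = normal_prob 0 (Num.sqrt (t - s)) D.
  move=> s0 st mD; have := Binc s t setT D s0 st (GT _ s0) mD.
  by rewrite setTI probability_setT mul1e.
split => //.
- by move=> y _; exact: mM.
- by move=> w; split; [exact: Mc|move=> y _; exact: M0].
exists d', Om, Q, G, Bv, Zv; split; last first.
  move=> s A HA; rewrite -Qpi; first by rewrite preimage_bigcap.
  apply: fin_bigcap_measurable; first exact: finite_seq.
  by move=> t /HA[_ mA]; rewrite -[_ @^-1` _]setTI; exact: mM.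
split.
- split => //; split.
  + by move=> t t0; exact: (sigma_of_subsig (sG _ t0) (Bad _ t0)).
  + exact: Bae.
  + move=> s t s0 st A1 _ GA1 [D mD <-]; rewrite setTI.
    by rewrite [RHS](_ : _ = (Q A1 * normal_prob 0 (Num.sqrt (t - s)) D)%E) ?Binc// -Blaw.
  + by move=> s t s0 st D mD; exact: Blaw.
- move=> t t0 _ [D mD <-]; rewrite setTI.
  rewrite (_ : _ @^-1` D = pi @^-1` (M t @^-1` D))//; apply: FG => //.
  apply: (sigma_of_subsig (let: And3 sF _ _ := hF in sF _ t0) (Mad _ t0)).
  by exists D => //; rewrite setTI.
- by move=> w; split; [exact: (Mc (pi w))|move=> y _; exact: M0].
- have ae0 : {ae P, forall w, M 0 w = mass b0 /\ forall y, 0 <= y ->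
      (besq_lifetime (2 * a) (M ^~ w) <= y%:E)%E -> M y w = 0}.
    (* For a > 0 the lifetime is infinite and there is no absorption to prove. *)
    have [az|an] := eqVneq a 0; last first.
      apply: filterS X0 => w e; split; first by rewrite /M e.
      have p : 0 < 2 * a by rewrite mulr_gt0// lt_def an.
      by move=> y y0; rewrite /besq_lifetime p leNgt ltry.
    have m1' s h C : 0 <= s -> 0 <= h -> F s C ->
        Rintegral P setT (fun w => \1_C w * incM 0 M s h w) = 0.
      by have := m1 s h C; rewrite az mulr0.
    have := besq_lifetime_absorbed hF Mad (fun t w _ => M0 t w) Msq Mc m1'.
    rewrite az mulr0; apply: filterS2 X0 => w e H; split; last exact: H.
    by rewrite /M e.
  exact: (ae_preimage mpi Qpi ae0).
- move=> y y0; exists (fun w => (M y (pi w) - M 0 (pi w) - 2 * a * y) / 2).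
  split; first exact: Bito.
  have := ae_preimage mpi Qpi X0; apply: filterS => w e.
  (* If a = 0 both sides vanish; otherwise the lifetime is infinite and the minimum is y. *)
  have -> : 2 * a * fine (mine y%:E (besq_lifetime (2 * a) (fun t => Zv t w))) = 2 * a * y.
    have [az|an] := eqVneq a 0; first by rewrite az mulr0 !mul0r.
    have p : 0 < 2 * a by rewrite mulr_gt0// lt_def an.
    by rewrite /besq_lifetime p /mine ltry.
  by rewrite /Zv/= /M e; field.
Qed.

Theorem theorem1p4 (R : realType) (alpha : R) (halpha : 0 < alpha < 1)
    (d : measure_display) (Omega : measurableType d) (P : probability Omega R)
    (X : R -> {RV P >-> ipspace alpha}) (b0 : ipspace alpha) :
  (type1_evolution X b0 ->
     is_BESQ 0 (mass b0) P (fun y w => mass (X y w))) /\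
  (type0_evolution X b0 ->
     is_BESQ (2 * alpha) (mass b0) P (fun y w => mass (X y w))).
Proof.
split => -[kappa [hk hX]].
  rewrite -[0](mulr0 2); apply: (besq_of_mass_laplace _ _ hX) => // y b lam y0 l0.
  exact: kappa1_laplace (hk y b (ltW y0)).
have a0 : 0 <= alpha by case/andP: halpha => /ltW.
apply: (besq_of_mass_laplace a0 _ hX) => // y b lam y0 l0.
exact: kappa0_laplace (hk y b (ltW y0)).
Qed.
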